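(* Suppose that we have a system of real polynomials $$f_1(x_1,\dots,x_n)=f_2(x_1,\dots,x_n)=\cdots=f_n(x_1,\dots,x_n)=0\qquad( * )$$ with Newton polytope $\Delta$, where $\Delta\cap\mathbb{Z}^n$ affinely spans $\mathbb{Z}^n$, whose solutions are a fiber of a projection map $\pi_E^+\colon Y^+_\Delta\to\mathbb{S}^n$. If there is a basis for $\{\pm1\}^{n+1}$ such that $(-1)^{(b,\,b\cdot F)}$ is a product of an odd number of basis elements for every primitive normal vector $b$ to a facet $F$ of $\Delta$, then the absolute value of the degree of the map $\pi_E^+$ is a lower bound for the number of real solutions to $( * )$, and this lower bound is a multiple of the number of components of $(Y^+_\Delta)^\circ$ (orientations of the components being changed if necessary). Moreover, the map $\pi_E^+$ does not have a degree if this condition is not satisfied.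
   Context: $\Delta\subset\mathbb{R}^n$ is a lattice polytope. $\mathbb{R}^\Delta$ is the real vector space with coordinates $x_\alpha$ indexed by $\alpha\in\Delta\cap\mathbb{Z}^n$, $\mathbb{P}^\Delta$ is the corresponding real projective space, and $\mathbb{S}^\Delta$ is the unit sphere in $\mathbb{R}^\Delta$ (equivalently, nonzero vectors modulo positive scalars), with its two-to-one map $\mathbb{S}^\Delta\to\mathbb{P}^\Delta$. For $y\in(\mathbb{R}^\times)^n$ and $\alpha\in\mathbb{Z}^n$, $y^\alpha=y_1^{\alpha_1}\cdots y_n^{\alpha_n}$. The map $\varphi_\Delta\colon(\mathbb{R}^\times)^n\to\mathbb{P}^\Delta$, $y\mapsto[y^\alpha\mid\alpha\in\Delta\cap\mathbb{Z}^n]$, is injective; $Y_\Delta$ is the closure of its image, and the spherical toric variety $Y^+_\Delta\subset\mathbb{S}^\Delta$ is the inverse image of $Y_\Delta$. For a face $F$ of $\Delta$, $\mathbb{S}^F=\{x\in\mathbb{S}^\Delta\mid x_\alpha=0\text{ if }\alpha\notin F\}$. $(Y^+_\Delta)^\circ$ is the set of points of $Y^+_\Delta$ over the interior and the facets of $\Delta$, that is, not lying in any $\mathbb{S}^F$ with $F$ a face of codimension at least $2$; it consists of smooth points. Systems and projections. The system has Newton polytope $\Delta$: each $f_i$ is a real polynomial whose exponent vectors lie in $\Delta\cap\mathbb{Z}^n$. Via $\varphi_\Delta$ its solutions correspond to a linear section $L\cap Y_\Delta$, where $L\subset\mathbb{P}^\Delta$ is a linear subspace of codimension $n$ (cut out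 by the linear forms whose coefficients are those of the $f_i$). Projecting from a general codimension one linear subspace $E$ of $L$ realizes the solutions as a fiber of a map $\pi_E\colon Y_\Delta\to\mathbb{RP}^n$, and this projection lifts to a map $\pi_E^+\colon Y^+_\Delta\to\mathbb{S}^n$ of spherical toric varieties. Degree. When $Y^+_\Delta$ is orientable, one fixes orientations of it (of each component of $(Y^+_\Delta)^\circ$) and of $\mathbb{S}^n$; the degree of $\pi_E^+$ is then the usual one, the number of points in the fiber over a regular value, each counted with sign $\pm1$ according to whether $\pi_E^+$ preserves or reverses orientation there. Changing orientations in each component if necessary, the degree is assumed to be divisible by the number of components of $(Y^+_\Delta)^\circ$. A primitive normal vector $b\in\mathbb{Z}^n$ to a facet $F$ has constant dot product with the points of $F$, and $b\cdot F\in\mathbb{Z}$ denotes this constant. For $v\in\mathbb{Z}^{n+1}$, $(-1)^v:=((-1)^{v_1},\dots,(-1)^{v_{n+1}})$. The group $\{\pm1\}^{n+1}$ is regarded as a vector space over $\mathbb{Z}/2\mathbb{Z}$, written multiplicatively; ''basis'' is meant in this sense, and ''a product of an odd number of basis elements'' means a product of an odd number of distinct elements of the basis.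
   Formalization: The solutions are assumed to form a fiber over a regular value (all real solutions nondegenerate), since over a critical value distinct solutions can be fewer than the degree; divisibility of the degree by the number of components, after reorienting, is assumed as in the context. *)

(* Defs.v *)
From HB Require Import structures.
From mathcomp Require Import all_boot all_order all_algebra.
From mathcomp Require Import all_classical all_reals all_analysis.

Set Implicit Arguments.
Unset Strict Implicit.
Unset Printing Implicit Defensive.

Import Order.TTheory GRing.Theory Num.Theory.
Import numFieldNormedType.Exports.

Local Open Scope classical_set_scope.
Local Open Scope ring_scope.

Section Polytopes.
Context {R : realType} {n : nat}.
Implicit Types (Delta F : set 'rV[R]_n) (v b : 'rV[int]_n).

Definition real_vec v : 'rV[R]_n := map_mx intr v.

Definition dotv (u x : 'rV[R]_n) : R := \sum_i u 0 i * x 0 i.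

Definition conv_hull k (p : 'I_k -> 'rV[R]_n) : set 'rV[R]_n :=
  [set x | exists w : 'I_k -> R,
    [/\ forall i, 0 <= w i, \sum_i w i = 1 & x = \sum_i w i *: p i]].

Definition lattice_polytope Delta : Prop :=
  exists k (p : 'I_k.+1 -> 'rV[int]_n), Delta = conv_hull (real_vec \o p).

Definition is_face Delta F : Prop :=
  exists u c, (forall x, Delta x -> c <= dotv u x) /\
    F = [set x | Delta x /\ dotv u x = c].

(* The rows of D are a basis of the direction space of the affine hull of F. *)
Definition has_dim F d : Prop :=
  exists x0 (D : 'M[R]_(d, n)),
    [/\ F x0, forall i, F (x0 + row i D), row_free D
      & forall x, F x -> (x - x0 <= D)%MS].

Definition is_facet Delta F : Prop := is_face Delta F /\ has_dim F n.-1.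

(* Codimension is relative to R^n, as Delta is full-dimensional below.  The
   empty face has no dimension here; no point of the sphere lies over it. *)
Definition is_face_codim_ge2 Delta F : Prop :=
  is_face Delta F /\ exists d, has_dim F d /\ (d.+2 <= n)%N.

Definition primitive_vec b : Prop := \big[gcdn/0%N]_(i < n) absz (b 0 i) = 1%N.

(* b is a primitive normal vector (inner or outer) to F, and c = b . F. *)
Definition primitive_normal F b (c : int) : Prop :=
  primitive_vec b /\ forall x, F x -> dotv (real_vec b) x = c%:~R.

(* a lists the points of Delta in Z^n without repetition; it is the index set
   of the coordinates of R^Delta = 'rV[R]_m. *)
Definition lattice_points Delta m (a : 'I_m -> 'rV[int]_n) : Prop :=
  injective a /\ forall v, Delta (real_vec v) <-> exists j, v = a j.

Definition affinely_spans m (a : 'I_m -> 'rV[int]_n) : Prop :=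
  forall v, exists c : 'I_m -> int,
    \sum_j c j = 1 /\ v = \sum_j c j *: a j.

End Polytopes.

Section SignVectors.
Context {k : nat}.

Definition sign_vec (s : 'rV[int]_k) : Prop := forall i, s 0 i = 1 \/ s 0 i = -1.

Definition sign_pow (v : 'rV[int]_k) : 'rV[int]_k := \row_i (-1) ^ v 0 i.

Definition sign_prod l (e : 'I_l -> 'rV[int]_k) (J : {set 'I_l}) : 'rV[int]_k :=
  \row_i \prod_(j in J) e j 0 i.

(* A basis of {1,-1}^k over Z/2 : the linear combinations of the e j are their
   products over subsets J. *)
Definition sign_basis l (e : 'I_l -> 'rV[int]_k) : Prop :=
  (forall j, sign_vec (e j)) /\
  forall s, sign_vec s -> exists! J : {set 'I_l}, sign_prod e J = s.

End SignVectors.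

Definition odd_basis_condition (R : realType) n (Delta : set 'rV[R]_n) : Prop :=
  exists e : 'I_(n + 1) -> 'rV[int]_(n + 1),
    sign_basis e /\
    forall F b c, is_facet Delta F -> primitive_normal F b c ->
      exists J : {set 'I_(n + 1)},
        odd #|J| /\ sign_pow (row_mx b (const_mx c)) = sign_prod e J.

Section Submanifolds.
Context {R : realType}.

(* M is a d-dimensional C^1 submanifold of R^m: locally at each of its points
   the zero set of a C^1 submersion to R^r, r = m - d. *)
Definition C1_submanifold d m (M : set 'rV[R]_m) : Prop :=
  forall p, M p -> exists r (g : 'rV[R]_m -> 'rV[R]_r),
    [/\ (d + r = m)%N,
        \forall x \near p, differentiable g x /\ {for x, continuous (jacobian g)},
        \rank (jacobian g p) = r
      & \forall x \near p, M x <-> g x = 0].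

Definition tangent m (M : set 'rV[R]_m) (p v : 'rV[R]_m) : Prop :=
  exists gamma : R -> 'rV[R]_m,
    [/\ gamma 0 = p, \forall t \near (0 : R), M (gamma t)
      & is_derive (0 : R) (1 : R) gamma v].

Definition frame d m (M : set 'rV[R]_m) (p : 'rV[R]_m) (B : 'M[R]_(d, m)) : Prop :=
  [/\ M p, forall i, tangent M p (row i B) & row_free B].

(* An orientation of a d-dimensional M tells which frames of its tangent spaces
   are positive.  The second clause is continuity: o is locally constant on
   the bundle of frames. *)
Definition orientation d m (M : set 'rV[R]_m)
    (o : 'rV[R]_m -> 'M[R]_(d, m) -> bool) : Prop :=
  (forall p B (A : 'M[R]_d), frame M p B -> A \in unitmx ->
     o p (A *m B) = (o p B == (0 < \det A))) /\
  (forall p B, frame M p B ->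
     \forall q \near p & B' \near B, frame M q B' -> o q B' = o p B).

End Submanifolds.

(* The degree of f : X -> N, where X is compact, its part M is a d-dimensional
   submanifold of R^m oriented by oM, and N is a d-dimensional submanifold of
   R^m' oriented by oN; f is given on a neighbourhood of X in R^m. *)
Section Degree.
Context {R : realType} {d m m' : nat}.
Variables (X M : set 'rV[R]_m) (N : set 'rV[R]_m') (f : 'rV[R]_m -> 'rV[R]_m').

Definition regular_point x : Prop :=
  exists B : 'M[R]_(d, m), frame M x B /\ row_free (B *m jacobian f x).

Definition fiber z : set 'rV[R]_m := [set x | X x /\ f x = z].

Definition regular_value z : Prop :=
  N z /\ forall x, fiber z x -> M x /\ regular_point x.

Variables (oM : 'rV[R]_m -> 'M[R]_(d, m) -> bool).
Variables (oN : 'rV[R]_m' -> 'M[R]_(d, m') -> bool).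

Definition local_sign x : int :=
  if `[< exists B, frame M x B /\ oN (f x) (B *m jacobian f x) = oM x B >]
  then 1 else -1.

Definition is_degree (k : int) : Prop :=
  forall z, regular_value z ->
    finite_set (fiber z) /\ \sum_(x \in fiber z) local_sign x = k.

End Degree.

Definition n_components (T : topologicalType) (A : set T) (k : nat) : Prop :=
  ([set connected_component A x | x in A] #= `I_k)%card.

Section SphericalToricVariety.
Context {R : realType} {n m : nat}.
Implicit Types (Delta : set 'rV[R]_n) (a : 'I_m -> 'rV[int]_n).

Definition enorm k (x : 'rV[R]_k) : R := Num.sqrt (\sum_i x 0 i ^+ 2).

Definition unit_sphere k : set 'rV[R]_k := [set x | enorm x = 1].

Definition normalize k (x : 'rV[R]_k) : 'rV[R]_k := (enorm x)^-1 *: x.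

Definition torus : set 'rV[R]_n := [set y | forall i, y 0 i != 0].

Definition monomials a (y : 'rV[R]_n) : 'rV[R]_m :=
  \row_j \prod_i y 0 i ^ a j 0 i.

Definition phi_plus a (y : 'rV[R]_n) : 'rV[R]_m := normalize (monomials a y).

(* A point of P^Delta is an antipodal pair of the sphere, and closure commutes
   with inverse image along the open map from the sphere to P^Delta. *)
Definition Yplus a : set 'rV[R]_m :=
  closure [set x | exists2 y, torus y & x = phi_plus a y \/ x = - phi_plus a y].

Definition face_sphere a (F : set 'rV[R]_n) : set 'rV[R]_m :=
  [set x | unit_sphere x /\ forall j, ~ F (real_vec (a j)) -> x 0 j = 0].

Definition Yplus_circ Delta a : set 'rV[R]_m :=
  [set x | Yplus a x /\
    forall F, is_face_codim_ge2 Delta F -> ~ face_sphere a F x].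

(* Column i of C lists the coefficients of f_i, so f_i(y) = sum_j C j i y^(a j). *)
Definition solutions a (C : 'M[R]_(m, n)) : set 'rV[R]_n :=
  [set y | torus y /\ monomials a y *m C = 0].

(* The lift to spheres of the projection from E = {x | x *m P = 0}. *)
Definition proj_plus (P : 'M[R]_(m, n.+1)) (x : 'rV[R]_m) : 'rV[R]_n.+1 :=
  normalize (x *m P).

(* L = {x | x *m C = 0} has codimension n, E is a codimension one subspace of L,
   and E misses Y_Delta, so that the projection from E is defined on it. *)
Definition projection_center a (C : 'M[R]_(m, n)) (P : 'M[R]_(m, n.+1)) : Prop :=
  [/\ \rank C = n, \rank P = n.+1,
      forall x : 'rV[R]_m, x *m P = 0 -> x *m C = 0
    & forall x, Yplus a x -> x *m P != 0].

(* The fiber of Y_Delta -> RP^n over [z] is the set of points phi_Delta(y), y a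
   solution.  Its points are in bijection with the fiber over z itself of the
   lift Y^+_Delta -> S^n. *)
Definition solutions_are_fiber a (C : 'M[R]_(m, n)) (P : 'M[R]_(m, n.+1))
    (z : 'rV[R]_n.+1) : Prop :=
  forall x, Yplus a x ->
    (proj_plus P x = z \/ proj_plus P x = - z) <->
    (exists2 y, solutions a C y & x = phi_plus a y \/ x = - phi_plus a y).

Definition proj_regular_value Delta a (P : 'M[R]_(m, n.+1)) (z : 'rV[R]_n.+1) : Prop :=
  regular_value (d := n) (Yplus a) (Yplus_circ Delta a) (unit_sphere (k := n.+1))
    (proj_plus P) z.

(* The degree of the lifted projection is d, for the orientations oY of
   (Y^+_Delta)^o and oS of S^n. *)
Definition proj_degree Delta a (P : 'M[R]_(m, n.+1))
    (oY : 'rV[R]_m -> 'M[R]_(n, m) -> bool)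
    (oS : 'rV[R]_n.+1 -> 'M[R]_(n, n.+1) -> bool) (d : int) : Prop :=
  orientation (Yplus_circ Delta a) oY /\
  is_degree (Yplus a) (Yplus_circ Delta a) (unit_sphere (k := n.+1))
    (proj_plus P) oY oS d.

End SphericalToricVariety.

(* Main.v *)
(* On the cone over the torus part of Y^+ the 2^(n+1) orthants are graphs of
   exponentials (the sheets), indexed by sign vectors g in (Z/2)^(n+1); two sheets
   meet along the facet F exactly when they differ by (b.F, b) mod 2.  Comparing
   an orientation with the logarithmic frame gives a sign w g on each sheet, and
   orientability amounts to w changing sign across every facet.  By Fourier
   analysis on (Z/2)^(n+1) such a w exists iff some character takes the value -1
   at all the vectors (-1)^(b, b.F), which is the condition on bases.

   For the degree, the signed count of a regular fiber inside the torus is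
   written, following Heinz, as an integral of rho(|XP - z|^2) det(D(XP)), where
   X runs over the sheets weighted by (-1)^w.  Moving z changes the integral by
   the flux of a divergence-free field; the flux at infinity vanishes in the
   limit because adjacent sheets cancel along facets and the minors of D(XP)
   vanish along smaller faces.  Fibers meeting facets are first pushed into the
   torus.  Counting points of the fiber then bounds |degree| by the number of
   solutions. *)
Require Import Defs.
From HB Require Import structures.
From mathcomp Require Import all_boot all_order fingroup perm all_algebra.
From mathcomp Require Import all_classical all_reals all_analysis.
From mathcomp Require Import ring lra zify.

Set Implicit Arguments.
Unset Strict Implicit.
Unset Printing Implicit Defensive.

Import Order.TTheory GRing.Theory Num.Theory.
Import numFieldNormedType.Exports.

Local Open Scope classical_set_scope.
Local Open Scope ring_scope.

(** * Maximum-norm estimates and continuity for matrices *)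

Section MatrixNorm.
Context {R : realType}.

(** Smoothness of [Yplus_circ] is available only through a local C^1 equation. At a point over a
    facet, n + 1 monomial coordinates are therefore selected whose restriction to the cone is a
    chart. This choice also yields the arithmetic fact behind the sign rule: the transverse
    coordinate has odd parity on (b.F, b) mod 2, since otherwise two different sheets would have the
    same image in the chart. Exactly one selected coordinate then changes sign between adjacent
    sheets, and with it the logarithmic frame.

    For the degree, the cone replaces an equation on the sphere by XP = z, that is n + 1 equations
    in the n + 1 parameters of a sheet, so the fiber is counted by zeros of maps from R^(n+1) to
    itself. Sheets are not compact: cutting off at radius k costs an error integrated over a box of
    volume of order k^(n+1), which is harmless because the weighted flux decays exponentially. Of
    the integral one asks only linearity, a bound, positivity and that derivatives integrate to
    zero; a limit of Riemann sums has these properties. *)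

Lemma near_normP (V : normedModType R) (p : V) (Q : set V) :
  (\forall x \near p, Q x) <-> exists2 e, 0 < e & forall x, `|x - p| < e -> Q x.
Proof.
rewrite (nbhs_normP p Q); split=> -[e /= e0 h]; exists e => // x.
  by move=> xe; apply: h; rewrite /= distrC.
by move=> /=; rewrite distrC; exact: h.
Qed.

Lemma near2_normP (V W : normedModType R) (p : V) (q : W) (Q : V -> W -> Prop) :
  (\forall x \near p & y \near q, Q x y) <->
  exists2 e, 0 < e & forall x y, `|x - p| < e -> `|y - q| < e -> Q x y.
Proof.
split.
  case=> -[A B] /= [/near_normP[e e0 he] /near_normP[d d0 hd]] h.
  exists (Num.min e d); first by rewrite lt_min e0.
  move=> x y; rewrite !lt_min => /andP[xe _] /andP[_ yd].
  exact: (h (x, y) (conj (he _ xe) (hd _ yd))).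
case=> e e0 h; exists ([set x | `|x - p| < e], [set y | `|y - q| < e]) => /=.
  by split; apply/near_normP; exists e.
by case=> x y /= [xe ye]; exact: h.
Qed.

Lemma mx_entry_le m n (M : 'M[R]_(m, n)) i j : `|M i j| <= `|M|.
Proof.
rewrite [leRHS]/Num.Def.normr /= mx_normrE.
exact: (le_bigmax _ (fun k : 'I_m * 'I_n => `|M k.1 k.2|) (i, j)).
Qed.

Lemma mx_norm_le m n (M : 'M[R]_(m, n)) e :
  0 <= e -> (forall i j, `|M i j| <= e) -> `|M| <= e.
Proof.
by move=> e0 h; rewrite [leLHS]/Num.Def.normr /= mx_normrE bigmax_le// => -[i j] _ /=.
Qed.

Lemma mx_norm_lt m n (M : 'M[R]_(m, n)) e :
  0 < e -> (forall i j, `|M i j| < e) -> `|M| < e.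
Proof.
move=> e0 h; rewrite [ltLHS]/Num.Def.normr /= mx_normrE.
by apply: bigmax_lt => // -[i j] _ /=.
Qed.

Lemma mulmx_norm m n p (A : 'M[R]_(m, n)) (B : 'M[R]_(n, p)) :
  `|A *m B| <= n%:R * (`|A| * `|B|).
Proof.
apply: mx_norm_le => [|i j]; first by rewrite mulr_ge0// mulr_ge0.
rewrite mxE (le_trans (ler_norm_sum _ _ _))//.
have -> : n%:R * (`|A| * `|B|) = \sum_(k < n) (`|A| * `|B|) :> R.
  by rewrite sumr_const card_ord mulr_natl.
by apply: ler_sum => k _; rewrite normrM ler_pM// mx_entry_le.
Qed.

Lemma mulmx_bound m n p (B : 'M[R]_(n, p)) :
  exists2 C, 0 < C & forall A : 'M[R]_(m, n), `|A *m B| <= C * `|A|.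
Proof.
exists (n%:R * `|B| + 1) => [|A]; first by rewrite ltr_wpDl// mulr_ge0.
rewrite (le_trans (mulmx_norm A B))// mulrCA mulrC ler_wpM2r//.
by rewrite lerDl.
Qed.

Lemma mulmx_lower m n p (B : 'M[R]_(n, p)) :
  row_free B -> exists2 C, 0 < C & forall A : 'M[R]_(m, n), `|A| <= C * `|A *m B|.
Proof.
move=> Bf; have [C C0 h] := @mulmx_bound m _ _ (pinvmx B).
exists C => // A; rewrite -{1}[A]mulmx1 -(mulmxVp Bf) mulmxA; exact: h.
Qed.

Lemma continuous_at_eq (T U : topologicalType) (f g : T -> U) x :
  f =1 g -> {for x, continuous g} -> {for x, continuous f}.
Proof. by move/funext->. Qed.

Lemma continuous_mxP (T : topologicalType) m n (f : T -> 'M[R]_(m, n)) x :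
  {for x, continuous f} <-> forall i j, {for x, continuous (fun t => f t i j)}.
Proof.
split=> h.
  move=> i j; apply: (@continuous_comp _ _ _ f (fun M : 'M[R]_(m, n) => M i j)) => //.
  exact: coord_continuous.
apply/cvgrPdist_lt => e e0.
near=> t; apply: mx_norm_lt => // i j; rewrite !mxE; move: i j.
near: t; apply: filter_forall => i; apply: filter_forall => j.
by have /cvgrPdist_lt/(_ e e0) := h i j.
Unshelve. all: by end_near. Qed.

Lemma continuous_sumP (T : topologicalType) (I : Type) (r : seq I) (P : pred I)
    (f : I -> T -> R) x : (forall i, {for x, continuous (f i)}) ->
  {for x, continuous (fun t => \sum_(i <- r | P i) f i t)}.
Proof.
move=> h; elim: r => [|i r ih].
  by apply: (continuous_at_eq (fun=> big_nil _ _ _ _)); exact: cst_continuous.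
apply: (continuous_at_eq (fun=> big_cons _ _ _ _ _ _)).
by case: (P i) => //; apply: (@continuousD _ R^o).
Qed.

Lemma continuous_prodP (T : topologicalType) (I : Type) (r : seq I) (P : pred I)
    (f : I -> T -> R) x : (forall i, {for x, continuous (f i)}) ->
  {for x, continuous (fun t => \prod_(i <- r | P i) f i t)}.
Proof.
move=> h; elim: r => [|i r ih].
  by apply: (continuous_at_eq (fun=> big_nil _ _ _ _)); exact: cst_continuous.
apply: (continuous_at_eq (fun=> big_cons _ _ _ _ _ _)).
by case: (P i) => //; apply: continuousM.
Qed.

Lemma continuous_det (T : topologicalType) n (f : T -> 'M[R]_n) x :
  {for x, continuous f} -> {for x, continuous (fun t => \det (f t))}.
Proof.
move=> /continuous_mxP h; rewrite /determinant.
apply: continuous_sumP => s; apply: continuousM; first exact: cst_continuous.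
exact: continuous_prodP.
Qed.

Lemma det_neq0_near (T : topologicalType) n (f : T -> 'M[R]_n) x :
  {for x, continuous f} -> \det (f x) != 0 -> \forall t \near x, \det (f t) != 0.
Proof. by move=> /continuous_det cf; exact: (cvgr_neq0 _ cf). Qed.

Lemma continuous_mulmx (T : topologicalType) m n p (f : T -> 'M[R]_(m, n))
    (g : T -> 'M[R]_(n, p)) x :
  {for x, continuous f} -> {for x, continuous g} ->
  {for x, continuous (fun t => f t *m g t)}.
Proof.
move=> /continuous_mxP hf /continuous_mxP hg; apply/continuous_mxP => i j.
apply: (continuous_at_eq (fun=> mxE _ _ _ _)).
by apply: continuous_sumP => k; apply: continuousM.
Qed.

Lemma continuous_col_mx (T : topologicalType) m1 m2 n (f : T -> 'M[R]_(m1, n))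
    (g : T -> 'M[R]_(m2, n)) x :
  {for x, continuous f} -> {for x, continuous g} ->
  {for x, continuous (fun t => col_mx (f t) (g t))}.
Proof.
move=> /continuous_mxP hf /continuous_mxP hg; apply/continuous_mxP => i j.
apply: (continuous_at_eq (fun=> mxE _ _ _ _)).
by case: (fintype.split i).
Qed.

Lemma continuous_invmx (T : topologicalType) n (f : T -> 'M[R]_n) x :
  {for x, continuous f} -> f x \in unitmx ->
  {for x, continuous (fun t => invmx (f t))}.
Proof.
move=> cf fx.
have cd := continuous_det cf.
have d0 : \det (f x) != 0 by rewrite -unitfE -unitmxE.
have nr : \forall t \near x, \det (f t) != 0.
  exact: (cvgr_neq0 _ cd d0).
have cg : {for x, continuous (fun t => (\det (f t))^-1 *: \adj (f t))}.
  apply/continuous_mxP => i j.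
  apply: (@continuous_at_eq _ _ _ (fun t => (\det (f t))^-1 * cofactor (f t) j i)).
    by move=> t; rewrite !mxE.
  apply: continuousM; first exact: continuousV.
  apply: continuousM; first exact: cst_continuous.
  apply: continuous_det; apply/continuous_mxP => k l.
  apply: (@continuous_at_eq _ _ _ (fun t => f t (lift j k) (lift i l))).
    by move=> t; rewrite !mxE.
  by move/continuous_mxP: cf; apply.
(* [invmx] returns its argument on singular matrices, so the adjugate formula is available only
   where the determinant is nonzero, which holds near [x]. *)
have E t : \det (f t) != 0 -> invmx (f t) = (\det (f t))^-1 *: \adj (f t).
  by move=> h; rewrite /invmx unitmxE unitfE h.
move: cg; rewrite /prop_for /continuous_at -(E x d0) => cg.
apply: (cvg_trans _ cg); apply: near_eq_cvg.
by near=> t; rewrite E//; near: t.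
Unshelve. all: by end_near. Qed.

End MatrixNorm.

(** * Strict differentiability and submanifolds *)

Section Derivatives.
Context {R : realType}.

Lemma is_deriveP (V : normedModType R) (f : R -> V) (a : R) (v : V) :
  is_derive a (1 : R) f v <->
  forall e, 0 < e -> exists2 d, 0 < d &
    forall h, `|h| < d -> `|f (a + h) - f a - h *: v| <= e * `|h|.
Proof.
split=> [[df <-] e e0|H].
  have := df; rewrite /derivable => /(@cvgrPdist_le _ _ _ _ _ _ _).1 /(_ e e0).
  move=> /nbhs_ballP [d /= d0 hd].
  exists d => // h hh; have [->|h0] := eqVneq h 0.
    by rewrite addr0 subrr scale0r subr0 !normr0 mulr0.
  have := hd h; rewrite /ball /= sub0r normrN => /(_ hh h0).
  rewrite distrC /derive => le1.
  have -> : f (a + h) - f a - h *: lim (h^-1 *: (f (h *: (1:R) + a) - f a) @[h --> 0^'])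
    = h *: (h^-1 *: (f (h *: (1:R) + a) - f a) - lim (h^-1 *: (f (h *: (1:R) + a) - f a) @[h --> 0^'])).
    by rewrite scalerBr scalerA mulfV// scale1r [h *: (1:R)]mulr1 [h + a]addrC.
  by rewrite normrZ mulrC ler_wpM2r.
have cv : h^-1 *: (f (h *: (1:R) + a) - f a) @[h --> 0^'] --> v.
  apply/cvgrPdist_le => e e0; have [d d0 hd] := H e e0.
  apply/nbhs_ballP; exists d => // h; rewrite /ball /= sub0r normrN => hh h0.
  rewrite distrC.
  have -> : h^-1 *: (f (h *: (1:R) + a) - f a) - v = h^-1 *: (f (a + h) - f a - h *: v).
    by rewrite [in RHS]scalerBr scalerA mulVf// scale1r [h *: (1:R)]mulr1 [h + a]addrC.
  by rewrite normrZ normfV ler_pdivrMl ?normr_gt0// mulrC hd.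
split; first by apply/cvg_ex; exists v.
exact/cvg_lim.
Qed.

Lemma is_derive_mxP m n (M : R -> 'M[R]_(m, n)) (t : R) D :
  is_derive t (1 : R) M D <-> forall i j, is_derive t (1 : R) (fun s => M s i j) (D i j).
Proof.
split=> [[dM <-] i j|H].
  by split; [exact: (derivable_mxP M t 1).1|rewrite derive_mx// mxE].
have dM : derivable M t 1 by apply/derivable_mxP => i j; case: (H i j).
by split=> //; rewrite derive_mx//; apply/matrixP => i j; rewrite mxE; case: (H i j).
Qed.

Lemma is_derive_near (V : normedModType R) (f g : R -> V) (a : R) (v : V) :
  (\forall t \near a, f t = g t) -> is_derive a (1 : R) f v -> is_derive a (1 : R) g v.
Proof.
move=> /near_normP [e0 e00 he] /is_deriveP H; apply/is_deriveP => e e1.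
have [d d0 hd] := H e e1; exists (Num.min d e0); first by rewrite lt_min d0.
move=> h; rewrite lt_min => /andP[h1 h2].
by rewrite -!he ?hd// ?subrr ?normr0// addrC addKr.
Qed.

Lemma is_derive_inj (V : normedModType R) (f : R -> V) (a : R) (v w : V) :
  is_derive a (1 : R) f v -> is_derive a (1 : R) f w -> v = w.
Proof. by move=> [_ <-] [_ <-]. Qed.

Lemma is_derive_line a b (g : 'rV[R]_a -> 'rV[R]_b) x v (t : R) :
  differentiable g (x + t *: v) ->
  is_derive t (1 : R) (fun s : R => g (x + s *: v)) (v *m jacobian g (x + t *: v)).
Proof.
move=> dg; have H1 : is_derive t (1 : R) (fun s : R => x + s *: v) v.
  apply/is_deriveP => e e0; exists 1 => // h _.
  have -> : x + (t + h) *: v - (x + t *: v) - h *: v = 0.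
    by apply/rowP => i; rewrite !mxE; ring.
  by rewrite normr0 mulr_ge0// ltW.
have dl : differentiable (fun s : R => x + s *: v) t.
  by apply/derivable1_diffP; case: H1.
split; first exact/derivable1_diffP/differentiable_comp.
rewrite deriveE; last exact/differentiable_comp.
rewrite diff_comp//=; have -> : 'd (fun s : R => x + s *: v) t 1 = v.
  by rewrite -deriveE//; case: H1.
by rewrite -deriveE// deriveEjacobian.
Qed.

Lemma is_derive_comp_jacobian a b (g : 'rV[R]_a -> 'rV[R]_b) (c : R -> 'rV[R]_a) t v :
  differentiable g (c t) -> is_derive t (1 : R) c v ->
  is_derive t (1 : R) (fun s : R => g (c s)) (v *m jacobian g (c t)).
Proof.
move=> dg H1; have dl : differentiable c t by apply/derivable1_diffP; case: H1.
split; first exact/derivable1_diffP/differentiable_comp.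
rewrite deriveE; last exact/differentiable_comp.
rewrite diff_comp//=; have -> : 'd c t 1 = v by rewrite -deriveE//; case: H1.
by rewrite -deriveE// deriveEjacobian.
Qed.

Lemma continuous_dist (V : normedModType R) (p : V) : continuous (fun x => `|x - p|).
Proof.
move=> x; apply/cvgrPdist_lt => eps eps0; apply/near_normP; exists eps => //.
move=> z zx; apply: (le_lt_trans (ler_dist_dist _ _)).
by rewrite opprB addrA subrK distrC.
Qed.

(** Varying both points is what transfers injectivity and surjectivity from [A] to [h] near [p]; an
    expansion at [p] alone would not control differences of values away from [p]. *)
Definition strict_diff a b (h : 'rV[R]_a -> 'rV[R]_b) p (A : 'M[R]_(a, b)) :=
  forall e, 0 < e -> exists2 d, 0 < d & forall x x',
    `|x - p| < d -> `|x' - p| < d -> `|h x - h x' - (x - x') *m A| <= e * `|x - x'|.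

(** Mean value theorem, entry by entry, for [g] minus its linear part along the segment from [x'] to
    [x]; the derivative there is a difference of Jacobians, small by continuity at [p]. *)
Lemma C1_strict_diff a b (g : 'rV[R]_a -> 'rV[R]_b) p :
  (\forall x \near p, differentiable g x) -> {for p, continuous (jacobian g)} ->
  strict_diff g p (jacobian g p).
Proof.
move=> /near_normP[d1 d10 hd1] cg e e0.
(* [mulmx_norm] costs a factor [a]; adding 1 keeps the denominator positive when [a = 0]. *)
have e'0 : 0 < e / (a%:R + 1) by rewrite divr_gt0// ltr_wpDl.
move/cvgrPdist_lt : cg => /(_ _ e'0) /near_normP[d2 d20 hd2].
exists (Num.min d1 d2); first by rewrite lt_min d10.
move=> x x'; rewrite !lt_min => /andP[x1 x2] /andP[x1' x2'].
set v := x - x'.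
have seg (t : R) d : t \in `[0, 1]%R -> `|x - p| < d -> `|x' - p| < d ->
    `|x' + t *: v - p| < d.
  rewrite in_itv /= => /andP[t0 t1] xd xd'.
  have -> : x' + t *: v - p = t *: (x - p) + (1 - t) *: (x' - p).
    by apply/rowP => i; rewrite !mxE; ring.
  rewrite (le_lt_trans (ler_normD _ _))// !normrZ !ger0_norm ?subr_ge0//.
  have [->|tn0] := eqVneq t 0; first by rewrite mul0r add0r subr0 mul1r.
  have tp : 0 < t by rewrite lt_neqAle eq_sym tn0.
  rewrite [ltRHS](_ : _ = t * d + (1 - t) * d); last by ring.
  by rewrite ltr_leD// ?ltr_pM2l// ler_wpM2l ?subr_ge0// ltW.
apply: mx_norm_le => [|i k]; first by rewrite mulr_ge0// ltW.
rewrite (ord1 i){i}.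
pose f (t : R) := g (x' + t *: v) 0 k - t * (v *m jacobian g p) 0 k.
pose df (t : R) := (v *m jacobian g (x' + t *: v)) 0 k - (v *m jacobian g p) 0 k.
have fd (t : R) : t \in `[0, 1]%R -> is_derive t (1 : R) f (df t).
  move=> t01; apply: is_deriveB.
    have := is_derive_line (hd1 _ (seg t _ t01 x1 x1')).
    by move/is_derive_mxP => /(_ 0 k).
  apply/is_deriveP => e1 e10; exists 1 => // z _.
  rewrite (_ : _ - _ - _ = 0) ?normr0 ?mulr_ge0// ?ltW//.
  by rewrite /GRing.scale /=; ring.
have fd1 (t : R) : t \in `]0, 1[%R -> is_derive t (1 : R) f (df t).
  by move=> t01; apply: fd; apply: subset_itv_oo_cc t01.
have fc : {within `[0, 1], continuous f}.
  apply: derivable_within_continuous => t t01.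
  by case: (fd t t01).
have [c c01 E] := @MVT_segment R f df 0 1 ler01 fd1 fc.
have -> : (g x - g x' - v *m jacobian g p) 0 k = f 1 - f 0.
  have e1 : x' + 1 *: v = x by rewrite scale1r addrC subrK.
  have e2 : x' + 0 *: v = x' by rewrite scale0r addr0.
  by rewrite /f e1 e2 mul1r mul0r subr0 !mxE; ring.
rewrite E subr0 mulr1 /df.
have -> : (v *m jacobian g (x' + c *: v)) 0 k - (v *m jacobian g p) 0 k
  = (v *m (jacobian g (x' + c *: v) - jacobian g p)) 0 k.
  by rewrite mulmxBr [RHS]mxE; congr (_ + _); rewrite [RHS]mxE.
apply: (le_trans (mx_entry_le _ _ _)); apply: (le_trans (mulmx_norm _ _)).
have := hd2 _ (seg c _ c01 x2 x2').
move: (jacobian g (x' + c *: v)) (jacobian g p) => J1 J2; rewrite distrC => lt2.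
rewrite mulrCA mulrC ler_wpM2r// (le_trans (y := a%:R * (e / (a%:R + 1))))//.
  by rewrite ler_wpM2l// ltW.
rewrite mulrCA -{2}[e]mulr1; apply: ler_wpM2l; first exact: ltW.
by rewrite ler_pdivrMr ?mul1r ?lerDl// ltr_wpDl.
Qed.

Section LocalInverse.
Context {a b : nat} (h : 'rV[R]_a -> 'rV[R]_b) (p : 'rV[R]_a) (A : 'M[R]_(a, b)).
Hypothesis hA : strict_diff h p A.

(** With tolerance [(2 * C)^-1] the linearization error contributes at most half of [|x - x'|] and
    is absorbed on the left. *)
Lemma strict_diff_lower : row_free A -> exists2 d, 0 < d & exists2 C, 0 < C &
  forall x x', `|x - p| < d -> `|x' - p| < d -> `|x - x'| <= C * `|h x - h x'|.
Proof.
move=> Af; have [C C0 hC] := @mulmx_lower R 1 _ _ _ Af.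
have e0 : 0 < (2 * C)^-1 by rewrite invr_gt0 mulr_gt0.
have [d d0 hd] := hA e0; exists d => //; exists (2 * C); first by rewrite mulr_gt0.
move=> x x' xd xd'; have h1 := hC (x - x').
have h2 : `|(x - x') *m A| <= `|h x - h x'| + `|h x - h x' - (x - x') *m A|.
  rewrite -[in leLHS](subKr (h x - h x') ((x - x') *m A)).
  exact: ler_normB.
have h3 := hd _ _ xd xd'.
have : `|x - x'| <= C * (`|h x - h x'| + (2 * C)^-1 * `|x - x'|).
  apply: (le_trans h1); apply: ler_wpM2l; first exact: ltW.
  by apply: (le_trans h2); rewrite lerD2l.
have -> : C * (`|h x - h x'| + (2 * C)^-1 * `|x - x'|) =
   C * `|h x - h x'| + `|x - x'| / 2.
  by field; rewrite gt_eqF.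
lra.
Qed.

Lemma strict_diff_continuous : exists2 d, 0 < d &
  exists2 C, 0 < C & forall x x', `|x - p| < d -> `|x' - p| < d ->
  `|h x - h x'| <= C * `|x - x'|.
Proof.
have [C C0 hC] := @mulmx_bound R 1 _ _ A.
have [d d0 hd] := hA ltr01; exists d => //; exists (C + 1); first by rewrite addr_gt0.
move=> x x' xd xd'; have h3 := hd _ _ xd xd'.
rewrite -(subrK ((x - x') *m A) (h x - h x')) (le_trans (ler_normD _ _))//.
by rewrite addrC mulrDl lerD.
Qed.

(* If the minimum of [|h - y|] on a small closed ball were positive, moving from
   the minimiser in the direction [(y - h) A^-1] would decrease it. *)
Lemma local_surjectivity : row_free A -> row_full A ->
  forall e, 0 < e -> exists2 d, 0 < d &
    forall y, `|y - h p| < d -> exists2 x, `|x - p| < e & h x = y.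
Proof.
move=> Af Au e e0.
have [d1 d10 [C C0 hlow]] := strict_diff_lower Af.
have [d2 d20 [K K0 hup]] := strict_diff_continuous.
pose B := pinvmx A.
have BA : B *m A = 1%:M.
  apply: (row_full_inj Au).
  by rewrite mulmx1 mulmxA mulmxKpV.
have [M M0 hM] := @mulmx_bound R 1 _ _ B.
have q0 : 0 < (2 * M)^-1 by rewrite invr_gt0 mulr_gt0.
have [d3 d30 hd3] := hA q0.
pose r := Num.min (Num.min d1 d2) (Num.min d3 e) / 2.
have r0 : 0 < r by rewrite divr_gt0// !lt_min d10 d20 d30 e0.
have [rd1 rd2 rd3 re] : [/\ r < d1, r < d2, r < d3 & r < e].
  have : 2 * r <= Num.min (Num.min d1 d2) (Num.min d3 e) by rewrite /r; lra.
  by rewrite !le_min => /andP[/andP[? ?] /andP[? ?]]; split; lra.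
pose D := [set x : 'rV[R]_a | `|x - p| <= r].
(* This radius keeps the minimiser [x] off the boundary: [h x] is no farther from [y] than [h p] is,
   so [|h x - h p| < r / C] and [hlow] gives [|x - p| < r]. *)
exists (r / (2 * C)); first by rewrite divr_gt0// mulr_gt0.
move=> y hy.
have pD : D p by rewrite /D /= subrr normr0 ltW.
have cn := @continuous_dist 'rV[R]_a p.
have cD : compact D.
  apply: bounded_closed_compact.
    exists (r + `|p|); split; first by rewrite num_real.
    move=> u ru x xD; apply: (le_trans _ (ltW ru)).
    by rewrite -(subrK p x) (le_trans (ler_normD _ _))// lerD2r.
  have -> : D = (fun x : 'rV[R]_a => `|x - p|) @^-1` [set t | t <= r] by [].
  apply: preimage_closed; last exact: closed_le.
  by move=> x _; exact: cn.
have cF : {within D, continuous (fun x => `|h x - y|)}.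
  apply/subspace_continuousP => x xD; apply/cvgrPdist_lt => eps eps0.
  rewrite near_withinE /from_subspace.
  have kk : 0 < Num.min (d2 - `|x - p|) (eps / K).
    rewrite lt_min divr_gt0// andbT subr_gt0; exact: le_lt_trans xD rd2.
  apply/(@near_normP R 'rV[R]_a x); exists (Num.min (d2 - `|x - p|) (eps / K)) => //.
  move=> z; rewrite lt_min => /andP[z1 z2] zD.
  apply: (le_lt_trans (ler_dist_dist _ _)).
  have -> : h x - y - (h z - y) = h x - h z by rewrite opprB addrA subrK.
  apply: (@le_lt_trans _ _ (K * `|x - z|)).
    by apply: hup; exact: (le_lt_trans _ rd2).
  by rewrite mulrC -ltr_pdivlMr// distrC.
have [x xD xmin] := EVT_min_rV (ex_intro _ p pD) cD cF.
rewrite inE in xD.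
have lep : `|h x - y| <= `|h p - y| by apply: xmin; rewrite inE.
have hyp : `|h p - y| < r / (2 * C) by rewrite distrC.
have xlt : `|x - p| < r.
  have xl : `|x - p| <= C * `|h x - h p|.
    by apply: hlow; [exact: le_lt_trans xD rd1|rewrite subrr normr0].
  apply: (le_lt_trans xl).
  have : `|h x - h p| <= `|h x - y| + `|h p - y|.
    have -> : h x - h p = (h x - y) - (h p - y) by rewrite opprB addrA subrK.
    exact: ler_normB.
  move=> le2; rewrite mulrC -ltr_pdivlMr//; apply: (le_lt_trans le2).
  have -> : r / C = r / (2 * C) + r / (2 * C) by field; rewrite gt_eqF.
  by rewrite ltr_leD// ?(le_lt_trans lep)// ltW.
exists x; first exact: lt_trans re.
apply/eqP; rewrite -subr_eq0 -normr_eq0; apply/negPn/negP => n0.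
have np : 0 < `|h x - y| by rewrite lt_neqAle eq_sym n0 normr_ge0.
pose v := (y - h x) *m B.
have vM : `|v| <= M * `|h x - y| by rewrite distrC; exact: hM.
(* The step [t *: v] stays in the closed ball; it multiplies the distance to [y] by [1 - t], up to
   an error of at most [t / 2] times that distance. *)
pose t := Num.min 1 ((r - `|x - p|) / (M * `|h x - y|)).
have t0 : 0 < t by rewrite lt_min ltr01 divr_gt0 ?subr_gt0 ?mulr_gt0.
have t1 : t <= 1 by rewrite ge_min lexx.
have tv : t * `|v| <= r - `|x - p|.
  apply: (@le_trans _ _ (t * (M * `|h x - y|))); first by rewrite ler_wpM2l// ltW.
  by rewrite -ler_pdivlMr ?mulr_gt0// ge_min lexx orbT.
have xtD : D (x + t *: v).
  rewrite /D /= addrAC (le_trans (ler_normD _ _))// normrZ gtr0_norm//.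
  by rewrite -lerBrDl.
have : `|h x - y| <= `|h (x + t *: v) - y| by apply: xmin; rewrite inE.
have xt3 : `|x + t *: v - p| < d3 by exact: le_lt_trans xtD rd3.
have x3 : `|x - p| < d3 by exact: lt_trans xlt rd3.
have := hd3 _ _ xt3 x3.
have -> : x + t *: v - x = t *: v by rewrite addrC addKr.
have vA : v *m A = y - h x by rewrite /v -mulmxA BA mulmx1.
rewrite -scalemxAl vA normrZ gtr0_norm// => le1.
have -> : h (x + t *: v) - y = (h (x + t *: v) - h x - t *: (y - h x)) + (1 - t) *: (h x - y).
  by apply/rowP => i; rewrite !mxE; ring.
apply/negP; rewrite -ltNge.
apply: (le_lt_trans (ler_normD _ _)); rewrite normrZ ger0_norm ?subr_ge0//.
have : (2 * M)^-1 * (t * `|v|) <= t * `|h x - y| / 2.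
  have -> : t * `|h x - y| / 2 = (2 * M)^-1 * (t * (M * `|h x - y|)).
    by field; rewrite gt_eqF.
  by rewrite ler_pM2l// ler_pM2l.
move=> le4; have := le_trans le1 le4.
have tn : 0 < t * `|h x - y| by rewrite mulr_gt0.
rewrite mulrBl mul1r; move: tn le1 le4; lra.
Qed.

End LocalInverse.
End Derivatives.

Section Submanifold.
Context {R : realType}.

Lemma row_free_ker a b (A : 'M[R]_(a, b)) :
  (forall v : 'rV_a, v *m A = 0 -> v = 0) -> row_free A.
Proof.
move=> h; rewrite -kermx_eq0; apply/eqP/row_matrixP => i.
by rewrite row0; apply: h; rewrite -row_mul mulmx_ker row0.
Qed.

Lemma row_mx_norm_le a b (x : 'rV[R]_a) (y : 'rV[R]_b) e :
  `|x| <= e -> `|y| <= e -> `|row_mx x y| <= e.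
Proof.
move=> xe ye; apply: mx_norm_le => [|i j]; first exact: le_trans (normr_ge0 x) xe.
rewrite (ord1 i) mxE; case: (fintype.split j) => k; exact: le_trans (mx_entry_le _ _ _) _.
Qed.

Lemma row_mx_norm_ge a b (x : 'rV[R]_a) (y : 'rV[R]_b) :
  `|x| <= `|row_mx x y| /\ `|y| <= `|row_mx x y|.
Proof.
split; apply: mx_norm_le => // i j; rewrite (ord1 i).
  by rewrite -(row_mxEl x y) mx_entry_le.
by rewrite -(row_mxEr x y) mx_entry_le.
Qed.

Lemma strict_diff_row_mx a b c (g : 'rV[R]_a -> 'rV[R]_b) (h : 'rV[R]_a -> 'rV[R]_c) p A B :
  strict_diff g p A -> strict_diff h p B ->
  strict_diff (fun x => row_mx (g x) (h x)) p (row_mx A B).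
Proof.
move=> gA hB e e0; have [d1 d10 hd1] := gA e e0; have [d2 d20 hd2] := hB e e0.
exists (Num.min d1 d2); first by rewrite lt_min d10.
move=> x x'; rewrite !lt_min => /andP[x1 x2] /andP[x1' x2'].
rewrite mul_mx_row opp_row_mx add_row_mx opp_row_mx add_row_mx.
by apply: row_mx_norm_le; [apply: hd1|apply: hd2].
Qed.

Lemma strict_diff_mulmx a b (A : 'M[R]_(a, b)) p : strict_diff (mulmx^~ A) p A.
Proof.
move=> e e0; exists 1 => // x x' _ _.
by rewrite mulmxBl subrr normr0 mulr_ge0// ltW.
Qed.

Context {d m : nat}.
Variable M : set 'rV[R]_m.
Implicit Types (p q : 'rV[R]_m).

(** Spreading the conditions over a ball, full rank included, lets one equation describe the tangent
    spaces at all nearby points of [M]. *)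
Definition local_eq r (g : 'rV[R]_m -> 'rV[R]_r) p e : Prop :=
  [/\ (d + r = m)%N, 0 < e & forall x, `|x - p| < e ->
   [/\ differentiable g x, {for x, continuous (jacobian g)},
       \rank (jacobian g x) = r & (M x <-> g x = 0)]].

Lemma local_eq_at r (g : 'rV[R]_m -> 'rV[R]_r) p e q :
  local_eq g p e -> `|q - p| < e -> local_eq g q (e - `|q - p|).
Proof.
move=> [dr e0 h] qp; split; rewrite ?subr_gt0// => x xq; apply: h.
rewrite -(subrKA q) (le_lt_trans (ler_normD _ _))//.
by rewrite -ltrBrDr.
Qed.

Lemma rank_near (T : topologicalType) a b (f : T -> 'M[R]_(a, b)) x :
  {for x, continuous f} -> row_full (f x) -> \forall t \near x, row_full (f t).
Proof.
move=> cf fx; have [L LE] := row_fullP fx.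
have cg : {for x, continuous (fun t => L *m f t)}.
  by apply/continuous_mulmx => //; exact: cst_continuous.
have nz : \det (L *m f x) != 0 by rewrite LE det1 oner_neq0.
apply: filterS (det_neq0_near cg nz) => t ht.
apply/row_fullP; exists (invmx (L *m f t) *m L).
by rewrite -mulmxA mulVmx// unitmxE unitfE.
Qed.

Lemma rank_near_free (T : topologicalType) a b (f : T -> 'M[R]_(a, b)) x :
  {for x, continuous f} -> row_free (f x) -> \forall t \near x, row_free (f t).
Proof.
move=> cf fx; have cg : {for x, continuous (fun t => (f t)^T)}.
  apply/continuous_mxP => i j; apply: (continuous_at_eq (fun=> mxE _ _ _ _)).
  by move/continuous_mxP : cf; apply.
have fT : row_full (f x)^T by rewrite /row_full mxrank_tr.
apply: filterS (rank_near cg fT) => t.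
by rewrite /row_full mxrank_tr.
Qed.

Lemma C1_local_eq p : C1_submanifold d M -> M p ->
  exists r (g : 'rV[R]_m -> 'rV[R]_r) e, local_eq g p e.
Proof.
move=> hM Mp; have [r [g [dr nb rk Me]]] := hM p Mp.
have cJ : {for p, continuous (jacobian g)} by case: (nbhs_singleton nb).
have rf : row_full (jacobian g p) by rewrite /row_full rk.
have nrk := rank_near cJ rf.
have [e e0 he] : exists2 e, 0 < e & forall x, `|x - p| < e ->
    [/\ differentiable g x, {for x, continuous (jacobian g)},
       \rank (jacobian g x) = r & (M x <-> g x = 0)].
  apply/(@near_normP R 'rV[R]_m p); apply: filterS (filterI nb (filterI nrk Me)).
  by move=> x [[? ?] [/eqP ? ?]].
by exists r, g, e; split.
Qed.

Section Local.
Context {r : nat} {g : 'rV[R]_m -> 'rV[R]_r} {p : 'rV[R]_m} {e : R}.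
Hypothesis (hg : local_eq g p e) (Mp : M p).
Let J := jacobian g p.

Let e0 : 0 < e. Proof. by case: hg. Qed.
Let pe : `|p - p| < e. Proof. by rewrite subrr normr0. Qed.

Let gp0 : g p = 0.
Proof. by case: hg => _ _ /(_ p pe) [_ _ _ h]; apply/h. Qed.

Let rankJ : \rank J = r.
Proof. by case: hg => _ _ /(_ p pe) []. Qed.

Lemma local_eq_strict : strict_diff g p J.
Proof.
case: hg => _ _ h; apply: C1_strict_diff; last by case: (h p pe).
by apply/(@near_normP R 'rV[R]_m p); exists e => // x /h[].
Qed.

Lemma rank_ker_local : \rank (kermx J) = d.
Proof.
by rewrite mxrank_ker rankJ; case: hg => dr _ _; exact: (canLR (addnK r) (esym dr)).
Qed.

Lemma tangent_ker v : tangent M p v -> v *m J = 0.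
Proof.
case=> c [c0 nM dc]; case: (hg) => _ _ h.
have cc : continuous_at 0 c.
  by apply: differentiable_continuous; apply/derivable1_diffP; case: dc.
have nc : \forall t \near (0:R), `|c t - p| < e.
  move/cvgrPdist_lt : cc => /(_ e e0); apply: filterS => t.
  by rewrite c0 distrC.
have dg : differentiable g (c 0) by rewrite c0; case: (h p pe).
have := is_derive_comp_jacobian dg dc; rewrite c0 => H1.
have H2 : is_derive (0:R) (1:R) (fun s => g (c s)) 0.
  have Hc : is_derive (0:R) (1:R) (fun=> 0 : 'rV[R]_r) 0.
    apply/is_deriveP => e1 e10; exists 1 => // z _.
    by rewrite subrr scaler0 subr0 normr0 mulr_ge0// ltW.
  apply: is_derive_near Hc.
  near=> t; have /h[_ _ _ [h1 _]] : `|c t - p| < e by near: t.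
  by rewrite /= h1//; near: t.
exact: is_derive_inj H1 H2.
Unshelve. all: by end_near. Qed.

(** Implicit function theorem. Completing [g] by linear coordinates [K] dual to a basis of [kermx J]
    makes the derivative [A] invertible; the curve solves [h0 (c t) = h0 p + t *: (v *m A)], and
    since [v *m J = 0] its [g]-part stays zero. *)
Lemma ker_tangent v : v *m J = 0 -> tangent M p v.
Proof.
move=> vJ.
pose B0 := row_base (kermx J); pose K := pinvmx B0; pose A := row_mx J K.
have B0f : row_free B0 by exact: row_base_free.
have Af : row_free A.
  apply: row_free_ker => w; rewrite mul_mx_row -[0]row_mx0 => /eq_row_mx[wJ wK].
  have : (w <= B0)%MS by rewrite eq_row_base; apply/sub_kermxP.
  by case/submxP => u wE; move: wK; rewrite wE -mulmxA mulmxVp// mulmx1 => ->; rewrite mul0mx.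
have Au : row_full A.
  rewrite /row_full; move: Af; rewrite /row_free => /eqP ->.
  by rewrite rank_ker_local addnC; case: hg => ->.
pose h0 x := row_mx (g x) (x *m K).
have sA : strict_diff h0 p A.
  by apply: strict_diff_row_mx; [exact: local_eq_strict|exact: strict_diff_mulmx].
have [d1 d10 [C C0 hlow]] := strict_diff_lower sA Af.
have [C2 C20 hC2] := @mulmx_lower R 1 _ _ _ Af.
have q0 : 0 < Num.min e d1 by rewrite lt_min e0.
have [dl dl0 hs] := local_surjectivity sA Af Au q0.
pose n := `|v *m A| + 1.
have n0 : 0 < n by rewrite ltr_wpDl.
(* Outside the range of [t] the default [p] is taken, so that [choice] yields a total function. *)
have H t : exists x, `|t| < dl / n ->
   `|x - p| < Num.min e d1 /\ h0 x = h0 p + t *: (v *m A).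
  have [ht|ht] := ltP `|t| (dl / n); last by exists p.
  have [] := hs (h0 p + t *: (v *m A)).
    rewrite addrC addKr normrZ (le_lt_trans (y := `|t| * n))//.
      by rewrite ler_wpM2l// lerDl.
    by rewrite -ltr_pdivlMr.
  by move=> x x1 x2; exists x.
have [c hc] := choice H.
have cle t : `|t| < dl / n -> `|c t - p| <= C * (`|t| * `|v *m A|).
  move=> /hc[]; rewrite lt_min => /andP[_ cd1] E.
  have pd1 : `|p - p| < d1 by rewrite subrr normr0.
  by have := hlow _ _ cd1 pd1; rewrite E [h0 p + _]addrC addrK normrZ.
have z0 : `|0 : R| < dl / n by rewrite normr0 divr_gt0.
have c0 : c 0 = p.
  apply/eqP; rewrite -subr_eq0 -normr_le0; have := cle 0 z0.
  by rewrite normr0 mul0r mulr0.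
exists c; split => //.
  apply/(@near_normP R R^o 0); exists (dl / n); first by rewrite divr_gt0.
  move=> t; rewrite subr0 => /hc[]; rewrite lt_min => /andP[te _] E.
  case: hg => _ _ /(_ _ te) [_ _ _ ->]; move: E; rewrite /h0 gp0 mul_mx_row vJ.
  by rewrite scale_row_mx scaler0 add_row_mx addr0 => /eq_row_mx[].
apply/is_deriveP => eps eps0.
have m0 : 0 < C * n * C2 by rewrite !mulr_gt0.
have [d2 d20 h2] := sA (eps / (C * n * C2)) (divr_gt0 eps0 m0).
exists (Num.min (dl / n) (d2 / (C * n))).
  by rewrite lt_min !divr_gt0// mulr_gt0.
move=> t; rewrite lt_min => /andP[t1 t2]; rewrite add0r c0.
have [_ E] := hc t t1.
have le1 : `|c t - p| <= C * n * `|t|.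
  apply: (le_trans (cle t t1)); rewrite -mulrA ler_pM2l// mulrC ler_wpM2r//.
  by rewrite lerDl.
have cd2 : `|c t - p| < d2.
  by apply: (le_lt_trans le1); rewrite mulrC -ltr_pdivlMr// mulr_gt0.
have pd2 : `|p - p| < d2 by rewrite subrr normr0.
have := h2 _ _ cd2 pd2.
rewrite E [h0 p + _]addrC addrK => le2; apply: (le_trans (hC2 _)).
rewrite distrC in le2; rewrite mulmxBl -scalemxAl.
apply: (@le_trans _ _ (C2 * (eps / (C * n * C2) * (C * n * `|t|)))).
  rewrite ler_pM2l// (le_trans le2)// ler_pM2l// divr_gt0//.
rewrite le_eqVlt; apply/orP; left; apply/eqP; field.
by rewrite !gt_eqF.
Qed.

Lemma frame_kerP (B : 'M[R]_(d, m)) : frame M p B <-> B *m J = 0 /\ row_free B.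
Proof.
split=> [[_ tB fB]|[BJ fB]].
  split=> //; apply/row_matrixP => i; rewrite row0 row_mul; exact: tangent_ker.
by split=> // i; apply: ker_tangent; rewrite -row_mul BJ row0.
Qed.

Lemma local_frame_exists : exists B : 'M[R]_(d, m), frame M p B.
Proof.
have : forall k, \rank (kermx J) = k ->
    exists B : 'M[R]_(k, m), B *m J = 0 /\ row_free B.
  move=> k <-; exists (row_base (kermx J)); split; last exact: row_base_free.
  by apply/sub_kermxP; rewrite eq_row_base.
by move=> /(_ d rank_ker_local) [B hB]; exists B; apply/frame_kerP.
Qed.

Lemma local_frame_span k (B : 'M[R]_(d, m)) (w : 'M[R]_(k, m)) :
  frame M p B -> w *m J = 0 -> (w <= B)%MS.
Proof.
move=> /frame_kerP[BJ fB] wJ; apply: (@submx_trans _ _ _ _ _ _ (kermx J)).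
  exact/sub_kermxP.
have sB : (B <= kermx J)%MS by exact/sub_kermxP.
by rewrite -(mxrank_leqif_sup sB) rank_ker_local.
Qed.

End Local.

Lemma local_frame_near r (g : 'rV[R]_m -> 'rV[R]_r) p e (B : 'M[R]_(d, m)) :
  local_eq g p e -> M p -> frame M p B ->
  forall eps, 0 < eps -> \forall q \near p, M q ->
    exists2 B', frame M q B' & `|B' - B| < eps.
Proof.
move=> hg Mp /(frame_kerP hg Mp)[BJ fB] eps eps0.
have [rankJ pe e0] : [/\ \rank (jacobian g p) = r, `|p - p| < e & 0 < e].
  by case: (hg) => _ e0 h; rewrite subrr normr0; split=> //; case: (h p); rewrite ?subrr ?normr0.
have rf : row_full (jacobian g p) by rewrite /row_full rankJ.
have [L LE] := row_fullP rf.
have cJ : {for p, continuous (jacobian g)} by case: hg => _ _ /(_ p pe)[].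
have cLJ : {for p, continuous (fun q => L *m jacobian g q)}.
  by apply: continuous_mulmx => //; exact: cst_continuous.
have uLJ : L *m jacobian g p \in unitmx by rewrite LE unitmx1.
(* [F q] projects the rows of [B] onto the kernel of [jacobian g q] along the rows of [L]; at [p] it
   returns [B] itself because [B *m jacobian g p = 0]. *)
pose F q := B - B *m jacobian g q *m invmx (L *m jacobian g q) *m L.
have cF : {for p, continuous F}.
  apply: continuousB; first exact: cst_continuous.
  apply: continuous_mulmx; last exact: cst_continuous.
  apply: continuous_mulmx; last exact: continuous_invmx.
  by apply: continuous_mulmx => //; exact: cst_continuous.
have Fp : F p = B by rewrite /F BJ !mul0mx subr0.
have nF := rank_near_free cF; rewrite Fp in nF; have {}nF := nF fB.
have nL : \forall q \near p, L *m jacobian g q \in unitmx.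
  have nz : \det (L *m jacobian g p) != 0 by rewrite LE det1 oner_neq0.
  by apply: filterS (det_neq0_near cLJ nz) => q; rewrite unitmxE unitfE.
have nB : \forall q \near p, `|F q - B| < eps.
  move/cvgrPdist_lt : cF => /(_ eps eps0); apply: filterS => q.
  by rewrite Fp distrC.
have ne : \forall q \near p, `|q - p| < e.
  by apply/(@near_normP R 'rV[R]_m p); exists e.
near=> q => Mq; exists (F q); last by near: q.
have qe : `|q - p| < e by near: q.
have hq := local_eq_at hg qe.
have [U fF] : L *m jacobian g q \in unitmx /\ row_free (F q) by split; near: q.
apply/(frame_kerP hq Mq); split; last exact: fF.
by rewrite /F mulmxBl -!mulmxA mulVmx// mulmx1 subrr.
Unshelve. all: by end_near. Qed.

Lemma frame_span p k (B : 'M[R]_(d, m)) (w : 'M[R]_(k, m)) :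
  C1_submanifold d M -> frame M p B ->
  (forall i, tangent M p (row i w)) -> (w <= B)%MS.
Proof.
move=> hM fB tw; have Mp : M p by case: fB.
have [r [g [e hg]]] := C1_local_eq hM Mp.
apply: (local_frame_span hg Mp fB); apply/row_matrixP => i.
by rewrite row0 row_mul; exact: (tangent_ker hg (tw i)).
Qed.

Lemma frame_change p (B B' : 'M[R]_(d, m)) :
  C1_submanifold d M -> frame M p B -> frame M p B' ->
  exists2 A, A \in unitmx & B' = A *m B.
Proof.
move=> hM fB fB'; have [_ tB' rB'] := fB'.
have /submxP[A E] := frame_span hM fB tB'.
exists A => //; rewrite -row_free_unit; move: rB'; rewrite E.
rewrite /row_free => /eqP h; rewrite eqn_leq rank_leq_row /= -{1}h.
exact: mxrankM_maxl.
Qed.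

Lemma frame_mul p (B : 'M[R]_(d, m)) A :
  C1_submanifold d M -> frame M p B -> A \in unitmx -> frame M p (A *m B).
Proof.
move=> hM fB Au; have Mp : M p by case: fB.
have [r [g [e hg]]] := C1_local_eq hM Mp.
move/(frame_kerP hg Mp): fB => [BJ rB]; apply/(frame_kerP hg Mp).
split; first by rewrite -mulmxA BJ mulmx0.
by rewrite /row_free mxrankMfree// -/(row_free A) row_free_unit.
Qed.

Lemma frame_exists p : C1_submanifold d M -> M p ->
  exists B : 'M[R]_(d, m), frame M p B.
Proof.
by move=> hM Mp; have [r [g [e hg]]] := C1_local_eq hM Mp; exact: local_frame_exists hg Mp.
Qed.

Lemma frame_near p (B : 'M[R]_(d, m)) : C1_submanifold d M -> frame M p B ->
  forall eps, 0 < eps -> \forall q \near p, M q ->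
    exists2 B', frame M q B' & `|B' - B| < eps.
Proof.
move=> hM fB; have Mp : M p by case: fB.
have [r [g [e hg]]] := C1_local_eq hM Mp; exact: local_frame_near hg Mp fB.
Qed.

(* For a cone over M, the linear map Q is a chart near p as soon as it is
   injective on the span of p and of the tangent space. *)
Section ConeChart.
Variables (p : 'rV[R]_m) (B : 'M[R]_(d, m)) (Q : 'M[R]_(m, 1 + d)).
Hypotheses (hM : C1_submanifold d M) (fB : frame M p B)
  (detQ : \det (col_mx p B *m Q) != 0).

Let Mp : M p. Proof. by case: fB. Qed.

Lemma cone_chart : exists2 d0, 0 < d0 &
  (forall x x' l, M x -> M x' -> `|x - p| < d0 -> `|x' - p| < d0 ->
     `|l - 1| < d0 -> x *m Q = l *: (x' *m Q) -> x = x') /\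
  (forall e, 0 < e -> exists2 dl, 0 < dl & forall w, `|w - p *m Q| < dl ->
     exists x l, [/\ M x, `|x - p| < e, `|l - 1| < e & l *: (x *m Q) = w]).
Proof.
have [r [g [e hg]]] := C1_local_eq hM Mp; have [dr e0 he] := hg.
have gp0 : g p = 0.
  by have [|_ _ _ h] := he p; [rewrite subrr normr0|apply/h].
have rJ : \rank (jacobian g p) = r.
  by have [] := he p; rewrite ?subrr ?normr0.
pose J := jacobian g p.
(* The cone is unfolded: the first entry of [y] is the scaling factor, the rest a point of the
   ambient space. The defining equation together with the scaled values of [Q] is a map between
   spaces of equal dimension, with invertible derivative [A] at [P0]. *)
pose h (y : 'rV[R]_(1 + m)) : 'rV[R]_(r + (1 + d)) :=
  row_mx (g (rsubmx y)) (lsubmx y 0 0 *: (rsubmx y *m Q)).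
pose P0 : 'rV[R]_(1 + m) := row_mx (const_mx 1) p.
pose A2 : 'M[R]_(1 + m, 1 + d) := col_mx (p *m Q) Q.
pose A1 : 'M[R]_(1 + m, r) := col_mx 0 J.
pose A : 'M[R]_(1 + m, r + (1 + d)) := row_mx A1 A2.
have subn (y y' : 'rV[R]_(1 + m)) : `|rsubmx y - rsubmx y'| <= `|y - y'| /\
    `|lsubmx y 0 0 - lsubmx y' 0 0| <= `|y - y'|.
  have [h1 h2] := row_mx_norm_ge (lsubmx (y - y')) (rsubmx (y - y')).
  rewrite hsubmxK in h1 h2; split.
    by apply: le_trans h2; rewrite raddfB.
  have -> : lsubmx y 0 0 - lsubmx y' 0 0 = lsubmx (y - y') 0 0 by rewrite raddfB [RHS]mxE [X in _ = _ + X]mxE.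
  exact: le_trans (mx_entry_le _ _ _) h1.
have s1 : strict_diff (fun y : 'rV[R]_(1 + m) => g (rsubmx y)) P0 A1.
  move=> eps eps0; have [d1 d10 h1] := local_eq_strict hg eps0.
  exists d1 => // x x' xd xd'.
  have [hx _] := subn x P0; have [hx' _] := subn x' P0; have [hxx _] := subn x x'.
  rewrite row_mxKr in hx hx'.
  apply: (@le_trans _ _ (eps * `|rsubmx x - rsubmx x'|)); last by rewrite ler_pM2l.
  have -> : (x - x') *m A1 = (rsubmx x - rsubmx x') *m J.
    rewrite -[X in X *m _](hsubmxK (x - x')) mul_row_col mulmx0 add0r.
    by rewrite raddfB.
  by apply: h1; [exact: le_lt_trans hx xd|exact: le_lt_trans hx' xd'].
have [K K0 hK] := @mulmx_bound R 1 _ _ Q.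
have s2 : strict_diff (fun y : 'rV[R]_(1 + m) => lsubmx y 0 0 *: (rsubmx y *m Q)) P0 A2.
  (* The remainder of the bilinear map has two quadratic terms, each allowed half of [eps / K]. *)
  move=> eps eps0; have d10 : 0 < eps / (2 * K) by rewrite divr_gt0// mulr_gt0.
  exists (eps / (2 * K)) => // y y' yd yd'.
  have [hy _] := subn y P0; have [_ hy'] := subn y' P0; have [hxx hll] := subn y y'.
  rewrite row_mxKr in hy; rewrite row_mxKl [const_mx _ _ _]mxE in hy'.
  have -> : (y - y') *m A2 = (lsubmx y 0 0 - lsubmx y' 0 0) *: (p *m Q) + (rsubmx y - rsubmx y') *m Q.
    rewrite -[X in X *m _](hsubmxK (y - y')) mul_row_col raddfB [rsubmx (y - y')]raddfB /=.
    congr (_ + _); rewrite -mul_scalar_mx; congr (_ *m _).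
    by apply/rowP => i; rewrite (ord1 i) !mxE eqxx mulr1n.
  move: (rsubmx y) (rsubmx y') (lsubmx y 0 0) (lsubmx y' 0 0) hy hy' hxx hll.
  move=> x x' l l' hy hy' hxx hll.
  have -> : l *: (x *m Q) - l' *: (x' *m Q) - ((l - l') *: (p *m Q) + (x - x') *m Q) =
     ((l - l') *: (x - p) + (l' - 1) *: (x - x')) *m Q.
    rewrite !scalemxAl -!mulmxBl -mulmxDl -mulmxBl; congr (_ *m _).
    by apply/rowP => i; rewrite !mxE; ring.
  apply: (le_trans (hK _)).
  have : `|(l - l') *: (x - p) + (l' - 1) *: (x - x')| <= `|y - y'| * (eps / (2 * K)) + (eps / (2 * K)) * `|y - y'|.
    apply: (le_trans (ler_normD _ _)); rewrite !normrZ; apply: lerD; apply: ler_pM => //.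
      exact: le_trans hy (ltW yd).
    exact: le_trans hy' (ltW yd').
  rewrite -(ler_pM2l K0) => /le_trans; apply.
  rewrite le_eqVlt; apply/orP; left; apply/eqP; field.
  by rewrite gt_eqF.
have sA : strict_diff h P0 A by exact: strict_diff_row_mx.
have Af : row_free A.
  apply: row_free_ker => y; rewrite -(hsubmxK y) mul_mx_row -[0]row_mx0 => /eq_row_mx[].
  rewrite !mul_row_col mulmx0 add0r => wJ E.
  have /submxP[u uE] := local_frame_span hg Mp fB wJ.
  move: E; rewrite uE -mulmxA => E.
  have : row_mx (lsubmx y) u *m (col_mx p B *m Q) = 0.
    by rewrite mulmxA mul_row_col mulmxDl -!mulmxA.
  move=> /(congr1 (mulmx^~ (invmx (col_mx p B *m Q)))).
  rewrite mul0mx mulmxK ?unitmxE ?unitfE// -[0]row_mx0 => /eq_row_mx[-> ->].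
  by rewrite mul0mx row_mx0.
have Au : row_full A.
  rewrite /row_full; move: Af; rewrite /row_free => /eqP ->.
  by rewrite addnCA [(r + d)%N]addnC dr.
have [d1 d10 [C C0 hlow]] := strict_diff_lower sA Af.
have hP0 : h P0 = row_mx 0 (p *m Q).
  by rewrite /h row_mxKr row_mxKl mxE scale1r gp0.
have P0d l x : `|(row_mx (const_mx l) x : 'rV[R]_(1 + m)) - P0| <= Num.max `|l - 1| `|x - p|.
  rewrite /P0 opp_row_mx add_row_mx; apply: row_mx_norm_le.
    by apply: mx_norm_le => [|i j]; rewrite ?mxE le_max ?normr_ge0 ?lexx.
  by rewrite le_max lexx orbT.
exists (Num.min e d1); first by rewrite lt_min e0.
split=> [x x' l Mx Mx'|e1 e10].
  rewrite !lt_min => /andP[xe xd] /andP[xe' xd'] /andP[_ ld] E.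
  have gx0 y : M y -> `|y - p| < e -> g y = 0 by move=> My /he[_ _ _ hy]; apply/hy.
  have hE : h (row_mx (const_mx 1) x) = h (row_mx (const_mx l) x').
    by rewrite /h !row_mxKr !row_mxKl !mxE scale1r !gx0// E.
  have y1 : `|(row_mx (const_mx 1) x : 'rV[R]_(1 + m)) - P0| < d1.
    by apply: (le_lt_trans (P0d _ _)); rewrite subrr normr0 gt_max d10.
  have y2 : `|(row_mx (const_mx l) x' : 'rV[R]_(1 + m)) - P0| < d1.
    by apply: (le_lt_trans (P0d _ _)); rewrite gt_max ld.
  have := hlow _ _ y1 y2; rewrite hE subrr normr0 mulr0 normr_le0 subr_eq0.
  by move=> /eqP /eq_row_mx[].
have q0 : 0 < Num.min e e1 by rewrite lt_min e0.
have [dl dl0 hs] := local_surjectivity sA Af Au q0.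
exists dl => // w wd; have [|y yP hy] := hs (row_mx 0 w).
  rewrite hP0 opp_row_mx add_row_mx subrr; apply: le_lt_trans wd.
  by apply: row_mx_norm_le; rewrite ?normr0.
have [h1 h2] := subn y P0; rewrite row_mxKr in h1; rewrite row_mxKl [const_mx _ _ _]mxE in h2.
move: yP; rewrite lt_min => /andP[ye ye1].
have := hy; rewrite /h => /eq_row_mx[h3 h4].
exists (rsubmx y), (lsubmx y 0 0); split=> //.
- by have [_ _ _ ->] := he _ (le_lt_trans h1 ye).
- exact: le_lt_trans h1 ye1.
- exact: le_lt_trans h2 ye1.
Qed.

(** [cone_chart] asks the factor [l] to be close to 1. Here that is automatic: at an index where
    [p *m Q] is nonzero, [l] is the quotient of two numbers close to the same nonzero value. *)
Lemma cone_chart_inj : exists2 d0, 0 < d0 &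
  forall x x' l, M x -> M x' -> `|x - p| < d0 -> `|x' - p| < d0 -> 0 < l ->
    x *m Q = l *: (x' *m Q) -> x = x'.
Proof.
have [d0 d00 [inj _]] := cone_chart.
have pQ0 : p *m Q != 0.
  apply: contraNneq detQ => E; apply/eqP/eqP; rewrite -[_ == _]negbK -unitfE -unitmxE.
  apply/negP => U; have : (row_mx 1%:M 0 : 'rV[R]_(1 + d)) *m (col_mx p B *m Q) = 0.
    by rewrite mulmxA mul_row_col mul1mx mul0mx addr0.
  move=> /(congr1 (mulmx^~ (invmx (col_mx p B *m Q)))); rewrite mul0mx mulmxK//.
  move=> /(congr1 lsubmx); rewrite row_mxKl linear0 => /matrixP/(_ 0 0).
  rewrite !mxE eqxx => /eqP.
  by rewrite oner_eq0.
have [k kn] : exists k, (p *m Q) 0 k != 0.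
  apply/existsP; apply: contraNT pQ0; rewrite negb_exists => /forallP h.
  by apply/eqP/rowP => k; rewrite [RHS]mxE; have := h k; rewrite negbK => /eqP.
set c := (p *m Q) 0 k in kn; have c0 : 0 < `|c| by rewrite normr_gt0.
have [K K0 hK] := @mulmx_bound R 1 _ _ Q.
(* The bound [1 / 2] keeps the denominator [u'] at least [|c| / 2] in size, and [d0 / 8] then brings
   [|l - 1|] below [d0]. *)
pose eta := Num.min (1 / 2) (d0 / 8).
have eta0 : 0 < eta by rewrite lt_min !divr_gt0.
have eta1 : eta <= 1 / 2 by rewrite ge_min lexx.
have eta2 : eta <= d0 / 8 by rewrite ge_min lexx orbT.
exists (Num.min d0 (eta * `|c| / K)).
  by rewrite lt_min d00 divr_gt0// mulr_gt0.
move=> x x' l Mx Mx'; rewrite !lt_min => /andP[xd xe] /andP[xd' xe'] l0 E.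
apply: (inj x x' l) => //.
have near y : `|y - p| < eta * `|c| / K -> `|(y *m Q) 0 k - c| < eta * `|c|.
  move=> h; have -> : (y *m Q) 0 k - c = ((y - p) *m Q) 0 k by rewrite mulmxBl [RHS]mxE [X in _ = _ + X]mxE.
  apply: (le_lt_trans (mx_entry_le _ _ _)); apply: (le_lt_trans (hK _)).
  by rewrite mulrC -ltr_pdivlMr.
have h1 := near _ xe; have h2 := near _ xe'.
have E2 : (x *m Q) 0 k = l * (x' *m Q) 0 k by rewrite E mxE.
move: ((x *m Q) 0 k) ((x' *m Q) 0 k) h1 h2 E2 => u u' h1 h2 E2.
have u'1 : `|c| / 2 <= `|u'|.
  have : `|c| <= `|u'| + `|u' - c| by rewrite -[X in `|X| <= _](subKr u' c) ler_normB.
  have : eta * `|c| <= 1 / 2 * `|c| by rewrite ler_pM2r.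
  lra.
have u'0 : 0 < `|u'| by apply: lt_le_trans u'1; rewrite divr_gt0.
have : `|l - 1| * `|u'| < d0 * `|u'|.
  rewrite -normrM mulrBl mul1r -E2.
  have : `|u - u'| <= `|u - c| + `|u' - c|.
    have -> : u - u' = (u - c) - (u' - c) by ring.
    exact: ler_normB.
  have : d0 * (`|c| / 2) <= d0 * `|u'| by rewrite ler_pM2l.
  have : eta * `|c| <= d0 / 8 * `|c| by rewrite ler_pM2r.
  have : 0 < d0 * `|c| by rewrite mulr_gt0.
  lra.
by rewrite ltr_pM2r.
Qed.

Lemma cone_chart_surj : forall e, 0 < e -> exists2 dl, 0 < dl &
  forall w, `|w - p *m Q| < dl ->
     exists x l, [/\ M x, `|x - p| < e, 0 < l & l *: (x *m Q) = w].
Proof.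
move=> e e0; have [d0 d00 [_ surj]] := cone_chart.
have q0 : 0 < Num.min e 1 by rewrite lt_min e0 ltr01.
have [dl dl0 h] := surj _ q0; exists dl => // w /h[x [l [Mx]]].
rewrite !lt_min => /andP[xe _] /andP[_ l1] E; exists x, l; split=> //.
by move: l1; rewrite ltr_norml => /andP[+ _]; lra.
Qed.

End ConeChart.
End Submanifold.

From mathcomp Require Import zify.

(** * Sheets, strata and facets of the spherical toric variety *)

Section EuclideanNorm.
Context {R : realType}.

Lemma sumsq_ge0 k (x : 'rV[R]_k) : 0 <= \sum_i x 0 i ^+ 2.
Proof. by apply: sumr_ge0 => i _; exact: sqr_ge0. Qed.

Lemma enorm_sq k (x : 'rV[R]_k) : enorm x ^+ 2 = \sum_i x 0 i ^+ 2.
Proof. by rewrite sqr_sqrtr// sumsq_ge0. Qed.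

Lemma enorm_ge0 k (x : 'rV[R]_k) : 0 <= enorm x.
Proof. exact: sqrtr_ge0. Qed.

Lemma enormZ k (l : R) (x : 'rV[R]_k) : enorm (l *: x) = `|l| * enorm x.
Proof.
rewrite -sqrtr_sqr -sqrtrM ?sqr_ge0// mulr_sumr; congr Num.sqrt.
by apply: eq_bigr => i _; rewrite mxE exprMn.
Qed.

Lemma enormN k (x : 'rV[R]_k) : enorm (- x) = enorm x.
Proof. by rewrite -scaleN1r enormZ normrN1 mul1r. Qed.

Lemma norm_le_enorm k (x : 'rV[R]_k) : `|x| <= enorm x.
Proof.
apply: mx_norm_le => [|i j]; first exact: enorm_ge0.
rewrite (ord1 i) -sqrtr_sqr ler_wsqrtr// (bigD1 j)//= lerDl.
by apply: sumr_ge0 => l _; exact: sqr_ge0.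
Qed.

Lemma enorm_eq0 k (x : 'rV[R]_k) : (enorm x == 0) = (x == 0).
Proof.
apply/eqP/eqP => [h|->].
  by apply/eqP; rewrite -normr_le0 -h norm_le_enorm.
by rewrite -(scale0r 0) enormZ normr0 mul0r.
Qed.

Lemma enorm_gt0 k (x : 'rV[R]_k) : (0 < enorm x) = (x != 0).
Proof. by rewrite lt_neqAle enorm_ge0 andbT eq_sym enorm_eq0. Qed.

Lemma continuous_enorm k : continuous (@enorm R k).
Proof.
move=> x; apply: (@continuous_comp _ _ _ (fun x : 'rV[R]_k => \sum_i x 0 i ^+ 2) Num.sqrt).
  apply: (@continuous_sumP R) => i.
  by apply: continuousM; exact: coord_continuous.
exact: sqrt_continuous.
Qed.

Lemma continuous_normalize k (x : 'rV[R]_k) : x != 0 -> {for x, continuous (@normalize R k)}.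
Proof.
move=> x0; apply/continuous_mxP => i j.
apply: (@continuous_at_eq _ _ _ (fun y : 'rV[R]_k => (enorm y)^-1 * y i j)).
  by move=> y; rewrite mxE.
apply: continuousM; last exact: coord_continuous.
apply: continuousV; last exact: continuous_enorm.
by rewrite enorm_eq0.
Qed.

Lemma enorm_normalize k (x : 'rV[R]_k) : x != 0 -> enorm (normalize x) = 1.
Proof.
move=> x0; rewrite /normalize enormZ ger0_norm ?invr_ge0 ?enorm_ge0// mulVf//.
by rewrite enorm_eq0.
Qed.

Lemma normalize_unit k (x : 'rV[R]_k) : enorm x = 1 -> normalize x = x.
Proof. by move=> x1; rewrite /normalize x1 invr1 scale1r. Qed.

Lemma normalizeZ k (l : R) (x : 'rV[R]_k) : 0 < l -> normalize (l *: x) = normalize x.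
Proof.
move=> l0; rewrite /normalize enormZ gtr0_norm// scalerA invfM mulrAC mulVf ?mul1r//.
by rewrite gt_eqF.
Qed.

Lemma normalizeN k (x : 'rV[R]_k) : normalize (- x) = - normalize x.
Proof. by rewrite /normalize enormN scalerN. Qed.

End EuclideanNorm.

Section Sheets.
Context {R : realType} {n m : nat}.
Variable a : 'I_m -> 'rV[int]_n.

Notation N := (1 + n)%N.
Notation G := {ffun 'I_N -> bool}.

(* The monomials of y become linear in the exponents with a leading coordinate 1,
   which records the scaling of a cone over the toric variety. *)
Definition hexp j : 'rV[int]_N := row_mx (const_mx 1) (a j).

Definition hmat : 'M[R]_(m, N) := \matrix_(j, i) (hexp j 0 i)%:~R.

Definition lam (t : 'rV[R]_N) (j : 'I_m) : R := (t *m hmat^T) 0 j.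

(** The pairing of (Z/2)^N with exponent vectors: the monomial with exponent [v] takes the value
    (-1)^parity at the sign vector (-1)^g. *)
Definition parity (g : G) (v : 'rV[int]_N) : bool :=
  \big[addb/false]_i (g i && odd (absz (v 0 i))).

Definition sgn (g : G) j : R := (-1) ^+ parity g (hexp j).

Definition sheet (g : G) (t : 'rV[R]_N) : 'rV[R]_m :=
  \row_j (sgn g j * expR (lam t j)).

Definition gadd (g h : G) : G := [ffun i => g i (+) h i].

Lemma oddzD (x y : int) : odd (absz (x + y)) = odd (absz x) (+) odd (absz y).
Proof. lia. Qed.

Lemma oddzM (x y : int) : odd (absz (x * y)) = odd (absz x) && odd (absz y).
Proof. by rewrite abszM oddM. Qed.

Lemma parityD g u v : parity g (u + v) = parity g u (+) parity g v.
Proof.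
rewrite /parity -big_split /=; apply: eq_bigr => i _.
by rewrite mxE oddzD; case: (g i).
Qed.

Lemma parityZ g (c : int) v : parity g (c *: v) = odd (absz c) && parity g v.
Proof.
rewrite /parity (big_morph (andb (odd (absz c))) (andb_addr _) (andbF _)).
by apply: eq_bigr => i _; rewrite mxE oddzM andbCA.
Qed.

Lemma parity0 g : parity g 0 = false.
Proof. by rewrite /parity big1// => i _; rewrite mxE /= andbF. Qed.

Lemma parity_sum g (I : finType) (f : I -> 'rV[int]_N) :
  parity g (\sum_i f i) = \big[addb/false]_i parity g (f i).
Proof. exact: (big_morph (parity g) (parityD g) (parity0 g)). Qed.

Lemma parity_gadd g h v : parity (gadd g h) v = parity g v (+) parity h v.
Proof.
rewrite /parity -big_split /=; apply: eq_bigr => i _.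
by rewrite ffunE; case: (odd _); rewrite ?andbT ?andbF.
Qed.

Lemma gaddK g h : gadd (gadd g h) h = g.
Proof. by apply/ffunP => i; rewrite !ffunE addbK. Qed.

Lemma sgn_neq0 g j : sgn g j != 0.
Proof. by rewrite /sgn signr_eq0. Qed.

Lemma normr_sgn g j : `|sgn g j| = 1.
Proof. exact: normr_sign. Qed.

Lemma sgn_inj g h j : (sgn g j == sgn h j) = (parity g (hexp j) == parity h (hexp j)).
Proof. exact: inj_eq (@signr_inj R) _ _. Qed.

Lemma lam_mulmx t j : lam t j = (t *m hmat^T) 0 j. Proof. by []. Qed.

Lemma sgnE g j : sgn g j = (-1) ^+ parity g (hexp j). Proof. by []. Qed.

Lemma lamE t j : lam t j = \sum_i t 0 i * (hexp j 0 i)%:~R.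
Proof. by rewrite /lam mxE; apply: eq_bigr => i _; rewrite !mxE. Qed.

Lemma lamD t s j : lam (t + s) j = lam t j + lam s j.
Proof. by rewrite /lam mulmxDl mxE. Qed.

Lemma lamZ (l : R) t j : lam (l *: t) j = l * lam t j.
Proof. by rewrite /lam -scalemxAl mxE. Qed.

Lemma lamN t j : lam (- t) j = - lam t j.
Proof. by rewrite -scaleN1r lamZ mulN1r. Qed.

Lemma lamB t s j : lam (t - s) j = lam t j - lam s j.
Proof. by rewrite lamD lamN. Qed.

Lemma lam0 j : lam 0 j = 0.
Proof. by rewrite /lam mul0mx mxE. Qed.

(** The radial direction of the cone: translating a parameter by a multiple of [e0] rescales the
    sheet by a positive factor. *)
Definition e0 : 'rV[R]_N := row_mx (const_mx 1) 0.

Lemma hexp0 j : hexp j 0 (lshift n 0) = 1.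
Proof. by rewrite row_mxEl mxE. Qed.

Lemma hexpS j i : hexp j 0 (rshift 1 i) = a j 0 i.
Proof. by rewrite row_mxEr. Qed.

Lemma lam_split t j :
  lam t j = t 0 (lshift n 0) + \sum_i t 0 (rshift 1 i) * (a j 0 i)%:~R.
Proof.
rewrite lamE big_split_ord /= big_ord1 hexp0 mulr1; congr (_ + _).
by apply: eq_bigr => i _; rewrite hexpS.
Qed.

Lemma lam_e0 j : lam e0 j = 1.
Proof.
rewrite lam_split row_mxEl mxE big1 ?addr0// => i _.
by rewrite row_mxEr mxE mul0r.
Qed.

Lemma sheetE g t j : sheet g t 0 j = sgn g j * expR (lam t j).
Proof. by rewrite mxE. Qed.

Lemma sheet_neq0 g t j : sheet g t 0 j != 0.
Proof. by rewrite sheetE mulf_neq0 ?sgn_neq0// gt_eqF ?expR_gt0. Qed.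

Lemma normr_sheet g t j : `|sheet g t 0 j| = expR (lam t j).
Proof. by rewrite sheetE normrM normr_sgn mul1r gtr0_norm ?expR_gt0. Qed.

Lemma sgr_sheet g t j : Num.sg (sheet g t 0 j) = sgn g j.
Proof.
rewrite sheetE sgrM [X in _ * X]gtr0_sg ?expR_gt0// mulr1 /sgn.
by case: parity; rewrite ?expr1 ?expr0 ?sgrN1 ?sgr1.
Qed.

Lemma sheet_scale g t (c : R) : sheet g (t + c *: e0) = expR c *: sheet g t.
Proof.
apply/rowP => j; rewrite !mxE lamD lamZ lam_e0 mulr1 expRD.
by ring.
Qed.

Hypothesis hspan : affinely_spans a.

(** The combination representing 0 has coefficient sum 1 but contributes nothing to the last [n]
    entries, so a multiple of it corrects the leading entry. *)
Lemma hexp_span (w : 'rV[int]_N) : exists c : 'I_m -> int, w = \sum_j c j *: hexp j.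
Proof.
have [c1 [s1 E1]] := hspan (rsubmx w); have [c0 [s0 E0]] := hspan 0.
exists (fun j => c1 j + (w 0 (lshift n 0) - 1) * c0 j).
apply/rowP => i; rewrite summxE.
under eq_bigr do rewrite mxE mulrDl -mulrA.
rewrite big_split /= -mulr_sumr.
have [k ->|k ->] := split_ordP i.
  rewrite (ord1 k); under eq_bigr do rewrite hexp0 mulr1.
  rewrite s1; under eq_bigr do rewrite hexp0 mulr1.
  by rewrite s0 mulr1 addrC subrK.
under eq_bigr do rewrite hexpS.
have -> : \sum_j c1 j * a j 0 k = w 0 (rshift 1 k).
  transitivity (rsubmx w 0 k); last by rewrite mxE.
  by rewrite E1 summxE; apply: eq_bigr => j _; rewrite mxE.
under eq_bigr do rewrite hexpS.
have -> : \sum_j c0 j * a j 0 k = 0.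
  transitivity ((0 : 'rV[int]_n) 0 k); last by rewrite mxE.
  by rewrite E0 summxE; apply: eq_bigr => j _; rewrite mxE.
by rewrite mulr0 addr0.
Qed.

Lemma lam_inj t : (forall j, lam t j = 0) -> t = 0.
Proof.
move=> h; apply/rowP => i; rewrite mxE.
have [c cE] := hexp_span (delta_mx 0 i).
transitivity (\sum_j (c j)%:~R * lam t j); last first.
  by rewrite big1// => j _; rewrite h mulr0.
under eq_bigr do rewrite lamE mulr_sumr.
rewrite exchange_big /=.
transitivity (\sum_k t 0 k * ((delta_mx 0 i : 'rV[int]_N) 0 k)%:~R).
  rewrite (bigD1 i)//= mxE !eqxx mulr1 big1 ?addr0// => k ki.
  by rewrite mxE eqxx (negbTE ki) mulr0.
apply: eq_bigr => k _; rewrite cE summxE rmorph_sum mulr_sumr.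
by apply: eq_bigr => j _; rewrite mxE rmorphM /= mulrCA.
Qed.

(** Unit vectors are integral combinations of the exponents, so the bits of [g] are determined by
    parities; exponents spanning only over the rationals would not separate the sheets. *)
Lemma parity_inj g h : (forall j, parity g (hexp j) = parity h (hexp j)) -> g = h.
Proof.
move=> E; have dE (f : G) i : f i = parity f (delta_mx 0 i).
  rewrite /parity (bigD1 i)//= mxE !eqxx /= andbT big1 ?addbF// => k ki.
  by rewrite mxE eqxx (negbTE ki) /= andbF.
apply/ffunP => i; rewrite !dE; have [c ->] := hexp_span (delta_mx 0 i).
by rewrite !parity_sum; apply: eq_bigr => j _; rewrite !parityZ E.
Qed.

Lemma sgn_sheet_inj g h : (forall j, sgn g j = sgn h j) -> g = h.
Proof. by move=> E; apply: parity_inj => j; apply/eqP; rewrite -sgn_inj E. Qed.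

Lemma sheet_inj g h t s : sheet g t = sheet h s -> g = h /\ t = s.
Proof.
move=> E; split.
  by apply: sgn_sheet_inj => j; rewrite -(sgr_sheet g t) E sgr_sheet.
apply/eqP; rewrite -subr_eq0; apply/eqP/lam_inj => j; rewrite lamB.
by apply/eqP; rewrite subr_eq0; apply/eqP/expR_inj; rewrite -(normr_sheet g) E normr_sheet.
Qed.

Lemma sheet_row_neq0 g t : sheet g t != 0.
Proof.
have [j] : exists j : 'I_m, True.
  case: m a hspan => [|k] a0 h; last by exists 0.
  by have [c [/eqP]] := h 0; rewrite big_ord0 eq_sym oner_eq0.
move=> _; apply: contraNneq (sheet_neq0 g t j) => ->; by rewrite mxE.
Qed.

Lemma normalize_sheet g t : exists s, normalize (sheet g t) = sheet g s.
Proof.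
exists (t + (- ln (enorm (sheet g t))) *: e0).
rewrite sheet_scale expRN lnK// posrE enorm_gt0; exact: sheet_row_neq0.
Qed.

Definition torus_pt g (x : 'rV[R]_m) : Prop := enorm x = 1 /\ exists t, x = sheet g t.

Lemma sign_exprz (b : bool) (z : int) : ((-1) ^+ b : R) ^ z = (-1) ^+ (b && odd (absz z)).
Proof.
case: b => /=; last by rewrite expr0 exp1rz.
rewrite expr1; case: z => k; first by rewrite signr_odd -exprnP.
by rewrite signr_odd NegzE abszN -exprnN -[in LHS]signr_odd -[in RHS]signr_odd invr_sign.
Qed.

Lemma expR_exprz (x : R) (z : int) : expR x ^ z = expR (x * z%:~R).
Proof.
case: z => k; first by rewrite -exprnP -expRM_natr.
by rewrite NegzE -exprnN -expRM_natr -expRN rmorphN mulrN.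
Qed.

Lemma monomials_sheet g t :
  sheet g t = ((-1) ^+ g (lshift n 0) * expR (t 0 (lshift n 0))) *:
    monomials a (\row_i ((-1) ^+ g (rshift 1 i) * expR (t 0 (rshift 1 i)))).
Proof.
apply/rowP => j; rewrite !mxE lam_split expRD.
rewrite /sgn /parity big_split_ord /= big_ord1 hexp0 andbT signr_addb.
rewrite mulrACA; congr (_ * _).
under [RHS]eq_bigr do rewrite mxE expfzMl sign_exprz expR_exprz.
rewrite big_split /= expR_sum; congr (_ * _).
have h0 : (-1) ^+ false = 1 :> R by [].
rewrite (big_morph (fun b : bool => (-1) ^+ b : R) (@signr_addb R) h0).
by apply: eq_bigr => i _; rewrite hexpS.
Qed.

Lemma torus_coords (y : 'rV[R]_n) (b : bool) (l : R) : torus y -> exists (g : G) (t : 'rV[R]_N),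
  [/\ g (lshift n 0) = b, t 0 (lshift n 0) = l
    & y = \row_i ((-1) ^+ g (rshift 1 i) * expR (t 0 (rshift 1 i)))].
Proof.
move=> ty; exists [ffun i => if fintype.split i is inr k then y 0 k < 0 else b].
exists (row_mx (const_mx l) (\row_i ln `|y 0 i|)); split.
- by rewrite ffunE; case: split_ordP => // k /eqP; rewrite eq_lrshift.
- by rewrite row_mxEl mxE.
apply/rowP => i; rewrite mxE row_mxEr mxE lnK ?posrE ?normr_gt0; last exact: ty.
rewrite ffunE; case: split_ordP => [k /esym/eqP|k /rshift_inj <-].
  by rewrite eq_lrshift.
by rewrite -numEsign.
Qed.

Lemma torus_ptP (x : 'rV[R]_m) : (exists2 y, torus y & x = phi_plus a y \/ x = - phi_plus a y) <->
  exists g, torus_pt g x.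
Proof.
have torus_row (g : G) (t : 'rV[R]_N) :
    torus (\row_i ((-1) ^+ g (rshift 1 i) * expR (t 0 (rshift 1 i)))).
  by move=> i; rewrite mxE mulf_neq0 ?signr_eq0// gt_eqF ?expR_gt0.
split=> [[y ty E]|[g [x1 [t xE]]]].
  (* The leading bit of the sign vector records which of the two antipodes is meant. *)
  pose b := `[< x = - phi_plus a y >].
  have [g [t [gb t0 yE]]] := torus_coords b 0 ty.
  have [s sE] := normalize_sheet g t.
  exists g; suff -> : x = normalize (sheet g t).
    by split; [apply/enorm_normalize/sheet_row_neq0|exists s].
  rewrite monomials_sheet -yE gb t0 expR0 mulr1 /b.
  case: asboolP => [->|ne]; first by rewrite expr1 scaleN1r normalizeN.
  by case: E => // ->; rewrite expr0 scale1r.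
exists (\row_i ((-1) ^+ g (rshift 1 i) * expR (t 0 (rshift 1 i)))) => //.
have -> : x = normalize (sheet g t) by rewrite -xE normalize_unit.
rewrite monomials_sheet mulrC -scalerA normalizeZ ?expR_gt0//.
by case: (g _); rewrite ?expr1 ?expr0 ?scale1r ?scaleN1r ?normalizeN; [right|left].
Qed.

Lemma YplusE : Yplus a = closure [set x | exists g, torus_pt g x].
Proof. by congr closure; apply/seteqP; split => x /= /torus_ptP. Qed.

Lemma torus_pt_Yplus g x : torus_pt g x -> Yplus a x.
Proof. by move=> h; rewrite YplusE; apply: subset_closure; exists g. Qed.

Lemma Yplus_approx (x : 'rV[R]_m) e : Yplus a x -> 0 < e ->
  exists g y, torus_pt g y /\ `|y - x| < e.
Proof.
rewrite YplusE => cx e0.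
have [|y [[g gy] yB]] := cx [set y | `|y - x| < e].
  by apply/(@near_normP R 'rV[R]_m); exists e.
by exists g, y.
Qed.

Lemma Yplus_enorm (x : 'rV[R]_m) : Yplus a x -> enorm x = 1.
Proof.
rewrite YplusE => cx; have : closure [set y : 'rV[R]_m | enorm y = 1] x.
  by apply: closureS cx => y [g []].
rewrite -(closure_id _).1//.
rewrite (_ : [set y | enorm y = 1] = (@enorm R m) @^-1` [set 1])//.
apply: closed_comp => [y _|]; first exact: continuous_enorm.
exact: closed_eq.
Qed.

Lemma Yplus_compact : compact (Yplus a : set 'rV[R]_m).
Proof.
apply: bounded_closed_compact; last exact: closed_closure.
exists 1; split; first by rewrite num_real.
move=> e e1 x /Yplus_enorm x1; apply: le_trans (ltW e1).
by rewrite -x1 norm_le_enorm.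
Qed.

End Sheets.

Section Strata.
Context {R : realType} {n m : nat}.
Variable a : 'I_m -> 'rV[int]_n.
Hypothesis hspan : affinely_spans a.

Notation N := (1 + n)%N.
Notation G := {ffun 'I_N -> bool}.
Notation lam := (@lam R n m a).
Notation sgn := (@sgn R n m a).
Notation sheet := (@sheet R n m a).
Notation hmat := (@hmat R n m a).
Notation torus_pt := (@torus_pt R n m a).

(** [p] is the limit of [sheet g (t + s *: u)] for large [s]: the coordinates on the face where
    [lam u] vanishes stay constant and the others die. *)
Definition stratum (p : 'rV[R]_m) (g : G) (t u : 'rV[R]_N) : Prop :=
  (forall j, lam u j <= 0) /\
  forall j, p 0 j = if lam u j == 0 then sgn g j * expR (lam t j) else 0.

Lemma sgr_near (x y : R) : `|y - x| < `|x| -> Num.sg y = Num.sg x.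
Proof.
case: (ltrgtP x 0) => [x0|x0|->]; last by rewrite normr0 normr_lt0.
  by rewrite (ltr0_norm x0) ltr_norml => /andP[_ h]; rewrite !ltr0_sg//; lra.
by rewrite (gtr0_norm x0) ltr_norml => /andP[h _]; rewrite !gtr0_sg//; lra.
Qed.

Lemma near_logs (p : 'rV[R]_m) d : 0 < d -> nbhs p [set y : 'rV[R]_m | forall j,
  (p 0 j = 0 -> `|y 0 j| < d) /\
  (p 0 j != 0 -> `|ln `|y 0 j| - ln `|p 0 j| | < d /\ Num.sg (y 0 j) = Num.sg (p 0 j))].
Proof.
move=> d0; near=> y; rewrite /=; near: y; apply: filter_forall => j.
have cj : {for p, continuous (fun y : 'rV[R]_m => y 0 j)}.
  exact: coord_continuous.
have [p0|pn0] := eqVneq (p 0 j) 0.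
  move/cvgrPdist_lt : cj => /(_ d d0); apply: filterS => y.
  by rewrite p0 sub0r normrN.
have pp : 0 < `|p 0 j| by rewrite normr_gt0.
have cl : {for p, continuous (fun y : 'rV[R]_m => ln `|y 0 j|)}.
  apply: (@continuous_comp _ _ _ (fun y : 'rV[R]_m => `|y 0 j|) (@ln R)).
    by apply: (@continuous_comp _ _ _ (fun y : 'rV[R]_m => y 0 j) Num.norm) => //; exact: norm_continuous.
  exact: continuous_ln.
move/cvgrPdist_lt : cj => /(_ _ pp); move/cvgrPdist_lt : cl => /(_ d d0).
apply: filterS2 => y; rewrite distrC => h1; rewrite distrC => h2.
by split=> [h|_]; [rewrite h eqxx in pn0|split=> //; exact: sgr_near].
Unshelve. all: by end_near. Qed.

(** On the support of [p] the logarithms of approximating torus points converge and lie in a linear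
    subspace, which is closed: this gives [t]. Off the support they tend to minus infinity, so a
    single good approximation, corrected by a bounded vector, gives [u]. *)
Lemma Yplus_stratum p : Yplus a p -> exists g t u, stratum p g t u.
Proof.
move=> Yp.
pose WS : 'M[R]_(N, m) := \matrix_(i, j) if p 0 j == 0 then 0 else (hexp a j 0 i)%:~R.
have WSE t j : (t *m WS) 0 j = if p 0 j == 0 then 0 else lam t j.
  rewrite mxE; under eq_bigr do rewrite mxE.
  case: ifP => _; last by rewrite lamE.
  by rewrite big1// => i _; rewrite mulr0.
pose l : 'rV[R]_m := \row_j if p 0 j == 0 then 0 else ln `|p 0 j|.
have app d : 0 < d -> exists g t, [/\ forall j, p 0 j != 0 -> sgn g j = Num.sg (p 0 j),
    `|t *m WS - l| <= d & forall j, p 0 j = 0 -> expR (lam t j) < d].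
  move=> d0; move: Yp; rewrite YplusE// => cx.
  have [y [[g [_ [t yE]]] hy]] := cx _ (near_logs p d0).
  exists g, t; split=> [j pj||j pj].
  - by have [_ /(_ pj)[_]] := hy j; rewrite yE sgr_sheet.
  - apply: mx_norm_le => [|i j]; first exact: ltW.
    rewrite (ord1 i) [X in `|X|]mxE WSE [X in _ + X]mxE mxE.
    case: ifP => [_|/negbT pj]; first by rewrite subrr normr0 ltW.
    by have [_ /(_ pj)[/ltW + _]] := hy j; rewrite yE normr_sheet expRK.
  - by have [/(_ pj) + _] := hy j; rewrite yE normr_sheet.
have [t0 t0E] : exists t0, t0 *m WS = l.
  have [C C0 hC] := @mulmx_bound R 1 _ _ (cokermx WS).
  (* [cokermx WS] annihilates exactly the row space, so its product with [l], a limit of zeros,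
     vanishes. *)
  have : (l <= WS)%MS.
    rewrite submxE -normr_le0 leNgt; apply/negP => lp.
    have d0 : 0 < `|l *m cokermx WS| / (2 * C) by rewrite divr_gt0// mulr_gt0.
    have [g [t [_ h _]]] := app _ d0.
    have E : l *m cokermx WS = - ((t *m WS - l) *m cokermx WS).
      by rewrite mulmxBl -mulmxA mulmx_coker mulmx0 sub0r opprK.
    have := hC (t *m WS - l); rewrite -normrN -E => le1.
    have : C * `|t *m WS - l| <= C * (`|l *m cokermx WS| / (2 * C)) by rewrite ler_pM2l.
    have -> : C * (`|l *m cokermx WS| / (2 * C)) = `|l *m cokermx WS| / 2.
      by field; rewrite gt_eqF.
    lra.
  by case/submxP => t0 ->; exists t0.
have [C C0 hC] := @mulmx_bound R 1 _ _ (pinvmx WS *m hmat^T).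
pose L := `|t0 *m hmat^T|.
(* [L] bounds [lam t0] and [C] bounds the correction [lam w]; a coordinate below [d] leaves [lam u]
   negative after both are subtracted. *)
pose d := expR (- (L + C + 1)).
have [g [t1 [hg h1 h2]]] := app d (expR_gt0 _).
pose w := (t1 - t0) *m WS *m pinvmx WS.
have wW : w *m WS = (t1 - t0) *m WS by rewrite mulmxKpV// submxMl.
have L0 : 0 <= L by exact: normr_ge0.
have d1 : d <= 1 by rewrite -expR0 ler_expR; lra.
have wj j : `|lam w j| <= C.
  apply: (le_trans (mx_entry_le _ _ _)); rewrite /w -mulmxA.
  apply: (le_trans (hC _)); rewrite -[leRHS]mulr1 ler_pM2l// mulmxBl t0E.
  exact: le_trans h1 d1.
pose u := t1 - t0 - w.
have uW : u *m WS = 0 by rewrite mulmxBl wW subrr.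
have uS j : p 0 j != 0 -> lam u j = 0.
  by move=> pj; have := WSE u j; rewrite uW mxE (negbTE pj).
have uN j : p 0 j = 0 -> lam u j < 0.
  move=> pj; have := h2 j pj; rewrite ltr_expR => lt1.
  have t0j : `|lam t0 j| <= L by exact: mx_entry_le.
  rewrite /u !lamB; have := wj j; move: t0j lt1; rewrite !ler_norml; lra.
exists g, t0, u; split=> [j|j].
  by have [/uN/ltW//|/uS ->] := eqVneq (p 0 j) 0.
have [/[dup] /uN + ->|pj] := eqVneq (p 0 j) 0; first by move=> h; rewrite lt_eqF.
rewrite uS// eqxx hg//.
have : lam t0 j = ln `|p 0 j| by have := WSE t0 j; rewrite t0E mxE (negbTE pj).
by move=> ->; rewrite lnK ?posrE ?normr_gt0// -numEsg.
Qed.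

(** The approaching sheet [g'] has only to agree with [g] on the face; this is how several sheets
    reach the same boundary point. *)
Lemma stratum_approach p g t u g' e : stratum p g t u -> enorm p = 1 ->
  (forall j, lam u j = 0 -> sgn g' j = sgn g j) -> 0 < e ->
  exists s0, forall s, s0 <= s -> `|normalize (sheet g' (t + s *: u)) - p| < e.
Proof.
move=> [ule pE] p1 gg e0.
have pn0 : p != 0 by rewrite -enorm_eq0 p1 oner_eq0.
have [d d0 hd] : exists2 d, 0 < d & forall y : 'rV[R]_m, `|y - p| < d -> `|normalize y - p| < e.
  have := continuous_normalize pn0; rewrite /prop_for /continuous_at normalize_unit//.
  move/cvgrPdist_lt => /(_ e e0) /(@near_normP R 'rV[R]_m)[d d0 h].
  by exists d => // y /h; rewrite distrC.
(* From [s = sj j] on, coordinate [j] off the face is below [d]; the sum of absolute values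
   dominates all these thresholds. *)
pose sj j := if lam u j == 0 then 0 else (ln d - lam t j - 1) / lam u j.
exists (\sum_j `|sj j|) => s hs; apply: hd; apply: mx_norm_lt => // i j.
rewrite (ord1 i) !mxE pE lamD lamZ.
case: eqVneq => [u0|un0].
  by rewrite u0 mulr0 addr0 gg// subrr normr0.
rewrite subr0 normrM normr_sgn mul1r gtr0_norm ?expR_gt0//.
rewrite -[ltRHS]lnK ?posrE// ltr_expR.
have ul0 : lam u j < 0 by rewrite lt_neqAle un0 ule.
have : sj j <= s.
  apply: le_trans hs; apply: (le_trans (ler_norm _)).
  by rewrite (bigD1 j)//= lerDl sumr_ge0.
by rewrite /sj (negbTE un0) ler_ndivrMr//; lra.
Qed.

Lemma torus_pt_normalize g t : torus_pt g (normalize (sheet g t)).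
Proof.
split; first exact/enorm_normalize/sheet_row_neq0.
exact: normalize_sheet.
Qed.

Lemma stratum_Yplus p g t u : stratum p g t u -> enorm p = 1 -> Yplus a p.
Proof.
move=> sp p1; rewrite YplusE// => B /(@near_normP R 'rV[R]_m)[e e0 he].
have [s0 h] := stratum_approach sp p1 (fun j _ => erefl (sgn g j)) e0.
exists (normalize (sheet g (t + s0 *: u))); split; last exact/he/h.
by exists g; exact: torus_pt_normalize.
Qed.

Lemma stratum_exists g u : (forall j, lam u j <= 0) -> (exists j, lam u j = 0) ->
  exists p t, stratum p g t u /\ enorm p = 1.
Proof.
move=> ule [j0 uj0].
pose q : 'rV[R]_m := \row_j if lam u j == 0 then sgn g j else 0.
have q0 : q != 0.
  apply/eqP => /rowP/(_ j0); rewrite !mxE uj0 eqxx => /eqP.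
  by rewrite (negbTE (sgn_neq0 _ _ _)).
exists (normalize q), ((- ln (enorm q)) *: e0); split; last exact: enorm_normalize.
split=> // j; rewrite !mxE lamZ lam_e0 mulr1 expRN lnK ?posrE ?enorm_gt0//.
by case: ifP => _; rewrite ?mulr0// mulrC.
Qed.

Section Faces.
Variable Delta : set 'rV[R]_n.
Hypotheses (hn : (0 < n)%N) (hDelta : lattice_polytope Delta) (ha : lattice_points Delta a).

Definition face_of (u : 'rV[R]_N) : set 'rV[R]_n :=
  [set x | Delta x /\ u 0 (lshift n 0) + dotv (rsubmx u) x = 0].

(** The exponents on the face, homogenized so that affine dimension becomes rank, shifted by one. *)
Definition umat (u : 'rV[R]_N) : 'M[R]_(m, N) :=
  \matrix_(j, i) if lam u j == 0 then hmat j i else 0.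

Lemma lam_dotv u j : lam u j = u 0 (lshift n 0) + dotv (rsubmx u) (real_vec (a j)).
Proof.
rewrite lam_split; congr (_ + _); apply: eq_bigr => i _.
by rewrite !mxE.
Qed.

Lemma Delta_vertex j : Delta (real_vec (a j)).
Proof. by case: ha => _ /(_ (a j)) ->; exists j. Qed.

Lemma Delta_comb x : Delta x -> exists k (q : 'I_k -> 'I_m) (w : 'I_k -> R),
  [/\ forall i, 0 <= w i, \sum_i w i = 1 & x = \sum_i w i *: real_vec (a (q i))].
Proof.
have [k [p DE]] := hDelta; have [_ hD] := ha.
have pq i : exists j, p i = a j.
  apply/hD; rewrite DE; exists (fun i' => (i' == i)%:R); split.
  - by move=> i'; rewrite ler0n.
  - by rewrite (bigD1 i)//= eqxx big1 ?addr0// => i' /negbTE ->.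
  - rewrite (bigD1 i)//= eqxx scale1r big1 ?addr0// => i' /negbTE ->.
    by rewrite scale0r.
have [q qE] := choice pq.
rewrite DE => -[w [w0 w1 xE]]; exists k.+1, q, w; split=> //.
by rewrite xE; apply: eq_bigr => i _; rewrite /= qE.
Qed.

Lemma dotv_sum (v : 'rV[R]_n) k (w : 'I_k -> R) (y : 'I_k -> 'rV[R]_n) :
  dotv v (\sum_i w i *: y i) = \sum_i w i * dotv v (y i).
Proof.
rewrite /dotv; under eq_bigr do rewrite summxE mulr_sumr.
rewrite exchange_big; apply: eq_bigr => i _ /=; rewrite mulr_sumr.
by apply: eq_bigr => l _; rewrite mxE mulrCA.
Qed.

Lemma affine_comb (u : 'rV[R]_N) k (w : 'I_k -> R) (q : 'I_k -> 'I_m) : \sum_i w i = 1 ->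
  u 0 (lshift n 0) + dotv (rsubmx u) (\sum_i w i *: real_vec (a (q i))) =
  \sum_i w i * lam u (q i).
Proof.
move=> w1; under [RHS]eq_bigr do rewrite lam_dotv mulrDr.
by rewrite big_split /= -mulr_suml w1 mul1r dotv_sum.
Qed.

Lemma face_of_vertex u j : face_of u (real_vec (a j)) <-> lam u j = 0.
Proof.
by rewrite lam_dotv; split=> [[]//|h]; split=> //; exact: Delta_vertex.
Qed.

Lemma face_of_is_face u : (forall j, lam u j <= 0) -> is_face Delta (face_of u).
Proof.
move=> ule; exists (- rsubmx u), (u 0 (lshift n 0)); split.
  move=> x /Delta_comb[k [q [w [w0 w1 ->]]]].
  have : \sum_i w i * lam u (q i) <= 0.
    by apply: sumr_le0 => i _; rewrite mulr_ge0_le0.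
  rewrite -(affine_comb _ _ w1) /dotv.
  under [X in _ -> _ <= X]eq_bigr do rewrite mxE mulNr.
  by rewrite sumrN; lra.
apply/seteqP; split=> x [Dx]; rewrite /dotv /= => h; split=> //.
  under eq_bigr do rewrite mxE mulNr.
  by rewrite sumrN; move: h; rewrite /dotv; lra.
move: h; under eq_bigr do rewrite mxE mulNr.
by rewrite sumrN /dotv; lra.
Qed.

Lemma face_of_comb u x : (forall j, lam u j <= 0) -> face_of u x ->
  exists k (q : 'I_k -> 'I_m) (w : 'I_k -> R),
  [/\ \sum_i w i = 1, x = \sum_i w i *: real_vec (a (q i))
    & forall i, w i = 0 \/ lam u (q i) = 0].
Proof.
move=> ule [/Delta_comb[k [q [w [w0 w1 ->]]]]]; rewrite (affine_comb _ _ w1) => s0.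
exists k, q, w; split=> // i.
have : \sum_i - (w i * lam u (q i)) = 0 by rewrite sumrN s0 oppr0.
move/eqP; rewrite psumr_eq0; last by move=> l _; rewrite oppr_ge0 mulr_ge0_le0.
move/allP => /(_ i (mem_index_enum i)) /implyP/(_ isT).
by rewrite oppr_eq0 mulf_eq0 => /orP[/eqP|/eqP]; [left|right].
Qed.

(** Subtracting one lattice point [a j0] of the face turns [umat u] into the block triangular [E]
    with the same row space: the point contributes 1 to the rank and the differences span the
    direction space. *)
Lemma face_of_dim u : (forall j, lam u j <= 0) -> (exists j, lam u j = 0) ->
  exists2 d, has_dim (face_of u) d & \rank (umat u) = d.+1.
Proof.
move=> ule [j0 uj0].
pose D0 : 'M[R]_(m, n) := \matrix_j
  if lam u j == 0 then real_vec (a j) - real_vec (a j0) else 0.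
have rD0 j : row j D0 = if lam u j == 0 then real_vec (a j) - real_vec (a j0) else 0.
  by rewrite rowK.
exists (\rank D0).
  exists (real_vec (a j0)), (rowsub (maxrankfun D0) D0); split.
  - exact/face_of_vertex.
  - move=> i; rewrite row_rowsub rD0; case: eqVneq => [h|_].
      by rewrite addrC subrK; apply/face_of_vertex.
    by rewrite addr0; apply/face_of_vertex.
  - exact: maxrowsub_free.
  - move=> x /(face_of_comb ule)[k [q [w [w1 -> h]]]].
    rewrite eq_maxrowsub.
    have -> : \sum_i w i *: real_vec (a (q i)) - real_vec (a j0) =
        \sum_i w i *: (real_vec (a (q i)) - real_vec (a j0)).
      by under [RHS]eq_bigr do rewrite scalerBr; rewrite sumrB -scaler_suml w1 scale1r.
    apply: summx_sub => i _; have [->|lu] := h i; first by rewrite scale0r sub0mx.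
    apply: scalemx_sub; have := rD0 (q i); rewrite lu eqxx => <-; exact: row_sub.
pose E : 'M[R]_(1 + m, 1 + n) := block_mx 1%:M (real_vec (a j0)) 0 D0.
have hrow j : row j hmat = row_mx 1%:M (real_vec (a j)).
  apply/rowP => i; rewrite mxE mxE; have [k ->|k ->] := split_ordP i.
    by rewrite (ord1 k) hexp0 row_mxEl mxE.
  by rewrite hexpS row_mxEr mxE.
have ur j : row j (umat u) = if lam u j == 0 then row j hmat else 0.
  by apply/rowP => i; rewrite !mxE; case: ifP; rewrite !mxE.
have rE : \rank E = (\rank D0).+1.
  have -> : E = block_mx 1%:M 0 0 D0 *m block_mx 1%:M (real_vec (a j0)) 0 1%:M.
    by rewrite mulmx_block !mulmx1 !mul1mx !mulmx0 !mul0mx !addr0 !add0r.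
  rewrite mxrankMfree ?rank_diag_block_mx ?mxrank1//.
  by rewrite row_free_unit unitmxE det_ublock !det1 mulr1 unitr1.
rewrite -rE; apply/eqP; rewrite eqn_leq; apply/andP; split; apply: mxrankS.
  apply/row_subP => j; rewrite ur; case: eqVneq => [h|_]; last exact: sub0mx.
  rewrite hrow; have -> : row_mx 1%:M (real_vec (a j)) =
     row_mx 1%:M (delta_mx 0 j) *m E.
    rewrite mul_row_block !mul1mx mulmx0 addr0 -rowE rD0 h eqxx.
    by rewrite addrC subrK.
  exact: submxMl.
have hS j : lam u j = 0 -> (row j hmat <= umat u)%MS.
  by move=> h; have := ur j; rewrite h eqxx => <-; exact: row_sub.
rewrite /E block_mxEv col_mx_sub -hrow hS//=.
apply/row_subP => k; rewrite row_row_mx row0 rD0.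
case: eqVneq => [h|_]; last by rewrite row_mx0 sub0mx.
have -> : row_mx 0 (real_vec (a k) - real_vec (a j0)) = row k hmat - row j0 hmat.
  by rewrite !hrow opp_row_mx add_row_mx subrr.
by apply: addmx_sub; rewrite ?eqmx_opp; apply: hS.
Qed.

Lemma has_dim_le (F : set 'rV[R]_n) d d' : has_dim F d -> has_dim F d' -> (d <= d')%N.
Proof.
move=> [x [D [Fx FD fD _]]] [y [D' [Fy _ _ h]]].
have : (D <= D')%MS.
  apply/row_subP => i; have -> : row i D = (x + row i D - y) - (x - y).
    by rewrite opprB addrA subrK addrC addKr.
  by apply: addmx_sub; rewrite ?eqmx_opp; apply: h.
move/mxrankS; move: fD; rewrite /row_free => /eqP -> /leq_trans; apply.
exact: rank_leq_row.
Qed.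

(** Every row of [umat u] is orthogonal to [u], so full column rank leaves only [u = 0]. *)
Lemma umat_full u : \rank (umat u) = N -> u = 0.
Proof.
move=> h; have uf : row_free (umat u)^T by rewrite /row_free mxrank_tr h.
apply/(row_free_inj uf); rewrite mul0mx; apply/rowP => j; rewrite [RHS]mxE mxE.
under eq_bigr do rewrite !mxE.
case: eqVneq => [h0|_]; last by rewrite big1// => i _; rewrite mulr0.
by rewrite -[RHS]h0 lamE; apply: eq_bigr => i _; rewrite mxE.
Qed.

Lemma stratum_support p g t u : stratum p g t u -> enorm p = 1 -> exists j, lam u j = 0.
Proof.
move=> [ule pE] p1; apply: contrapT => /forallNP h.
suff p0 : p = 0 by move/eqP: p1; rewrite p0 (eqP (_ : enorm 0 == 0)) ?enorm_eq0// eq_sym oner_eq0.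
by apply/rowP => j; rewrite pE mxE; case: eqVneq => // lu; have := h j.
Qed.

(** [u = 0] is the torus and rank [n] a facet; a smaller rank would put [p] on the sphere of a face
    of codimension at least 2. *)
Lemma circ_stratum p g t u : Yplus_circ Delta a p -> stratum p g t u ->
  u = 0 \/ \rank (umat u) = n.
Proof.
move=> [Yp ncirc] sp; have p1 := Yplus_enorm hspan Yp.
have [ule pE] := sp.
have [d hd rk] := face_of_dim ule (stratum_support sp p1).
have [dn|dn] := leqP d.+2 n.
  exfalso; apply: (ncirc (face_of u)).
    by split; [exact: face_of_is_face|exists d].
  split=> // j nF; rewrite pE; case: eqVneq => // h0.
  by case: nF; exact/face_of_vertex.
have := rank_leq_col (umat u); rewrite rk leq_eqVlt => /orP[/eqP E|].
  by left; apply: umat_full; rewrite rk E.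
rewrite ltnS => dn'; right; apply/eqP; rewrite eqn_leq dn'.
by rewrite -ltnS.
Qed.

(** All coordinates of a torus point are nonzero, so a face whose sphere contains it contains every
    lattice point, and these span the whole space affinely. *)
Lemma torus_circ g x : torus_pt g x -> Yplus_circ Delta a x.
Proof.
move=> tx; split; first exact: torus_pt_Yplus tx.
move=> F [_ [d [[x0 [D [Fx0 _ fD h]]] dn]]] [_ hF].
have aF j : F (real_vec (a j)).
  apply: contrapT => /hF; case: tx => _ [t ->] /eqP.
  by rewrite (negbTE (sheet_neq0 _ _ _ _)).
have : (1%:M <= D)%MS.
  apply/row_subP => i; rewrite row1.
  have [c [c1 cE]] := hspan (delta_mx 0 i); have [c' [c'1 c'E]] := hspan 0.
  have hx0 (b : 'I_m -> int) v : \sum_j b j = 1 -> v = \sum_j b j *: a j ->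
      (real_vec v - x0 <= D)%MS.
    move=> b1 ->; have -> : real_vec (\sum_j b j *: a j) - x0 =
        \sum_j (b j)%:~R *: (real_vec (a j) - x0).
      under [RHS]eq_bigr do rewrite scalerBr.
      rewrite sumrB -scaler_suml -rmorph_sum b1 scale1r; congr (_ - _).
      apply/rowP => l; rewrite mxE summxE summxE rmorph_sum.
      by apply: eq_bigr => j _; rewrite !mxE rmorphM.
    by apply: summx_sub => j _; apply: scalemx_sub; exact: h.
  have -> : delta_mx 0 i = (real_vec (delta_mx 0 i) - x0) - (real_vec 0 - x0) :> 'rV[R]_n.
    rewrite opprB addrA subrK; apply/rowP => l; rewrite !mxE.
    by case: (_ && _); rewrite subr0.
  apply: addmx_sub; rewrite ?eqmx_opp.
    exact: hx0 c1 cE.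
  exact: hx0 c'1 c'E.
move/mxrankS; rewrite mxrank1 => /leq_trans/(_ (rank_leq_row D)).
by move=> nd; have := leq_trans dn nd; rewrite ltnNge leqnSn.
Qed.

End Faces.
End Strata.

From mathcomp Require Import zify.

Section FacetsCharts.
Context {R : realType} {n m : nat}.
Variable a : 'I_m -> 'rV[int]_n.
Hypothesis hspan : affinely_spans a.

Notation N := (1 + n)%N.
Notation G := {ffun 'I_N -> bool}.
Notation lam := (@lam R n m a).
Notation hmat := (@hmat R n m a).
Notation umat := (@umat R n m a).

Variable Delta : set 'rV[R]_n.
Hypotheses (hn : (0 < n)%N) (hDelta : lattice_polytope Delta) (ha : lattice_points Delta a).

Definition idot (b v : 'rV[int]_n) : int := \sum_i b 0 i * v 0 i.

Definition fvec (b : 'rV[int]_n) (c : int) : G :=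
  [ffun i => odd (absz ((row_mx (const_mx c) b : 'rV[int]_N) 0 i))].

Lemma parity_fvec b c j : parity (fvec b c) (hexp a j) = odd (absz (c + idot b (a j))).
Proof.
rewrite /parity big_split_ord big_ord1 /= ffunE hexp0 row_mxEl mxE /= andbT oddzD; congr (_ (+) _).
rewrite /idot (big_morph (fun z : int => odd (absz z)) oddzD (erefl : odd (absz 0) = false)).
by apply: eq_bigr => i _; rewrite ffunE hexpS row_mxEr oddzM.
Qed.

(** Modulo 2 the sum [c + idot b (a j)] is the lattice distance of [a j] from the facet, zero on
    it. *)
Lemma parity_fvec_face b c j : idot b (a j) = c -> parity (fvec b c) (hexp a j) = false.
Proof. by move=> E; rewrite parity_fvec E oddzD addbb. Qed.

Lemma fvec_neq0 b c : primitive_vec b -> exists i, fvec b c i.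
Proof.
move=> pb; apply: contrapT => /forallNP h.
have : (2 %| \big[gcdn/0]_(i < n) absz (b ord0 i))%N.
  apply: (big_ind (fun x => (2 %| x)%N)) => // [x y x2 y2|i _]; first by rewrite dvdn_gcd x2.
  by have := h (rshift 1 i); rewrite ffunE row_mxEr dvdn2 => /negP.
by rewrite pb.
Qed.

Lemma gadd_fvec_neq g b c : primitive_vec b -> gadd g (fvec b c) <> g.
Proof.
move=> /(fvec_neq0 c)[i bi] /ffunP/(_ i); rewrite ffunE bi.
by case: (g i).
Qed.

Lemma rat_row_int k (w : 'rV[rat]_k) : exists (d : int) (z : 'rV[int]_k),
  d != 0 /\ forall i, (z 0 i)%:~R = d%:~R * w 0 i.
Proof.
exists (\prod_i denq (w 0 i)), (\row_i (numq (w 0 i) * \prod_(l | l != i) denq (w 0 l))).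
split; first by apply/prodf_neq0 => i _; exact: denq_neq0.
by move=> i; rewrite mxE [\prod_j denq (w 0 j)](bigD1 i)//= !intrM numqE; ring.
Qed.

Lemma primitive_multiple (z : 'rV[int]_n) : z != 0 ->
  exists (e : int) b, [/\ e != 0, primitive_vec b & z = e *: b].
Proof.
move=> z0; pose e := \big[gcdn/0]_(i < n) absz (z 0 i).
have ed i : (e %| absz (z ord0 i))%N.
  by rewrite /e (bigD1 i)//= dvdn_gcdl.
have e0 : (0 < e)%N.
  rewrite lt0n; apply: contraNneq z0 => E; apply/eqP/rowP => i; rewrite mxE.
  by move: (ed i); rewrite E dvd0n absz_eq0 => /eqP.
have dz i : exists q : int, z 0 i = e%:Z * q.
  by have := ed i; rewrite -[e]/(absz e%:Z) -dvdzE => /dvdzP[q ->]; exists q; rewrite mulrC.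
have [q qE] := choice dz.
exists e%:Z, (\row_i q i); split.
- by rewrite eqz_nat -lt0n.
- rewrite /primitive_vec; apply/eqP; rewrite -(eqn_pmul2l e0) muln1.
  rewrite (big_morph (muln e) (muln_gcdr e) (muln0 e)); apply/eqP.
  transitivity (\big[gcdn/0%N]_(i < n) absz (z ord0 i)) => //.
  by apply: eq_bigr => i _; rewrite mxE qE abszM.
- by apply/rowP => i; rewrite !mxE qE.
Qed.

Lemma dotv_real_vec b v : dotv (real_vec b : 'rV[R]_n) (real_vec v) = (idot b v)%:~R.
Proof.
by rewrite /dotv rmorph_sum; apply: eq_bigr => i _; rewrite !mxE rmorphM.
Qed.

Lemma has_face_vertex u : \rank (umat u) = n -> exists j, lam u j = 0.
Proof.
move=> rk; apply: contrapT => /forallNP h; have : umat u = 0.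
  by apply/matrixP => j i; rewrite !mxE; case: eqVneq => // /h.
by move=> E; move: rk hn; rewrite E mxrank0 => <-.
Qed.

(** The functional [u] is real, but the exponents on its face are integral. Rank does not change
    under extension of the rationals, so the orthogonal space has a rational vector; clearing
    denominators and dividing by the gcd gives [b]. *)
Lemma facet_normal u : (forall j, lam u j <= 0) -> \rank (umat u) = n ->
  exists b c, [/\ primitive_vec b, forall j, lam u j = 0 -> idot b (a j) = c,
    is_facet Delta (face_of Delta u) & primitive_normal (face_of Delta u) b c].
Proof.
move=> ule rk; have [j0 uj0] := has_face_vertex rk.
pose AQ : 'M[rat]_(m, N) := \matrix_(j, i) if lam u j == 0 then (hexp a j 0 i)%:~R else 0.
have AE : umat u = map_mx ratr AQ.
  apply/matrixP => j i; rewrite [LHS]mxE [RHS]mxE [AQ j i]mxE.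
  by case: ifP => _; [rewrite ratr_int [LHS]mxE|rewrite rmorph0].
have rQ : \rank AQ = n by rewrite -[RHS]rk AE mxrank_map.
have : kermx AQ^T != 0.
  by rewrite kermx_eq0 /row_free mxrank_tr rQ ltn_eqF// add1n.
move=> /rowV0Pn[w /sub_kermxP wA w0].
have [d [z [d0 zE]]] := rat_row_int w.
have zj j : lam u j = 0 -> z 0 (lshift n 0) + idot (rsubmx z) (a j) = 0.
  move=> uj; apply/eqP; rewrite -(intr_eq0 rat) rmorphD rmorph_sum /= zE.
  under eq_bigr do rewrite rmorphM mxE /= zE -mulrA.
  rewrite -mulr_sumr -mulrDr mulf_eq0 intr_eq0 (negbTE d0) /=; apply/eqP.
  have /rowP/(_ j) := wA; rewrite mxE [RHS]mxE big_split_ord /= big_ord1 => h.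
  rewrite -[RHS]h [AQ^T _ _]mxE [AQ _ _]mxE uj eqxx hexp0 mulr1; congr (_ + _).
  by apply: eq_bigr => i _; rewrite [AQ^T _ _]mxE [AQ _ _]mxE uj eqxx hexpS.
(* If the linear part vanished, the relation at the point [a j0] of the facet would kill the
   constant term as well. *)
have z'0 : rsubmx z != 0.
  apply: contraNneq w0 => z'0; have := zj j0 uj0; rewrite z'0 /idot big1 ?addr0; last first.
    by move=> i _; rewrite mxE mul0r.
  move=> z00; apply/eqP/rowP => i; apply/eqP; rewrite mxE.
  have : (z 0 i)%:~R = 0 :> rat.
    have [k ->|k ->] := split_ordP i; first by rewrite (ord1 k) z00.
    by have /rowP/(_ k) := z'0; rewrite !mxE => ->.
  by rewrite zE => /eqP; rewrite mulf_eq0 intr_eq0 (negbTE d0).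
have [e [b [e0' pb zb]]] := primitive_multiple z'0.
have bj j : lam u j = 0 -> idot b (a j) = idot b (a j0).
  move=> uj; apply: (mulfI e0'); apply: (addrI (z 0 (lshift n 0))).
  have dE v : e * idot b v = idot (rsubmx z) v.
    by rewrite zb /idot mulr_sumr; apply: eq_bigr => i _; rewrite mxE mulrA.
  by rewrite !dE !zj.
exists b, (idot b (a j0)); split=> //.
  split; first exact: (face_of_is_face hDelta ha ule).
  have [d' hd rk'] := face_of_dim hDelta ha ule (ex_intro _ j0 uj0).
  by rewrite (_ : n.-1 = d')// -rk rk'.
split=> // x /(face_of_comb hDelta ha ule)[k [q [w' [w1 -> h]]]].
rewrite dotv_sum; transitivity (\sum_i w' i * (idot b (a j0))%:~R).
  apply: eq_bigr => i _; have [->|uq] := h i; first by rewrite !mul0r.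
  by rewrite dotv_real_vec bj.
by rewrite -mulr_suml w1 mul1r.
Qed.

Lemma facet_functional F b c : is_facet Delta F -> primitive_normal F b c ->
  exists u, [/\ forall j, lam u j <= 0, \rank (umat u) = n
    & forall j, lam u j = 0 -> idot b (a j) = c].
Proof.
move=> [[v [c' [hv FE]]] dF] [pb bF].
pose u : 'rV[R]_N := row_mx (const_mx c') (- v).
have dvN x : dotv (- v) x = - dotv v x.
  by rewrite /dotv -sumrN; apply: eq_bigr => i _; rewrite mxE mulNr.
have uE j : lam u j = c' - dotv v (real_vec (a j)).
  by rewrite lam_dotv row_mxEl mxE row_mxKr dvN.
have ule j : lam u j <= 0 by rewrite uE subr_le0; apply/hv/(Delta_vertex ha).
have FE' : F = face_of Delta u.
  rewrite FE; apply/seteqP; split=> x [Dx h]; split=> //; move: h;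
    rewrite row_mxEl mxE row_mxKr dvN; lra.
have Fj j : lam u j = 0 -> F (real_vec (a j)).
  by rewrite FE' => h; apply/face_of_vertex.
have [x0 [D [Fx0 _ _ _]]] := dF.
have ex : exists j, lam u j = 0.
  move: Fx0; rewrite FE' => /(face_of_comb hDelta ha ule)[k [q [w [w1 _ h]]]].
  apply: contrapT => /forallNP hj; have s0 : \sum_i w i = 0.
    by apply: big1 => i _; case: (h i) => // /hj.
  by move/eqP: w1; rewrite s0 eq_sym oner_eq0.
have [d hd rk] := face_of_dim hDelta ha ule ex.
exists u; split=> //.
  rewrite rk; suff -> : d = n.-1 by rewrite prednK.
  by rewrite -FE' in hd; apply/eqP; rewrite eqn_leq !(has_dim_le hd dF, has_dim_le dF hd).
move=> j /Fj /bF; rewrite dotv_real_vec => /eqP; rewrite eqr_int => /eqP //.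
Qed.

Section Chart.
Variables (u : 'rV[R]_N) (c : 'I_N -> 'I_m).

(* Near a point over the facet {lam u = 0}, c 0 gives a coordinate of least
   positive height and the other coordinates are units on the facet. *)
Definition adapted : Prop :=
  [/\ rowsub c hmat \in unitmx, forall i, i != lshift n 0 -> lam u (c i) = 0
    & forall j, lam u j != 0 -> lam u j <= lam u (c (lshift n 0)) < 0].

(** Row [j] expresses exponent [j] through the exponents selected by [c]; the logarithms of the
    coordinates on the toric variety satisfy the same linear relations. *)
Definition crel : 'M[R]_(m, N) := hmat *m invmx (rowsub c hmat).

Lemma crelE : crel = hmat *m invmx (rowsub c hmat). Proof. by []. Qed.

Lemma lam_crel t j : adapted -> lam t j = \sum_i crel j i * lam t (c i).
Proof.
case=> Mu _ _; have E : hmat^T = (rowsub c hmat)^T *m crel^T.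
  by rewrite -trmx_mul /crel -mulmxA mulVmx// mulmx1.
have -> : lam t j = (t *m (rowsub c hmat)^T *m crel^T) 0 j by rewrite -mulmxA -E.
rewrite mxE; apply: eq_bigr => i _; rewrite [crel^T _ _]mxE mulrC; congr (_ * _).
by rewrite lam_mulmx !mxE; apply: eq_bigr => k _; rewrite !mxE.
Qed.

Lemma crel_sum1 j : adapted -> \sum_i crel j i = 1.
Proof.
move=> ad; rewrite -(lam_e0 a j) (lam_crel _ _ ad).
by apply: eq_bigr => i _; rewrite lam_e0 mulr1.
Qed.

Lemma crel_head j : adapted -> lam u j = crel j (lshift n 0) * lam u (c (lshift n 0)).
Proof.
move=> ad; have [_ h _] := ad; rewrite (lam_crel _ _ ad) (bigD1 (lshift n 0))//= big1 ?addr0//.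
by move=> i i0; rewrite h// mulr0.
Qed.

Lemma crel_facet j : adapted -> lam u j = 0 -> lam u (c (lshift n 0)) != 0 ->
  crel j (lshift n 0) = 0.
Proof.
move=> ad uj; have := crel_head j ad; rewrite uj => /esym/eqP.
by rewrite mulf_eq0 => /orP[/eqP//|->].
Qed.

(** The selected transverse exponent has the least positive height above the facet, so every height
    off the facet is at least that one: such coordinates vanish at least as fast as the transverse
    one. *)
Lemma crel_ge1 j : adapted -> lam u j != 0 -> 1 <= crel j (lshift n 0).
Proof.
move=> ad uj; have [_ _ /(_ j uj)/andP[h1 h2]] := ad.
move: h1; rewrite (crel_head j ad) -[X in _ <= X]mul1r ler_nM2r//.
Qed.

End Chart.

Lemma rank_rows k1 k2 k (A : 'M[R]_(k1, k2)) : \rank A = k ->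
  exists f : 'I_k -> 'I_k1, row_free (rowsub f A).
Proof. by move=> <-; exists (maxrankfun A); exact: maxrowsub_free. Qed.

Lemma rank_hmat : \rank hmat = N.
Proof.
rewrite -mxrank_tr; apply/eqP; apply: row_free_ker => t tE.
by apply: (lam_inj hspan) => j; rewrite lam_mulmx tE mxE.
Qed.

Lemma adapted_exists u : (forall j, lam u j <= 0) -> u = 0 \/ \rank (umat u) = n ->
  exists c, adapted u c.
Proof.
move=> ule [->|rk].
  have [f ff] := rank_rows rank_hmat; exists f; split.
  - by rewrite -row_free_unit.
  - by move=> i _; rewrite lam0.
  - by move=> j; rewrite lam0 eqxx.
have [f ff] := rank_rows rk.
have fu i : lam u (f i) = 0.
  apply/eqP; apply: contraT => un; have : row i (rowsub f (umat u)) = 0.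
    by apply/rowP => k; rewrite !mxE (negbTE un).
  rewrite rowE -[X in _ = X -> _](mul0mx _ (rowsub f (umat u))) => /(row_free_inj ff).
  by move=> /rowP/(_ i)/eqP; rewrite !mxE !eqxx oner_eq0.
have [j1 uj1] : exists j, lam u j != 0.
  apply: contrapT => /forallNP h; have E : umat u = hmat.
    by apply/matrixP => j i; rewrite !mxE; case: eqVneq (h j).
  by move: rk; rewrite E rank_hmat add1n => /eqP; rewrite gtn_eqF.
(* Maximal among the negative values of [lam u], that is, of least positive height. *)
case: (@arg_maxP _ _ _ j1 (fun j => lam u j != 0) (lam u) uj1) => j0 uj0 jmax.
pose c (i : 'I_N) := match fintype.split i with inl _ => j0 | inr k => f k end.
have cl k : c (lshift n k) = j0 by rewrite /c (unsplitK (inl k)).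
have cr k : c (rshift 1 k) = f k by rewrite /c (unsplitK (inr k)).
exists c; split.
- rewrite -row_free_unit.
  have E : rowsub c hmat = col_mx (row j0 hmat) (rowsub f (umat u)).
    apply/matrixP => i k; have [l ->|l ->] := split_ordP i.
      by rewrite mxE cl col_mxEu [RHS]mxE.
    by rewrite mxE cr col_mxEd !mxE fu eqxx.
  rewrite E; apply: row_free_ker => v; rewrite -(hsubmxK v) mul_row_col => vE.
  have uf : rowsub f (umat u) *m u^T = 0.
    apply/colP => i; rewrite [RHS]mxE mxE -[RHS](fu i) lamE; apply: eq_bigr => k _.
    by rewrite [u^T _ _]mxE mulrC [rowsub _ _ _ _]mxE [umat _ _ _]mxE fu eqxx [hmat _ _]mxE.
  have := congr1 (mulmx^~ u^T) vE; rewrite mulmxDl -!mulmxA uf mulmx0 addr0 mul0mx => h.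
  have v0 : lsubmx v = 0.
    have hu : row j0 hmat *m u^T = (lam u j0)%:M.
      apply/matrixP => i k; rewrite (ord1 i) (ord1 k) !mxE eqxx mulr1n lamE.
      by apply: eq_bigr => l _; rewrite !mxE mulrC.
    move: h; rewrite hu mul_mx_scalar => /eqP; rewrite scaler_eq0 (negbTE uj0).
    by move/eqP.
  move: vE; rewrite v0 mul0mx add0r -[X in _ = X -> _](mul0mx _ (rowsub f (umat u))).
  by move=> /(row_free_inj ff) ->; rewrite row_mx0.
- move=> i; have [k ->|k ->] := split_ordP i; first by rewrite (ord1 k) eqxx.
  by rewrite cr.
- move=> j uj; rewrite cl lt_neqAle uj0 ule !andbT; exact: jmax.
Qed.

End FacetsCharts.

(** * Tangent vectors of the toric variety by logarithmic differentiation *)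

Section RealDerivatives.
Context {R : realType}.

Lemma is_derive_scale (w : R) (f : R -> R) (x d : R) :
  is_derive x (1 : R) f d -> is_derive x (1 : R) (fun t => w * f t) (w * d).
Proof.
move=> /is_deriveP H; apply/is_deriveP => e e0.
have w0 : 0 < `|w| + 1 by rewrite ltr_wpDl.
have [dl dl0 h] := H (e / (`|w| + 1)) (divr_gt0 e0 w0).
exists dl => // z zd; have -> : w * f (x + z) - w * f x - z *: (w * d) = w * (f (x + z) - f x - z *: d).
  by rewrite /GRing.scale /=; ring.
rewrite normrM; apply: (@le_trans _ _ ((`|w| + 1) * `|f (x + z) - f x - z *: d|)).
  by rewrite ler_wpM2r// lerDl.
apply: (@le_trans _ _ ((`|w| + 1) * (e / (`|w| + 1) * `|z|))).
  by rewrite ler_pM2l// h.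
by rewrite mulrA mulrCA mulfV ?gt_eqF// mulr1.
Qed.

(** Terms with zero coefficient may fail to be differentiable: the logarithm of a vanishing
    coordinate can occur in a relation that ignores it. *)
Lemma is_derive_lincomb k (w : 'I_k -> R) (f : 'I_k -> R -> R) (x : R) (d : 'I_k -> R) :
  (forall i, w i = 0 \/ is_derive x (1 : R) (f i) (d i)) ->
  is_derive x (1 : R) (fun t => \sum_i w i * f i t) (\sum_i w i * d i).
Proof.
move=> h; have -> : (fun t => \sum_i w i * f i t) = \sum_i (fun t => w i * f i t).
  by apply/funext => t; rewrite fct_sumE.
apply: is_derive_sum => i; have [w0|di] := h i; last exact: is_derive_scale.
have -> : (fun t => w i * f i t) = (fun=> 0) by apply/funext => t; rewrite w0 mul0r.
rewrite w0 mul0r; apply/is_deriveP => e e0; exists 1 => // z _.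
by rewrite subrr scaler0 subr0 normr0 mulr_ge0// ltW.
Qed.

Lemma is_derive_continuous (V : normedModType R) (f : R -> V) (x : R) d :
  is_derive x (1 : R) f d -> {for x, continuous f}.
Proof.
by move=> df; apply: differentiable_continuous; apply/derivable1_diffP; case: df.
Qed.

Lemma near_continuous (T U : topologicalType) (f : T -> U) x (Q : set U) :
  {for x, continuous f} -> nbhs (f x) Q -> \forall t \near x, Q (f t).
Proof. by move=> cf; exact: cf. Qed.

Lemma is_derive_ln_abs (c : R -> R) (l : R) : c 0 != 0 -> is_derive (0 : R) (1 : R) c l ->
  is_derive (0 : R) (1 : R) (fun t => ln `|c t|) (l / c 0).
Proof.
move=> c0 dc; pose s := Num.sg (c 0).
have sc : 0 < s * c 0 by rewrite -normrEsg normr_gt0.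
have dsc := is_derive_scale s dc.
have := @is_derive1_comp _ (@ln R) (fun t => s * c t) 0 _ _ (is_derive1_ln sc) dsc.
have -> : (s * c 0)^-1 * (s * l) = l / c 0.
  have s0 : s != 0 by rewrite sgr_eq0.
  by field; rewrite c0.
apply: is_derive_near.
have /cvgrPdist_lt := is_derive_continuous dc.
have cp : 0 < `|c 0| by rewrite normr_gt0.
move=> /(_ _ cp); apply: filterS => t; rewrite distrC => /sgr_near E.
by rewrite /= /s -E -normrEsg.
Qed.

Lemma derive_zero_bound (f g : R -> R) (K l : R) : f 0 = 0 -> g 0 = 0 ->
  is_derive (0 : R) (1 : R) f l -> is_derive (0 : R) (1 : R) g 0 ->
  0 < K -> (\forall t \near (0 : R), `|f t| <= K * `|g t|) -> l = 0.
Proof.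
move=> f0 g0 /is_deriveP df /is_deriveP dg K0 /near_normP[d0 d00 hd].
apply/eqP; rewrite -normr_le0 leNgt; apply/negP => lp.
have e0 : 0 < `|l| / (2 * (1 + K)) by rewrite divr_gt0// mulr_gt0// addr_gt0.
have [d1 d10 h1] := df _ e0; have [d2 d20 h2] := dg _ e0.
pose h := Num.min d0 (Num.min d1 d2) / 2.
have hp : 0 < h by rewrite divr_gt0// !lt_min d00 d10 d20.
have [h0 h1' h2'] : [/\ `|h| < d0, `|h| < d1 & `|h| < d2].
  rewrite (gtr0_norm hp); have : 2 * h <= Num.min d0 (Num.min d1 d2) by rewrite /h; lra.
  by rewrite !le_min => /and3P[? ? ?]; split; lra.
have := h1 h h1'; have := h2 h h2'; have := hd h; rewrite subr0 => /(_ h0).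
rewrite !add0r f0 g0 !subr0 scaler0 subr0 => le1 le2 le3.
have : `|h *: l| <= `|f h| + `|f h - h *: l|.
  by rewrite -[X in `|X| <= _](subKr (f h)) ler_normB.
have hE : `|h| = h by exact: gtr0_norm.
rewrite hE in le2 le3; have -> : `|h *: l| = h * `|l| by rewrite normrM hE.
move=> le4; have le5 : K * `|g h| <= K * (`|l| / (2 * (1 + K)) * h) by rewrite ler_pM2l.
have E : `|l| / (2 * (1 + K)) * h + K * (`|l| / (2 * (1 + K)) * h) = h * `|l| / 2.
  by field; rewrite gt_eqF// addr_gt0.
have : 0 < h * `|l| by rewrite mulr_gt0.
lra.
Qed.

End RealDerivatives.

Section TangentCharts.
Context {R : realType} {n m : nat}.
Variable a : 'I_m -> 'rV[int]_n.
Hypothesis hspan : affinely_spans a.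

Notation N := (1 + n)%N.
Notation G := {ffun 'I_N -> bool}.
Notation lam := (@lam R n m a).
Notation sgn := (@sgn R n m a).
Notation stratum := (@stratum R n m a).
Notation adapted := (@adapted R n m a).
Notation crel := (@crel R n m a).

Variable Delta : set 'rV[R]_n.
Hypotheses (hn : (0 < n)%N) (hDelta : lattice_polytope Delta) (ha : lattice_points Delta a).
Local Notation M := (Yplus_circ Delta a).

Lemma stratum_near p g t u : stratum p g t u ->
  nbhs p [set x : 'rV[R]_m | forall j, lam u j = 0 ->
    `|ln `|x 0 j| - ln `|p 0 j| | < 1 /\ Num.sg (x 0 j) = sgn g j].
Proof.
move=> [_ pE]; apply: filterS (near_logs p ltr01) => x hx j uj.
have pj : p 0 j = sgn g j * expR (lam t j) by rewrite pE uj eqxx.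
have pn : p 0 j != 0 by rewrite pj mulf_neq0 ?sgn_neq0// gt_eqF ?expR_gt0.
have [_ /(_ pn)[h1 ->]] := hx j; split=> //.
by rewrite pj sgrM [X in _ * X]gtr0_sg ?expR_gt0// mulr1 sgnE; case: parity; rewrite ?sgrN1 ?sgr1.
Qed.

Lemma stratum_neq0 x g t u j : stratum x g t u -> (x 0 j != 0) = (lam u j == 0).
Proof.
move=> [_ ->]; case: ifP => _; last by rewrite eqxx.
by rewrite mulf_neq0 ?sgn_neq0// gt_eqF ?expR_gt0.
Qed.

Lemma stratum_log x g t u j : stratum x g t u -> x 0 j != 0 -> ln `|x 0 j| = lam t j.
Proof.
move=> sx xj; have [_ ->] := sx; rewrite -(stratum_neq0 j sx) xj.
by rewrite normrM normr_sgn mul1r gtr0_norm ?expR_gt0// expRK.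
Qed.

Lemma log_crel x u c j : Yplus a x -> adapted u c ->
  (forall i, x 0 (c i) != 0 \/ crel c j i = 0) -> x 0 j != 0 ->
  ln `|x 0 j| = \sum_i crel c j i * ln `|x 0 (c i)|.
Proof.
move=> Yx ad h xj; have [g [t [u' sx]]] := Yplus_stratum hspan Yx.
rewrite (stratum_log sx xj) (lam_crel t j ad); apply: eq_bigr => i _.
by have [xi|->] := h i; [rewrite (stratum_log sx xi)|rewrite !mul0r].
Qed.

Lemma face_crel u c i j : adapted u c -> lam u j = 0 -> lam u (c i) = 0 \/ crel c j i = 0.
Proof.
move=> ad uj; have [->|i0] := eqVneq i (lshift n 0); last first.
  by left; case: ad => _ h _; exact: h.
have [->|h] := eqVneq (lam u (c (lshift n 0))) 0; first by left.
by right; exact: (crel_facet ad uj h).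
Qed.

(** In logarithms, a coordinate off the facet is a power at least 1 of the transverse one times a
    factor bounded near [p]; as coordinates on the unit sphere are at most 1, the power may be
    lowered to 1. *)
Lemma facet_bound p g t u c : stratum p g t u -> adapted u c ->
  exists2 K, 0 < K & \forall x \near p, Yplus a x ->
    forall j, lam u j != 0 -> `|x 0 j| <= K * `|x 0 (c (lshift n 0))|.
Proof.
move=> sp ad; pose K0 := \sum_j \sum_i `|crel c j i| * (`|ln `|p 0 (c i)| | + 1).
exists (expR K0); first exact: expR_gt0.
apply: filterS (stratum_near sp) => x hx Yx j uj.
have [g' [t' [u' sx]]] := Yplus_stratum hspan Yx.
have [_ adi adj] := ad; have /andP[_ uc0] := adj j uj.
have xi i : i != lshift n 0 -> x 0 (c i) != 0.
  move=> i0; have [_ h] := hx _ (adi _ i0).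
  by rewrite -sgr_eq0 h sgn_neq0.
have r1 := crel_ge1 ad uj.
(* Logarithms are unusable when the transverse coordinate vanishes; then the stratum of [x] forces
   every coordinate off the facet to vanish. *)
have [x0|xn0] := eqVneq (x 0 (c (lshift n 0))) 0.
  rewrite x0 normr0 mulr0 normr_le0; apply: contraT; rewrite (stratum_neq0 j sx) => /eqP u'j.
  have := stratum_neq0 (c (lshift n 0)) sx; rewrite x0 eqxx => /esym/negbT/negP[].
  have := lam_crel u' j ad; rewrite u'j (bigD1 (lshift n 0))//= big1 ?addr0.
    move=> /esym/eqP; rewrite mulf_eq0 => /orP[/eqP r0|//].
    by move: r1; rewrite r0 ler10.
  by move=> i /xi; rewrite (stratum_neq0 _ sx) => /eqP ->; rewrite mulr0.
have [xj0|xj] := eqVneq (x 0 j) 0; first by rewrite xj0 normr0 mulr_ge0// expR_ge0.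
have xpos : 0 < `|x 0 (c (lshift n 0))| by rewrite normr_gt0.
rewrite -[X in X <= _]lnK ?posrE ?normr_gt0// -[X in _ * X]lnK ?posrE// -expRD ler_expR.
have -> : ln `|x 0 j| = \sum_i crel c j i * ln `|x 0 (c i)|.
  apply: (log_crel Yx ad) => // i; left.
  by have [->//|/xi] := eqVneq i (lshift n 0).
rewrite (bigD1 (lshift n 0))//= addrC lerD//.
  apply: (@le_trans _ _ (\sum_(i | i != lshift n 0) `|crel c j i| * (`|ln `|p 0 (c i)| | + 1))).
    apply: ler_sum => i i0; apply: (le_trans (ler_norm _)); rewrite normrM ler_wpM2l//.
    have [h _] := hx _ (adi _ i0).
    rewrite -[X in `|X| <= _](subrK (ln `|p 0 (c i)|)) addrC (le_trans (ler_normD _ _))//.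
    by rewrite lerD2l ltW.
  rewrite /K0 [X in _ <= X](bigD1 j)//= [X in _ <= X + _](bigD1 (lshift n 0))//= addrAC lerDr.
  apply: addr_ge0; first by rewrite mulr_ge0// addr_ge0.
  by apply: sumr_ge0 => k _; apply: sumr_ge0 => i _; rewrite mulr_ge0// addr_ge0.
have lx0 : ln `|x 0 (c (lshift n 0))| <= 0.
  apply: ln_le0; apply: (le_trans (mx_entry_le x 0 _)).
  by rewrite -(Yplus_enorm hspan Yx) norm_le_enorm.
by rewrite -[X in _ <= X]mul1r ler_wnM2r.
Qed.

Section TangentAt.
Variables (p : 'rV[R]_m) (g : G) (t u : 'rV[R]_N) (c : 'I_N -> 'I_m).
Hypotheses (sp : stratum p g t u) (ad : adapted u c) (Mp : M p).

Let Yp : Yplus a p. Proof. by case: Mp. Qed.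

(** Coordinates on the face stay nonzero along the curve near [p], so the multiplicative relation
    [log_crel] can be differentiated there. *)
Lemma tangent_face v j : tangent M p v -> lam u j = 0 ->
  v 0 j / p 0 j = \sum_i crel c j i * (v 0 (c i) / p 0 (c i)).
Proof.
move=> [gam [g0 nM dg]] uj.
have dgj k : is_derive (0:R) (1:R) (fun s => gam s 0 k) (v 0 k).
  by move/is_derive_mxP : dg => /(_ 0 k).
have pj k : lam u k = 0 -> p 0 k != 0 by move=> h; rewrite (stratum_neq0 k sp) h.
have dl k : lam u k = 0 -> is_derive (0:R) (1:R) (fun s => ln `|gam s 0 k|) (v 0 k / p 0 k).
  by move=> uk; have := @is_derive_ln_abs _ (fun s => gam s 0 k) (v 0 k); rewrite g0; apply=> //; exact: pj.
have H1 := dl _ uj.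
have H2 : is_derive (0:R) (1:R) (fun s => \sum_i crel c j i * ln `|gam s 0 (c i)|)
    (\sum_i crel c j i * (v 0 (c i) / p 0 (c i))).
  apply: is_derive_lincomb => i; have [ui|->] := face_crel i ad uj; last by left.
  by right; exact: dl.
apply: (is_derive_inj H1); apply: is_derive_near H2.
have cg := is_derive_continuous dg.
have np : \forall s \near (0:R), forall j, lam u j = 0 ->
    `|ln `|gam s 0 j| - ln `|p 0 j| | < 1 /\ Num.sg (gam s 0 j) = sgn g j.
  have sn := stratum_near sp; rewrite -{1}g0 in sn.
  exact: (near_continuous cg sn).
apply: filterS2 nM np => s [Ys _] hs.
have gs k : lam u k = 0 -> gam s 0 k != 0.
  by move=> uk; rewrite -sgr_eq0 (hs k uk).2 sgn_neq0.
rewrite -(log_crel Ys ad)//; last exact: gs.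
by move=> i; have [/gs|->] := face_crel i ad uj; [left|right].
Qed.

(** By [facet_bound] the transverse coordinate dominates all others off the facet, hence also to
    first order. *)
Lemma tangent_transverse v j : tangent M p v -> lam u j != 0 ->
  v 0 (c (lshift n 0)) = 0 -> v 0 j = 0.
Proof.
move=> [gam [g0 nM dg]] uj vc.
have [K K0 nK] := facet_bound sp ad.
have cg := is_derive_continuous dg.
have dgj k : is_derive (0:R) (1:R) (fun s => gam s 0 k) (v 0 k).
  by move/is_derive_mxP : dg => /(_ 0 k).
have p0 k : lam u k != 0 -> gam 0 0 k = 0.
  by move=> uk; rewrite g0; apply/eqP; rewrite -[_ == _]negbK (stratum_neq0 k sp) uk.
have [_ _ /(_ j uj)/andP[_ uc]] := ad.
apply: (@derive_zero_bound _ (fun s => gam s 0 j) (fun s => gam s 0 (c (lshift n 0))) K) => //.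
- exact: p0.
- by apply: p0; rewrite lt_eqF.
- by have := dgj (c (lshift n 0)); rewrite vc.
have np : \forall s \near (0:R), Yplus a (gam s) ->
    forall j, lam u j != 0 -> `|gam s 0 j| <= K * `|gam s 0 (c (lshift n 0))|.
  have sn := nK; rewrite -{1}g0 in sn.
  exact: (near_continuous cg sn).
by apply: filterS2 nM np => s [Ys _] /(_ Ys); apply.
Qed.

Lemma tangent_orthogonal v : tangent M p v -> \sum_j p 0 j * v 0 j = 0.
Proof.
move=> [gam [g0 nM dg]].
have dgj k : is_derive (0:R) (1:R) (fun s => gam s 0 k) (v 0 k).
  by move/is_derive_mxP : dg => /(_ 0 k).
have H : is_derive (0:R) (1:R) (fun s => \sum_j 1 * (gam s 0 j * gam s 0 j))
    (\sum_j 1 * (p 0 j * v 0 j + p 0 j * v 0 j)).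
  apply: is_derive_lincomb => j; right.
  by have := is_deriveM (dgj j) (dgj j); rewrite g0.
have H2 : is_derive (0:R) (1:R) (fun s => \sum_j 1 * (gam s 0 j * gam s 0 j)) 0.
  have Hc : is_derive (0:R) (1:R) (fun=> 1 : R) 0.
    apply/is_deriveP => e1 e10; exists 1 => // z _.
    by rewrite subrr scaler0 subr0 normr0 mulr_ge0// ltW.
  apply: is_derive_near Hc; apply: filterS nM => s [Ys _].
  have := enorm_sq (gam s); rewrite (Yplus_enorm hspan Ys) expr1n => E.
  rewrite [LHS]E.
  by apply: eq_bigr => j _; rewrite mul1r expr2.
have := is_derive_inj H H2; under eq_bigr do rewrite mul1r -mulr2n.
by rewrite sumrMnl => /eqP; rewrite mulrn_eq0 /= => /eqP.
Qed.

Lemma col_mx_frame_free (B : 'M[R]_(n, m)) : C1_submanifold n M -> frame M p B ->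
  row_free (col_mx p B).
Proof.
move=> hM fB; apply: row_free_ker => z; rewrite -(hsubmxK z) mul_row_col => zE.
have Bp : B *m p^T = 0.
  apply/colP => i; rewrite [RHS]mxE mxE; have [_ /(_ i) tB _] := fB.
  rewrite -[RHS](tangent_orthogonal tB); apply: eq_bigr => j _.
  by rewrite !mxE mulrC.
have pp : p *m p^T = 1%:M.
  apply/matrixP => i j; rewrite (ord1 i) (ord1 j) !mxE eqxx mulr1n.
  have := enorm_sq p; rewrite (Yplus_enorm hspan Yp) expr1n => E.
  rewrite [RHS]E.
  by apply: eq_bigr => k _; rewrite mxE expr2.
have := congr1 (mulmx^~ p^T) zE; rewrite mulmxDl -!mulmxA Bp pp mulmx0 addr0 mulmx1 mul0mx.
move=> z0; move: zE; rewrite z0 mul0mx add0r -[X in _ = X -> _](mul0mx _ B).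
have [_ _ rB] := fB.
by move=> /(row_free_inj rB) ->; rewrite row_mx0.
Qed.

Definition selmx (c : 'I_N -> 'I_m) : 'M[R]_(m, N) := \matrix_(j, i) (j == c i)%:R.

Lemma mul_selmx k (A : 'M[R]_(k, m)) i l : (A *m selmx c) i l = A i (c l).
Proof.
rewrite mxE (bigD1 (c l))//= mxE eqxx mulr1 big1 ?addr0// => j jn.
by rewrite mxE (negbTE jn) mulr0.
Qed.

Lemma tangent_comb (B : 'M[R]_(n, m)) (w : 'rV[R]_n) : C1_submanifold n M ->
  frame M p B -> tangent M p (w *m B).
Proof.
move=> hM fB; have [r [h [e hg]]] := C1_local_eq hM Mp.
have [BJ _] := (frame_kerP hg Mp B).1 fB.
by apply: (ker_tangent hg Mp); rewrite -mulmxA BJ mulmx0.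
Qed.

(** A vector [l p + w], with [w] tangent, whose selected coordinates vanish is zero: on the face
    [w / p] is the constant [-l], because the relations [crel] have coefficient sum 1, and off the
    face [w] is controlled by its transverse coordinate. Independence of [p] and the frame
    concludes. *)
Lemma chart_det_neq0 (B : 'M[R]_(n, m)) : C1_submanifold n M -> frame M p B ->
  \det (col_mx p B *m selmx c) != 0.
Proof.
move=> hM fB; rewrite -unitfE -unitmxE -row_free_unit; apply: row_free_ker => z zQ.
have fr := col_mx_frame_free hM fB.
apply: (row_free_inj fr); rewrite mul0mx.
pose w := rsubmx z *m B; have tw : tangent M p w by exact: tangent_comb.
pose l := lsubmx z 0 0.
have zE j : (z *m col_mx p B) 0 j = l * p 0 j + w 0 j.
  rewrite -{1}(hsubmxK z) mul_row_col mxE; congr (_ + _).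
  by rewrite mxE big_ord1.
have z0 i : l * p 0 (c i) + w 0 (c i) = 0.
  by rewrite -zE -mul_selmx -mulmxA zQ mxE.
have pj k : lam u k = 0 -> p 0 k != 0 by move=> h; rewrite (stratum_neq0 k sp) h.
have pj0 k : lam u k != 0 -> p 0 k = 0.
  by move=> h; apply/eqP; rewrite -[_ == _]negbK (stratum_neq0 k sp) h.
apply/rowP => j; rewrite zE [RHS]mxE; have [uj|uj] := eqVneq (lam u j) 0.
  have := tangent_face tw uj.
  have -> : \sum_i crel c j i * (w 0 (c i) / p 0 (c i)) = \sum_i - l * crel c j i.
    apply: eq_bigr => i _; have [ui|->] := face_crel i ad uj; last by rewrite mul0r mulr0.
    have -> : w 0 (c i) = - (l * p 0 (c i)) by apply/eqP; rewrite -addr_eq0 addrC z0.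
    by rewrite -mulNr mulfK ?pj// mulrC.
  rewrite -mulr_sumr (crel_sum1 j ad) mulr1.
  move=> /(congr1 (fun x => x * p 0 j)); rewrite divfK ?pj// => ->.
  by rewrite mulNr addrN.
have [_ _ /(_ j uj)/andP[_ uc]] := ad.
have wc : w 0 (c (lshift n 0)) = 0.
  by have := z0 (lshift n 0); rewrite pj0 ?lt_eqF// mulr0 add0r.
by rewrite (tangent_transverse tw uj wc) pj0// mulr0 addr0.
Qed.

End TangentAt.
End TangentCharts.

(** * Orientations and signs of sheets *)

Section Coherence.
Context {R : realType} {n m : nat}.
Variable a : 'I_m -> 'rV[int]_n.
Hypothesis hspan : affinely_spans a.

Notation N := (1 + n)%N.
Notation G := {ffun 'I_N -> bool}.
Notation lam := (@lam R n m a).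
Notation sgn := (@sgn R n m a).
Notation sheet := (@sheet R n m a).
Notation hmat := (@hmat R n m a).
Notation torus_pt := (@torus_pt R n m a).
Notation umat := (@umat R n m a).
Notation stratum := (@stratum R n m a).
Notation adapted := (@adapted R n m a).
Notation crel := (@crel R n m a).

Variable Delta : set 'rV[R]_n.
Hypotheses (hn : (0 < n)%N) (hDelta : lattice_polytope Delta) (ha : lattice_points Delta a).
Local Notation M := (Yplus_circ Delta a).
Hypothesis hM : C1_submanifold n M.

(* The Jacobian matrix of a sheet at the parameter of its point x. *)
Definition tmat (x : 'rV[R]_m) : 'M[R]_(N, m) := \matrix_(i, j) (hmat j i * x 0 j).

(* The sign of st c x B compares a frame B at a point x of the torus with the
   logarithmic frame of the torus; it does not depend on the chart c. *)
Definition st (c : 'I_N -> 'I_m) (x : 'rV[R]_m) (B : 'M[R]_(n, m)) : R :=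
  \det (rowsub c hmat) * (\prod_i x 0 (c i)) * \det (col_mx x B *m selmx c).

Lemma torus_stratum g x : torus_pt g x -> exists t, stratum x g t 0.
Proof.
by case=> _ [t ->]; exists t; split=> j; rewrite lam0 ?lexx// eqxx sheetE.
Qed.

Lemma adapted0 (c : 'I_N -> 'I_m) : rowsub c hmat \in unitmx -> adapted 0 c.
Proof.
by move=> h; split=> // [i _|j]; rewrite lam0 ?eqxx.
Qed.

Lemma torus_pt_neq0 g x j : torus_pt g x -> x 0 j != 0.
Proof. by case=> _ [t ->]; exact: sheet_neq0. Qed.

Lemma torus_pt_sgr g x j : torus_pt g x -> Num.sg (x 0 j) = sgn g j.
Proof. by case=> _ [t ->]; exact: sgr_sheet. Qed.

Lemma torus_pt_inj g h x : torus_pt g x -> torus_pt h x -> g = h.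
Proof.
move=> tg th; apply: (@sgn_sheet_inj R _ _ _ hspan) => j.
by rewrite -(torus_pt_sgr j tg) (torus_pt_sgr j th).
Qed.

Lemma torus_chart_exists : exists c : 'I_N -> 'I_m, rowsub c hmat \in unitmx.
Proof.
have [f ff] := rank_rows (rank_hmat (R := R) hspan); exists f; by rewrite -row_free_unit.
Qed.

(** The radial vector and the tangent vectors all satisfy the logarithmic relations, so they are
    combinations of the rows of the Jacobian of the sheet. Up to a square, [st] measures the
    determinant of [T]. *)
Lemma torus_frame_mat g x (B : 'M[R]_(n, m)) : torus_pt g x -> frame M x B ->
  exists T, col_mx x B = T *m tmat x.
Proof.
move=> tx fB; have Mx : M x by case: fB.
have [c cu] := torus_chart_exists; have ad := adapted0 cu.
have [t sx] := torus_stratum tx.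
have row_ok (v : 'rV[R]_m) : (forall j, v 0 j / x 0 j = \sum_i crel c j i * (v 0 (c i) / x 0 (c i))) ->
    (v <= tmat x)%MS.
  move=> h; apply/submxP.
  exists (\row_k \sum_i invmx (rowsub c hmat) k i * (v 0 (c i) / x 0 (c i))).
  apply/rowP => j; have -> : v 0 j = v 0 j / x 0 j * x 0 j by rewrite divfK// (torus_pt_neq0 j tx).
  rewrite h [RHS]mxE mulr_suml; under [RHS]eq_bigr do rewrite mxE mulr_suml.
  rewrite exchange_big /=; apply: eq_bigr => i _.
  rewrite crelE mxE !mulr_suml; apply: eq_bigr => k _.
  rewrite [tmat x _ _]mxE; ring.
suff /submxP[T ->] : (col_mx x B <= tmat x)%MS by exists T.
rewrite col_mx_sub; apply/andP; split.
  apply: row_ok => j; rewrite divff ?(torus_pt_neq0 j tx)//.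
  rewrite -[LHS](crel_sum1 j ad); apply: eq_bigr => i _.
  by rewrite divff ?mulr1// (torus_pt_neq0 _ tx).
apply/row_subP => i; apply: row_ok => j.
have [_ tB _] := fB.
by apply: (tangent_face hspan sx ad (tB i)); rewrite lam0.
Qed.

Lemma det_tmat_selmx x c : \det (tmat x *m selmx c) = \det (rowsub c hmat) * \prod_i x 0 (c i).
Proof.
have -> : tmat x *m selmx c = (rowsub c hmat)^T *m diag_mx (\row_i x 0 (c i)).
  apply/matrixP => i l; rewrite mul_selmx mul_mx_diag.
  by rewrite !mxE.
rewrite det_mulmx det_tr det_diag; congr (_ * _).
by apply: eq_bigr => i _; rewrite mxE.
Qed.

Lemma st_det c x B T : col_mx x B = T *m tmat x ->
  st c x B = (\det (rowsub c hmat) * \prod_i x 0 (c i)) ^+ 2 * \det T.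
Proof.
move=> E; rewrite /st E -mulmxA det_mulmx det_tmat_selmx expr2; ring.
Qed.

Lemma sgr_st g c x (B : 'M[R]_(n, m)) T : torus_pt g x -> rowsub c hmat \in unitmx ->
  col_mx x B = T *m tmat x -> Num.sg (st c x B) = Num.sg (\det T).
Proof.
move=> tx cu E; rewrite (st_det c E) sgrM gtr0_sg ?mul1r//.
rewrite lt_neqAle sqr_ge0 andbT eq_sym expf_neq0// mulf_neq0//.
  by rewrite -unitfE -unitmxE.
by apply/prodf_neq0 => i _; exact: torus_pt_neq0 tx.
Qed.

Lemma st_chart g c c' x (B : 'M[R]_(n, m)) : torus_pt g x -> frame M x B ->
  rowsub c hmat \in unitmx -> rowsub c' hmat \in unitmx ->
  Num.sg (st c x B) = Num.sg (st c' x B).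
Proof.
move=> tx fB cu cu'; have [T E] := torus_frame_mat tx fB.
by rewrite !(sgr_st tx _ E).
Qed.

Lemma st_neq0 g c x (B : 'M[R]_(n, m)) : torus_pt g x -> frame M x B ->
  rowsub c hmat \in unitmx -> st c x B != 0.
Proof.
move=> tx fB cu; have Mx : M x by case: fB.
have [t sx] := torus_stratum tx.
rewrite /st !mulf_neq0//.
- by rewrite -unitfE -unitmxE.
- by apply/prodf_neq0 => i _; exact: torus_pt_neq0 tx.
- exact: (chart_det_neq0 hspan sx (adapted0 cu) Mx hM fB).
Qed.

Lemma st_mul c x (B : 'M[R]_(n, m)) A : st c x (A *m B) = \det A * st c x B.
Proof.
have E : col_mx x (A *m B) = block_mx 1%:M 0 0 A *m col_mx x B.
  by rewrite mul_block_col !mul0mx mul1mx addr0 add0r.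
by rewrite /st E -mulmxA det_mulmx det_lblock det1 mul1r; ring.
Qed.

Lemma det_near (Q : 'M[R]_(m, N)) p (B : 'M[R]_(n, m)) : \det (col_mx p B *m Q) != 0 ->
  exists2 e, 0 < e & forall (x : 'rV[R]_m) (B' : 'M[R]_(n, m)), `|x - p| < e -> `|B' - B| < e ->
    Num.sg (\det (col_mx x B' *m Q)) = Num.sg (\det (col_mx p B *m Q)).
Proof.
move=> d0; pose f (z : 'rV[R]_m * 'M[R]_(n, m)) := \det (col_mx z.1 z.2 *m Q).
have cf : {for (p, B), continuous f}.
  apply: continuous_det; apply: continuous_mulmx; last exact: cst_continuous.
  by apply: continuous_col_mx; [exact: cvg_fst|exact: cvg_snd].
have np : nbhs (f (p, B)) [set y | Num.sg y = Num.sg (f (p, B))].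
  apply/(@near_normP R R^o); exists `|f (p, B)|; first by rewrite normr_gt0.
  by move=> y /sgr_near.
have := near_continuous cf np => H.
exact: (near2_normP p B (fun x B' => Num.sg (f (x, B')) = Num.sg (f (p, B)))).1 H.
Qed.

Lemma stratum_gadd p g v t u : stratum p g t u ->
  (forall j, lam u j = 0 -> parity v (hexp a j) = false) -> stratum p (gadd g v) t u.
Proof.
move=> [ule pE] hv; split=> // j; rewrite pE; case: eqVneq => // uj.
by rewrite !sgnE parity_gadd hv// addbF.
Qed.

(* Two sheets agreeing in sign on the facet and on the transverse coordinate
   would contain distinct points with the same image in a chart of M. *)
Lemma sheet_unique p (B : 'M[R]_(n, m)) g g' t u c : frame M p B -> stratum p g t u -> adapted u c ->
  (forall j, lam u j = 0 -> sgn g' j = sgn g j) ->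
  sgn g' (c (lshift n 0)) = sgn g (c (lshift n 0)) -> g' = g.
Proof.
move=> fB sp ad hS h0; have Mp : M p by case: fB.
have p1 : enorm p = 1 by apply: (Yplus_enorm hspan); case: Mp.
have dn0 := chart_det_neq0 hspan sp ad Mp hM fB.
have [d d0 inj] := cone_chart_inj hM fB dn0.
have [s1 hs1] := stratum_approach sp p1 (fun j _ => erefl (sgn g j)) d0.
have [s2 hs2] := stratum_approach sp p1 hS d0.
pose s := Num.max s1 s2.
have h1 := hs1 s; have h2 := hs2 s; move: h1 h2.
rewrite !le_max !lexx orbT /= => /(_ isT) h1 /(_ isT) h2.
set x := sheet g (t + s *: u) in h1; set x' := sheet g' (t + s *: u) in h2.
have tx : torus_pt g (normalize x) by exact: torus_pt_normalize.
have tx' : torus_pt g' (normalize x') by exact: torus_pt_normalize.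
have xc i : x' 0 (c i) = x 0 (c i).
  rewrite !sheetE; congr (_ * _); have [->//|i0] := eqVneq i (lshift n 0).
  by apply: hS; case: ad => _ h _; exact: h.
have e0 : 0 < enorm x by rewrite enorm_gt0 sheet_row_neq0.
have e0' : 0 < enorm x' by rewrite enorm_gt0 sheet_row_neq0.
apply: (torus_pt_inj tx'); rewrite -(_ : normalize x = normalize x')//.
apply: (inj _ _ (enorm x' / enorm x)) => //.
- exact: (torus_circ hspan Delta tx).
- exact: (torus_circ hspan Delta tx').
- exact: divr_gt0.
apply/rowP => i; rewrite mul_selmx [RHS]mxE mul_selmx /normalize [LHS]mxE [X in _ = _ * X]mxE xc mulrA.
congr (_ * _).
by rewrite mulrAC mulfV ?gt_eqF// mul1r.
Qed.

Lemma sgr_prod (I : finType) (f : I -> R) : Num.sg (\prod_i f i) = \prod_i Num.sg (f i).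
Proof. exact: (big_morph Num.sg (@sgrM R) (@sgr1 R)). Qed.

Lemma coh_torus c g p (B : 'M[R]_(n, m)) : torus_pt g p -> frame M p B -> rowsub c hmat \in unitmx ->
  exists2 e, 0 < e & forall (x : 'rV[R]_m) (B' : 'M[R]_(n, m)), `|x - p| < e -> `|B' - B| < e ->
    forall g', torus_pt g' x ->
    g' = g /\ Num.sg (st c x B') = Num.sg (st c p B).
Proof.
move=> tp fB cu; have Mp : M p by case: fB.
have [t sp] := torus_stratum tp.
have dn0 := chart_det_neq0 hspan sp (adapted0 cu) Mp hM fB.
have [e e0 he] := det_near dn0.
have /(@near_normP R 'rV[R]_m)[e1 e10 he1] := stratum_near sp.
exists (Num.min e e1); first by rewrite lt_min e0.
move=> x B'; rewrite !lt_min => /andP[xe xe1] /andP[Be _] g' tx.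
have gg : g' = g.
  apply: (@sgn_sheet_inj R _ _ _ hspan) => j; rewrite -(torus_pt_sgr j tx).
  by have [] := he1 x xe1 j (lam0 a j).
split=> //; rewrite /st !sgrM (he _ _ xe Be) !sgr_prod; congr (_ * _ * _).
by apply: eq_bigr => i _; rewrite (torus_pt_sgr _ tx) (torus_pt_sgr _ tp) gg.
Qed.

Section Facet.
Variables (p : 'rV[R]_m) (B : 'M[R]_(n, m)) (g : G) (t u : 'rV[R]_N).
Variables (b : 'rV[int]_n) (h : int).
Hypotheses (fB : frame M p B) (sp : stratum p g t u) (rk : \rank (umat u) = n).
Hypotheses (pb : primitive_vec b) (bF : forall j, lam u j = 0 -> idot b (a j) = h).
Let v := fvec b h.

(** Smoothness enters here: if the transverse exponent were even against [v], the sheets [g] and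
    [gadd g v] would agree in sign on the facet and on the transverse coordinate, and coincide by
    [sheet_unique]; but [v] is nonzero because [b] is primitive. *)
Lemma parity_facet c : adapted u c -> parity v (hexp a (c (lshift n 0))) = true.
Proof.
move=> ad; apply: contrapT => /negP/negbTE pf.
apply: (@gadd_fvec_neq n g b h pb); apply: (sheet_unique fB sp ad).
  by move=> j uj; rewrite !sgnE parity_gadd parity_fvec_face ?bF// addbF.
by rewrite !sgnE parity_gadd pf addbF.
Qed.

Lemma facet_sheets c g' : adapted u c ->
  (forall j, lam u j = 0 -> sgn g' j = sgn g j) -> g' = g \/ g' = gadd g v.
Proof.
move=> ad hS; have pv := parity_facet ad.
have [E|E] := eqVneq (sgn g' (c (lshift n 0))) (sgn g (c (lshift n 0))).
  by left; exact: (sheet_unique fB sp ad).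
right; have vf j : lam u j = 0 -> parity v (hexp a j) = false.
  by move=> uj; rewrite parity_fvec_face ?bF.
apply: (sheet_unique fB (stratum_gadd sp vf) ad).
  by move=> j uj; rewrite !sgnE parity_gadd vf// addbF; exact: hS.
apply/eqP; rewrite sgn_inj parity_gadd pv; move: E; rewrite sgn_inj.
by case: (parity g' _); case: (parity g _).
Qed.

(** In a chart adapted to the facet the determinant of the frame is continuous through [p], and
    among the signs of the selected coordinates only the transverse one differs between the two
    sheets. At torus points [st_chart] passes to the given chart [c0]. *)
Lemma coh_facet c0 : rowsub c0 hmat \in unitmx ->
  exists s, s != 0 /\
  exists2 e, 0 < e & forall (x : 'rV[R]_m) (B' : 'M[R]_(n, m)), `|x - p| < e -> `|B' - B| < e ->
    frame M x B' -> forall g', torus_pt g' x ->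
    (g' = g /\ Num.sg (st c0 x B') = s) \/ (g' = gadd g v /\ Num.sg (st c0 x B') = - s).
Proof.
move=> cu0; have Mp : M p by case: fB.
have ule : forall j, lam u j <= 0 by case: sp.
have [c ad] := adapted_exists hspan ule (or_intror rk).
have cu : rowsub c hmat \in unitmx by case: ad.
have dn0 := chart_det_neq0 hspan sp ad Mp hM fB.
exists (Num.sg (\det (rowsub c hmat)) * (\prod_i sgn g (c i)) * Num.sg (\det (col_mx p B *m selmx c))).
split.
  rewrite !mulf_neq0// ?sgr_eq0//; first by rewrite -unitfE -unitmxE.
  by apply/prodf_neq0 => i _; exact: sgn_neq0.
have [e e0 he] := det_near dn0.
have /(@near_normP R 'rV[R]_m)[e1 e10 he1] := stratum_near sp.
exists (Num.min e e1); first by rewrite lt_min e0.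
move=> x B'; rewrite !lt_min => /andP[xe xe1] /andP[Be _] fB' g' tx.
have hS j : lam u j = 0 -> sgn g' j = sgn g j.
  by move=> uj; rewrite -(torus_pt_sgr j tx); have [] := he1 x xe1 j uj.
have stE : Num.sg (st c0 x B') =
    Num.sg (\det (rowsub c hmat)) * (\prod_i sgn g' (c i)) * Num.sg (\det (col_mx p B *m selmx c)).
  rewrite (st_chart tx fB' cu0 cu) /st !sgrM (he _ _ xe Be) sgr_prod; congr (_ * _ * _).
  by apply: eq_bigr => i _; rewrite (torus_pt_sgr _ tx).
have [gE|gE] := facet_sheets ad hS; [left|right]; split=> //; rewrite stE gE//.
have -> : \prod_i sgn (gadd g v) (c i) = - \prod_i sgn g (c i).
  rewrite (bigD1 (lshift n 0))//= [in RHS](bigD1 (lshift n 0))//= -mulNr; congr (_ * _).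
    rewrite !sgnE parity_gadd parity_facet// addbT.
    by case: (parity g _); rewrite /= ?expr0 ?expr1 ?opprK.
  apply: eq_bigr => i i0; rewrite !sgnE parity_gadd parity_fvec_face ?addbF//.
  by apply: bF; case: ad => _ hi _; exact: hi.
by rewrite mulrN mulNr.
Qed.

Lemma facet_approach g' e : (forall j, lam u j = 0 -> sgn g' j = sgn g j) -> 0 < e ->
  exists2 x, torus_pt g' x & `|x - p| < e.
Proof.
move=> hS e0; have Mp : M p by case: fB.
have p1 : enorm p = 1 by apply: (Yplus_enorm hspan); case: Mp.
have [s hs] := stratum_approach sp p1 hS e0.
exists (normalize (sheet g' (t + s *: u))); last exact: hs.
exact: torus_pt_normalize.
Qed.

Lemma facet_gadd j : lam u j = 0 -> sgn (gadd g v) j = sgn g j.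
Proof. by move=> uj; rewrite !sgnE parity_gadd parity_fvec_face ?bF// addbF. Qed.

End Facet.

Lemma circ_facet p g t u : M p -> stratum p g t u -> u != 0 -> \rank (umat u) = n.
Proof. by move=> Mp sp u0; case: (circ_stratum hspan hDelta ha Mp sp) u0 => // ->; rewrite eqxx. Qed.

Lemma stratum0_torus p g t : Yplus a p -> stratum p g t 0 -> torus_pt g p.
Proof.
move=> Yp [_ pE]; split; first exact: (Yplus_enorm hspan).
by exists t; apply/rowP => j; rewrite pE lam0 eqxx sheetE.
Qed.

End Coherence.

Section Orientations.
Context {R : realType} {n m : nat}.
Variable a : 'I_m -> 'rV[int]_n.
Hypothesis hspan : affinely_spans a.

Notation N := (1 + n)%N.
Notation G := {ffun 'I_N -> bool}.
Notation lam := (@lam R n m a).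
Notation sgn := (@sgn R n m a).
Notation sheet := (@sheet R n m a).
Notation hmat := (@hmat R n m a).
Notation torus_pt := (@torus_pt R n m a).
Notation umat := (@umat R n m a).
Notation stratum := (@stratum R n m a).
Notation st := (@st R n m a).

Variable Delta : set 'rV[R]_n.
Hypotheses (hn : (0 < n)%N) (hDelta : lattice_polytope Delta) (ha : lattice_points Delta a).
Local Notation M := (Yplus_circ Delta a).
Hypothesis hM : C1_submanifold n M.
Variable c : 'I_N -> 'I_m.
Hypothesis cu : rowsub c hmat \in unitmx.

Lemma torus_frame_dense p (B : 'M[R]_(n, m)) e : frame M p B -> 0 < e ->
  exists x B' g, [/\ torus_pt g x, frame M x B', `|x - p| < e & `|B' - B| < e].
Proof.
move=> fB e0; have Mp : M p by case: fB.
have /(@near_normP R 'rV[R]_m)[d d0 hd] := frame_near hM fB e0.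
have m0 : 0 < Num.min e d by rewrite lt_min e0.
have [g [x [tx]]] := Yplus_approx hspan (proj1 Mp) m0; rewrite lt_min => /andP[xe xd].
have [B' fB' Be] := hd x xd (torus_circ hspan Delta tx).
by exists x, B', g.
Qed.

(* w g compares an orientation with the logarithmic frame on the sheet g; the
   sheets g and g + (h, b) mod 2 meet along F, where that frame changes sign. *)
Definition facet_alternating (w : G -> bool) : Prop :=
  forall F b h, is_facet Delta F -> primitive_normal F b h ->
  forall g, w (gadd g (fvec b h)) = ~~ w g.

(** Across a facet both [w] and the sign of [st] flip, so their product keeps one sign around the
    facet point. *)
Lemma signed_coherence (w : G -> bool) p (B : 'M[R]_(n, m)) : facet_alternating w -> frame M p B ->
  exists beta : bool, exists2 e, 0 < e & forall (x : 'rV[R]_m) (B' : 'M[R]_(n, m)),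
    `|x - p| < e -> `|B' - B| < e -> frame M x B' -> forall g, torus_pt g x ->
    (0 < (-1) ^+ w g * st c x B') = beta.
Proof.
move=> hw fB; have Mp : M p by case: fB.
have [g [t [u sp]]] := Yplus_stratum hspan (proj1 Mp).
have [u0|un0] := eqVneq u 0.
  have tp : torus_pt g p by apply: (stratum0_torus hspan (proj1 Mp) (t := t)); rewrite -u0.
  have [e e0 he] := coh_torus hspan hM tp fB cu.
  exists (0 < (-1) ^+ w g * st c p B); exists e => // x B' xe Be fB' g' tx.
  have [-> E] := he x B' xe Be g' tx.
  by rewrite -sgr_gt0 sgrM E -sgrM sgr_gt0.
have rk := circ_facet hspan hDelta ha Mp sp un0.
have [b [h [pb bF fF pF]]] := facet_normal hn hDelta ha (proj1 sp) rk.
have [s [s0 [e e0 he]]] := coh_facet hspan hM fB sp rk pb bF cu.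
exists (0 < (-1) ^+ w g * s); exists e => // x B' xe Be fB' g' tx.
have [[-> E]|[-> E]] := he x B' xe Be fB' g' tx.
  by rewrite -sgr_gt0 sgrM E -[in RHS]sgr_gt0 sgrM -[in RHS]E sgr_id E.
rewrite (hw _ _ _ fF pF) signrN mulNr -mulrN.
by rewrite -sgr_gt0 sgrM sgrN E opprK -[in RHS]sgr_gt0 sgrM -[s in RHS]opprK -E sgrN sgr_id E opprK.
Qed.

Section Existence.
Variable w : G -> bool.
Hypothesis hw : facet_alternating w.

(** At points over facets, where [st] vanishes, the orientation is read off from nearby torus
    frames. [signed_coherence] makes these unanimous and density provides some, so falsity means
    that all of them are negative. *)
Definition torus_orientation (p : 'rV[R]_m) (B : 'M[R]_(n, m)) : bool :=
  `[< exists2 e, 0 < e & forall (x : 'rV[R]_m) (B' : 'M[R]_(n, m)),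
    `|x - p| < e -> `|B' - B| < e -> frame M x B' -> forall g, torus_pt g x ->
    0 < (-1) ^+ w g * st c x B' >].

Lemma torus_orientationE p (B : 'M[R]_(n, m)) : frame M p B ->
  exists2 e, 0 < e & forall (x : 'rV[R]_m) (B' : 'M[R]_(n, m)),
    `|x - p| < e -> `|B' - B| < e -> frame M x B' -> forall g, torus_pt g x ->
    (0 < (-1) ^+ w g * st c x B') = torus_orientation p B.
Proof.
move=> fB; have [beta [e e0 he]] := signed_coherence hw fB.
exists e => // x B' xe Be fB' g tx; rewrite (he x B' xe Be fB' g tx).
case: beta he => he; apply/esym; first by apply/asboolP; exists e.
apply/asboolP => -[e1 e10 he1].
have m0 : 0 < Num.min e e1 by rewrite lt_min e0.
have [y [C [g' [ty fC]]]] := torus_frame_dense fB m0.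
rewrite !lt_min => /andP[ye ye1] /andP[Ce Ce1].
by have := he1 y C ye1 Ce1 fC g' ty; rewrite (he y C ye Ce fC g' ty).
Qed.

Lemma torus_orientation_orientation : orientation M torus_orientation.
Proof.
split=> [p B A fB Au|p B fB].
  have fAB := frame_mul hM fB Au.
  have [e e0 he] := torus_orientationE fB; have [e1 e10 he1] := torus_orientationE fAB.
  have k0 : 0 < n%:R * `|A| + 1 by rewrite ltr_wpDl// mulr_ge0.
  have m0 : 0 < Num.min (Num.min e e1) (e1 / (n%:R * `|A| + 1)).
    by rewrite !lt_min e0 e10 divr_gt0.
  have [y [C [g [ty fC]]]] := torus_frame_dense fB m0.
  rewrite !lt_min => /andP[/andP[ye ye1] _] /andP[/andP[Ce _] Ce1].
  have ACe : `|A *m C - A *m B| < e1.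
    rewrite -mulmxBr (le_lt_trans (mulmx_norm _ _))// mulrA.
    move: Ce1; rewrite ltr_pdivlMr// mulrC; apply: le_lt_trans.
    by rewrite ler_wpM2r// lerDl.
  rewrite -(he1 y _ ye1 ACe (frame_mul hM fC Au) g ty) -(he y C ye Ce fC g ty).
  have dA : \det A != 0 by rewrite -unitfE -unitmxE.
  have s0 : (-1) ^+ w g * st c y C != 0.
    by rewrite mulf_neq0 ?signr_eq0// (st_neq0 hspan hM ty fC cu).
  rewrite st_mul mulrCA; move: s0; set z := _ * st c y C => s0.
  case: (ltrgtP 0 (\det A)) => [d0|d0|d0]; last by rewrite -d0 eqxx in dA.
    by rewrite pmulr_rgt0// eqb_id.
  by rewrite nmulr_rgt0// eqbF_neg -leNgt le_eqVlt (negbTE s0).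
have [e e0 he] := torus_orientationE fB.
apply/near2_normP; exists (e / 2); first by rewrite divr_gt0.
move=> q B' qe Be fB'; have [e1 e10 he1] := torus_orientationE fB'.
have m0 : 0 < Num.min e1 (e / 2) by rewrite lt_min e10 divr_gt0.
have [y [C [g [ty fC]]]] := torus_frame_dense fB' m0.
rewrite !lt_min => /andP[ye1 ye] /andP[Ce1 Ce].
rewrite -(he1 y C ye1 Ce1 fC g ty) (he y C _ _ fC g ty)//.
  by rewrite -(subrKA q) (le_lt_trans (ler_normD _ _))// (splitr e) ltrD.
by rewrite -(subrKA B') (le_lt_trans (ler_normD _ _))// (splitr e) ltrD.
Qed.

End Existence.

Section SheetSigns.
Variable oY : 'rV[R]_m -> 'M[R]_(n, m) -> bool.
Hypothesis hoY : orientation M oY.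

Definition agree x (B : 'M[R]_(n, m)) : bool := oY x B == (0 < st c x B).

Lemma agree_frame g x (B B' : 'M[R]_(n, m)) : torus_pt g x -> frame M x B -> frame M x B' ->
  agree x B = agree x B'.
Proof.
move=> tx fB fB'; have [A Au ->] := frame_change hM fB fB'.
rewrite /agree (proj1 hoY _ _ _ fB Au) st_mul.
have dA : \det A != 0 by rewrite -unitfE -unitmxE.
have s0 := st_neq0 hspan hM tx fB cu.
case: (ltrgtP 0 (\det A)) => [d0|d0|d0]; last by rewrite -d0 eqxx in dA.
  by rewrite (pmulr_rgt0 _ d0) eqb_id.
rewrite (nmulr_rgt0 _ d0); case: (ltrgtP 0 (st c x B)) s0; case: (oY x B) => //=.
Qed.

Lemma agree_near g p (B : 'M[R]_(n, m)) : torus_pt g p -> frame M p B ->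
  exists2 e, 0 < e & forall (x : 'rV[R]_m) (B' : 'M[R]_(n, m)), `|x - p| < e ->
    torus_pt g x -> frame M x B' -> agree x B' = agree p B.
Proof.
move=> tp fB; have [e e0 he] := coh_torus hspan hM tp fB cu.
have /near2_normP[e1 e10 he1] := proj2 hoY _ _ fB.
have m0 : 0 < Num.min e e1 by rewrite lt_min e0.
have /(@near_normP R 'rV[R]_m)[d d0 hd] := frame_near hM fB m0.
exists (Num.min (Num.min e e1) d); first by rewrite lt_min m0.
move=> x B'; rewrite !lt_min => /andP[/andP[xe xe1] xd] tx fB'.
have [C fC] := hd x xd (torus_circ hspan Delta tx); rewrite lt_min => /andP[Ce Ce1].
rewrite (agree_frame tx fB' fC) /agree (he1 x C xe1 Ce1 fC).
by have [_ E] := he x C xe Ce g tx; rewrite -[0 < st c x C]sgr_gt0 E sgr_gt0.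
Qed.

(** Connectedness of the line by calculus: the indicator has derivative zero everywhere. *)
Lemma locally_constant_bool (f : R -> bool) :
  (forall s, \forall s' \near s, f s' = f s) -> forall s s', f s = f s'.
Proof.
move=> h s s'; have H x : is_derive x (1 : R) (fun s => (f s)%:R : R) 0.
  have Hc : is_derive x (1 : R) (fun=> (f x)%:R : R) 0.
    apply/is_deriveP => e1 e10; exists 1 => // z _.
    by rewrite subrr scaler0 subr0 normr0 mulr_ge0// ltW.
  by apply: is_derive_near Hc; apply: filterS (h x) => z ->.
have := is_derive_0_is_cst s s' H; case: (f s); case: (f s') => //= /eqP.
  by rewrite oner_eq0.
by rewrite eq_sym oner_eq0.
Qed.

Lemma continuous_sheet_line g t v : continuous (fun s : R => normalize (sheet g (t + s *: v))).
Proof.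
move=> s; have cs : {for s, continuous (fun s : R => sheet g (t + s *: v))}.
  apply/continuous_mxP => i j.
  have -> : (fun z : R => sheet g (t + z *: v) i j) =
      (fun z => sgn g j * expR (lam t j + z * lam v j)).
    by apply/funext => z; rewrite mxE lamD lamZ.
  apply: continuousM; first exact: cst_continuous.
  have c1 : {for s, continuous (fun z : R => lam t j + z * lam v j)}.
    apply: (@continuousD _ R^o); first exact: cst_continuous.
    by apply: continuousM; [exact: cvg_id|exact: cst_continuous].
  exact: (continuous_comp c1 (@continuous_expR R _)).
apply: (@continuous_comp _ _ _ (fun s : R => sheet g (t + s *: v)) (@normalize R m)) => //.
by apply: continuous_normalize; exact: sheet_row_neq0.
Qed.

(** A sheet is connected through straight segments of parameters, along which agreement is locally
    constant. *)
Lemma agree_sheet g t t' (B B' : 'M[R]_(n, m)) :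
  frame M (normalize (sheet g t)) B -> frame M (normalize (sheet g t')) B' ->
  agree (normalize (sheet g t)) B = agree (normalize (sheet g t')) B'.
Proof.
move=> fB fB'; pose x (s : R) := normalize (sheet g (t + s *: (t' - t))).
have tx s : torus_pt g (x s) by exact: torus_pt_normalize.
have Mx s : M (x s) := torus_circ hspan Delta (tx s).
have [C fC] := choice (fun s => frame_exists hM (Mx s)).
have loc s : \forall s' \near s, agree (x s') (C s') = agree (x s) (C s).
  have [e e0 he] := agree_near (tx s) (fC s).
  have /cvgrPdist_lt/(_ e e0) := @continuous_sheet_line g t (t' - t) s.
  by apply: filterS => s'; rewrite distrC => xs; apply: he.
have E := locally_constant_bool loc 0 1.
have x0 : x 0 = normalize (sheet g t) by rewrite /x scale0r addr0.
have x1 : x 1 = normalize (sheet g t') by rewrite /x scale1r addrC subrK.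
rewrite -x0 in fB *; rewrite -x1 in fB' *.
by rewrite (agree_frame (tx 0) fB (fC 0)) E (agree_frame (tx 1) (fC 1) fB').
Qed.

Lemma sheet_signs : exists w : G -> bool, forall g x (B : 'M[R]_(n, m)),
  torus_pt g x -> frame M x B -> oY x B = (0 < (-1) ^+ w g * st c x B).
Proof.
have Mx g : M (normalize (sheet g 0)) := torus_circ hspan Delta (torus_pt_normalize hspan g 0).
have [C fC] := choice (fun g => frame_exists hM (Mx g)).
exists (fun g => ~~ agree (normalize (sheet g 0)) (C g)) => g x B tx fB.
have [x1 [t xE]] := tx.
have xn : x = normalize (sheet g t) by rewrite -xE normalize_unit.
have := agree_sheet (fC g); rewrite xn in fB tx *; move=> /(_ _ _ fB) ->.
have s0 := st_neq0 hspan hM tx fB cu.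
rewrite /agree; case: (ltrgtP 0 (st c _ B)) s0 => // h _; case: (oY _ B) => /=;
  by rewrite ?expr0 ?expr1 ?mul1r ?mulN1r ?oppr_gt0 ?h ?(lt_gtF h).
Qed.

(** The exponents in the support have rank [n] after homogenization, whereas those on a face of
    dimension [d] have rank at most [d + 1], which is less than [n] in codimension 2. *)
Lemma facet_point_circ p g t u : stratum p g t u -> enorm p = 1 -> \rank (umat u) = n -> M p.
Proof.
move=> sp p1 rk; split; first exact: (stratum_Yplus hspan sp p1).
move=> F [_ [d [[x0 [D [_ _ _ hD]]] dn]]] [_ hF].
have aF j : lam u j = 0 -> F (real_vec (a j)).
  move=> uj; apply: contrapT => /hF/eqP; rewrite -[_ == _]negbK.
  by rewrite (stratum_neq0 j sp) uj eqxx.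
have : (umat u <= (col_mx (row_mx 1%:M x0) (row_mx 0 D) : 'M[R]_(1 + d, N)))%MS.
  apply/row_subP => j; have -> : row j (umat u) = if lam u j == 0 then row_mx 1%:M (real_vec (a j)) else 0.
    apply/rowP => i; rewrite mxE mxE; case: ifP => _; last by rewrite mxE.
    rewrite [LHS]mxE; have [k ->|k ->] := split_ordP i.
      by rewrite (ord1 k) hexp0 row_mxEl mxE.
    by rewrite hexpS row_mxEr mxE.
  case: eqVneq => [uj|_]; last exact: sub0mx.
  have /submxP[z zE] := hD _ (aF j uj).
  apply/submxP; exists (row_mx 1%:M z); rewrite mul_row_col mul1mx mul_mx_row mulmx0 -zE.
  by rewrite add_row_mx addr0 addrC subrK.
move/mxrankS; rewrite rk => /leq_trans/(_ (rank_leq_row _)).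
by rewrite add1n => h; have := leq_trans dn h; rewrite ltnn.
Qed.

(** Every facet carries a point of [M]. Near it both adjacent sheets occur, the orientation is
    constant on nearby frames and [st] takes opposite signs, so [w] must differ. *)
Lemma sheet_signs_alternating (w : G -> bool) :
  (forall g x (B : 'M[R]_(n, m)), torus_pt g x -> frame M x B ->
     oY x B = (0 < (-1) ^+ w g * st c x B)) -> facet_alternating w.
Proof.
move=> hw F b h fF pF g; have pb : primitive_vec b by case: pF.
have [u [ule rk bF]] := facet_functional hn hDelta ha fF pF.
have [p [t [sp p1]]] := stratum_exists g ule (has_face_vertex hn rk).
have Mp := facet_point_circ sp p1 rk.
have [B fB] := frame_exists hM Mp.
have [s [s0 [e e0 he]]] := coh_facet hspan hM fB sp rk pb bF cu.
have /near2_normP[e1 e10 he1] := proj2 hoY _ _ fB.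
have m0 : 0 < Num.min e e1 by rewrite lt_min e0.
have /(@near_normP R 'rV[R]_m)[d d0 hd] := frame_near hM fB m0.
have m1 : 0 < Num.min (Num.min e e1) d by rewrite lt_min m0.
have val g' : (forall j, lam u j = 0 -> sgn g' j = sgn g j) ->
    exists x C, [/\ torus_pt g' x, frame M x C, oY x C = oY p B, `|x - p| < e & `|C - B| < e].
  move=> hS; have [x tx] := facet_approach hspan fB sp hS m1.
  rewrite !lt_min => /andP[/andP[xe xe1] xd].
  have [C fC] := hd x xd (torus_circ hspan Delta tx); rewrite lt_min => /andP[Ce Ce1].
  by exists x, C; split=> //; exact: he1.
have [x [C [tx fC oC xe Ce]]] := val g (fun _ _ => erefl).
have [x' [C' [tx' fC' oC' xe' Ce']]] := val (gadd g (fvec b h)) (facet_gadd g bF).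
have gg : gadd g (fvec b h) <> g by exact: gadd_fvec_neq.
have [[_ E]|[/esym//]] := he x C xe Ce fC g tx.
have [[//]|[_ E']] := he x' C' xe' Ce' fC' _ tx'.
have := hw g x C tx fC; have := hw _ x' C' tx' fC'; rewrite oC oC' => -> .
rewrite -sgr_gt0 sgrM E' -[in RHS]sgr_gt0 [in RHS]sgrM E.
have sg1 (z : bool) : Num.sg ((-1) ^+ z) = (-1) ^+ z :> R by case: z; rewrite ?sgrN1 ?sgr1.
rewrite !sg1; case: (w g); case: (w _) => //=; rewrite ?expr0 ?expr1 ?mul1r ?mulN1r ?opprK;
 rewrite oppr_gt0; case: (ltrgtP 0 s) s0 => //.
Qed.

End SheetSigns.
End Orientations.

(** * Characters of the sign group and odd bases *)

Section SignCombinatorics.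
Context {n : nat}.
Notation G := {ffun 'I_(1 + n) -> bool}.

Lemma signr_addb_prod (I : finType) (e : I -> int) (J K : {set I}) :
  (forall i, e i * e i = 1) ->
  \prod_(i in J) e i * \prod_(i in K) e i = \prod_(i in finset (fun i => (i \in J) (+) (i \in K))) e i.
Proof.
move=> e2; rewrite !(big_mkcond (fun i => i \in _)) -big_split/=; apply: eq_bigr => i _.
by rewrite inE; case: (i \in J); case: (i \in K); rewrite /= ?mulr1 ?mul1r ?e2.
Qed.

Lemma prod_signr_card (I : finType) (J : {set I}) : \prod_(i in J) (-1) = (-1) ^+ odd #|J| :> int.
Proof. by rewrite prodr_const signr_odd. Qed.

(** Moves the leading bit to the end, where the vector (b, b.F) of the theorem has its constant. *)
Definition sign_row (g : G) : 'rV[int]_(n + 1) :=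
  row_mx (\row_i (-1) ^+ g (rshift 1 i)) (const_mx ((-1) ^+ g (lshift n ord0))).

Lemma exprz_sign (z : int) : (-1) ^ z = (-1) ^+ odd `|z| :> int.
Proof.
case: z => k; first by rewrite -[LHS]exprnP signr_odd.
rewrite NegzE -[LHS]/((-1) ^- k.+1) abszN -[`|Posz _|%N]/(k.+1) -signr_odd.
by case: (odd _); rewrite ?expr1 ?expr0 ?invr1// invrN1.
Qed.

Lemma sign_row_fvec (b : 'rV[int]_n) (c : int) :
  sign_row (fvec b c) = sign_pow (row_mx b (const_mx c)).
Proof.
apply/rowP => i; rewrite [RHS]mxE exprz_sign; have [k ->|k ->] := split_ordP i.
  by rewrite !row_mxEl mxE ffunE row_mxEr.
by rewrite !row_mxEr !mxE ffunE row_mxEl mxE.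
Qed.

Lemma sign_row_vec g : sign_vec (sign_row g).
Proof.
by move=> i; rewrite /sign_row; have [k ->|k ->] := split_ordP i;
  rewrite ?row_mxEl ?row_mxEr mxE; case: (g _); [right|left|right|left].
Qed.

Lemma sign_row_gadd g h i : sign_row (gadd g h) 0 i = sign_row g 0 i * sign_row h 0 i.
Proof.
by rewrite /sign_row; have [k ->|k ->] := split_ordP i;
  rewrite ?row_mxEl ?row_mxEr !mxE ffunE signr_addb.
Qed.

Lemma sign_row_prod (c g : G) :
  \prod_(i < 1 + n) (-1) ^+ (c i && g i) =
  \prod_(i < n + 1) (sign_row g 0 i) ^+ (sign_row c 0 i == -1) :> int.
Proof.
rewrite big_split_ord/= big_ord1 [RHS]big_split_ord/= big_ord1 mulrC; congr (_ * _).
  apply: eq_bigr => i _; rewrite !row_mxEl !mxE.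
  by case: (c _); case: (g _).
by rewrite /= !row_mxEr !mxE; case: (c _); case: (g _).
Qed.

End SignCombinatorics.

Section OddBasis.
Context {R : realType} {n : nat}.
Variable Delta : set 'rV[R]_n.
Notation G := {ffun 'I_(1 + n) -> bool}.
Notation facet_alternating := (@facet_alternating R n Delta).

(** [w] counts basis elements mod 2. Multiplying sign vectors takes the symmetric difference of
    their index sets, so this count is additive, and it is odd on facet vectors by assumption. *)
Lemma odd_basis_alternating : odd_basis_condition Delta -> exists w, facet_alternating w.
Proof.
move=> [e [[ev eb] eF]].
have hJ g : exists J, sign_prod e J = sign_row g.
  by have [J [JE _]] := eb _ (sign_row_vec g); exists J.
have [J JE] := choice hJ.
have uniq K g : sign_prod e K = sign_row g -> K = J g.
  move=> KE; have [K0 [_ h]] := eb _ (sign_row_vec g).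
  by rewrite -(h _ KE) (h _ (JE g)).
exists (fun g => odd #|J g|) => F b h fF pF g.
have [K [oK KE]] := eF F b h fF pF; rewrite -sign_row_fvec in KE.
have e2 j i : e j 0 i * e j 0 i = 1 by case: (ev j i) => ->.
have <- : finset (fun j => (j \in J g) (+) (j \in K)) = J (gadd g (fvec b h)).
  apply: uniq; apply/rowP => i; rewrite mxE sign_row_gadd -JE KE !mxE.
  by rewrite -signr_addb_prod.
have := @signr_addb_prod _ (fun=> -1) (J g) K (fun=> erefl).
rewrite !prod_signr_card oK; case: (odd _) => /=; case: (odd _) => //.
Qed.

Lemma char_sum (g : G) :
  \sum_(c : G) \prod_i (-1) ^+ (c i && g i) = \prod_i (1 + (-1) ^+ g i) :> int.
Proof.
rewrite -(bigA_distr_bigA (fun i b => (-1) ^+ (b && g i)))/=; apply: eq_bigr => i _.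
by rewrite big_bool/= addrC.
Qed.

Lemma char_gadd (c g h : G) :
  \prod_i (-1) ^+ (c i && gadd g h i) =
  \prod_i (-1) ^+ (c i && g i) * \prod_i (-1) ^+ (c i && h i) :> int.
Proof. by rewrite -big_split; apply: eq_bigr => i _; rewrite ffunE andb_addr signr_addb. Qed.

(* Some character of G has a nonzero Fourier coefficient against (-1)^w, and the
   alternation of w forces its value at each facet vector. *)
Lemma alternating_char w : facet_alternating w -> exists c : G,
  forall F b h, is_facet Delta F -> primitive_normal F b h ->
    \prod_i (-1) ^+ (c i && fvec b h i) = -1 :> int.
Proof.
move=> hw; pose A (c : G) : int := \sum_(g : G) (-1) ^+ w g * \prod_i (-1) ^+ (c i && g i).
(* Fourier inversion at the origin: summed over all characters, only [g = 0] survives. *)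
have sA : \sum_c A c != 0.
  rewrite exchange_big/=; under eq_bigr do rewrite -mulr_sumr char_sum.
  rewrite (bigD1 [ffun=> false])//= [X in _ + X]big1 ?addr0 => [|g g0].
    rewrite mulf_neq0 ?signr_eq0//; apply/prodf_neq0 => i _.
    by rewrite ffunE.
  have [i gi] : exists i, g i.
    apply/existsP; apply: contraNT g0; rewrite negb_exists => /forallP h.
    by apply/eqP/ffunP => i; rewrite ffunE; apply: negbTE.
  by rewrite (bigD1 i)//= gi mul0r mulr0.
have [c Ac] : exists c, A c != 0.
  apply/existsP; apply: contraNT sA; rewrite negb_exists => /forallP h.
  by rewrite big1// => c _; apply/eqP; rewrite -[_ == _]negbK.
exists c => F b h fF pF; set s := \prod_i _.
have E : A c = - s * A c.
  rewrite {1}/A (reindex_inj (h := fun g => gadd g (fvec b h))); last first.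
    by move=> g g' E; rewrite -(gaddK g (fvec b h)) E gaddK.
  rewrite mulr_sumr; apply: eq_bigr => g _; rewrite (hw _ _ _ fF pF) char_gadd signrN -/s.
  by rewrite !mulNr mulrA mulrC.
have : (1 + s) * A c = 0 by rewrite mulrDl mul1r {1}E mulNr addNr.
by move/eqP; rewrite mulf_eq0 (negbTE Ac) orbF addrC addr_eq0 => /eqP.
Qed.

(** A basis on which the character [c] is -1 throughout: [e j] flips entry [j], and also entry [i0]
    when [c j] is false. A vector of character -1 must then use an odd number of elements. *)
Lemma odd_basis_exists k (c : 'I_k -> bool) i0 : c i0 ->
  exists e : 'I_k -> 'rV[int]_k, sign_basis e /\
  forall s, sign_vec s -> \prod_i (s 0 i) ^+ c i = -1 ->
    exists J : {set 'I_k}, odd #|J| /\ s = sign_prod e J.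
Proof.
move=> c0; pose e (j : 'I_k) : 'rV[int]_k := \row_i (-1) ^+ ((i == j) (+) (~~ c j && (i == i0))).
have eN J i : i != i0 -> sign_prod e J 0 i = (-1) ^+ (i \in J).
  move=> ii; rewrite mxE big_mkcond (bigD1 i)//= big1 ?mulr1 => [|j ji].
    by case: ifP => // _; rewrite mxE eqxx (negbTE ii) andbF.
  by case: ifP => // _; rewrite mxE [i == j]eq_sym (negbTE ji) (negbTE ii) andbF.
have e0 J : sign_prod e J 0 i0 = (-1) ^+ (i0 \in J) * \prod_(j in J | j != i0) (-1) ^+ ~~ c j.
  rewrite mxE; case: (boolP (i0 \in J)) => iJ.
    rewrite (bigD1 i0)//=; congr (_ * _); first by rewrite mxE eqxx c0.
    by apply: eq_bigr => j /andP[_ ji]; rewrite mxE eqxx andbT [i0 == j]eq_sym (negbTE ji).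
  rewrite mul1r; rewrite [RHS](eq_bigl (fun j => j \in J)) => [|j]; last first.
    by case: (boolP (j \in J)) => //= jJ; apply: contraNneq iJ => <-.
  apply: eq_bigr => j jJ; have ji : j != i0 by apply: contraNneq iJ => <-.
  by rewrite mxE eqxx andbT [i0 == j]eq_sym (negbTE ji).
have basis : sign_basis e.
  split=> [j i|s hs]; first by rewrite mxE; case: (_ (+) _); [right|left].
  have sE i : s 0 i = (-1) ^+ (s 0 i == -1) by case: (hs i) => ->.
  pose J0 : {set 'I_k} := finset (fun j => (j != i0) && (s 0 j == -1)).
  (* Entries other than [i0] determine which [e j] with [j != i0] occur; [q] is their total effect
     on entry [i0], after which membership of [i0] is forced. *)
  pose q : int := \prod_(j in J0) (-1) ^+ ~~ c j.
  have q2 : q = 1 \/ q = -1.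
    by rewrite /q; elim/big_ind: _; [left| |move=> i _; case: (~~ _); [right|left]];
      move=> // x y [->|->] [->|->]; [left|right|right|left].
  pose J : {set 'I_k} := finset (fun j => if j == i0 then s 0 i0 * q == -1 else s 0 j == -1).
  have JE K : sign_prod e K = s -> K = J.
    move=> KE; apply/setP => j; rewrite inE; case: eqVneq => [->|ji]; last first.
      by rewrite -KE eN//; case: (j \in K).
    rewrite -{1}KE e0; have -> : \prod_(j in K | j != i0) ((-1) ^+ (~~ c j) : int) = q.
      apply: eq_bigl => i; rewrite inE andbC; case: eqVneq => //= ii.
      by rewrite -KE eN//; case: (i \in K).
    by case: q2 => ->; case: (i0 \in K).
  exists J; split=> [|K /JE//]; apply/rowP => i; have [->|ii] := eqVneq i i0; last first.
    by rewrite eN// inE (negbTE ii) -sE.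
  rewrite e0; have -> : \prod_(j in J | j != i0) ((-1) ^+ (~~ c j) : int) = q.
    by apply: eq_bigl => j; rewrite !inE andbC; case: eqVneq.
  by rewrite inE eqxx; case: (hs i0) => ->; case: q2 => ->.
exists e; split=> // s hs sc; have [J [JE _]] := proj2 basis s hs; exists J; split=> //.
have : \prod_i (s 0 i) ^+ c i = \prod_(j in J) (-1).
  rewrite -JE; under eq_bigr do rewrite mxE -prodrXl.
  rewrite exchange_big; apply: eq_bigr => j _ /=.
  rewrite (bigD1 i0)//= c0 expr1 mxE eqxx andbT.
  have [E|ji] := eqVneq i0 j.
    rewrite -E c0 big1 ?mulr1 ?expr1// => i /negbTE ii.
    by rewrite mxE ii andbF expr0 expr1n.
  rewrite (bigD1 j) 1?eq_sym//= big1 => [|i /andP[i0i ij]].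
    by rewrite mxE eqxx [j == i0]eq_sym (negbTE ji) andbF; case: (c j).
  by rewrite mxE (negbTE ij) (negbTE i0i) andbF expr0 expr1n.
by rewrite sc prod_signr_card; case: (odd _).
Qed.

Lemma alternating_odd_basis w : facet_alternating w -> odd_basis_condition Delta.
Proof.
move=> hw; have [c hc] := alternating_char hw.
have key (d : 'I_(n + 1) -> bool) i0 : d i0 ->
    (forall F b h, is_facet Delta F -> primitive_normal F b h ->
      \prod_i (sign_row (fvec b h) 0 i) ^+ d i = -1) -> odd_basis_condition Delta.
  move=> di0 hd; have [e [be he]] := odd_basis_exists di0.
  exists e; split=> // F b h fF pF; rewrite -sign_row_fvec.
  by apply: he; [exact: sign_row_vec|exact: hd fF pF].
have [/existsP[i ci]|] := boolP [exists i, sign_row c 0 i == -1].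
  by apply: (key (fun i => sign_row c 0 i == -1) i ci) => F b h fF pF; rewrite -sign_row_prod; exact: hc fF pF.
(* A trivial character cannot take the value -1, so the facet condition is vacuous and the all-true
   [d] will do. *)
rewrite negb_exists => /forallP c0; apply: (key (fun=> true) (rshift n ord0)) => // F b h fF pF.
by have := hc F b h fF pF; rewrite sign_row_prod big1// => i _; rewrite (negbTE (c0 i)).
Qed.

End OddBasis.

(** * Integral formula for signed counts of zeros *)

Section Taylor.
Context {R : realType}.

(* Uniform first-order Taylor expansions on bounded sets: unlike
   differentiability, this is what Riemann sums need. *)
Definition tay k (F : 'rV[R]_k -> R) (D : 'rV[R]_k -> 'rV[R]_k) : Prop :=
  forall r, exists2 C, 0 <= C & forall x v, `|x| <= r -> `|v| <= r ->
    [/\ `|F x| <= C, `|D x| <= C & `|F (x + v) - F x - dotv (D x) v| <= C * `|v| ^+ 2].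

Definition tay1 (f f' : R -> R) : Prop :=
  forall r, exists2 C, 0 <= C & forall x v, `|x| <= r -> `|v| <= r ->
    [/\ `|f x| <= C, `|f' x| <= C & `|f (x + v) - f x - f' x * v| <= C * `|v| ^+ 2].

Section Fixed.
Context {k : nat}.
Implicit Types (F : 'rV[R]_k -> R) (D : 'rV[R]_k -> 'rV[R]_k).

Lemma dotvDl (u u' v : 'rV[R]_k) : dotv (u + u') v = dotv u v + dotv u' v.
Proof. by rewrite -big_split; apply: eq_bigr => i _; rewrite mxE mulrDl. Qed.

Lemma dotvDr (u v v' : 'rV[R]_k) : dotv u (v + v') = dotv u v + dotv u v'.
Proof. by rewrite -big_split; apply: eq_bigr => i _; rewrite mxE mulrDr. Qed.

Lemma dotvZl (c : R) (u v : 'rV[R]_k) : dotv (c *: u) v = c * dotv u v.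
Proof. by rewrite mulr_sumr; apply: eq_bigr => i _; rewrite mxE mulrA. Qed.

Lemma dotvZr (c : R) (u v : 'rV[R]_k) : dotv u (c *: v) = c * dotv u v.
Proof. by rewrite mulr_sumr; apply: eq_bigr => i _; rewrite mxE mulrCA. Qed.

Lemma dotv0l (v : 'rV[R]_k) : dotv 0 v = 0.
Proof. by rewrite /dotv big1// => i _; rewrite mxE mul0r. Qed.

Lemma dotv_norm (u v : 'rV[R]_k) : `|dotv u v| <= k%:R * `|u| * `|v|.
Proof.
rewrite (le_trans (ler_norm_sum _ _ _))//.
rewrite (le_trans (ler_sum _ (G := fun=> `|u| * `|v|) _))//; last first.
  by rewrite sumr_const card_ord mulr_natl mulrnAl.
by move=> i _; rewrite normrM ler_pM// mx_entry_le.
Qed.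

Lemma tay_ext F F' D D' : F =1 F' -> D =1 D' -> tay F D -> tay F' D'.
Proof. by move=> /funext -> /funext ->. Qed.

Lemma tay_cst c : tay (fun=> c : R) (fun=> 0 : 'rV[R]_k).
Proof.
move=> r; exists `|c| => // x v _ _; split => //; first by rewrite normr0.
by rewrite subrr dotv0l subr0 normr0 mulr_ge0// sqr_ge0.
Qed.

Lemma tay_dotv (u : 'rV[R]_k) : tay (dotv u) (fun=> u).
Proof.
move=> r; exists (k%:R * `|u| * Num.max r 0 + `|u|) => [|x v xr vr].
  by rewrite addr_ge0// mulr_ge0// ?mulr_ge0// le_max lexx orbT.
split.
- rewrite (le_trans (dotv_norm _ _))// ler_wpDr// ler_wpM2l// ?mulr_ge0//.
  by rewrite (le_trans xr)// le_max lexx.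
- by rewrite ler_wpDl// mulr_ge0// ?mulr_ge0// le_max lexx orbT.
- rewrite dotvDr [X in X - _]addrAC subrr add0r subrr normr0.
  by rewrite mulr_ge0// ?sqr_ge0// addr_ge0// mulr_ge0// ?mulr_ge0// le_max lexx orbT.
Qed.

Lemma tayD F D F' D' : tay F D -> tay F' D' -> tay (fun x => F x + F' x) (fun x => D x + D' x).
Proof.
move=> h h' r; have [C C0 hC] := h r; have [C' C'0 hC'] := h' r.
exists (C + C'); first exact: addr_ge0.
move=> x v xr vr; have [a b c] := hC x v xr vr; have [a' b' c'] := hC' x v xr vr.
split; [exact: le_trans (ler_normD _ _) (lerD a a')|exact: le_trans (ler_normD _ _) (lerD b b')|].
rewrite dotvDl mulrDl; apply: le_trans (lerD c c'); apply: le_trans (ler_normD _ _).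
by rewrite le_eqVlt; apply/orP; left; apply/eqP; congr `|_|; ring.
Qed.

Lemma tay_incr F D r : tay F D -> exists2 L, 0 <= L & forall x v, `|x| <= r -> `|v| <= r ->
  [/\ `|F x| <= L, `|D x| <= L & `|F (x + v) - F x| <= L * `|v|].
Proof.
move=> h; have [C C0 hC] := h r; have [r0|r0] := ltP r 0.
  by exists C => // x v xr; have := le_lt_trans xr r0; rewrite normr_lt0.
exists (C + (k%:R * C + C * r)) => [|x v xr vr].
  by rewrite !addr_ge0// mulr_ge0.
have [a b c] := hC x v xr vr.
have p : 0 <= k%:R * C + C * r by rewrite addr_ge0// mulr_ge0.
split; rewrite ?(le_trans a) ?(le_trans b) ?lerDl//.
rewrite -(subrK (dotv (D x) v) (_ - F x)) (le_trans (ler_normD _ _))//.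
apply: (@le_trans _ _ (C * r * `|v| + k%:R * C * `|v|)); last first.
  by rewrite -mulrDl ler_wpM2r// [C * r + _]addrC lerDr.
apply: lerD; last by rewrite (le_trans (dotv_norm _ _))// ler_wpM2r// ler_wpM2l.
by rewrite (le_trans c)// expr2 mulrA ler_wpM2r// ler_wpM2l.
Qed.

Lemma tayM F D F' D' : tay F D -> tay F' D' ->
  tay (fun x => F x * F' x) (fun x => F x *: D' x + F' x *: D x).
Proof.
move=> h h' r; have [C C0 hC] := h r; have [C' C'0 hC'] := h' r.
have [L L0 hL] := tay_incr r h; have [L' L'0 hL'] := tay_incr r h'.
exists (C * C' + (L * L' + C * C') + (L * L' + C * C')) => [|x v xr vr].
  by rewrite !addr_ge0// mulr_ge0.
have [a b c] := hC x v xr vr; have [a' b' c'] := hC' x v xr vr.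
have [_ _ l] := hL x v xr vr; have [_ _ l'] := hL' x v xr vr.
have q : 0 <= L * L' by rewrite mulr_ge0.
have q' : 0 <= C * C' by rewrite mulr_ge0.
split.
- rewrite normrM (le_trans (ler_pM _ _ a a'))//; lra.
- rewrite (le_trans (ler_normD _ _))// !normrZ.
  have := ler_pM (normr_ge0 _) (normr_ge0 _) a b'.
  have := ler_pM (normr_ge0 _) (normr_ge0 _) a' b; lra.
rewrite dotvDl !dotvZl.
have -> : F (x + v) * F' (x + v) - F x * F' x - (F x * dotv (D' x) v + F' x * dotv (D x) v) =
   (F (x + v) - F x) * (F' (x + v) - F' x) + (F x * (F' (x + v) - F' x - dotv (D' x) v) +
   F' x * (F (x + v) - F x - dotv (D x) v)) by ring.
rewrite (le_trans (ler_normD _ _))// [X in X + _]normrM.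
have := ler_pM (normr_ge0 _) (normr_ge0 _) l l'.
rewrite mulrACA -expr2 => h1.
have := ler_normD (F x * (F' (x + v) - F' x - dotv (D' x) v)) (F' x * (F (x + v) - F x - dotv (D x) v)).
rewrite !normrM.
have := ler_pM (normr_ge0 _) (normr_ge0 _) a c'.
have := ler_pM (normr_ge0 _) (normr_ge0 _) a' c.
have := mulr_ge0 q (sqr_ge0 `|v|).
have := mulr_ge0 q' (sqr_ge0 `|v|).
rewrite !mulrDl [C' * (C * _)]mulrA [C' * C]mulrC mulrA; lra.
Qed.

Lemma tay_comp f f' F D : tay1 f f' -> tay F D -> tay (fun x => f (F x)) (fun x => f' (F x) *: D x).
Proof.
move=> hf h r; have [C C0 hC] := h r; have [L L0 hL] := tay_incr r h.
have [r0|r0] := ltP r 0.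
  by exists 0 => // x v xr; have := le_lt_trans xr r0; rewrite normr_lt0.
have [c c0 hc] := hf (L + L * r).
exists (c + c * L + (c * L ^+ 2 + c * C)) => [|x v xr vr].
  by rewrite !addr_ge0// mulr_ge0// sqr_ge0.
have [a b e] := hC x v xr vr; have [a1 b1 l] := hL x v xr vr.
have Lr : 0 <= L * r by rewrite mulr_ge0.
have [] := hc (F x) (F (x + v) - F x).
- by rewrite (le_trans a1)// lerDl.
- by rewrite (le_trans l)// ler_wpDl// ler_wpM2l.
rewrite [F x + _]addrC subrK => fa fb fe.
have cL : 0 <= c * L by rewrite mulr_ge0.
have cL2 : 0 <= c * L ^+ 2 by rewrite mulr_ge0// sqr_ge0.
have cC : 0 <= c * C by rewrite mulr_ge0.
split; first by apply: le_trans fa _; lra.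
  by rewrite normrZ (le_trans (ler_pM _ _ fb b1))//; lra.
rewrite dotvZl.
have -> : f (F (x + v)) - f (F x) - f' (F x) * dotv (D x) v =
  (f (F (x + v)) - f (F x) - f' (F x) * (F (x + v) - F x)) +
  f' (F x) * (F (x + v) - F x - dotv (D x) v) by ring.
rewrite (le_trans (ler_normD _ _))// [in X in _ + X]normrM.
have h1 := ler_pM (normr_ge0 _) (normr_ge0 _) fb e.
have h2 : `|F (x + v) - F x| ^+ 2 <= L ^+ 2 * `|v| ^+ 2.
  by rewrite -exprMn ler_pXn2r// ?nnegrE ?mulr_ge0.
have h3 := ler_wpM2l c0 h2.
have v2 := sqr_ge0 `|v|.
have := mulr_ge0 c0 v2; have := mulr_ge0 cL v2; rewrite !mulrDl; lra.
Qed.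

Lemma dotv_delta (u : 'rV[R]_k) l : dotv u (delta_mx 0 l) = u 0 l.
Proof.
rewrite /dotv (bigD1 l)//= mxE !eqxx mulr1 big1 ?addr0// => i /negbTE il.
by rewrite mxE il andbF mulr0.
Qed.

Lemma norm_scale_delta (d : R) (l : 'I_k) : 0 <= d -> `|d *: delta_mx 0 l : 'rV[R]_k| <= d.
Proof.
move=> d0; apply: mx_norm_le => // i j.
rewrite !mxE normrM (ger0_norm d0) ler_piMr//; case: (_ && _); rewrite ?normr1 ?normr0//.
Qed.

Lemma tay_near0 F D x d : tay F D -> 0 < d ->
  (forall v, `|v| <= d -> F (x + v) = 0) -> D x = 0.
Proof.
move=> h d0 hF; apply/rowP => l; rewrite [RHS]mxE.
have [C C0 hC] := h (Num.max `|x| 1).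
apply/eqP; rewrite -normr_eq0 eq_le normr_ge0 andbT; apply/ler_addgt0Pr => e e0; rewrite add0r.
pose c := Num.min (Num.min 1 d) (e / (C + 1)).
have c0 : 0 < c by rewrite !lt_min ltr01 d0 divr_gt0//; lra.
have [c1 c2 c3] : [/\ c <= 1, c <= d & c <= e / (C + 1)].
  by split; rewrite /c !ge_min lexx ?orbT.
have nc := norm_scale_delta l (ltW c0).
have [] := hC x (c *: delta_mx 0 l); rewrite ?le_max ?lexx//.
  by apply/orP; right; exact: le_trans c1.
move=> _ _; rewrite hF ?(le_trans nc)// -[F x](congr1 F (addr0 x)) hF ?normr0 ?(ltW d0)//.
rewrite subr0 sub0r normrN dotvZr normrM (gtr0_norm c0) dotv_delta => hD.
have : c * `|D x 0 l| <= c * (C * c).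
  apply: le_trans hD _; rewrite [X in _ <= X]mulrCA; apply: (ler_wpM2l C0).
  by rewrite -expr2 ler_pXn2r// nnegrE// ltW.
rewrite ler_pM2l// => /le_trans; apply.
have C1 : 0 < C + 1 by lra.
have : c * (C + 1) <= e by rewrite -ler_pdivlMr.
have := ltW c0; nra.
Qed.

Lemma tay_sum (I : finType) (F : I -> 'rV[R]_k -> R) (D : I -> 'rV[R]_k -> 'rV[R]_k) :
  (forall i, tay (F i) (D i)) -> tay (fun x => \sum_i F i x) (fun x => \sum_i D i x).
Proof.
move=> h; suff H s : tay (fun x => \sum_(i <- s) F i x) (fun x => \sum_(i <- s) D i x) by exact: H.
elim: s => [|i s ih].
  by apply: tay_ext (tay_cst 0) => x; rewrite big_nil.
by apply: tay_ext (tayD (h i) ih) => x; rewrite big_cons.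
Qed.

Lemma tayZ c F D : tay F D -> tay (fun x => c * F x) (fun x => c *: D x).
Proof.
move=> h; apply: tay_ext (tayM (tay_cst c) h) => x//.
by rewrite scaler0 addr0.
Qed.

Lemma tay_prod (I : finType) (F : I -> 'rV[R]_k -> R) (D : I -> 'rV[R]_k -> 'rV[R]_k) :
  (forall i, tay (F i) (D i)) ->
  tay (fun x => \prod_i F i x) (fun x => \sum_i (\prod_(j | j != i) F j x) *: D i x).
Proof.
move=> h; suff H s : uniq s -> tay (fun x => \prod_(i <- s) F i x)
    (fun x => \sum_(i <- s) (\prod_(j <- s | j != i) F j x) *: D i x).
  exact: (H _ (index_enum_uniq I)).
elim: s => [_|i s ih /=/andP[is_ us]].
  by apply: tay_ext (tay_cst 1) => x; rewrite big_nil.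
apply: tay_ext (tayM (h i) (ih us)) => x; first by rewrite big_cons.
rewrite big_cons addrC; congr (_ + _).
  congr (_ *: _); rewrite big_cons eqxx/= big_seq [RHS]big_seq_cond; apply: eq_bigl => j.
  by case: (boolP (j \in s)) => //= js; apply/esym; apply: contraNneq is_ => <-.
rewrite scaler_sumr big_seq [RHS]big_seq; apply: eq_bigr => j js.
rewrite big_cons ifT ?scalerA//.
by apply: contraNneq is_ => ->.
Qed.

Definition setrow p (i : 'I_p) (v : 'rV[R]_p) (A : 'M[R]_p) : 'M[R]_p :=
  \matrix_(i', j) if i' == i then v 0 j else A i' j.

Lemma det_setrow p (i : 'I_p) v A : \det (setrow i v A) = \sum_j v 0 j * cofactor A i j.
Proof.
rewrite (expand_det_row _ i); apply: eq_bigr => j _; rewrite mxE eqxx; congr (_ * (_ * \det _)).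
by apply/matrixP => i' j'; rewrite !mxE eq_sym (negbTE (neq_lift _ _)).
Qed.

Lemma tay_det p (A : 'rV[R]_k -> 'M[R]_p) (D : 'I_p -> 'I_p -> 'rV[R]_k -> 'rV[R]_k) :
  (forall i j, tay (fun x => A x i j) (D i j)) ->
  tay (fun x => \det (A x))
    (fun x => \row_l \sum_i \det (setrow i (\row_j D i j x 0 l) (A x))).
Proof.
move=> h.
have hs (s : 'S_p) := tayZ ((-1) ^+ s) (tay_prod (fun i => h i (s i))).
apply: tay_ext (tay_sum hs) => x //.
apply/rowP => l; rewrite summxE !mxE exchange_big/=.
apply: eq_bigr => s _; rewrite mxE summxE mulr_sumr; apply: eq_bigr => i _.
congr (_ * _); rewrite mxE mulrC [RHS](bigD1 i)//= !mxE eqxx; congr (_ * _).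
by apply: eq_bigr => j /negbTE ji; rewrite !mxE ji.
Qed.

End Fixed.

Lemma tay1_expR : tay1 (@expR R) (@expR R).
Proof.
(* The upper bound comes from [1 - v <= expR (- v)], multiplied by [expR v]. *)
have E (v : R) : 0 <= expR v - 1 - v <= expR `|v| * `|v| ^+ 2.
  have h := expR_ge1Dx v; apply/andP; split; first by lra.
  have h' := expR_ge1Dx (- v); have p := expR_gt0 v; have p' := expR_gt0 (- v).
  have E : expR v * expR (- v) = 1 by rewrite -expRD subrr expR0.
  have [v0|v0] := leP 0 v; [rewrite ger0_norm//|rewrite ltr0_norm//]; nra.
move=> r; have [r0|r0] := ltP r 0.
  by exists 0 => // x v xr; have := le_lt_trans xr r0; rewrite normr_lt0.
have e1 : 0 <= expR r * expR r by rewrite mulr_ge0// expR_ge0.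
exists (expR r + expR r * expR r) => [|x v xr vr]; first by rewrite addr_ge0// expR_ge0.
have ex : expR x <= expR r by rewrite ler_expR (le_trans (ler_norm _)).
have ev : expR `|v| <= expR r by rewrite ler_expR.
have p := expR_gt0 x.
split; rewrite ?(ger0_norm (expR_ge0 _)) ?(le_trans ex)// ?lerDl//.
have -> : expR (x + v) - expR x - expR x * v = expR x * (expR v - 1 - v) by rewrite expRD; ring.
have /andP[E0 E1] := E v.
rewrite normrM (ger0_norm (ltW p)) (ger0_norm E0).
apply: (@le_trans _ _ (expR r * expR r * `|v| ^+ 2)).
  rewrite -mulrA; apply: ler_pM => //.
  by apply: le_trans E1 _; rewrite ler_wpM2r// sqr_ge0.
by rewrite ler_wpM2r// ?sqr_ge0// lerDr expR_ge0.
Qed.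

(** Its derivative is Lipschitz, which is all that [tay1] asks; it builds the cutoffs in place of a
    smooth bump function. *)
Definition sqp (u : R) : R := Num.max 0 u ^+ 2.

Lemma tay1_sqp : tay1 sqp (fun u => 2 * Num.max 0 u).
Proof.
move=> r; have [r0|r0] := ltP r 0.
  by exists 0 => // x v xr; have := le_lt_trans xr r0; rewrite normr_lt0.
exists (r ^+ 2 + 2 * r + 1) => [|x v xr vr]; first nra.
move: xr vr; rewrite !ler_norml => /andP[x1 x2] /andP[v1 v2].
rewrite real_normK ?num_real// /sqp.
case: (leP 0 x) => x0; case: (leP 0 (x + v)) => xv0; split; apply/andP; split; nra.
Qed.

Lemma sqp_ge0 u : 0 <= sqp u. Proof. exact: sqr_ge0. Qed.

Lemma sqp_eq0 u : u <= 0 -> sqp u = 0.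
Proof. by move=> u0; rewrite /sqp max_l// expr0n. Qed.

End Taylor.

(** * An integral obtained from Riemann sums *)

Section GridIntegral.
Context {R : realType} {N : nat}.
Implicit Types (phi psi : 'rV[R]_N -> R).

Definition supported phi (L : nat) := forall t, L%:R < `|t| -> phi t = 0.

Definition test phi (L : nat) C := supported phi L /\ forall t, `|phi t| <= C.

(* A stand-in for the Lebesgue integral of compactly supported functions. *)
Record integral_like (I : ('rV[R]_N -> R) -> R) : Prop := IntegralLike {
  intD : forall phi psi L C L' C', test phi L C -> test psi L' C' ->
    I (fun t => phi t + psi t) = I phi + I psi;
  intZ : forall c phi L C, test phi L C -> I (fun t => c * phi t) = c * I phi;
  int_bound : forall phi L C, test phi L C -> `|I phi| <= C * (L.*2.+1)%:R ^+ N;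
  int_gt0 : forall phi L C c q, test phi L C -> (forall t, 0 <= phi t) -> 0 < c ->
    (forall t, `|t| <= q.+1%:R^-1 -> c <= phi t) -> 0 < I phi;
  int_derive : forall phi D L, tay phi D -> supported phi L ->
    forall l, I (fun t => D t 0 l) = 0 }.

(** Mesh 1/(k+1) on the cube of half side k+1, so that refinement and exhaustion happen together. *)
Definition grid k (v : {ffun 'I_N -> 'I_((k.+1 ^ 2).*2).+1}) : 'rV[R]_N :=
  \row_i (((v i)%:R - (k.+1 ^ 2)%:R) / k.+1%:R).

Definition riemann_sum phi k : R := k.+1%:R ^- N * \sum_(v : {ffun 'I_N -> 'I_((k.+1 ^ 2).*2).+1}) phi (grid v).

Definition box (e : R) (t : 'rV[R]_N) : R := (`|t| <= e)%R%:R.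

Lemma boxE e t : 0 <= e -> box e t = \prod_i (`|t 0 i| <= e)%R%:R.
Proof.
move=> e0; rewrite /box; case: (boolP (`|t| <= e)) => te.
  by rewrite big1// => i _; rewrite (le_trans (mx_entry_le _ _ _) te).
have [i ti] : exists i, ~~ (`|t 0 i| <= e).
  apply/existsP; apply: contraNT te; rewrite negb_exists => /forallP h.
  by apply: mx_norm_le => // i j; rewrite (ord1 i); have := h j; rewrite negbK.
by rewrite (bigD1 i)//= (negbTE ti) mul0r.
Qed.

Lemma riemann_sum_box e k : 0 <= e -> riemann_sum (box e) k =
  (k.+1%:R^-1 * \sum_(x < ((k.+1 ^ 2).*2).+1) (`|(x%:R - (k.+1 ^ 2)%:R) / k.+1%:R| <= e)%R%:R) ^+ N.
Proof.
move=> e0; rewrite exprMn exprVn; congr (_ * _).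
rewrite -[in RHS](card_ord N) -prodr_const bigA_distr_bigA; apply: eq_bigr => v _.
by rewrite boxE//; apply: eq_bigr => i _; rewrite mxE.
Qed.

Lemma ord_count n (P : pred nat) : \sum_(x < n) (P x)%:R = (size (seq.filter P (iota 0 n)))%:R :> R.
Proof.
rewrite -(big_mkord predT (fun x => (P x)%:R)) /index_iota subn0 size_filter -sum1_count.
rewrite natr_sum [RHS]big_mkcond; apply: eq_bigr => x _; by case: (P x).
Qed.

Lemma riemann_sum_box_le L k : riemann_sum (box L%:R) k <= (L.*2.+1)%:R ^+ N.
Proof.
have k0 : 0 < k.+1%:R :> R by rewrite ltr0n.
rewrite riemann_sum_box// lerXn2r ?nnegrE//.
  by rewrite mulr_ge0// sumr_ge0.
rewrite ler_pdivrMl// (ord_count _ (fun x : nat => `|(x%:R - (k.+1 ^ 2)%:R) / k.+1%:R| <= L%:R :> R)).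
rewrite -natrM ler_nat.
set s := seq.filter _ _; have us : uniq s by rewrite filter_uniq// iota_uniq.
apply: (@leq_trans (size (iota (k.+1 ^ 2 - L * k.+1) (L * k.+1 * 2 + 1)))).
  apply: uniq_leq_size => // x; rewrite mem_filter mem_iota => /andP[+ _].
  rewrite normrM normfV (gtr0_norm k0) ler_pdivrMr// ler_norml -natrM.
  rewrite lerNl opprB !lerBlDr -!natrD !ler_nat mem_iota => /andP[]; lia.
by rewrite size_iota; nia.
Qed.

Lemma riemann_sum_box_ge q k : q.+1%:R^-1 ^+ N <= riemann_sum (box q.+1%:R^-1) k.
Proof.
have k0 : 0 < k.+1%:R :> R by rewrite ltr0n.
have q0 : 0 < q.+1%:R :> R by rewrite ltr0n.
rewrite riemann_sum_box ?invr_ge0// lerXn2r ?nnegrE ?invr_ge0//.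
  by rewrite mulr_ge0// sumr_ge0.
rewrite ler_pdivlMl// ler_pdivrMr//.
rewrite (ord_count _ (fun x : nat => `|(x%:R - (k.+1 ^ 2)%:R) / k.+1%:R| <= q.+1%:R^-1 :> R)).
rewrite -natrM ler_nat.
set s := seq.filter _ _.
apply: (@leq_trans ((k.+1 %/ q.+1).+1 * q.+1)%N); first by rewrite ltnW// ltn_ceil.
rewrite leq_mul2r/= -(size_iota (k.+1 ^ 2) (k.+1 %/ q.+1).+1).
apply: uniq_leq_size; first exact: iota_uniq.
move=> x; rewrite mem_iota mem_filter mem_iota => /andP[x1 x2].
have h : ((k.+1 %/ q.+1) * q.+1 <= k.+1)%N by exact: leq_trunc_div.
have h2 : ((x - k.+1 ^ 2) * q.+1 <= k.+1)%N by nia.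
apply/andP; split; last by nia.
rewrite -natrB// normrM normfV (gtr0_norm k0) ger0_norm// ler_pdivrMr// mulrC ler_pdivlMr//.
by rewrite -natrM ler_nat.
Qed.

Lemma riemann_sumD phi psi k :
  riemann_sum (fun t => phi t + psi t) k = riemann_sum phi k + riemann_sum psi k.
Proof. by rewrite /riemann_sum big_split mulrDr. Qed.

Lemma riemann_sumZ c phi k : riemann_sum (fun t => c * phi t) k = c * riemann_sum phi k.
Proof. by rewrite /riemann_sum -mulr_sumr mulrCA. Qed.

Lemma ler_riemann_sum phi psi k : (forall t, phi t <= psi t) -> riemann_sum phi k <= riemann_sum psi k.
Proof. by move=> h; rewrite ler_wpM2l ?invr_ge0 ?exprn_ge0// ler_sum. Qed.

Lemma riemann_sum_norm phi k : `|riemann_sum phi k| <= riemann_sum (fun t => `|phi t|) k.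
Proof.
rewrite normrM ger0_norm ?invr_ge0 ?exprn_ge0// ler_wpM2l ?invr_ge0 ?exprn_ge0//.
exact: ler_norm_sum.
Qed.

Lemma riemann_sum_bound phi L C k : test phi L C -> `|riemann_sum phi k| <= C * (L.*2.+1)%:R ^+ N.
Proof.
move=> [sp hC]; have C0 : 0 <= C := le_trans (normr_ge0 _) (hC 0).
apply: le_trans (riemann_sum_norm _ _) _.
apply: (@le_trans _ _ (riemann_sum (fun t => C * box L%:R t) k)); last first.
  by rewrite riemann_sumZ ler_wpM2l// riemann_sum_box_le.
apply: ler_riemann_sum => t; rewrite /box; case: (leP `|t| L%:R) => h /=; first by rewrite mulr1.
by rewrite sp// normr0 mulr0.
Qed.

(** A shift by one mesh step permutes the indices cyclically; both the point leaving the cube and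
    the wrapped one have norm above [L], where [phi] vanishes. *)
Lemma riemann_sum_shift phi L k l : supported phi L -> (L <= k)%N ->
  riemann_sum (fun t => phi (t + k.+1%:R^-1 *: delta_mx 0 l)) k = riemann_sum phi k.
Proof.
move=> sp Lk; congr (_ * _).
pose sh (v : {ffun 'I_N -> 'I_((k.+1 ^ 2).*2).+1}) := [ffun i => if i == l then ordS (v i) else v i].
have shI : injective sh.
  move=> v w /ffunP E; apply/ffunP => i; have := E i; rewrite !ffunE.
  by case: ifP => // _ /ordS_inj.
rewrite [RHS](reindex_inj shI); apply: eq_bigr => v _.
have k0 : k.+1%:R != 0 :> R by rewrite pnatr_eq0.
have [vl|vl] := ltnP (v l) ((k.+1 ^ 2).*2).
  congr (phi _); apply/rowP => i; rewrite !mxE ffunE eqxx/=; case: eqVneq => [->|_]; last first.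
    by rewrite mulr0 addr0.
  have -> : (ordS (v l))%:R = (v l)%:R + 1 :> R by rewrite natr1 /ordS/= modn_small.
  by rewrite mulr1; ring.
have El : (v l : nat) = ((k.+1 ^ 2).*2)%N by apply/eqP; rewrite eqn_leq vl -ltnS ltn_ord.
have kk : ((k.+1 ^ 2).*2%:R - (k.+1 ^ 2)%:R) / k.+1%:R = k.+1%:R :> R.
  by rewrite -natrB -?addnn ?leq_addr// addnK natrX expr2 mulfK.
rewrite !sp//.
  apply: lt_le_trans (mx_entry_le _ 0 l); rewrite mxE ffunE eqxx/= El modnn.
  rewrite sub0r mulNr normrN natrX expr2 mulfK// ger0_norm// ltr_nat; exact: leq_ltn_trans Lk _.
apply: lt_le_trans (mx_entry_le _ 0 l); rewrite !mxE !eqxx El kk mulr1 ger0_norm ?addr_ge0 ?invr_ge0//.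
by rewrite ltr_wpDr ?invr_ge0// ltr_nat ltnS.
Qed.

Lemma tay_supported phi D L t : tay phi D -> supported phi L -> L%:R < `|t| -> D t = 0.
Proof.
move=> h sp Lt; apply: (tay_near0 (d := (`|t| - L%:R) / 2) h); first by rewrite divr_gt0//; lra.
move=> v vd; apply: sp; have := lerB_dist t (- v); rewrite normrN opprK; lra.
Qed.

(** Summation by parts: the difference quotient of [phi] has sum zero by shift invariance and
    differs from the derivative by O(1/k), uniformly. *)
Lemma riemann_sum_derive phi D L l : tay phi D -> supported phi L ->
  (fun k => riemann_sum (fun t => D t 0 l) k) @ \oo --> (0 : R).
Proof.
move=> h sp; have [C C0 hC] := h L.+2%:R.
apply/cvgrPdist_le => e e0.
pose A := C * (L.+1.*2.+1)%:R ^+ N.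
have A0 : 0 <= A by rewrite mulr_ge0// exprn_ge0.
have [k0 hk0] : exists k0 : nat, A / e < k0%:R.
  by exists (Num.truncn (A / e)).+1; rewrite truncnS_gt.
near=> k.
have kL : (L <= k)%N by near: k; exact: nbhs_infty_ge.
have kk0 : (k0 <= k)%N by near: k; exact: nbhs_infty_ge.
have kp : 0 < k.+1%:R :> R by rewrite ltr0n.
pose E t := phi (t + k.+1%:R^-1 *: delta_mx 0 l) + (-1) * phi t + (- k.+1%:R^-1) * D t 0 l.
have SE : riemann_sum E k = - k.+1%:R^-1 * riemann_sum (fun t => D t 0 l) k.
  rewrite /E riemann_sumD riemann_sumD (riemann_sum_shift _ sp kL) !riemann_sumZ.
  by rewrite mulN1r subrr add0r.
have nv := @norm_scale_delta R N k.+1%:R^-1 l _; rewrite invr_ge0 ler0n in nv; have {}nv := nv isT.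
have k1 : k.+1%:R^-1 <= 1 :> R by rewrite invf_le1// ler1n.
(* The shifted function may be nonzero slightly beyond [L], whence the support bound [L.+1]. *)
have TE : test E L.+1 (C * k.+1%:R^-1 ^+ 2).
  have C2 : 0 <= C * k.+1%:R^-1 ^+ 2 :> R by rewrite mulr_ge0// sqr_ge0.
  have sE : supported E L.+1.
    move=> t Lt; have L1 : L%:R < `|t| by apply: lt_trans Lt; rewrite ltr_nat.
    rewrite /E (tay_supported h sp L1) mxE mulr0 addr0 (sp t)// mulr0 addr0 sp//.
    have := lerB_dist t (- (k.+1%:R^-1 *: delta_mx 0 l : 'rV[R]_N)); rewrite normrN opprK.
    have nv1 := le_trans nv k1; move: Lt; rewrite -[L.+1%:R]natr1 => Lt nn.
    by apply: lt_le_trans nn; rewrite ltrBrDr; apply: le_lt_trans Lt; rewrite lerD2l.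
  split=> // t; have [tL|tL] := leP `|t| L.+1%:R; last by rewrite sE// normr0.
  have [] := hC t (k.+1%:R^-1 *: delta_mx 0 l).
  - by rewrite (le_trans tL)// ler_nat.
  - by rewrite (le_trans nv)// (le_trans k1)// ler1n.
  move=> _ _; rewrite dotvZr dotv_delta.
  rewrite /E mulN1r mulNr => /le_trans; apply.
  by apply: ler_wpM2l => //; rewrite lerXn2r ?nnegrE ?invr_ge0.
have ki : 0 < k.+1%:R^-1 :> R by rewrite invr_gt0.
have := riemann_sum_bound k TE; rewrite SE normrM normrN (gtr0_norm ki) sub0r normrN.
have -> : C * k.+1%:R^-1 ^+ 2 * L.+1.*2.+1%:R ^+ N = k.+1%:R^-1 * (A / k.+1%:R) by rewrite /A; ring.
rewrite (ler_pM2l ki) => /le_trans; apply.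
rewrite ler_pdivrMr// -ler_pdivrMl// mulrC.
by rewrite (le_trans (ltW hk0))// ler_nat (leq_trans kk0).
Unshelve. all: by end_near.
Qed.

Lemma testD phi psi L C L' C' : test phi L C -> test psi L' C' ->
  test (fun t => phi t + psi t) (maxn L L') (C + C').
Proof.
move=> [s h] [s' h']; split=> t; last exact: le_trans (ler_normD _ _) (lerD _ _).
by move=> Lt; rewrite s ?s' ?addr0//; apply: le_lt_trans Lt; rewrite ler_nat (leq_maxl, leq_maxr).
Qed.

Lemma testZ c phi L C : test phi L C -> test (fun t => c * phi t) L (`|c| * C).
Proof.
by move=> [s h]; split=> t; [move=> /s ->; rewrite mulr0|rewrite normrM ler_wpM2l].
Qed.

Lemma test_sum (I : finType) (phi : I -> 'rV[R]_N -> R) L C : (forall i, test (phi i) L C) ->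
  test (fun t => \sum_i phi i t) L (#|I|%:R * C).
Proof.
move=> h; split=> [t Lt|t]; first by rewrite big1// => i _; exact: (h i).1.
rewrite (le_trans (ler_norm_sum _ _ _))// mulr_natl -sumr_const ler_sum// => i _; exact: (h i).2.
Qed.

Lemma tay_test phi D L : tay phi D -> supported phi L ->
  exists C, test phi L C /\ forall l, test (fun t => D t 0 l) L C.
Proof.
move=> h sp; have [C C0 hC] := h L%:R; exists C; split=> [|l]; split=> t.
- exact: sp.
- have [tL|tL] := leP `|t| L%:R; last by rewrite sp// normr0.
  by have [] := hC t 0 tL; rewrite ?normr0.
- by move=> Lt; rewrite (tay_supported h sp Lt) mxE.
- have [tL|tL] := leP `|t| L%:R; last by rewrite (tay_supported h sp tL) mxE normr0.
  have [|_ b _] := hC t 0 tL; rewrite ?normr0//.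
  by apply: le_trans b; exact: mx_entry_le.
Qed.

Section Linearity.
Variable I : ('rV[R]_N -> R) -> R.
Hypothesis hI : integral_like I.

Lemma int0 : I (fun=> 0) = 0.
Proof.
have t0 : test (fun=> 0 : R) 0 0 by split=> [//|t]; rewrite normr0.
by have := intZ hI 0 t0; under [X in I X]funext do rewrite mul0r; rewrite mul0r.
Qed.

Lemma int_sum (J : finType) (phi : J -> 'rV[R]_N -> R) L C : (forall i, test (phi i) L C) ->
  I (fun t => \sum_i phi i t) = \sum_i I (phi i).
Proof.
move=> h; suff H s : I (fun t => \sum_(i <- s) phi i t) = \sum_(i <- s) I (phi i) /\
    test (fun t => \sum_(i <- s) phi i t) L ((size s)%:R * C) by exact: (H _).1.
elim: s => [|i s [ih ts]].
  under [X in I X]funext do rewrite big_nil.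
  rewrite big_nil int0 mul0r; split=> //; split=> t; first by rewrite big_nil.
  by rewrite big_nil normr0.
have -> : (fun t => \sum_(j <- i :: s) phi j t) = (fun t => phi i t + \sum_(j <- s) phi j t).
  by apply/funext => t; rewrite big_cons.
rewrite big_cons (intD hI (h i) ts) ih; split=> //.
have := testD (h i) ts; rewrite maxnn.
have -> : (size (i :: s))%:R * C = C + (size s)%:R * C by rewrite /= -natr1 mulrDl mul1r addrC.
done.
Qed.

End Linearity.

End GridIntegral.

Lemma ultra_bounded_cvg (R : realType) (U : set_system nat) (u : nat -> R) C :
  UltraFilter U -> (forall k, `|u k| <= C) -> exists l : R, u @ U --> l.
Proof.
move=> UU hC; have PU : ProperFilter U by exact: ultra_proper.
have cpt := @segment_compact R (- C) C.
have FA : U (u @^-1` [set` `[- C, C]]).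
  by apply: filterE => k; rewrite /= in_itv/= -ler_norml.
have [l [_ cl]] := cpt (u @ U) _ FA.
exists l => A lA; have [//|UA] := in_ultra_setVsetC (u @^-1` A) UU.
have [x [nx Ax]] := cl (~` A) A UA lA; by case: nx.
Qed.

(* The limit along an ultrafilter of Riemann sums on finer and finer grids. *)
Lemma integral_like_exists (R : realType) N : exists I, @integral_like R N I.
Proof.
have [U [UU Uoo]] := ultraFilterLemma (F := \oo) _.
have PU : ProperFilter U by exact: ultra_proper.
have cv (phi : 'rV[R]_N -> R) L C : test phi L C -> riemann_sum phi @ U --> lim (riemann_sum phi @ U).
  move=> h; have [l hl] := ultra_bounded_cvg UU (fun k => riemann_sum_bound k h).
  by rewrite (cvg_lim _ hl).
exists (fun phi => lim (riemann_sum phi @ U)); split.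
- move=> phi psi L C L' C' h h'; apply: cvg_lim => //.
  have -> : riemann_sum (fun t => phi t + psi t) = riemann_sum phi \+ riemann_sum psi.
    by apply/funext => k; exact: riemann_sumD.
  exact: cvgD (cv _ _ _ h) (cv _ _ _ h').
- move=> c phi L C h; apply: cvg_lim => //.
  have -> : riemann_sum (fun t => c * phi t) = (fun k => c * riemann_sum phi k).
    by apply/funext => k; exact: riemann_sumZ.
  exact: cvgMr (cv _ _ _ h).
- move=> phi L C h; rewrite ler_norml; apply/andP; split.
    apply: (limr_ge (cv _ _ _ h)); apply: filterE => k.
    by have := riemann_sum_bound k h; rewrite ler_norml => /andP[].
  apply: (limr_le (cv _ _ _ h)); apply: filterE => k.
  by have := riemann_sum_bound k h; rewrite ler_norml => /andP[].
- move=> phi L C c q h p0 c0 hc.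
  apply: (@lt_le_trans _ _ (c * q.+1%:R^-1 ^+ N)); first by rewrite mulr_gt0// exprn_gt0// invr_gt0.
  apply: (limr_ge (cv _ _ _ h)); apply: filterE => k.
  apply: (@le_trans _ _ (riemann_sum (fun t : 'rV[R]_N => c * box q.+1%:R^-1 t) k)).
    by rewrite riemann_sumZ ler_pM2l// riemann_sum_box_ge.
  apply: ler_riemann_sum => t; rewrite /box; case: (leP `|t| q.+1%:R^-1) => ht /=; first by rewrite mulr1 hc.
  by rewrite mulr0.
- move=> phi D L h sp l; apply: cvg_lim => //.
  by apply: cvg_trans (riemann_sum_derive l h sp); apply: cvg_app.
Qed.

(** * Divergence-free minors and the homotopy formula *)

Section Piola.
Context {R : realType} {N : nat}.

(** Symmetry of the second derivatives is part of the notion, ready for use in [piola]; the closure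
    lemmas propagate it directly. *)
Definition smooth k (F : 'rV[R]_k -> R) (D : 'rV[R]_k -> 'rV[R]_k) : Prop :=
  tay F D /\ exists E : 'I_k -> 'rV[R]_k -> 'rV[R]_k,
    (forall j, tay (fun x => D x 0 j) (E j)) /\ forall j l x, E j x 0 l = E l x 0 j.

Definition minor_mx (B : 'M[R]_(N, 1 + N)) (k : 'I_(1 + N)) : 'M[R]_(1 + N) :=
  col_mx (delta_mx 0 k) B.

Lemma det_setrow_delta p (i : 'I_p) (v : 'rV[R]_p) A :
  \det (setrow i v A) = \sum_j v 0 j * \det (setrow i (delta_mx 0 j) A).
Proof.
rewrite det_setrow; apply: eq_bigr => j _; congr (_ * _).
rewrite det_setrow (bigD1 j)//= big1 ?addr0 => [|l /negbTE lj].
  by rewrite mxE !eqxx mul1r.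
by rewrite mxE lj andbF mul0r.
Qed.

Lemma setrow_col_mx (v w : 'rV[R]_(1 + N)) (B : 'M[R]_(N, 1 + N)) :
  setrow (lshift N ord0) v (col_mx w B) = col_mx v B.
Proof.
apply/matrixP => i j; rewrite mxE; have [k ->|k ->] := split_ordP i.
  by rewrite (ord1 k) eqxx col_mxEu.
by rewrite eq_rlshift !col_mxEd.
Qed.

Lemma minor_orthogonal (B : 'M[R]_(N, 1 + N)) b :
  \sum_k B b k * \det (minor_mx B k) = 0.
Proof.
have -> : \sum_k B b k * \det (minor_mx B k) = \det (col_mx (row b B) B).
  rewrite -(setrow_col_mx _ 0) det_setrow_delta; apply: eq_bigr => k _.
  by rewrite setrow_col_mx mxE.
apply: (determinant_alternate (i1 := lshift N ord0) (i2 := rshift 1 b)).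
  by rewrite eq_lrshift.
by move=> j; rewrite col_mxEu col_mxEd mxE.
Qed.

Lemma minor_swap (B : 'M[R]_(N, 1 + N)) b j k :
  \det (setrow (rshift 1 b) (delta_mx 0 j) (minor_mx B k)) =
  - \det (setrow (rshift 1 b) (delta_mx 0 k) (minor_mx B j)).
Proof.
set M1 := setrow _ _ (minor_mx B k); set M2 := setrow _ _ (minor_mx B j).
have -> : M1 = row_perm (tperm (lshift N ord0) (rshift 1 b)) M2.
  apply/matrixP => i l; rewrite [RHS]mxE [LHS]mxE [in RHS]mxE.
  have [p ->|p ->] := split_ordP i.
    by rewrite (ord1 p) tpermL eqxx eq_lrshift col_mxEu.
  have [->|pb] := eqVneq p b; first by rewrite tpermR eqxx eq_lrshift col_mxEu.
  rewrite tpermD ?eq_rshift ?eq_lrshift//; last by rewrite eq_sym.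
  by rewrite (negbTE pb) /minor_mx !col_mxEd.
by rewrite row_permE det_mulmx det_perm odd_tperm eq_lrshift expr1 mulN1r.
Qed.

Variables (H : 'I_N -> 'rV[R]_(1 + N) -> R) (K : 'I_N -> 'rV[R]_(1 + N) -> 'rV[R]_(1 + N)).
Hypothesis hH : forall b, smooth (H b) (K b).

Definition minor k (x : 'rV[R]_(1 + N)) : R :=
  \det (minor_mx (\matrix_(b, j) K b x 0 j) k).

(* Closedness of the pullback of a volume form. *)
Lemma piola : exists DZ : 'I_(1 + N) -> 'rV[R]_(1 + N) -> 'rV[R]_(1 + N),
  (forall k, tay (minor k) (DZ k)) /\ forall x, \sum_k DZ k x 0 k = 0.
Proof.
have [E hE] := choice (fun b => proj2 (hH b)).
pose DM (i j : 'I_(1 + N)) x : 'rV[R]_(1 + N) := match fintype.split i with inl _ => 0 | inr b => E b j x end.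
have tM k i j : tay (fun x => minor_mx (\matrix_(b, j) K b x 0 j) k i j) (DM i j).
  rewrite /DM; have [p ->|p ->] := split_ordP i.
    by apply: tay_ext (tay_cst (delta_mx 0 k p j)) => x//; rewrite /minor_mx col_mxEu.
  by apply: tay_ext ((hE p).1 j) => x//; rewrite /minor_mx col_mxEd mxE.
exists (fun k x => \row_l \sum_i \det (setrow i (\row_j DM i j x 0 l)
   (minor_mx (\matrix_(b, j) K b x 0 j) k))); split=> [k|x]; first exact: tay_det (tM k).
under eq_bigr do rewrite mxE big_split_ord/= big_ord1.
rewrite big_split/= big1 ?add0r => [|k _].
  rewrite exchange_big/= big1// => b _; set B := \matrix_(_, _) _.
  under eq_bigr do rewrite det_setrow_delta.
  (* The determinants are antisymmetric in [j] and [k] by [minor_swap] while the Hessian is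
     symmetric, so the double sum is its own negative. *)
  set S := \sum_k _; suff : S + S = 0 by move/eqP; rewrite -mulr2n mulrn_eq0 => /eqP.
  rewrite {1}/S exchange_big -big_split/= big1// => k _; rewrite -big_split big1// => j _.
  rewrite /= !mxE /DM -[rshift 1 b]/(unsplit (inr b)) unsplitK /= (minor_swap B b k j).
  by rewrite ((hE b).2 k j x) mulrN addNr.
rewrite det_setrow big1// => j _; rewrite mxE /DM -[lshift N ord0]/(unsplit (inl ord0)) unsplitK.
by rewrite mxE mul0r.
Qed.

Variables (f f' : R -> R) (X : 'rV[R]_(1 + N) -> R) (DX : 'rV[R]_(1 + N) -> 'rV[R]_(1 + N)).
Hypotheses (hf : tay1 f f') (hX : tay X DX).

Definition flux k x : R := X x * (f (\sum_b H b x ^+ 2) * minor k x).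

(** The gradient of [f] of the squared norm is a combination of rows of the Jacobian, which
    [minor_orthogonal] kills, and the minors are divergence free; only the derivative of the cutoff
    [X] is left. *)
Lemma flux_divergence : exists DF : 'I_(1 + N) -> 'rV[R]_(1 + N) -> 'rV[R]_(1 + N),
  (forall k, tay (flux k) (DF k)) /\
  forall x, \sum_k DF k x 0 k = f (\sum_b H b x ^+ 2) * \sum_k DX x 0 k * minor k x.
Proof.
have [DZ [tZ Z0]] := piola.
have tq : tay (fun x => \sum_b H b x ^+ 2) (fun x => \sum_b (H b x *: K b x + H b x *: K b x)).
  by apply: tay_sum => b; have h := (hH b).1; apply: tay_ext (tayM h h) => // x; rewrite expr2.
have tF k := tayM hX (tayM (tay_comp hf tq) (tZ k)).
exists (fun k x => X x *: (f (\sum_b H b x ^+ 2) *: DZ k x +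
   minor k x *: (f' (\sum_b H b x ^+ 2) *: \sum_b (H b x *: K b x + H b x *: K b x))) +
   (f (\sum_b H b x ^+ 2) * minor k x) *: DX x); split=> // x.
set q := \sum_b H b x ^+ 2; set S := \sum_b (_ + _).
have E k : (X x *: (f q *: DZ k x + minor k x *: (f' q *: S)) + (f q * minor k x) *: DX x) 0 k =
  (X x * f q) * DZ k x 0 k + (X x * f' q) * (S 0 k * minor k x) + f q * (DX x 0 k * minor k x).
  by rewrite mxE mxE mxE mxE mxE mxE mxE; ring.
under eq_bigr do rewrite E.
rewrite !big_split/= -!mulr_sumr Z0 mulr0 add0r.
have -> : \sum_k S 0 k * minor k x = 0.
  have Sk k : S 0 k * minor k x = \sum_b (2 * H b x) * (K b x 0 k * minor k x).
    rewrite /S summxE mulr_suml; apply: eq_bigr => b _; rewrite mxE mxE; ring.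
  under eq_bigr do rewrite Sk.
  rewrite exchange_big/= big1// => b _; rewrite -mulr_sumr.
  set B : 'M[R]_(N, 1 + N) := \matrix_(b, j) K b x 0 j.
  rewrite (eq_bigr (fun k => B b k * \det (minor_mx B k))) => [|k _]; last by rewrite mxE.
  by rewrite minor_orthogonal mulr0.
by rewrite mulr0 add0r.
Qed.

End Piola.

(** Over a subdivision of [0, 1] into equal parts the quadratic errors sum to a quantity inversely
    proportional to the number of parts. *)
Lemma increment_bound (R : realType) (f : R -> R) d C :
  (forall s h, 0 <= s -> 0 <= h -> s + h <= 1 -> `|f (s + h) - f s| <= d * h + C * h ^+ 2) ->
  `|f 1 - f 0| <= d.
Proof.
move=> hf; apply/ler_addgt0Pr => e e0.
have [k hk] : exists k : nat, `|C| / e < k.+1%:R.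
  by exists (Num.truncn (`|C| / e)); rewrite truncnS_gt.
have kp : 0 < k.+1%:R :> R by rewrite ltr0n.
pose t i : R := i%:R / k.+1%:R.
have B i : (i <= k.+1)%N -> `|f (t i) - f 0| <= i%:R * (d * k.+1%:R^-1 + C * k.+1%:R^-1 ^+ 2).
  elim: i => [_|i ih ik]; first by rewrite /t mul0r subrr normr0 mul0r.
  have tS : t i.+1 = t i + k.+1%:R^-1 by rewrite /t -natr1 mulrDl mul1r.
  have h : `|f (t i.+1) - f (t i)| <= d * k.+1%:R^-1 + C * k.+1%:R^-1 ^+ 2.
    by rewrite tS; apply: hf; rewrite ?invr_ge0 ?mulr_ge0 ?invr_ge0// -tS ler_pdivrMr// mul1r ler_nat.
  rewrite -natr1 mulrDl mul1r; apply: le_trans (lerD (ih (ltnW ik)) h).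
  by rewrite -(subrKA (f (t i))) addrC ler_normD.
have := B k.+1 (leqnn _); rewrite /t divff ?gt_eqF// => /le_trans; apply.
rewrite mulrDr mulrCA divff ?gt_eqF// mulr1 lerD2l.
have -> : k.+1%:R * (C * k.+1%:R^-1 ^+ 2) = C / k.+1%:R by field; rewrite gt_eqF.
rewrite ler_pdivrMr// (le_trans (ler_norm _))//.
by rewrite mulrC -ler_pdivrMr// ltW.
Qed.

Section Homotopy.
Context {R : realType} {N : nat}.
Variable I : ('rV[R]_N -> R) -> R.
Hypothesis hI : integral_like I.

Definition at_time (s : R) (t : 'rV[R]_N) : 'rV[R]_(1 + N) := row_mx (const_mx s) t.

Lemma at_time_norm s t r : `|s| <= r -> `|t| <= r -> `|at_time s t| <= r.
Proof.
move=> sr tr; have r0 := le_trans (normr_ge0 _) sr; apply: mx_norm_le => // i j.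
rewrite (ord1 i) /at_time; have [p ->|p ->] := split_ordP j; first by rewrite row_mxEl mxE.
by rewrite row_mxEr (le_trans (mx_entry_le _ _ _)).
Qed.

Lemma at_timeD s s' t t' : at_time s t + at_time s' t' = at_time (s + s') (t + t').
Proof. by rewrite /at_time add_row_mx; congr row_mx; apply/matrixP => i j; rewrite !mxE. Qed.

Lemma dotv_at_time (u : 'rV[R]_(1 + N)) s t :
  dotv u (at_time s t) = u 0 (lshift N ord0) * s + dotv (rsubmx u) t.
Proof.
rewrite /dotv big_split_ord/= big_ord1 /at_time row_mxEl mxE; congr (_ + _).
by apply: eq_bigr => i _; rewrite row_mxEr mxE.
Qed.

Lemma tay_at_time F D s : tay F D ->
  tay (fun t => F (at_time s t)) (fun t => rsubmx (D (at_time s t))).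
Proof.
move=> h r; have [C C0 hC] := h (Num.max `|s| r); exists C => // t v tr vr.
have [] := hC (at_time s t) (at_time 0 v).
- by apply: at_time_norm; rewrite le_max ?lexx ?tr ?orbT.
- by apply: at_time_norm; rewrite le_max ?normr0 ?normr_ge0 ?vr ?orbT.
rewrite at_timeD addr0 dotv_at_time mulr0 add0r => a b c.
have n0 : `|at_time 0 v| <= `|v| by apply: at_time_norm; rewrite ?normr0.
split=> //.
  apply: le_trans b; apply: mx_norm_le => // i j; rewrite mxE; exact: mx_entry_le.
apply: le_trans c _; apply: ler_wpM2l => //; rewrite lerXn2r ?nnegrE//.
Qed.

(** The spatial derivatives integrate to zero by [int_derive], so the integral of the time component
    changes at the rate of the integral of the full divergence. *)
Lemma homotopy_bound (F : 'I_(1 + N) -> 'rV[R]_(1 + N) -> R) DF L eta :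
  (forall k, tay (F k) (DF k)) ->
  (forall k s t, L%:R < `|t| -> F k (at_time s t) = 0) ->
  (forall s t, 0 <= s <= 1 -> `|\sum_k DF k (at_time s t) 0 k| <= eta) ->
  `|I (fun t => F (lshift N ord0) (at_time 1 t)) - I (fun t => F (lshift N ord0) (at_time 0 t))|
    <= eta * (L.*2.+1)%:R ^+ N.
Proof.
move=> tF sF hdiv; set o := lshift N ord0; set B := _ ^+ N.
have sup k s : supported (fun t => F k (at_time s t)) L by move=> t; exact: sF.
have D0 k s t : L%:R < `|t| -> DF k (at_time s t) = 0.
  move=> Lt; apply: (tay_near0 (d := (`|t| - L%:R) / 2) (tF k)); first by rewrite divr_gt0//; lra.
  move=> v vd; rewrite -[v]hsubmxK.
  have -> : lsubmx v = const_mx (v 0 o) by apply/rowP => i; rewrite !mxE (ord1 i).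
  rewrite -/(at_time _ _) at_timeD; apply: sF.
  have rv : `|rsubmx v| <= `|v|.
    by apply: mx_norm_le => // i j; rewrite mxE; exact: mx_entry_le.
  have := lerB_dist t (- rsubmx v); rewrite normrN opprK; lra.
have [C C0 hC] := tF o (L%:R + 1).
apply: (increment_bound (f := fun s => I (fun t => F o (at_time s t))) (C := C * B)) => s h s0 h0 sh.
have s01 : 0 <= s <= 1 by lra.
have tG : test (fun t => \sum_k DF k (at_time s t) 0 k) L eta.
  split=> t; last exact: hdiv.
  by move=> Lt; rewrite big1// => k _; rewrite D0// mxE.
have [Cs hCs] := choice (fun l : 'I_N => tay_test (tay_at_time s (tF (rshift 1 l))) (sup _ _)).
pose c := \sum_l Cs l.
have tD l : test (fun t => DF (rshift 1 l) (at_time s t) 0 (rshift 1 l)) L c.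
  have [_ /(_ l)[a b]] := hCs l; split=> t; first by move=> /a; rewrite mxE.
  have := b t; rewrite mxE => /le_trans; apply; rewrite /c (bigD1 l)//= lerDl sumr_ge0// => i _.
  by have [_ /(_ l)[_ /(_ 0)]] := hCs i; apply: le_trans.
have [C1 [tA1 _]] := tay_test (tay_at_time (s + h) (tF o)) (sup _ _).
have [C2 [tA2 _]] := tay_test (tay_at_time s (tF o)) (sup _ _).
pose E t := F o (at_time (s + h) t) + ((-1) * F o (at_time s t) +
  (- h * (\sum_k DF k (at_time s t) 0 k) + h * (\sum_l DF (rshift 1 l) (at_time s t) 0 (rshift 1 l)))).
have IE : I E = I (fun t => F o (at_time (s + h) t)) - I (fun t => F o (at_time s t)) -
   h * I (fun t => \sum_k DF k (at_time s t) 0 k).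
  have t3 := testZ (- h) tG; have t4 := testZ h (test_sum tD).
  have t2 := testZ (-1) tA2.
  rewrite /E (intD hI tA1 (testD t2 (testD t3 t4))) (intD hI t2 (testD t3 t4)) (intD hI t3 t4).
  rewrite (intZ hI _ tA2) (intZ hI _ tG) (intZ hI _ (test_sum tD)) (int_sum hI tD).
  rewrite (big1 _ xpredT) => [|l _]; first by ring.
  have := int_derive hI (tay_at_time s (tF (rshift 1 l))) (sup _ _) l.
  by under [X in I X]funext do rewrite mxE.
have TE : test E L (C * h ^+ 2).
  have Ch : 0 <= C * h ^+ 2 by rewrite mulr_ge0// sqr_ge0.
  have sE : supported E L.
    move=> t Lt; rewrite /E !sF// !big1 ?mulr0 ?addr0// => l _; by rewrite D0// mxE.
  split=> // t; have [tL|tL] := leP `|t| L%:R; last by rewrite sE// normr0.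
  have L0 : 0 <= L%:R :> R by [].
  have [] := hC (at_time s t) (at_time h 0).
  - by apply: at_time_norm; rewrite ?ger0_norm//; lra.
  - by apply: at_time_norm; rewrite ?normr0 ?ger0_norm//; lra.
  move=> _ _; rewrite at_timeD addr0 dotv_at_time.
  have -> : dotv (rsubmx (DF o (at_time s t))) 0 = 0.
    by rewrite /dotv big1// => i _; rewrite [X in _ * X]mxE mulr0.
  have nh : `|at_time h 0| <= h by apply: at_time_norm; rewrite ?normr0// ger0_norm.
  rewrite addr0 => H; rewrite /E big_split_ord/= big_ord1 -/o.
  set a := F o _ in H *; set b := F o _ in H *; set d := DF o _ 0 o in H *; set S := \sum_(i < N) _.
  have -> : a + (-1 * b + (- h * (d + S) + h * S)) = a - b - d * h by ring.
  apply: le_trans H _; apply: (ler_wpM2l C0); rewrite lerXn2r ?nnegrE//.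
have b1 := int_bound hI TE; have b2 := int_bound hI tG; rewrite IE -/B in b1 b2.
set y := I (fun t => \sum_k _) in b1 b2; set x : R := (X in `|X| <= _ + _); rewrite -/x in b1.
rewrite -(subrK (h * y) x) (le_trans (ler_normD _ _))// addrC lerD//.
  by rewrite normrM ger0_norm// mulrC ler_wpM2r.
by rewrite mulrAC.
Qed.

End Homotopy.

Section ScalarProfiles.
Context {R : realType}.

Lemma tay1_tay (f f' : R -> R) :
  tay (fun x : 'rV[R]_1 => f (x 0 0)) (fun x => const_mx (f' (x 0 0))) -> tay1 f f'.
Proof.
move=> h r; have [C C0 hC] := h r; exists C => // x v xr vr.
have n1 (y : R) : `|const_mx y : 'rV[R]_1| <= `|y|.
  by apply: mx_norm_le => // i j; rewrite mxE.
have [] := hC _ _ (le_trans (n1 x) xr) (le_trans (n1 v) vr).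
move=> a b c; move: a b c; rewrite [const_mx x 0 0]mxE => a b c; split=> //.
  by apply: le_trans b; have := mx_entry_le (const_mx (f' x) : 'rV[R]_1) 0 0; rewrite mxE.
move: c; rewrite /dotv big_ord1 !mxE => c.
by apply: le_trans c _; rewrite ler_wpM2l// lerXn2r ?nnegrE.
Qed.

Lemma tay_tay1 (f f' : R -> R) : tay1 f f' ->
  tay (fun x : 'rV[R]_1 => f (x 0 0)) (fun x => const_mx (f' (x 0 0))).
Proof.
move=> h; apply: tay_ext (tay_comp h (tay_dotv (const_mx 1))) => x.
  by rewrite /dotv big_ord1 mxE mul1r.
by apply/rowP => i; rewrite /dotv big_ord1 !mxE mul1r mulr1.
Qed.

Lemma tay1_comp (f f' g g' : R -> R) : tay1 f f' -> tay1 g g' ->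
  tay1 (fun x => f (g x)) (fun x => f' (g x) * g' x).
Proof.
move=> hf hg; apply: tay1_tay; apply: tay_ext (tay_comp hf (tay_tay1 hg)) => x //.
by apply/rowP => i; rewrite !mxE.
Qed.

Lemma tay1_affine a b : tay1 (fun u => a + b * u) (fun=> b : R).
Proof.
apply: tay1_tay; apply: tay_ext (tayD (tay_cst a) (tay_dotv (const_mx b))) => x.
  by rewrite /dotv big_ord1 mxE.
by rewrite add0r.
Qed.

(** Applied to a squared distance, it concentrates at the zeros of that distance as [c] grows. *)
Definition rho (c u : R) : R := sqp (1 + - c * u).

Lemma tay1_rho c : exists f', tay1 (rho c) f'.
Proof. by eexists; apply: tay1_comp tay1_sqp (tay1_affine 1 (- c)). Qed.

Lemma rho_ge0 c u : 0 <= rho c u. Proof. exact: sqp_ge0. Qed.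

Lemma rho_eq0 c u : 1 <= c * u -> rho c u = 0.
Proof. by move=> h; rewrite /rho sqp_eq0// mulNr; lra. Qed.

Lemma rho_le1 c u : 0 <= c * u -> rho c u <= 1.
Proof.
move=> h; rewrite /rho /sqp expr_le1// ?le_max ?lexx// ge_max ler01/= mulNr; lra.
Qed.

Lemma rho_ge c u : c * u <= 2^-1 -> 4^-1 <= rho c u.
Proof. by move=> h; rewrite /rho /sqp mulNr max_r; nra. Qed.

Definition kap (u : R) : R := sqp (1 + - 1 * sqp (-1 + 1 * u)).
Definition dkap (u : R) : R :=
  2 * Num.max 0 (1 + - 1 * sqp (-1 + 1 * u)) * (- 1 * (2 * Num.max 0 (-1 + 1 * u) * 1)).

Lemma tay1_kap : tay1 kap dkap.
Proof.
exact: (tay1_comp tay1_sqp (tay1_comp (tay1_affine 1 (-1)) (tay1_comp tay1_sqp (tay1_affine (-1) 1)))).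
Qed.

Lemma kap1 u : u <= 1 -> kap u = 1.
Proof. by move=> h; rewrite /kap (sqp_eq0 (u := -1 + 1 * u)) ?mulr0 ?addr0 /sqp ?max_r ?expr1n//; lra. Qed.

Lemma kap0 u : 2 <= u -> kap u = 0.
Proof.
move=> h; rewrite /kap sqp_eq0// /sqp (@max_r _ _ 0 (-1 + 1 * u)); first nra.
lra.
Qed.

Lemma dkap0 u : (u <= 1) || (2 <= u) -> dkap u = 0.
Proof.
case/orP => h; rewrite /dkap; first by rewrite (@max_l _ _ 0 (-1 + 1 * u)); lra.
rewrite (@max_l _ _ 0 (1 + _)); first lra.
by rewrite /sqp (@max_r _ _ 0 (-1 + 1 * u)); [nra|lra].
Qed.

Lemma dkap_bound u : `|dkap u| <= 4.
Proof.
have [h|h] := leP u 1; first by rewrite dkap0 ?h// normr0.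
have [h2|h2] := leP 2 u; first by rewrite dkap0 ?h2 ?orbT// normr0.
rewrite /dkap /sqp (@max_r _ _ 0 (-1 + 1 * u)); last lra.
rewrite (@max_r _ _ 0 (1 + _)); last nra.
set v := -1 + 1 * u; have v0 : 0 <= v by rewrite /v; lra.
have v1 : v <= 1 by rewrite /v; lra.
have v2 : v ^+ 2 <= 1 by rewrite expr_le1.
have v3 := sqr_ge0 v.
have : 0 <= v * (1 - v ^+ 2) <= 1 by apply/andP; split; nra.
by rewrite ler_norml => /andP[h3 h4]; apply/andP; split; nra.
Qed.

End ScalarProfiles.

Section SmoothClosure.
Context {R : realType} {k : nat}.
Implicit Types (F : 'rV[R]_k -> R) (D : 'rV[R]_k -> 'rV[R]_k).

Lemma smooth_ext F F' D D' : F =1 F' -> D =1 D' -> smooth F D -> smooth F' D'.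
Proof. by move=> /funext -> /funext ->. Qed.

Lemma smooth_dotv (u : 'rV[R]_k) : smooth (dotv u) (fun=> u).
Proof. by split; [exact: tay_dotv|exists (fun _ _ => 0); split=> [j|j l x]; [exact: (tay_cst (u 0 j))|rewrite !mxE]]. Qed.

Lemma smooth_cst (c : R) : smooth (fun=> c) (fun=> 0 : 'rV[R]_k).
Proof. by split; [exact: tay_cst|exists (fun _ _ => 0); split=> [j|j l x]; [exact: (tay_cst ((0 : 'rV[R]_k) 0 j))|rewrite !mxE]]. Qed.

Lemma smoothD F D F' D' : smooth F D -> smooth F' D' ->
  smooth (fun x => F x + F' x) (fun x => D x + D' x).
Proof.
move=> [t [E [tE sE]]] [t' [E' [tE' sE']]]; split; first exact: tayD.
exists (fun j x => E j x + E' j x); split=> [j|j l x]; last by rewrite !mxE sE sE'.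
by apply: tay_ext (tayD (tE j) (tE' j)) => x//; rewrite mxE.
Qed.

Lemma smoothM F D F' D' : smooth F D -> smooth F' D' ->
  smooth (fun x => F x * F' x) (fun x => F x *: D' x + F' x *: D x).
Proof.
move=> [t [E [tE sE]]] [t' [E' [tE' sE']]]; split; first exact: tayM.
exists (fun j x => (F x *: E' j x + D' x 0 j *: D x) + (F' x *: E j x + D x 0 j *: D' x)).
split=> [j|j l x]; last by rewrite !mxE sE sE'; ring.
by apply: tay_ext (tayD (tayM t (tE' j)) (tayM t' (tE j))) => x//; rewrite !mxE.
Qed.

Lemma smoothZ c F D : smooth F D -> smooth (fun x => c * F x) (fun x => c *: D x).
Proof.
move=> h; apply: smooth_ext (smoothM (smooth_cst c) h) => x//.
by rewrite scaler0 addr0.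
Qed.

Lemma smooth_sum (I : finType) (F : I -> 'rV[R]_k -> R) (D : I -> 'rV[R]_k -> 'rV[R]_k) :
  (forall i, smooth (F i) (D i)) -> smooth (fun x => \sum_i F i x) (fun x => \sum_i D i x).
Proof.
move=> h; suff H s : smooth (fun x => \sum_(i <- s) F i x) (fun x => \sum_(i <- s) D i x) by exact: H.
elim: s => [|i s ih].
  by apply: smooth_ext (smooth_cst 0) => x; rewrite big_nil.
by apply: smooth_ext (smoothD (h i) ih) => x; rewrite big_cons.
Qed.

Lemma smooth_expR_dotv (u : 'rV[R]_k) :
  smooth (fun x => expR (dotv u x)) (fun x => expR (dotv u x) *: u).
Proof.
have t := tay_comp tay1_expR (tay_dotv u); split=> //.
exists (fun j x => u 0 j *: (expR (dotv u x) *: u)); split=> [j|j l x].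
  by apply: tay_ext (tayZ (u 0 j) t) => x //; rewrite mxE mulrC.
by rewrite !mxE; ring.
Qed.

Lemma smooth_tay_hess F D : smooth F D -> forall j, exists E, tay (fun x => D x 0 j) E.
Proof. by move=> [_ [E [tE _]]] j; exists (E j). Qed.

End SmoothClosure.

Section Lift.
Context {R : realType} {N : nat}.
Implicit Types (F : 'rV[R]_N -> R) (D : 'rV[R]_N -> 'rV[R]_N).

Lemma norm_rsubmx (x : 'rV[R]_(1 + N)) : `|rsubmx x| <= `|x|.
Proof. by apply: mx_norm_le => // i j; rewrite mxE; exact: mx_entry_le. Qed.

Lemma tay_lift F D : tay F D ->
  tay (fun x : 'rV[R]_(1 + N) => F (rsubmx x)) (fun x => row_mx 0 (D (rsubmx x))).
Proof.
move=> h r; have [C C0 hC] := h r; exists C => // x v xr vr.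
have [] := hC (rsubmx x) (rsubmx v); rewrite ?(le_trans (norm_rsubmx _))// => a b c; split=> //.
  apply: mx_norm_le => // i j; have [p ->|p ->] := split_ordP j; first by rewrite row_mxEl mxE normr0.
  by rewrite row_mxEr (le_trans (mx_entry_le _ _ _)).
rewrite linearD; set e := (X in `|X|); set e' := (X in `|X| <= _) in c.
have -> : e = e'.
  rewrite /e /e'; congr (_ - _); rewrite /dotv big_split_ord/= big_ord1 row_mxEl mxE mul0r add0r.
  by apply: eq_bigr => i _; rewrite row_mxEr mxE.
by apply: le_trans c _; rewrite ler_wpM2l// lerXn2r ?nnegrE// norm_rsubmx.
Qed.

Lemma smooth_lift F D : smooth F D ->
  smooth (fun x : 'rV[R]_(1 + N) => F (rsubmx x)) (fun x => row_mx 0 (D (rsubmx x))).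
Proof.
move=> [t [E [tE sE]]]; split; first exact: tay_lift.
exists (fun j x => match fintype.split j with inl _ => 0 | inr l => row_mx 0 (E l (rsubmx x)) end).
split=> [j|j l x]; [have [p ->|p ->] := split_ordP j|have [p ->|p ->] := split_ordP j; have [q ->|q ->] := split_ordP l].
- by apply: tay_ext (tay_cst 0) => x//; rewrite row_mxEl mxE.
- by apply: tay_ext (tay_lift (tE p)) => x//; rewrite row_mxEr.
- by rewrite !mxE.
- by rewrite row_mxEl !mxE.
- by rewrite row_mxEl !mxE.
- by rewrite !row_mxEr sE.
Qed.

Lemma smooth_interpolate F D F' D' : smooth F D -> smooth F' D' ->
  smooth (fun x : 'rV[R]_(1 + N) => F (rsubmx x) + x 0 (lshift N ord0) * (F' (rsubmx x) - F (rsubmx x)))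
    (fun x => row_mx (const_mx (F' (rsubmx x) - F (rsubmx x)))
       (D (rsubmx x) + x 0 (lshift N ord0) *: (D' (rsubmx x) - D (rsubmx x)))).
Proof.
move=> h h'; have l := smooth_lift h; have l' := smooth_lift h'.
have := smoothD l (smoothM (smooth_dotv (delta_mx 0 (lshift N ord0))) (smoothD l' (smoothZ (-1) l))).
have E (x : 'rV[R]_(1 + N)) : dotv (delta_mx 0 (lshift N ord0)) x = x 0 (lshift N ord0).
  rewrite /dotv (bigD1 (lshift N ord0))//= mxE !eqxx mul1r big1 ?addr0// => i /negbTE il.
  by rewrite mxE il andbF mul0r.
apply: smooth_ext => x; rewrite E mulN1r//.
have -> : delta_mx 0 (lshift N ord0) = row_mx (const_mx 1) 0 :> 'rV[R]_(1 + N).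
  apply/rowP => j; have [p ->|p ->] := split_ordP j.
    by rewrite row_mxEl (ord1 p) !mxE !eqxx.
  by rewrite row_mxEr !mxE eq_rlshift andbF.
rewrite !scale_row_mx !add_row_mx !scale_row_mx !add_row_mx !scaler0 !addr0 add0r scaleN1r.
by congr row_mx; apply/rowP => j; rewrite !mxE mulr0 add0r mulr1.
Qed.

End Lift.

Section Family.
Context {R : realType} {N : nat}.
Variable I : ('rV[R]_N -> R) -> R.
Hypothesis hI : integral_like I.

Definition det_grad (D : 'I_N -> 'rV[R]_N -> 'rV[R]_N) t : R := \det (\matrix_(b, l) D b t 0 l).

Lemma minor_mx0 (B : 'M[R]_(N, 1 + N)) : \det (minor_mx B (lshift N ord0)) = \det (rsubmx B).
Proof.
rewrite /minor_mx; have -> : col_mx (delta_mx 0 (lshift N ord0)) B =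
    block_mx 1%:M 0 (lsubmx B) (rsubmx B) :> 'M[R]_(1 + N).
  rewrite -[B in LHS]hsubmxK -[delta_mx _ _ in LHS]hsubmxK block_mxEh -!block_mxEh; congr block_mx.
    by apply/matrixP => i j; rewrite !mxE (ord1 i) (ord1 j) !eqxx.
  by apply/matrixP => i j; rewrite !mxE eq_rlshift andbF.
by rewrite det_lblock det1 mul1r.
Qed.

Definition path_mx (F F' : 'I_N -> 'rV[R]_N -> R) (D D' : 'I_N -> 'rV[R]_N -> 'rV[R]_N) s t : 'M[R]_(N, 1 + N) :=
  \matrix_(b, j) row_mx (const_mx (F' b t - F b t)) (D b t + s *: (D' b t - D b t)) 0 j.

Definition path_sq (F F' : 'I_N -> 'rV[R]_N -> R) s t : R :=
  \sum_b (F b t + s * (F' b t - F b t)) ^+ 2.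

(** The bound [eta] is imposed on the weighted sum over [J] and not termwise, so that cancellation
    between its members counts. *)
Lemma homotopy_family (J : finType) (w : J -> R) (F F' : J -> 'I_N -> 'rV[R]_N -> R)
    (D D' : J -> 'I_N -> 'rV[R]_N -> 'rV[R]_N) X DX L c eta :
  (forall g b, smooth (F g b) (D g b)) -> (forall g b, smooth (F' g b) (D' g b)) ->
  tay X DX -> supported X L ->
  (forall s t, 0 <= s <= 1 -> `|\sum_g w g * (rho c (path_sq (F g) (F' g) s t) *
      \sum_l DX t 0 l * \det (minor_mx (path_mx (F g) (F' g) (D g) (D' g) s t) (rshift 1 l)))| <= eta) ->
  `|I (fun t => \sum_g w g * (X t * (rho c (\sum_b F' g b t ^+ 2) * det_grad (D' g) t))) -
    I (fun t => \sum_g w g * (X t * (rho c (\sum_b F g b t ^+ 2) * det_grad (D g) t)))| <=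
  eta * (L.*2.+1)%:R ^+ N.
Proof.
move=> hF hF' hX sX heta; have [f' hf] := tay1_rho c.
pose H g b (x : 'rV[R]_(1 + N)) :=
  F g b (rsubmx x) + x 0 (lshift N ord0) * (F' g b (rsubmx x) - F g b (rsubmx x)).
pose K g b (x : 'rV[R]_(1 + N)) : 'rV[R]_(1 + N) := row_mx (const_mx (F' g b (rsubmx x) - F g b (rsubmx x)))
       (D g b (rsubmx x) + x 0 (lshift N ord0) *: (D' g b (rsubmx x) - D g b (rsubmx x))).
have hH g b : smooth (H g b) (K g b) by exact: smooth_interpolate.
have [DF hDF] := choice (fun g => flux_divergence (hH g) hf (tay_lift hX)).
have at0 s t : (at_time s t : 'rV[R]_(1 + N)) 0 (lshift N ord0) = s by rewrite row_mxEl mxE.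
have atr s t : rsubmx (at_time s t : 'rV[R]_(1 + N)) = t by rewrite row_mxKr.
have sq g s t : \sum_b H g b (at_time s t) ^+ 2 = path_sq (F g) (F' g) s t.
  by apply: eq_bigr => b _; rewrite /H at0 atr.
have mn g s t : (\matrix_(b, j) K g b (at_time s t) 0 j) = path_mx (F g) (F' g) (D g) (D' g) s t.
  by apply/matrixP => b j; rewrite [LHS]mxE [RHS]mxE /K at0 atr.
pose Fx k x := \sum_g w g * flux (H g) (K g) (rho c) (fun x => X (rsubmx x)) k x.
have tFx k : tay (Fx k) (fun x => \sum_g w g *: DF g k x).
  by apply: tay_sum => g; apply: tayZ; exact: (hDF g).1.
have E s t : Fx (lshift N ord0) (at_time s t) = \sum_g w g * (X t * (rho c (path_sq (F g) (F' g) s t) *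
    \det (\matrix_(b, l) (D g b t + s *: (D' g b t - D g b t)) 0 l))).
  apply: eq_bigr => g _; rewrite /flux atr sq /minor mn minor_mx0.
  by congr (_ * (_ * (_ * \det _))); apply/matrixP => b l; rewrite 2!mxE row_mxEr [RHS]mxE.
have I1 : I (fun t => Fx (lshift N ord0) (at_time 1 t)) =
    I (fun t => \sum_g w g * (X t * (rho c (\sum_b F' g b t ^+ 2) * det_grad (D' g) t))).
  congr I; apply/funext => t; rewrite E; apply: eq_bigr => g _; rewrite /det_grad; congr (_ * (_ * (_ * _))).
    by rewrite /path_sq; congr rho; apply: eq_bigr => b _; rewrite mul1r addrC subrK.
  by congr (\det _); apply/matrixP => b l; rewrite mxE [RHS]mxE scale1r addrC subrK.
have I0 : I (fun t => Fx (lshift N ord0) (at_time 0 t)) =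
    I (fun t => \sum_g w g * (X t * (rho c (\sum_b F g b t ^+ 2) * det_grad (D g) t))).
  congr I; apply/funext => t; rewrite E; apply: eq_bigr => g _; rewrite /det_grad; congr (_ * (_ * (_ * _))).
    by rewrite /path_sq; congr rho; apply: eq_bigr => b _; rewrite mul0r addr0.
  by congr (\det _); apply/matrixP => b l; rewrite mxE [RHS]mxE scale0r addr0.
rewrite -I1 -I0; apply: (homotopy_bound hI tFx).
  by move=> k s t Lt; rewrite /Fx big1// => g _; rewrite /flux atr sX// mul0r mulr0.
move=> s t s01; apply: le_trans (heta s t s01); rewrite le_eqVlt; apply/orP; left; apply/eqP.
congr (`|_|); under eq_bigr do rewrite summxE.
rewrite exchange_big/=; apply: eq_bigr => g _.
under eq_bigr do rewrite mxE.
rewrite -mulr_sumr (hDF g).2 sq; congr (_ * (_ * _)).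
rewrite big_split_ord/= big_ord1 row_mxEl mxE mul0r add0r; apply: eq_bigr => l _.
by rewrite row_mxEr atr /minor mn.
Qed.

End Family.

Section Squares.
Context {R : realType} {N : nat}.
Implicit Types v t y : 'rV[R]_N.

Definition esq v : R := \sum_l v 0 l ^+ 2.

Lemma esq_ge0 v : 0 <= esq v. Proof. by apply: sumr_ge0 => l _; exact: sqr_ge0. Qed.

Lemma esq_ge_entry v l : v 0 l ^+ 2 <= esq v.
Proof. by rewrite /esq (bigD1 l)//= lerDl sumr_ge0// => i _; exact: sqr_ge0. Qed.

Lemma esq_ge v : `|v| ^+ 2 <= esq v.
Proof.
have h : `|v| <= Num.sqrt (esq v).
  apply: mx_norm_le => [|i j]; first exact: sqrtr_ge0.
  by rewrite (ord1 i) -sqrtr_sqr ler_sqrt ?esq_ge0// esq_ge_entry.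
by rewrite -[esq v]sqr_sqrtr ?esq_ge0// lerXn2r ?nnegrE ?sqrtr_ge0.
Qed.

Lemma esq_le v : esq v <= N%:R * `|v| ^+ 2.
Proof.
rewrite (le_trans (ler_sum _ (G := fun=> `|v| ^+ 2) _))//; last first.
  by rewrite sumr_const card_ord mulr_natl.
by move=> l _; rewrite -[v 0 l ^+ 2]real_normK ?num_real// lerXn2r ?nnegrE// mx_entry_le.
Qed.

Lemma norm_lt_esq v r : 0 <= r -> esq v < r ^+ 2 -> `|v| < r.
Proof. by move=> r0 /(le_lt_trans (esq_ge v)); rewrite ltr_pXn2r ?nnegrE. Qed.

(** Built on the Euclidean square, which is polynomial, unlike the maximum norm that measures
    supports. *)
Definition cutoff t0 (r : R) t : R := kap (r^-2 * esq (t - t0)).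

Lemma smooth_esq t0 : smooth (fun t => esq (t - t0)) (fun t => 2 *: (t - t0)).
Proof.
have s l : smooth (fun t => (t - t0) 0 l) (fun=> delta_mx 0 l).
  apply: smooth_ext (smoothD (smooth_dotv (delta_mx 0 l)) (smooth_cst (- t0 0 l))) => t.
    rewrite 2!mxE; congr (_ + _); rewrite /dotv (bigD1 l)//= mxE !eqxx mul1r big1 ?addr0// => i /negbTE il.
    by rewrite mxE il andbF mul0r.
  by rewrite addr0.
apply: smooth_ext (smooth_sum (fun l => smoothM (s l) (s l))) => t.
  by apply: eq_bigr => l _; rewrite expr2.
apply/rowP => j; rewrite summxE (bigD1 j)//= big1 => [|l lj].
  by rewrite addr0 !mxE !eqxx mulr1; ring.
by rewrite !mxE [j == l]eq_sym (negbTE lj) andbF mulr0 addr0.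
Qed.

Lemma cutoff_tay t0 r : 0 < r -> exists DX, [/\ tay (cutoff t0 r) DX,
  forall t, DX t = 0 \/ r ^+ 2 < esq (t - t0) < 2 * r ^+ 2 &
  forall t l, `|DX t 0 l| <= 16 / r].
Proof.
move=> r0; have r2 : 0 < r ^+ 2 by rewrite exprn_gt0.
have h := tay_comp tay1_kap (tayZ (r^-2) (smooth_esq t0).1).
exists (fun t => dkap (r^-2 * esq (t - t0)) *: (r^-2 *: (2 *: (t - t0)))); split=> //.
  move=> t; have [|E] := boolP ((r^-2 * esq (t - t0) <= 1) || (2 <= r^-2 * esq (t - t0))).
    by move/dkap0 ->; left; rewrite scale0r.
  right; move: E; rewrite negb_or -!ltNge mulrC ltr_pdivlMr// ltr_pdivrMr// mul1r => /andP[-> ->].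
  done.
move=> t l; rewrite !mxE.
have [|E] := boolP ((r^-2 * esq (t - t0) <= 1) || (2 <= r^-2 * esq (t - t0))).
  by move/dkap0 ->; rewrite mul0r normr0 divr_ge0// ltW.
move: E; rewrite negb_or -!ltNge => /andP[_ h2].
have b : `|(t - t0) 0 l| <= 2 * r.
  have : (t - t0) 0 l ^+ 2 <= (2 * r) ^+ 2.
    apply: le_trans (esq_ge_entry _ _) _; move: h2; rewrite mulrC ltr_pdivrMr// => /ltW/le_trans; apply.
    by rewrite exprMn; nra.
  by rewrite -[_ ^+ 2]real_normK ?num_real// ler_pXn2r ?nnegrE ?mulr_ge0// ltW.
move: b; rewrite !mxE => b.
(* The factor 4 bounds [dkap], one factor 2 comes from differentiating the square, and [2 * r]
   bounds an entry of [t - t0] where the derivative lives. *)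
have -> : 16 / r = 4 * (r^-2 * (2 * (2 * r))) by field; rewrite gt_eqF.
rewrite normrM ler_pM ?dkap_bound//.
have ri : 0 < r^-2 by rewrite invr_gt0.
by rewrite normrM (gtr0_norm ri) ler_pM2l// normrM (ger0_norm (ler0n R 2)) ler_pM2l.
Qed.

Lemma cutoff_supported t0 r L : 0 < r -> `|t0| + 2 * r <= L%:R -> supported (cutoff t0 r) L.
Proof.
move=> r0 hL t Lt; rewrite /cutoff kap0// mulrC ler_pdivlMr ?exprn_gt0//.
apply: le_trans (esq_ge _).
have h : 2 * r <= `|t - t0| by have := lerB_dist t t0; lra.
have : (2 * r) ^+ 2 <= `|t - t0| ^+ 2 by rewrite lerXn2r ?nnegrE ?mulr_ge0// ltW.
have := sqr_ge0 r; rewrite exprMn; nra.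
Qed.

Lemma cutoff1 t0 r t : 0 < r -> esq (t - t0) <= r ^+ 2 -> cutoff t0 r t = 1.
Proof. by move=> r0 h; rewrite /cutoff kap1// mulrC ler_pdivrMr ?exprn_gt0// mul1r. Qed.

Lemma cutoff0 t0 r t : 0 < r -> 2 * r ^+ 2 <= esq (t - t0) -> cutoff t0 r t = 0.
Proof. by move=> r0 h; rewrite /cutoff kap0// mulrC ler_pdivlMr ?exprn_gt0. Qed.

End Squares.

(** * Local degree at a nondegenerate zero *)

Section LocalDegree.
Context {R : realType} {N : nat}.
Variable I : ('rV[R]_N -> R) -> R.
Hypothesis hI : integral_like I.

Lemma homotopy_const (F F' : 'I_N -> 'rV[R]_N -> R) (D D' : 'I_N -> 'rV[R]_N -> 'rV[R]_N) X DX L c :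
  (forall b, smooth (F b) (D b)) -> (forall b, smooth (F' b) (D' b)) ->
  tay X DX -> supported X L ->
  (forall s t, 0 <= s <= 1 -> DX t = 0 \/ 1 <= c * path_sq F F' s t) ->
  I (fun t => X t * (rho c (\sum_b F' b t ^+ 2) * det_grad D' t)) =
  I (fun t => X t * (rho c (\sum_b F b t ^+ 2) * det_grad D t)).
Proof.
move=> hF hF' hX sX h.
have := homotopy_family hI (J := unit) (w := fun=> 1) (F := fun=> F) (F' := fun=> F')
  (D := fun=> D) (D' := fun=> D') (c := c) (eta := 0) (fun _ => hF) (fun _ => hF') hX sX.
have E G D0 : (fun t : 'rV[R]_N => \sum_(g : unit) 1 * (X t * (rho c (\sum_b G b t ^+ 2) * det_grad D0 t))) =
    (fun t => X t * (rho c (\sum_b G b t ^+ 2) * det_grad D0 t)).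
  by apply/funext => t; rewrite (big_pred1 tt) ?mul1r// => -[].
rewrite !E mul0r => H; apply/eqP; rewrite -subr_eq0 -normr_eq0 eq_le normr_ge0 andbT; apply: H.
move=> s t s01; rewrite (big_pred1 tt); last by case.
rewrite mul1r.
have [DX0|hc] := h s t s01; last by rewrite rho_eq0// mul0r normr0.
by rewrite big1 ?mulr0 ?normr0// => l _; rewrite DX0 mxE mul0r.
Qed.

Definition int_lin (M : 'M[R]_N) (y : 'rV[R]_N) c : R :=
  I (fun t => rho c (esq (t *m M - y)) * \det M).

Definition lin (M : 'M[R]_N) (y : 'rV[R]_N) b (t : 'rV[R]_N) : R := (t *m M - y) 0 b.

Lemma smooth_lin M y b : smooth (lin M y b) (fun=> row b M^T).
Proof.
apply: smooth_ext (smoothD (smooth_dotv (row b M^T)) (smooth_cst (- y 0 b))) => t; last by rewrite addr0.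
rewrite /lin 3!mxE; congr (_ + _); apply: eq_bigr => l _; by rewrite !mxE mulrC.
Qed.

Lemma det_grad_lin (M : 'M[R]_N) t : det_grad (fun b _ => row b M^T) t = \det M.
Proof.
by rewrite /det_grad -det_tr; congr (\det _); apply/matrixP => i j; rewrite !mxE.
Qed.

Lemma path_sq_lin M y M' y' s t :
  path_sq (lin M y) (lin M' y') s t = esq (t *m (M + s *: (M' - M)) - (y + s *: (y' - y))).
Proof.
apply: eq_bigr => b _; congr (_ ^+ 2); rewrite /lin mulmxDr -scalemxAr mulmxBr.
move: (t *m M) (t *m M') => u u'; rewrite !mxE; ring.
Qed.

Lemma lin_homotopy M y M' y' a c : 0 < a -> 0 < c ->
  (forall s (v : 'rV[R]_N), 0 <= s <= 1 -> a * `|v| <= `|v *m (M + s *: (M' - M))|) ->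
  int_lin M y c = int_lin M' y' c.
Proof.
move=> a0 c0 ha.
pose r0 := (`|y| + `|y' - y| + (1 + c^-1)) / a.
have ci : 0 < c^-1 by rewrite invr_gt0.
have r0p : 0 < r0 by rewrite divr_gt0// ltr_wpDl ?addr_ge0//; lra.
have key s t : 0 <= s <= 1 -> path_sq (lin M y) (lin M' y') s t * c < 1 -> `|t| <= r0.
  move=> s01; rewrite path_sq_lin -ltr_pdivlMr// mul1r => h.
  have : `|t *m (M + s *: (M' - M)) - (y + s *: (y' - y))| < 1 + c^-1.
    apply: norm_lt_esq; first lra.
    by apply: lt_le_trans h _; nra.
  have := ha s t s01; rewrite /r0 ler_pdivlMr// mulrC.
  have h1 := lerB_dist (t *m (M + s *: (M' - M))) (y + s *: (y' - y)).
  have h2 := ler_normD y (s *: (y' - y)); move: h2; rewrite normrZ ger0_norm; last lra.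
  have : s * `|y' - y| <= `|y' - y| by rewrite ler_piMl//; lra.
  lra.
pose r := N%:R * r0 + 1.
have r1 : 0 < r by rewrite ltr_wpDl// mulr_ge0// ltW.
have [DX [tX DX0 _]] := cutoff_tay (0 : 'rV[R]_N) r1.
have cutoffE s t : 0 <= s <= 1 -> path_sq (lin M y) (lin M' y') s t * c < 1 -> esq (t - 0) <= r ^+ 2.
  move=> s01 h; have tr := key s t s01 h; rewrite subr0.
  apply: le_trans (esq_le _) _.
  have [/(congr1 (fun k : nat => k%:R : R)) N0|N0] := posnP N; first by rewrite N0 mul0r sqr_ge0.
  have N1 : 1 <= N%:R :> R by rewrite ler1n.
  have t2 : `|t| ^+ 2 <= r0 ^+ 2 by rewrite lerXn2r ?nnegrE ?(ltW r0p).
  have : N%:R * `|t| ^+ 2 <= N%:R * r0 ^+ 2 by rewrite ler_wpM2l.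
  rewrite /r; move: (sqr_ge0 r0) (ltW r0p) => *; nra.
have [L hL] : exists L : nat, `|0 : 'rV[R]_N| + 2 * r <= L%:R.
  by exists (Num.truncn (`|0 : 'rV[R]_N| + 2 * r)).+1; rewrite ltW// truncnS_gt.
have := homotopy_const (smooth_lin M y) (smooth_lin M' y') (c := c) tX (cutoff_supported r1 hL).
have Efun M1 y1 s : 0 <= s <= 1 -> (forall t, path_sq (lin M y) (lin M' y') s t = \sum_b lin M1 y1 b t ^+ 2) ->
    (fun t => cutoff 0 r t * (rho c (\sum_b lin M1 y1 b t ^+ 2) * det_grad (fun b _ => row b M1^T) t)) =
    (fun t => rho c (esq (t *m M1 - y1)) * \det M1).
  move=> s01 hs; apply/funext => t; rewrite det_grad_lin.
  have [h|h] := ltP (path_sq (lin M y) (lin M' y') s t * c) 1.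
    by rewrite cutoff1 ?mul1r//; exact: cutoffE h.
  have E : rho c (\sum_b lin M1 y1 b t ^+ 2) = 0 by rewrite rho_eq0// -hs mulrC.
  by rewrite -[esq _]/(\sum_b lin M1 y1 b t ^+ 2) E !mul0r mulr0.
rewrite (Efun M y 0) ?(Efun M' y' 1) ?lexx ?ler01// => [H|t|t].
- apply/esym; apply: H => s t s01.
  have [h|h] := ltP (path_sq (lin M y) (lin M' y') s t * c) 1; last by right; rewrite mulrC.
  left; have [//|/andP[h1 _]] := DX0 t; have := cutoffE s t s01 h; by rewrite leNgt h1.
- by apply: eq_bigr => b _; rewrite mul1r addrC subrK.
- by apply: eq_bigr => b _; rewrite mul0r addr0.
Qed.

Lemma segment_lower (M M' : 'M[R]_N) : (forall s, 0 <= s <= 1 -> M + s *: (M' - M) \in unitmx) ->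
  exists2 a, 0 < a & forall s (v : 'rV[R]_N), 0 <= s <= 1 -> a * `|v| <= `|v *m (M + s *: (M' - M))|.
Proof.
move=> hu; pose f s := M + s *: (M' - M).
have cf : continuous f.
  move=> s; apply/continuous_mxP => i j.
  apply: (@continuous_at_eq _ _ _ (fun s : R => M i j + s * (M' i j - M i j))).
    by move=> t; rewrite !mxE.
  apply: (@continuousD _ R^o); first exact: cst_continuous.
  by apply: continuousM; [exact: cvg_id|exact: cst_continuous].
have [c _ hc] : exists2 c : R, c \in `[0, 1]%R & forall t : R, t \in `[0, 1]%R -> `|invmx (f t)| <= `|invmx (f c)|.
  apply: EVT_max => //; apply: continuous_in_subspaceT => s /set_mem; rewrite /= in_itv/= => s01.
  by apply: (continuous_comp (continuous_invmx (cf s) (hu s s01))); exact: norm_continuous.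
exists (N%:R * `|invmx (f c)| + 1)^-1.
  by rewrite invr_gt0 ltr_wpDl// mulr_ge0.
move=> s v s01; rewrite mulrC ler_pdivrMr; last by rewrite ltr_wpDl// mulr_ge0.
have E : v = v *m f s *m invmx (f s) by rewrite mulmxK// hu.
rewrite {1}E (le_trans (mulmx_norm _ _))// mulrCA ler_wpM2l//.
rewrite (@le_trans _ _ (N%:R * `|invmx (f c)|)) ?lerDl// ler_wpM2l// hc// in_itv/=.
Qed.

Lemma lin_segment M M' c : 0 < c -> (forall s, 0 <= s <= 1 -> M + s *: (M' - M) \in unitmx) ->
  forall y y', int_lin M y c = int_lin M' y' c.
Proof.
by move=> c0 /segment_lower[a a0 ha] y y'; apply: (lin_homotopy _ _ a0).
Qed.

End LocalDegree.

Section LinearDegree.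
Context {R : realType} {n : nat}.
Notation N := (1 + n)%N.
Variable I : ('rV[R]_N -> R) -> R.
Hypothesis hI : integral_like I.

Lemma det_combine_trig (L : 'M[R]_N) (D : 'M[R]_N) s : is_trig_mx L -> is_trig_mx D ->
  \det (L + s *: (D - L)) = \prod_i (L i i + s * (D i i - L i i)).
Proof.
move=> /is_trig_mxP hL /is_trig_mxP hD; rewrite det_trig; last first.
  by apply/is_trig_mxP => i j ij; rewrite !mxE hL// hD// subrr mulr0 addr0.
by apply: eq_bigr => i _; rewrite !mxE.
Qed.

(** LUP factorization deforms [M] inside the invertible matrices to a signed permutation matrix: [L]
    moves to the identity and [U] to the diagonal of its signs, triangularity keeping determinants
    nonzero. A signed permutation is orthogonal, so it preserves [esq] and only its determinant
    remains. *)
Lemma int_lin_sign (M : 'M[R]_N) y c : M \in unitmx -> 0 < c ->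
  int_lin I M y c = Num.sg (\det M) * I (fun t => rho c (esq t)).
Proof.
move=> Mu c0.
have [P [L [U [PL Lt LD Ut MP]]]] : exists (P L U : 'M[R]_N), [/\ is_perm_mx P, is_trig_mx L,
    forall i, L i i = 1, is_trig_mx U^T & P *m M = L *m U].
  have := @cormen_lup_correct R n M; have := @cormen_lup_perm R n M.
  have := @cormen_lup_lower R n M; have := @cormen_lup_upper R n M.
  case: (cormen_lup _) => [[P L] U] /= hU hL hP E; exists P, L, U; split=> //.
  - by apply/is_trig_mxP => i j ij; rewrite hL ?(ltnW ij)// -val_eqE ltn_eqF.
  - by move=> i; rewrite hL// eqxx.
  - by apply/is_trig_mxP => i j ij; rewrite mxE hU.
have /is_perm_mxP[p Pp] := PL.
have PV : P^T *m P = 1%:M by rewrite Pp tr_perm_mx -perm_mxM mulVg perm_mx1.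
have PV' : P *m P^T = 1%:M by rewrite Pp tr_perm_mx -perm_mxM mulgV perm_mx1.
have dP : \det P^T ^+ 2 = 1 by rewrite det_tr Pp det_perm sqrr_sign.
have PTu : P^T \in unitmx by rewrite unitmxE unitfE -sqrf_eq0 dP oner_eq0.
have ME : M = P^T *m (L *m U) by rewrite -MP mulmxA PV mul1mx.
have dL : \det L = 1 by rewrite det_trig// big1.
have dU : \det U = \prod_i U i i by rewrite -det_tr det_trig//; apply: eq_bigr => i _; rewrite mxE.
have Uu : U \in unitmx.
  have := Mu; rewrite ME !unitmx_mul => /andP[_ /andP[_ //]].
have U0 i : U i i != 0.
  by have := Uu; rewrite unitmxE unitfE dU => /prodf_neq0; apply.
pose D : 'M[R]_N := diag_mx (\row_i Num.sg (U i i)).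
have DT : is_trig_mx D^T.
  by apply/is_trig_mxP => i j ij; rewrite !mxE -val_eqE gtn_eqF// mulr0n.
have sg2 i : Num.sg (U i i) * Num.sg (U i i) = 1 by rewrite -sgrM -expr2 gtr0_sg// lt_neqAle sqr_ge0 eq_sym sqrf_eq0 U0.
have s1 : int_lin I M y c = int_lin I (P^T *m U) 0 c.
  apply: (lin_segment hI c0) => s s01.
  have -> : M + s *: (P^T *m U - M) = P^T *m ((L + s *: (1%:M - L)) *m U).
    by rewrite ME mulmxDl -scalemxAl mulmxBl mul1mx mulmxDr -scalemxAr mulmxBr.
  have t1 : is_trig_mx (1%:M : 'M[R]_N).
    by apply/is_trig_mxP => i j ij; rewrite mxE -val_eqE ltn_eqF.
  rewrite !unitmx_mul PTu Uu andbT unitmxE (det_combine_trig s Lt t1).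
  by rewrite big1 ?unitr1// => i _; rewrite LD mxE eqxx subrr mulr0 addr0.
have s2 : int_lin I (P^T *m U) 0 c = int_lin I (P^T *m D) 0 c.
  apply: (lin_segment hI c0) => s s01.
  have -> : P^T *m U + s *: (P^T *m D - P^T *m U) = P^T *m (U + s *: (D - U)).
    by rewrite mulmxDr -scalemxAr mulmxBr.
  rewrite unitmx_mul PTu unitmxE -det_tr linearD linearZ linearB/= det_combine_trig// unitfE.
  apply/prodf_neq0 => i _; rewrite !mxE eqxx mulr1n.
  have := U0 i; case: (ltrgtP 0 (U i i)) => [h|h|<-]; rewrite ?eqxx// => _.
    by rewrite gtr0_sg// gt_eqF//; nra.
  by rewrite ltr0_sg// lt_eqF//; nra.
have dD : \det D = Num.sg (\det U).
  by rewrite det_diag dU sgr_prod; apply: eq_bigr => i _; rewrite mxE.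
have dM : Num.sg (\det M) = \det (P^T *m D).
  rewrite ME !det_mulmx dL mul1r dD sgrM; congr (_ * _).
  by rewrite det_tr Pp det_perm; case: (perm.odd_perm p); rewrite ?sgrN1 ?sgr1.
rewrite s1 s2 /int_lin dM.
have tst : exists L C, test (fun t : 'rV[R]_N => rho c (esq t)) L C.
  have ci : 0 < c^-1 by rewrite invr_gt0.
  exists (Num.truncn (1 + c^-1)).+1, 1; split=> t.
    move=> tL; rewrite rho_eq0// -ler_pdivrMl// mulr1; apply: le_trans (esq_ge _).
    have : 1 + c^-1 < `|t| by apply: lt_trans tL; exact: truncnS_gt.
    by nra.
  by rewrite ger0_norm ?rho_ge0// rho_le1// mulr_ge0 ?esq_ge0// ltW.
have [L1 [C1 t1]] := tst; rewrite -(intZ hI _ t1); congr I; apply/funext => t.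
rewrite subr0 mulrC; congr (_ * rho c _).
have E (v : 'rV[R]_N) : esq v = (v *m v^T) 0 0.
  by rewrite mxE; apply: eq_bigr => l _; rewrite mxE expr2.
rewrite !E trmx_mul trmx_mul trmxK mulmxA -[t *m _ *m _ ]mulmxA.
have DD : D *m D^T = 1%:M.
  rewrite tr_diag_mx mulmx_diag -[1%:M]diag_const_mx; congr diag_mx.
  by apply/rowP => i; rewrite !mxE sg2.
have Q : P^T *m D *m (D^T *m P) = 1%:M by rewrite mulmxA -[P^T *m D *m D^T]mulmxA DD mulmx1 PV.
move: Q; move: (P^T *m D) (D^T *m P) => X Y Q.
by rewrite mulmxA -(mulmxA t X Y) Q mulmx1.
Qed.

(** On a small shell around [t0] the quadratic error is too small to cancel the linear part, so the
    straight path from [F] to its linearization has no zero there and [rho] vanishes for large [c];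
    [int_lin_sign] evaluates the linear case. *)
Lemma nondegenerate_zero (F : 'I_N -> 'rV[R]_N -> R) D t0 :
  (forall b, smooth (F b) (D b)) -> (forall b, F b t0 = 0) -> det_grad D t0 != 0 ->
  exists2 r1, 0 < r1 & forall r, 0 < r <= r1 -> exists2 c1, 0 < c1 & forall c, c1 <= c ->
    I (fun t => cutoff t0 r t * (rho c (\sum_b F b t ^+ 2) * det_grad D t)) =
    Num.sg (det_grad D t0) * I (fun t => rho c (esq t)).
Proof.
move=> hF F0 d0; pose M : 'M[R]_N := \matrix_(l, b) D b t0 0 l.
have dM : \det M = det_grad D t0.
  by rewrite -det_tr /det_grad; congr (\det _); apply/matrixP => i j; rewrite !mxE.
have Mu : M \in unitmx by rewrite unitmxE unitfE dM.
have [Ci Ci0 hCi] : exists2 Ci, 0 < Ci & forall v : 'rV[R]_N, `|v| <= Ci * `|v *m M|.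
  by apply: mulmx_lower; rewrite row_free_unit.
have hT0 b : exists Tb : R, 0 <= Tb /\ forall v : 'rV[R]_N, `|v| <= 1 ->
    `|F b (t0 + v) - dotv (D b t0) v| <= Tb * `|v| ^+ 2.
  have [C C0 hC] := (hF b).1 (`|t0| + 1); exists C; split=> // v v1.
  have [||_ _] := hC t0 v; rewrite ?lerDl ?(le_trans v1) ?lerDr//.
  by rewrite F0 subr0.
have [T hT] := choice hT0.
pose C := \sum_b T b.
have CT b : T b <= C by rewrite /C (bigD1 b)//= lerDl sumr_ge0// => i _; exact: (hT i).1.
have C0 : 0 <= C by apply: sumr_ge0 => b _; exact: (hT b).1.
have k0 : 0 < 4 * Ci * (C + 1) by rewrite mulr_gt0 ?mulr_gt0//; lra.
(* On the shell [|v| < 2 * r]: the bound [2^-1] keeps [v] in the range of the Taylor estimate, and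
   the other one makes [Ci * C * |v| ^+ 2] at most [|v| / 2]. *)
exists (Num.min 2^-1 (4 * Ci * (C + 1))^-1); first by rewrite lt_min !invr_gt0 k0 ltr0n.
move=> r /andP[r0]; rewrite le_min => /andP[r12 rk].
have rk' : 4 * Ci * (C + 1) * r <= 1 by rewrite -ler_pdivlMl// mulr1.
have N0 : 0 < N%:R :> R by rewrite ltr0n.
have c10 : 0 < 4 * Ci ^+ 2 * N%:R / r ^+ 2 by rewrite divr_gt0 ?exprn_gt0// mulr_gt0// mulr_gt0// exprn_gt0.
(* On the shell [r ^+ 2 < esq v] and [|v| <= 2 * Ci * |p|], so this [c] gives [1 <= c * esq p]; the
   factor [N] converts the maximum norm to [esq]. *)
exists (4 * Ci ^+ 2 * N%:R / r ^+ 2) => // c c1.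
have c0 : 0 < c := lt_le_trans c10 c1.
have c1' : 4 * Ci ^+ 2 * N%:R <= c * r ^+ 2 by rewrite -ler_pdivrMr ?exprn_gt0.
have rowM b : row b M^T = D b t0 by apply/rowP => l; rewrite !mxE.
have [DX [tX DX0 _]] := cutoff_tay t0 r0.
have [L hL] : exists L : nat, `|t0| + 2 * r <= L%:R.
  by exists (Num.truncn (`|t0| + 2 * r)).+1; rewrite ltW// truncnS_gt.
have H : I (fun t => cutoff t0 r t * (rho c (\sum_b lin M (t0 *m M) b t ^+ 2) * det_grad (fun b _ => row b M^T) t)) =
    I (fun t => cutoff t0 r t * (rho c (\sum_b F b t ^+ 2) * det_grad D t)).
  apply: (homotopy_const hI hF (smooth_lin M (t0 *m M)) tX (cutoff_supported r0 hL)) => s t s01.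
  have [E|/andP[q1 q2]] := DX0 t; [by left|right].
  set v := t - t0 in q1 q2.
  have v2 : `|v| < 2 * r by apply: norm_lt_esq; [rewrite mulr_ge0// ltW|rewrite exprMn; nra].
  have v1 : `|v| <= 1 by lra.
  pose p : 'rV[R]_N := \row_b (F b t + s * (lin M (t0 *m M) b t - F b t)).
  have -> : path_sq F (lin M (t0 *m M)) s t = esq p by apply: eq_bigr => b _; rewrite mxE.
  have pe : `|p - v *m M| <= C * `|v| ^+ 2.
    apply: mx_norm_le => [|i b]; first by rewrite mulr_ge0// sqr_ge0.
    have Es (q w : 'rV[R]_N) : (q - w) 0 b = q 0 b - w 0 b by rewrite !mxE.
    rewrite (ord1 i) Es [p 0 b]mxE.
    have -> : lin M (t0 *m M) b t = (v *m M) 0 b by rewrite /lin -mulmxBl.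
    have -> : (v *m M) 0 b = dotv (D b t0) v.
      by rewrite -rowM mxE; apply: eq_bigr => l _; rewrite !mxE mulrC.
    have -> : F b t + s * (dotv (D b t0) v - F b t) - dotv (D b t0) v =
      (1 - s) * (F b (t0 + v) - dotv (D b t0) v) by rewrite /v [t0 + _]addrC subrK; ring.
    rewrite normrM ger0_norm; last lra.
    have h1 := (hT b).2 v v1.
    have h2 : T b * `|v| ^+ 2 <= C * `|v| ^+ 2 by rewrite ler_wpM2r// sqr_ge0.
    apply: le_trans (le_trans h1 h2); rewrite ler_piMl//; lra.
  have pl : `|v| <= 2 * Ci * `|p|.
    have := hCi v; have := lerB_dist (v *m M) (v *m M - p); rewrite subKr distrC => h1 h2.
    have h3 : Ci * (`|v *m M| - `|p - v *m M|) <= Ci * `|p| by rewrite ler_pM2l.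
    have h4 : Ci * `|p - v *m M| <= Ci * (C * `|v| ^+ 2) by rewrite ler_pM2l.
    have h5 : 2 * Ci * C * `|v| <= 1.
      apply: le_trans rk'; have : 2 * Ci * C * `|v| <= 2 * Ci * C * (2 * r).
        by rewrite ler_wpM2l ?(ltW v2)// mulr_ge0// mulr_ge0// ltW.
      have := mulr_ge0 (ltW Ci0) (ltW r0); nra.
    have h6 : 2 * Ci * C * `|v| * `|v| <= `|v| by rewrite ler_piMl.
    lra.
  have pq : `|v| ^+ 2 <= 4 * Ci ^+ 2 * `|p| ^+ 2.
    have := lerXn2r 2; rewrite /= => /(_ R `|v| (2 * Ci * `|p|)).
    rewrite !nnegrE normr_ge0 mulr_ge0 ?mulr_ge0 ?(ltW Ci0)// => /(_ isT isT pl).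
    by rewrite !exprMn; lra.
  have e1 := esq_ge p; have e2 := esq_le v.
  have : r ^+ 2 <= N%:R * (4 * Ci ^+ 2 * esq p).
    apply: le_trans (ltW q1) _; apply: le_trans e2 _; rewrite ler_pM2l//.
    apply: le_trans pq _; rewrite ler_pM2l// mulr_gt0// exprn_gt0//.
  move=> h7; have : c * r ^+ 2 <= c * (N%:R * (4 * Ci ^+ 2 * esq p)) by rewrite ler_pM2l.
  move=> /(le_trans c1') => h8.
  have K0 : 0 < 4 * Ci ^+ 2 * N%:R by rewrite mulr_gt0// mulr_gt0// exprn_gt0.
  by rewrite -(ler_pM2l K0) mulr1; apply: le_trans h8 _; rewrite le_eqVlt; apply/orP; left; apply/eqP; ring.
rewrite -H -dM -(int_lin_sign (t0 *m M) Mu c0); congr I; apply/funext => t; rewrite det_grad_lin.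
rewrite -[\sum_b _]/(esq (t *m M - t0 *m M)).
have [h|h] := ltP (c * esq (t *m M - t0 *m M)) 1; last by rewrite (rho_eq0 h) mul0r mulr0.
rewrite cutoff1 ?mul1r//; set v := t - t0; rewrite -mulmxBl -/v in h.
have e1 := esq_ge (v *m M); have e2 := esq_le v.
have pq : `|v| ^+ 2 <= Ci ^+ 2 * `|v *m M| ^+ 2.
  by rewrite -exprMn lerXn2r ?nnegrE ?mulr_ge0 ?(ltW Ci0).
have Ci2 : 0 < Ci ^+ 2 by rewrite exprn_gt0.
have h1 : c * `|v| ^+ 2 <= Ci ^+ 2.
  apply: (@le_trans _ _ (c * (Ci ^+ 2 * esq (v *m M)))).
    by rewrite ler_pM2l//; apply: le_trans pq _; rewrite ler_pM2l.
  by rewrite mulrCA -[X in _ <= X]mulr1 ler_pM2l// ltW.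
rewrite -(ler_pM2l c0); apply: (@le_trans _ _ (N%:R * (c * `|v| ^+ 2))); first by rewrite mulrCA ler_pM2l.
apply: (@le_trans _ _ (N%:R * Ci ^+ 2)); first by rewrite ler_pM2l.
apply: le_trans c1'; rewrite mulrC ler_pM2r//; nra.
Qed.

End LinearDegree.

Section Bounds.
Context {R : realType}.

Lemma seq_bound (T : eqType) (s : seq T) (f : T -> R) :
  exists2 c, 0 < c & forall x, x \in s -> f x <= c.
Proof.
elim: s => [|y s [c c0 hc]]; first by exists 1.
exists (c + `|f y|) => [|x]; first by rewrite ltr_pwDl.
rewrite inE => /predU1P[->|/hc h]; first by rewrite (le_trans (ler_norm _))// lerDr ltW.
by rewrite (le_trans h)// lerDl.
Qed.

Lemma seq_min (T : eqType) (s : seq T) (f : T -> R) : (forall x, 0 < f x) ->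
  exists2 c, 0 < c & forall x, x \in s -> c <= f x.
Proof.
move=> f0; have [c c0 hc] := seq_bound s (fun x => (f x)^-1).
exists c^-1 => [|x /hc h]; first by rewrite invr_gt0.
by rewrite -[f x]invrK lef_pV2 ?posrE ?invr_gt0.
Qed.

(** Bounds are encoded by one integer, weakening as it grows, so that finitely many local ones have
    a common value. *)
Lemma compact_nat_bound k (K : set 'rV[R]_k) (Q : nat -> 'rV[R]_k -> Prop) : compact K ->
  (forall i j x, (i <= j)%N -> Q i x -> Q j x) ->
  (forall x, K x -> exists i, exists2 e, 0 < e & forall y, `|y - x| < e -> Q i y) ->
  exists i, forall x, K x -> Q i x.
Proof.
move=> /compact_near_coveringP cK mono loc.
have [] := cK nat \oo Q _.
  move=> x /loc[i [e e0 he]].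
  exists ([set y | `|y - x| < e], [set j | (i <= j)%N]) => /=; last first.
    by move=> [y j] /= [ye ij]; apply: mono ij _; exact: he.
  split; last exact: nbhs_infty_ge.
  by apply/(@near_normP R 'rV[R]_k); exists e.
by move=> i _ /(_ i (leqnn i)) h; exists i.
Qed.

Lemma tay_continuous k (F : 'rV[R]_k -> R) D x e : tay F D -> 0 < e ->
  exists2 d, 0 < d & forall y, `|y - x| < d -> `|F y - F x| < e.
Proof.
move=> h e0; have [L L0 hL] := tay_incr (`|x| + 1) h.
have L1 : 0 < L + 1 by lra.
exists (Num.min 1 (e / (L + 1))); first by rewrite lt_min ltr01 divr_gt0.
move=> y; rewrite lt_min => /andP[y1 ye].
have [||_ _] := hL x (y - x); [by rewrite lerDl|by rewrite (le_trans (ltW y1))// lerDr|].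
rewrite [x + _]addrC subrK => /le_lt_trans; apply.
rewrite ltr_pdivlMr// in ye; have := normr_ge0 (y - x); nra.
Qed.

Lemma closed_ball_compact k r : compact [set x : 'rV[R]_k | `|x| <= r].
Proof.
apply: bounded_closed_compact.
  by exists r; split; [rewrite num_real|move=> e re x /= xr; exact: le_trans (ltW re)].
apply: (closed_comp (f := fun x : 'rV[R]_k => `|x|) (D := [set y | y <= r])); last exact: closed_le.
by move=> x _; exact: norm_continuous.
Qed.

End Bounds.

Section FiniteZeros.
Context {R : realType} {n : nat}.
Notation N := (1 + n)%N.
Variable I : ('rV[R]_N -> R) -> R.
Hypothesis hI : integral_like I.

Lemma test_mono (phi : 'rV[R]_N -> R) L C L' C' : test phi L C -> (L <= L')%N -> C <= C' -> test phi L' C'.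
Proof.
move=> [s h] LL CC; split=> [t Lt|t]; last exact: le_trans CC.
by apply: s; apply: le_lt_trans Lt; rewrite ler_nat.
Qed.

Lemma int_sum_test (J : finType) (phi : J -> 'rV[R]_N -> R) :
  (forall i, exists L C, test (phi i) L C) ->
  I (fun t => \sum_i phi i t) = \sum_i I (phi i).
Proof.
move=> h; have [L hL] := choice h; have [C hC] := choice hL.
apply: (int_sum hI (L := \max_i L i) (C := \sum_i C i)) => i.
have C0 j : 0 <= C j := le_trans (normr_ge0 _) ((hC j).2 0).
apply: test_mono (hC i) _ _; first exact: leq_bigmax.
by rewrite (bigD1 i)//= lerDl sumr_ge0.
Qed.

Lemma int_sum_seq (J : eqType) (s : seq J) (phi : J -> 'rV[R]_N -> R) :
  (forall i, exists L C, test (phi i) L C) ->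
  I (fun t => \sum_(i <- s) phi i t) = \sum_(i <- s) I (phi i).
Proof.
move=> h; rewrite big_tnth -int_sum_test//.
by congr I; apply/funext => t; rewrite big_tnth.
Qed.

Lemma tay_det_grad (D : 'I_N -> 'rV[R]_N -> 'rV[R]_N) :
  (forall b j, exists E, tay (fun x => D b x 0 j) E) -> exists E, tay (det_grad D) E.
Proof.
move=> h; have hE0 b : exists E : 'I_N -> 'rV[R]_N -> 'rV[R]_N, forall j, tay (fun x => D b x 0 j) (E j).
  by have [E hE] := choice (h b); exists E.
have [E hE] := choice hE0.
eexists; apply: (tay_det (D := E)) => b j.
by apply: tay_ext (hE b j) => x//; rewrite mxE.
Qed.

(** For large [c] the integrand lives near the zeros: the bound [r0] excludes approximate zeros far
    away, and compactness of the ball excludes others. The large cutoff is then replaced by disjoint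
    cutoffs around the points of [T]. *)
Lemma finite_zeros (F : 'I_N -> 'rV[R]_N -> R) D (T : seq 'rV[R]_N) r0 e0 :
  (forall b, smooth (F b) (D b)) -> uniq T -> (forall t, t \in T <-> forall b, F b t = 0) ->
  (forall t, t \in T -> det_grad D t != 0) -> 0 < e0 ->
  (forall t, \sum_b F b t ^+ 2 < e0 -> `|t| <= r0) ->
  exists k0 : nat, exists2 c0, 0 < c0 & forall (k : nat) c, (k0 <= k)%N -> c0 <= c ->
    I (fun t => cutoff 0 k%:R t * (rho c (\sum_b F b t ^+ 2) * det_grad D t)) =
    \sum_(t <- T) Num.sg (det_grad D t) * I (fun t => rho c (esq t)).
Proof.
move=> hF uT TP dT e0p hr0.
have [Dd hDd] : exists E, tay (det_grad D) E.
  by apply: tay_det_grad => b j; exact: smooth_tay_hess (hF b) j.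
have hloc t : exists r1, 0 < r1 /\ (t \in T -> forall r, 0 < r <= r1 -> exists2 c1, 0 < c1 & forall c, c1 <= c ->
    I (fun t' => cutoff t r t' * (rho c (\sum_b F b t' ^+ 2) * det_grad D t')) =
    Num.sg (det_grad D t) * I (fun t => rho c (esq t))).
  have [tT|tT] := boolP (t \in T); last by exists 1.
  by have [r1 r10 hr1] := nondegenerate_zero hI hF ((TP t).1 tT) (dT t tT); exists r1; split.
have [r1 hr1] := choice hloc.
have [ra ra0 hra] := seq_min T (fun x => (hr1 x).1).
(* A quarter of the distance keeps the doubled balls apart; on the diagonal the value 1 is a
   placeholder that keeps [sep] positive. *)
pose sep (p : 'rV[R]_N * 'rV[R]_N) : R := if p.1 == p.2 then 1 else `|p.1 - p.2| / 4.
have sep0 p : 0 < sep p.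
  rewrite /sep; case: eqVneq => // pq; by rewrite divr_gt0// normr_gt0 subr_eq0.
have [rb rb0 hrb] := seq_min [seq (x, y) | x <- T, y <- T] sep0.
pose r := Num.min ra rb; have rp : 0 < r by rewrite lt_min ra0.
have hc t : exists c1, 0 < c1 /\ (t \in T -> forall c, c1 <= c ->
    I (fun t' => cutoff t r t' * (rho c (\sum_b F b t' ^+ 2) * det_grad D t')) =
    Num.sg (det_grad D t) * I (fun t => rho c (esq t))).
  have [tT|tT] := boolP (t \in T); last by exists 1.
  have [|c1 c10 h] := (hr1 t).2 tT r; last by exists c1.
  by rewrite rp /r ge_min hra.
have [c1 hc1] := choice hc.
have [ca ca0 hca] := seq_bound T c1.
pose S t := \sum_b F b t ^+ 2.
have [DS tS] : exists DS, tay S DS.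
  exists (fun x => \sum_b (F b x *: D b x + F b x *: D b x)).
  by apply: tay_sum => b; exact: (tayM (hF b).1 (hF b).1).
have S0 t : 0 <= S t by apply: sumr_ge0 => b _; exact: sqr_ge0.
have N0 : 0 < N%:R :> R by rewrite ltr0n.
have N1 : 1 <= N%:R :> R by rewrite ler1n.
have [i0 hi0] : exists i0 : nat, forall x, `|x| <= r0 ->
    (exists2 t, t \in T & esq (x - t) < r ^+ 2) \/ i0.+1%:R^-1 <= S x.
  pose Q (i : nat) (x : 'rV[R]_N) := (exists2 t, t \in T & esq (x - t) < r ^+ 2) \/ i.+1%:R^-1 <= S x.
  apply: (@compact_nat_bound R N _ Q (@closed_ball_compact R N r0)) => [i j x ij [|h]|x xr].
  - by left.
  - by right; apply: le_trans h; rewrite lef_pV2 ?posrE// ler_nat ltnS.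
  have := S0 x; rewrite le_eqVlt => /predU1P[Sx|Sx].
    have xT : x \in T.
      apply/TP => b; move/esym/eqP: Sx; rewrite psumr_eq0 => [/allP/(_ b)|b' _]; last exact: sqr_ge0.
      by rewrite mem_index_enum sqrf_eq0 => /(_ isT)/eqP.
    exists 0%N, (r / N%:R); first by rewrite divr_gt0.
    move=> y yx; left; exists x => //; apply: le_lt_trans (esq_le _) _.
    have : `|y - x| ^+ 2 < (r / N%:R) ^+ 2 by rewrite ltr_pXn2r ?nnegrE// divr_ge0// ltW.
    rewrite -(ltr_pM2l N0) => /lt_le_trans; apply.
    rewrite expr_div_n mulrCA -[X in _ <= X]mulr1 ler_pM2l ?exprn_gt0//.
    by rewrite expr2 invfM mulrA divff ?gt_eqF// mul1r invf_le1.
  have [k hk] : exists k : nat, (S x / 2)^-1 < k.+1%:R.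
    by exists (Num.truncn (S x / 2)^-1); exact: truncnS_gt.
  have Sx2 : 0 < S x / 2 by rewrite divr_gt0.
  have [d d0 hd] := tay_continuous x tS Sx2.
  exists k, d => // y /hd; rewrite ltr_norml => /andP[h _]; right.
  have : k.+1%:R^-1 < S x / 2 by rewrite invf_plt ?posrE.
  move: h; move: (k.+1%:R^-1) (S x) (S y) => q u v; lra.
exists (Num.truncn (N%:R * `|r0|)).+1, (ca + e0^-1 + i0.+1%:R).
  by rewrite !addr_gt0// invr_gt0.
move=> k c kk cc.
have ei0 : 0 < e0^-1 by rewrite invr_gt0.
have i00 : 0 < i0.+1%:R :> R by [].
have c0 : 0 < c by lra.
have ce : 1 <= c * e0 by rewrite -ler_pdivrMr// div1r; lra.
have ci : 1 <= c * i0.+1%:R^-1 by rewrite ler_pdivlMr// mul1r; lra.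
have kr : N%:R * `|r0| < k%:R.
  by apply: lt_le_trans (truncnS_gt _) _; rewrite ler_nat.
have k0 : 0 < k%:R :> R by apply: le_lt_trans kr; rewrite mulr_ge0.
have E t : cutoff 0 k%:R t * (rho c (S t) * det_grad D t) =
    \sum_(x <- T) cutoff x r t * (rho c (S t) * det_grad D t).
  have [h|h] := leP 1 (c * S t).
    by rewrite (rho_eq0 h) mul0r mulr0 big1// => x _; rewrite mulr0.
  have tr : `|t| <= r0 by apply: hr0; rewrite -/(S t) -(ltr_pM2l c0); lra.
  have [[x xT xt]|hS] := hi0 t tr; last first.
    have : c * i0.+1%:R^-1 <= c * S t by rewrite ler_pM2l.
    by move/(le_trans ci); rewrite leNgt h.
  have E1 : cutoff x r t = 1 := cutoff1 rp (ltW xt).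
  have E2 : cutoff 0 k%:R t = 1.
    apply: cutoff1 => //; rewrite subr0; apply: le_trans (esq_le _) _.
    have rr : `|r0| = r0 by rewrite ger0_norm// (le_trans _ tr).
    rewrite rr in kr; have t0 := normr_ge0 t.
    have h1 : (N%:R * `|t|) ^+ 2 <= k%:R ^+ 2.
      rewrite lerXn2r ?nnegrE ?mulr_ge0//; apply: le_trans (ltW kr); by rewrite ler_pM2l.
    apply: le_trans h1; rewrite exprMn ler_wpM2r ?sqr_ge0// expr2 ler_peMl//.
  rewrite (bigD1_seq x)//= E1 E2 !mul1r.
  rewrite big_seq_cond big1 ?addr0// => y /andP[yT yx]; rewrite cutoff0 ?mul0r//.
  have : rb <= sep (y, x) by apply: hrb; apply: allpairs_f.
  rewrite /sep /= (negbTE yx) ler_pdivlMr// => h4.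
  have xr : `|t - x| < r by apply: norm_lt_esq => //; exact: ltW.
  have rrb : r <= rb by rewrite /r ge_min lexx orbT.
  have h5 : 2 * r <= `|t - y|.
    have := ler_distD t y x; rewrite [`|y - t|]distrC; lra.
  apply: le_trans (esq_ge _); have : (2 * r) ^+ 2 <= `|t - y| ^+ 2.
    by rewrite lerXn2r ?nnegrE// mulr_ge0// ltW.
  by rewrite exprMn; have := sqr_ge0 r; nra.
have -> : (fun t => cutoff 0 k%:R t * (rho c (\sum_b F b t ^+ 2) * det_grad D t)) =
   (fun t => \sum_(x <- T) cutoff x r t * (rho c (S t) * det_grad D t)) by apply/funext.
rewrite int_sum_seq => [|x].
  rewrite big_seq [RHS]big_seq; apply: eq_bigr => x xT; apply: (hc1 x).2 => //.
  by rewrite (le_trans (hca x xT))//; lra.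
have [f' hf'] := tay1_rho c; have [DX [tX _ _]] := cutoff_tay x rp.
have tt := tayM tX (tayM (tay_comp hf' tS) hDd).
have [L hL] : exists L : nat, `|x| + 2 * r <= L%:R.
  by exists (Num.truncn (`|x| + 2 * r)).+1; rewrite ltW// truncnS_gt.
have sup : supported (fun t => cutoff x r t * (rho c (S t) * det_grad D t)) L.
  by move=> t Lt; rewrite (cutoff_supported rp hL Lt) mul0r.
by have [C [h _]] := tay_test tt sup; exists L, C.
Qed.

End FiniteZeros.

(** * Flux at infinity *)

Section Decay.
Context {R : realType} {n m : nat}.
Variable a : 'I_m -> 'rV[int]_n.
Hypothesis hspan : affinely_spans a.

Notation N := (1 + n)%N.
Notation G := {ffun 'I_N -> bool}.
Notation lam := (@lam R n m a).
Notation sheet := (@sheet R n m a).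
Notation hmat := (@hmat R n m a).
Notation umat := (@umat R n m a).
Notation tmat := (@tmat R n m a).

Variable Delta : set 'rV[R]_n.
Hypotheses (hn : (0 < n)%N) (hDelta : lattice_polytope Delta) (ha : lattice_points Delta a).
Variable w : G -> bool.
Hypothesis hw : facet_alternating Delta w.
Variable P : 'M[R]_(m, N).
Hypothesis hP : forall x, Yplus a x -> x *m P != 0.
Variables (z0 z1 : 'rV[R]_N) (c : R).
Hypothesis c0 : 0 < c.

Definition segment_pt (s : R) : 'rV[R]_N := z0 + s *: (z1 - z0).

(** [z0 - z1] is the time derivative of [X *m P - segment_pt s], and [tmat X *m P] holds its
    derivatives in the parameters of the sheet. *)
Definition flux_minor (l : 'I_N) (X : 'rV[R]_m) : R :=
  \det (minor_mx (row_mx (z0 - z1)^T (tmat X *m P)^T) (rshift 1 l)).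

Definition sheet_flux l s X : R := rho c (esq (X *m P - segment_pt s)) * flux_minor l X.

Lemma tay_mulmx k p (A : 'M[R]_(k, p)) b : tay (fun x : 'rV[R]_k => (x *m A) 0 b) (fun=> row b A^T).
Proof.
apply: tay_ext (tay_dotv (row b A^T)) => x //.
by rewrite [RHS]mxE; apply: eq_bigr => l _; rewrite !mxE mulrC.
Qed.

(** The expansion is taken in the point [X], which stays bounded where the flux is nonzero even if
    the parameter [t] escapes to infinity. *)
Lemma sheet_flux_tay l : exists D,
  tay (fun x : 'rV[R]_(1 + m) => sheet_flux l (x 0 (lshift m ord0)) (rsubmx x)) D.
Proof.
pose A : 'M[R]_(1 + m, N) := col_mx (z0 - z1) P.
have comp b : tay (fun x : 'rV[R]_(1 + m) => (rsubmx x *m P - segment_pt (x 0 (lshift m ord0))) 0 b)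
    (fun=> row b A^T).
  apply: tay_ext (tayD (tay_mulmx A b) (tay_cst (- z0 0 b))) => x; last by rewrite addr0.
  rewrite -{1}[x]hsubmxK mul_row_col.
  have -> : lsubmx x *m (z0 - z1) = x 0 (lshift m ord0) *: (z0 - z1).
    by apply/rowP => i; rewrite !mxE big_ord1 !mxE.
  move: (rsubmx x *m P) => u; rewrite /segment_pt !mxE; ring.
have ent i j : exists D, tay (fun x : 'rV[R]_(1 + m) =>
    minor_mx (row_mx (z0 - z1)^T (tmat (rsubmx x) *m P)^T) (rshift 1 l) i j) D.
  have [p ->|p ->] := split_ordP i.
    by eexists; apply: tay_ext (tay_cst (delta_mx 0 (rshift 1 l) p j)) => x//; rewrite /minor_mx col_mxEu.
  have [q ->|q ->] := split_ordP j.
    by eexists; apply: tay_ext (tay_cst ((z0 - z1)^T p q)) => x//; rewrite /minor_mx col_mxEd row_mxEl.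
  eexists; apply: tay_ext (tay_lift (tay_mulmx (\matrix_(i, b) (hmat i q * P i b)) p)) => x//.
  rewrite /minor_mx col_mxEd row_mxEr [LHS]mxE [RHS]mxE [RHS]mxE; apply: eq_bigr => k _.
  by rewrite !mxE; ring.
have ent0 i : exists E : 'I_(1 + N) -> 'rV[R]_(1 + m) -> 'rV[R]_(1 + m), forall j, tay (fun x : 'rV[R]_(1 + m) =>
    minor_mx (row_mx (z0 - z1)^T (tmat (rsubmx x) *m P)^T) (rshift 1 l) i j) (E j).
  by have [E hE] := choice (ent i); exists E.
have [E hE] := choice ent0.
have [f' hf] := tay1_rho c.
have tq : tay (fun x : 'rV[R]_(1 + m) => esq (rsubmx x *m P - segment_pt (x 0 (lshift m ord0))))
    (fun x => \sum_b ((rsubmx x *m P - segment_pt (x 0 (lshift m ord0))) 0 b *: row b A^T +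
      (rsubmx x *m P - segment_pt (x 0 (lshift m ord0))) 0 b *: row b A^T)).
  exact: (tay_sum (fun b => tayM (comp b) (comp b))).
by eexists; apply: (tayM (tay_comp hf tq) (tay_det hE)).
Qed.

Lemma lam_bound : exists2 K, 0 < K & forall t j, `|lam t j| <= K * `|t|.
Proof.
have [K K0 hK] := mulmx_bound 1 (hmat^T : 'M[R]_(N, m)).
by exists K => // t j; apply: le_trans (mx_entry_le _ _ _) (hK t).
Qed.

(** Homogeneity reduces the bound to the compact set [Yplus a], where [P] has no zero. *)
Lemma sheet_lower : exists2 k, 0 < k & forall g t, k * `|sheet g t| <= `|sheet g t *m P|.
Proof.
have [K K0 hK] := mulmx_bound 1 P.
pose Q (i : nat) (x : 'rV[R]_m) : Prop := i.+1%:R^-1 <= `|x *m P|.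
have [i hi] : exists i, forall x, Yplus a x -> Q i x.
  apply: (@compact_nat_bound R m (Yplus a) Q) => [|i j x ij h|x Yx]; first exact: Yplus_compact.
    by apply: le_trans h; rewrite lef_pV2 ?posrE// ler_nat ltnS.
  have p0 : 0 < `|x *m P| by rewrite normr_gt0 hP.
  have [k hk] : exists k : nat, (`|x *m P| / 2)^-1 < k.+1%:R.
    by exists (Num.truncn (`|x *m P| / 2)^-1); exact: truncnS_gt.
  exists k, (`|x *m P| / 2 / K); first by rewrite !divr_gt0.
  move=> y; rewrite ltr_pdivlMr// => yx; rewrite /Q.
  have h1 : k.+1%:R^-1 < `|x *m P| / 2 by rewrite invf_plt ?posrE// divr_gt0.
  have h2 := hK (y - x); rewrite mulmxBl in h2.
  have := lerB_dist (x *m P) (y *m P); rewrite distrC.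
  move: h1 h2 yx; rewrite mulrC; move: (k.+1%:R^-1) => q; lra.
exists i.+1%:R^-1; first by rewrite invr_gt0.
move=> g t; have e0 : 0 < enorm (sheet g t) by rewrite enorm_gt0// sheet_row_neq0.
have xE : sheet g t = enorm (sheet g t) *: normalize (sheet g t).
  by rewrite /normalize scalerA divff ?gt_eqF// scale1r.
have Yx : Yplus a (normalize (sheet g t)) := torus_pt_Yplus hspan (torus_pt_normalize hspan g t).
rewrite {2}xE -scalemxAl normrZ gtr0_norm// mulrC; apply: ler_pM => //; last exact: hi.
exact: norm_le_enorm.
Qed.

Lemma rank_col_mx_le p q r (A : 'M[R]_(p, r)) (B : 'M[R]_(q, r)) :
  (\rank (col_mx A B) <= \rank A + \rank B)%N.
Proof. by rewrite -addsmxE; case: (mxrank_adds_leqif A B). Qed.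

(** A rank count: exponents on a face of dimension at most [n - 2] give rank below [n], the time
    column and the unit row add at most one each, and the matrix has size [n + 2]. *)
Lemma flux_minor_eq0 u (X : 'rV[R]_m) l : (\rank (umat u) < n)%N ->
  (forall j, lam u j != 0 -> X 0 j = 0) -> flux_minor l X = 0.
Proof.
move=> rk hX; apply/eqP; rewrite -[_ == 0]negbK -unitfE -unitmxE -row_free_unit -row_leq_rank -ltnNge.
have TE : tmat X = (umat u)^T *m diag_mx X.
  apply/matrixP => i j; rewrite mul_mx_diag !mxE; case: eqVneq => [//|/hX ->].
  by rewrite mulr0 mul0r.
have rT : (\rank (tmat X *m P)^T < n)%N.
  rewrite mxrank_tr; apply: leq_ltn_trans (mxrankM_maxl _ _) _; rewrite TE.
  by apply: leq_ltn_trans (mxrankM_maxl _ _) _; rewrite mxrank_tr.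
have r1 : (\rank (row_mx (z0 - z1)^T (tmat X *m P)^T) <= 1 + \rank (tmat X *m P)^T)%N.
  rewrite -mxrank_tr tr_row_mx trmxK; apply: leq_trans (rank_col_mx_le _ _) _.
  by rewrite mxrank_tr leq_add2r rank_leq_row.
apply: leq_ltn_trans (rank_col_mx_le _ _) _.
apply: (@leq_ltn_trans (1 + (1 + \rank (tmat X *m P)^T))%N); first by rewrite leq_add// rank_leq_row.
by rewrite !ltn_add2l (leq_trans rT)// leqnSn.
Qed.

Lemma alternating_sum (f : G -> R) F b h : is_facet Delta F -> primitive_normal F b h ->
  (forall g, f (gadd g (fvec b h)) = f g) -> \sum_g (-1) ^+ w g * f g = 0.
Proof.
move=> fF pF hf; set S := \sum_g _.
have : S = - S.
  rewrite {1}/S (reindex_inj (h := fun g => gadd g (fvec b h))); last first.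
    by move=> g g' E; rewrite -(gaddK g (fvec b h)) E gaddK.
  by rewrite -sumrN; apply: eq_bigr => g _; rewrite (hw fF pF) hf signrN mulNr.
lra.
Qed.

(** One integer controls the starting radius, the constant and the inverse rate, so that the
    property is monotone in it and fits [compact_nat_bound]. *)
Definition flux_decays (i : nat) (t : 'rV[R]_N) : Prop := forall r s l, i%:R <= r -> 0 <= s <= 1 ->
  `|\sum_g (-1) ^+ w g * sheet_flux l s (sheet g (r *: t))| <= i%:R * expR (- (r / i.+1%:R)).

Lemma flux_decays_mono i j t : (i <= j)%N -> flux_decays i t -> flux_decays j t.
Proof.
move=> ij h r s l jr s01; have ijR : i%:R <= j%:R :> R by rewrite ler_nat.
have r0 : 0 <= r := le_trans (ler0n _ _) jr.
apply: le_trans (h r s l (le_trans ijR jr) s01) _; apply: ler_pM; rewrite ?expR_ge0//.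
by rewrite ler_expR lerN2 ler_wpM2l// lef_pV2 ?posrE// ler_nat ltnS.
Qed.

Lemma segment_pt_norm s : 0 <= s <= 1 -> `|segment_pt s| <= `|z0| + `|z1 - z0|.
Proof.
move=> /andP[s0 s1]; apply: le_trans (ler_normD _ _) _.
by rewrite lerD2l normrZ ger0_norm// ler_piMl.
Qed.

Lemma sheet_flux_support : exists2 B, 0 < B & forall g t l s, 0 <= s <= 1 ->
  B < `|sheet g t| -> sheet_flux l s (sheet g t) = 0.
Proof.
have [k k0 hk] := sheet_lower.
have ci : 0 < c^-1 by rewrite invr_gt0.
have A0 : 0 < `|z0| + `|z1 - z0| + (1 + c^-1) by rewrite ltr_wpDl ?addr_ge0//; lra.
exists ((`|z0| + `|z1 - z0| + (1 + c^-1)) / k); first by rewrite divr_gt0.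
move=> g t l s s01; rewrite ltr_pdivrMr// mulrC => h.
rewrite /sheet_flux rho_eq0 ?mul0r// mulrC -ler_pdivrMr// div1r; apply: le_trans (esq_ge _).
have := hk g t; have := segment_pt_norm s01.
have := lerB_dist (sheet g t *m P) (segment_pt s) => h1 h2 h3.
have h4 : 1 + c^-1 <= `|sheet g t *m P - segment_pt s| by lra.
nra.
Qed.

Lemma sheet_entry_norm g t j : expR (lam t j) <= `|sheet g t|.
Proof. by rewrite -(normr_sheet a g t j) mx_entry_le. Qed.

(* In a direction u with lam u j > 0 the sheets leave the support of rho.
   Otherwise they tend to the stratum {lam u = 0}: over a facet adjacent sheets
   cancel, over a smaller face the minors vanish. *)
Lemma flux_decays_near t : t != 0 -> exists i, exists2 e, 0 < e & forall t', `|t' - t| < e -> flux_decays i t'.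
Proof.
move=> t0; have [K K0 hK] := lam_bound.
have [B B0 hB] := sheet_flux_support.
have lam_near e t' j : `|t' - t| < e / K -> `|lam t' j - lam t j| < e.
  rewrite ltr_pdivlMr// mulrC => h; have := hK (t' - t) j; rewrite lamD lamN => /le_lt_trans; exact.
have [/existsP[j0 j0P]|] := boolP [exists j, 0 < lam t j].
  have [i hi] : exists i : nat, B / (lam t j0 / 2) < i%:R.
    by exists (Num.truncn (B / (lam t j0 / 2))).+1; exact: truncnS_gt.
  have l2 : 0 < lam t j0 / 2 by rewrite divr_gt0.
  exists i, (lam t j0 / 2 / K); first by rewrite divr_gt0.
  move=> t' tt r s l ir s01; rewrite big1 ?normr0 ?mulr_ge0 ?expR_ge0// => g _.
  rewrite hB ?mulr0//; apply: lt_le_trans (sheet_entry_norm g _ j0); rewrite lamZ.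
  have h1 := lam_near _ _ j0 tt; have r0 : 0 <= r := le_trans (ler0n _ _) ir.
  have h2 : lam t j0 / 2 <= lam t' j0 by move: h1; rewrite ltr_norml => /andP[]; lra.
  have h3 : B < r * (lam t j0 / 2) by rewrite -ltr_pdivrMr//; apply: lt_le_trans ir.
  have h4 : r * (lam t j0 / 2) <= r * lam t' j0 by rewrite ler_wpM2l.
  have := expR_ge1Dx (r * lam t' j0); lra.
rewrite negb_exists => /forallP tle; have {}tle j : lam t j <= 0 by rewrite leNgt.
pose f j : R := if lam t j == 0 then 1 else - lam t j / 2.
have [eta eta0 heta] : exists2 eta, 0 < eta & forall j, j \in enum 'I_m -> eta <= f j.
  apply: seq_min => j; rewrite /f; case: eqVneq => // lj.
  by rewrite divr_gt0// oppr_gt0 lt_neqAle lj tle.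
have {}heta j : lam t j != 0 -> 2 * eta <= - lam t j.
  by move=> lj; have := heta j (mem_enum _ _); rewrite /f (negbTE lj); lra.
have hL0 l : exists L, 0 <= L /\ forall s X V, 0 <= s <= 1 -> `|X| <= B -> `|V| <= 1 ->
    `|sheet_flux l s (X + V) - sheet_flux l s X| <= L * `|V|.
  have [D tD] := sheet_flux_tay l; have [L L0 hL] := tay_incr (B + 1) tD.
  exists L; split=> // s X V s01 XB V1.
  have [||_ _] := hL (at_time s X) (at_time 0 V).
  - by apply: at_time_norm; rewrite ?ger0_norm//; lra.
  - by apply: at_time_norm; rewrite ?normr0; lra.
  rewrite at_timeD addr0 !row_mxKr !row_mxEl !mxE => /le_trans; apply.
  by rewrite ler_wpM2l//; apply: at_time_norm; rewrite ?normr0.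
have [L hL] := choice hL0.
pose A := #|G|%:R * \sum_l L l.
have L0 l : L l <= \sum_l L l by rewrite (bigD1 l)//= lerDl sumr_ge0// => k _; exact: (hL k).1.
(* Large enough both for the Lipschitz constant [A] and for the inverse of the decay rate [eta]. *)
have [i hi] : exists i : nat, A + eta^-1 < i%:R.
  by exists (Num.truncn (A + eta^-1)).+1; exact: truncnS_gt.
have A0 : 0 <= A by rewrite mulr_ge0// sumr_ge0// => k _; exact: (hL k).1.
have ei0 : 0 < eta^-1 by rewrite invr_gt0.
exists i, (eta / K); first by rewrite divr_gt0.
move=> t' tt r s l ir s01; have r0 : 0 <= r := le_trans (ler0n _ _) ir.
have off j : lam t j != 0 -> expR (lam (r *: t') j) <= expR (- (r * eta)).
  move=> lj; rewrite ler_expR lamZ -mulrN ler_wpM2l//.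
  have := heta j lj; have := lam_near _ _ j tt; rewrite ltr_norml => /andP[_]; lra.
have rhs0 : 0 <= i%:R * expR (- (r / i.+1%:R)) by rewrite mulr_ge0 ?expR_ge0.
(* Either one coordinate already exceeds [B] and every flux vanishes, or all points stay in the ball
   where the Lipschitz constants hold. *)
have [/existsP[j0 j0P]|] := boolP [exists j, B < expR (lam (r *: t') j)].
  rewrite big1 ?normr0// => g _; rewrite hB ?mulr0//.
  exact: lt_le_trans j0P (sheet_entry_norm g _ j0).
rewrite negb_exists => /forallP XB; have {}XB j : expR (lam (r *: t') j) <= B by rewrite leNgt.
pose X g := sheet g (r *: t').
(* [XS] deletes the coordinates off the limiting face; it lies within [expR (- (r * eta))] of [X],
   and its weighted flux sums to zero. *)
pose XS g : 'rV[R]_m := \row_j if lam t j == 0 then X g 0 j else 0.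
have e1 : expR (- (r * eta)) <= 1 by rewrite -expR0 ler_expR oppr_le0 mulr_ge0// ltW.
have dX g : `|X g - XS g| <= expR (- (r * eta)).
  apply: mx_norm_le => [|p j]; first exact: expR_ge0.
  rewrite (ord1 p); have E (q v : 'rV[R]_m) : (q - v) 0 j = q 0 j - v 0 j by rewrite !mxE.
  rewrite E [XS g 0 j]mxE; case: eqVneq => [_|lj]; first by rewrite subrr normr0 expR_ge0.
  by rewrite subr0 normr_sheet; exact: off.
have XSB g : `|XS g| <= B.
  apply: mx_norm_le => [|p j]; first exact: ltW.
  by rewrite mxE; case: ifP => _; rewrite ?normr0 ?(ltW B0)// normr_sheet.
have fl g : `|sheet_flux l s (X g) - sheet_flux l s (XS g)| <= L l * expR (- (r * eta)).
  have := (hL l).2 s (XS g) (X g - XS g) s01 (XSB g) (le_trans (dX g) e1).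
  rewrite [XS g + _]addrC subrK => /le_trans; apply; rewrite ler_wpM2l//; exact: (hL l).1.
have S0 : \sum_g (-1) ^+ w g * sheet_flux l s (XS g) = 0.
  have [rk|rk] := ltnP (\rank (umat t)) n.
    rewrite big1// => g _; rewrite /sheet_flux (flux_minor_eq0 l rk) ?mulr0// => j /negbTE lj.
    by rewrite mxE lj.
  have rkn : \rank (umat t) = n.
    apply/eqP; rewrite eqn_leq rk andbT; have := rank_leq_col (umat t); rewrite leq_eqVlt.
    by case/orP => [/eqP/umat_full/eqP|]; rewrite ?(negbTE t0)// add1n ltnS.
  have [b [h [pb bF fF pF]]] := facet_normal hn hDelta ha tle rkn.
  apply: (alternating_sum fF pF) => g; congr (sheet_flux l s _).
  apply/rowP => j; rewrite !mxE; case: eqVneq => // lj.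
  by rewrite (facet_gadd g bF lj).
have -> : \sum_g (-1) ^+ w g * sheet_flux l s (sheet g (r *: t')) =
    \sum_g (-1) ^+ w g * (sheet_flux l s (X g) - sheet_flux l s (XS g)).
  under [RHS]eq_bigr do rewrite mulrBr.
  by rewrite sumrB S0 subr0.
apply: le_trans (ler_norm_sum _ _ _) _.
apply: (@le_trans _ _ (A * expR (- (r * eta)))).
  rewrite /A -mulrA mulr_natl -sumr_const; apply: ler_sum => g _.
  rewrite normrM normr_sign mul1r; apply: le_trans (fl g) _.
  by rewrite ler_wpM2r ?expR_ge0.
apply: ler_pM; rewrite ?expR_ge0//; first lra.
rewrite ler_expR lerN2 ler_wpM2l// invf_ple ?posrE//.
by rewrite -natr1; lra.
Qed.

Lemma flux_decay : exists i : nat, forall t s l, i%:R <= `|t| -> 0 <= s <= 1 ->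
  `|\sum_g (-1) ^+ w g * sheet_flux l s (sheet g t)| <= i%:R * expR (- (`|t| / i.+1%:R)).
Proof.
have cK : compact [set t : 'rV[R]_N | `|t| = 1].
  apply: bounded_closed_compact.
    by exists 1; split; [rewrite num_real|move=> e e1 x /= ->; exact: ltW].
  apply: (closed_comp (f := fun x : 'rV[R]_N => `|x|) (D := [set y | y = 1])); last exact: closed_eq.
  by move=> x _; exact: norm_continuous.
have [i hi] : exists i, forall t, [set t : 'rV[R]_N | `|t| = 1] t -> flux_decays i t.
  apply: (compact_nat_bound cK) => [i j t|t t1]; first exact: flux_decays_mono.
  by apply: flux_decays_near; rewrite -normr_eq0 t1 oner_eq0.
(* At [t = 0] the hypothesis forces [i = 0], and any unit direction with radius 0 gives the
   bound. *)
exists i => t s l it s01; have [t0|t0] := eqVneq t 0.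
  have := it; rewrite t0 normr0 => i0.
  have h : flux_decays i (delta_mx 0 (lshift n ord0)).
    apply: hi; rewrite /=; apply/eqP; rewrite eq_le; apply/andP; split.
      by apply: mx_norm_le => // p q; rewrite mxE; case: (_ && _); rewrite ?normr1 ?normr0.
    by have := mx_entry_le (delta_mx 0 (lshift n ord0) : 'rV[R]_N) 0 (lshift n ord0); rewrite mxE !eqxx normr1.
  by have := h 0 s l i0 s01; rewrite scale0r.
have n0 : 0 < `|t| by rewrite normr_gt0.
have /hi h : `| `|t|^-1 *: t| = 1 by rewrite normrZ normfV normr_id mulVf ?gt_eqF.
have E : `|t| *: (`|t|^-1 *: t) = t by rewrite scalerA divff ?scale1r// gt_eqF.
by have := h `|t| s l it s01; rewrite E.
Qed.

End Decay.

(** [expR (- y) <= y^-1] at [y = k * d / N.+1], raised to the power [N.+1], outweighs the growth of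
    order [k ^ N]. *)
Lemma expR_poly_small (R : realType) (d A e : R) (N : nat) : 0 < d -> 0 <= A -> 0 < e ->
  exists k0 : nat, forall k : nat, (k0 <= k)%N -> A * expR (- (k%:R * d)) * (k.*2.*2.+1)%:R ^+ N < e.
Proof.
move=> d0 A0 e0; pose B := A * 5 ^+ N * (N.+1%:R / d) ^+ N.+1.
have B0 : 0 <= B by rewrite !mulr_ge0// exprn_ge0// divr_ge0// ltW.
exists (Num.truncn (B / e)).+1 => k kk.
have k1 : (0 < k)%N by apply: leq_trans kk.
have kp : 0 < k%:R :> R by rewrite ltr0n.
have kB : B < k%:R * e.
  by rewrite -ltr_pdivrMr//; apply: lt_le_trans (truncnS_gt _) _; rewrite ler_nat.
have E1 : expR (- (k%:R * d)) <= ((N.+1%:R / d) / k%:R) ^+ N.+1.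
  have -> : - (k%:R * d) = N.+1%:R * - (k%:R * d / N.+1%:R).
    by rewrite mulrN [_ * (_ / _)]mulrC divfK ?pnatr_eq0.
  rewrite expRM_natl lerXn2r ?nnegrE ?expR_ge0//.
    by rewrite !divr_ge0// ltW.
  have y0 : 0 < k%:R * d / N.+1%:R by rewrite divr_gt0// mulr_gt0.
  rewrite expRN; have -> : N.+1%:R / d / k%:R = (k%:R * d / N.+1%:R)^-1.
    by rewrite !invfM invrK; ring.
  by rewrite lef_pV2 ?posrE ?expR_gt0//; apply: le_trans (expR_ge1Dx _); rewrite lerDr.
have E2 : (k.*2.*2.+1)%:R ^+ N <= (5 * k%:R) ^+ N :> R.
  by rewrite lerXn2r ?nnegrE// -natrM ler_nat; lia.
apply: (@le_lt_trans _ _ (A * ((N.+1%:R / d) / k%:R) ^+ N.+1 * (5 * k%:R) ^+ N)).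
  by apply: ler_pM; rewrite ?exprn_ge0// ?mulr_ge0 ?expR_ge0// ler_wpM2l.
have -> : A * ((N.+1%:R / d) / k%:R) ^+ N.+1 * (5 * k%:R) ^+ N = B / k%:R.
  rewrite /B expr_div_n exprMn [k%:R ^+ N.+1]exprSr invfM.
  have kn : k%:R ^+ N != 0 :> R by rewrite expf_neq0// gt_eqF.
  have F (x y q p i : R) : q != 0 -> x * (y * (q^-1 * i)) * (p * q) = x * p * y * i.
    by move=> q0; field.
  by rewrite [(5 * _) ^+ N]exprMn; exact: F.
by rewrite ltr_pdivrMr// mulrC.
Qed.

(** * Constancy of the signed count over all sheets *)

Section GlobalDegree.
Context {R : realType} {n m : nat}.
Variable a : 'I_m -> 'rV[int]_n.
Hypothesis hspan : affinely_spans a.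

Notation N := (1 + n)%N.
Notation G := {ffun 'I_N -> bool}.
Notation lam := (@lam R n m a).
Notation sgn := (@sgn R n m a).
Notation sheet := (@sheet R n m a).
Notation hmat := (@hmat R n m a).
Notation tmat := (@tmat R n m a).

Variable Delta : set 'rV[R]_n.
Hypotheses (hn : (0 < n)%N) (hDelta : lattice_polytope Delta) (ha : lattice_points Delta a).
Variable w : G -> bool.
Hypothesis hw : facet_alternating Delta w.
Variable P : 'M[R]_(m, N).
Hypothesis hP : forall x, Yplus a x -> x *m P != 0.

Definition psi g z b t : R := (sheet g t *m P - z) 0 b.
Definition dpsi g b t : 'rV[R]_N := row b (tmat (sheet g t) *m P)^T.

Lemma smooth_psi g z b : smooth (psi g z b) (dpsi g b).
Proof.
pose f j t := (sgn g j * P j b) * expR (dotv (row j hmat) t).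
pose d j t := (sgn g j * P j b) *: (expR (dotv (row j hmat) t) *: row j hmat).
have h j : smooth (f j) (d j) by exact: smoothZ (smooth_expR_dotv _).
have lE t j : dotv (row j hmat) t = lam t j.
  by rewrite [RHS]mxE; apply: eq_bigr => i _; rewrite !mxE mulrC.
apply: smooth_ext (smoothD (smooth_sum h) (smooth_cst (- z 0 b))) => t.
  have E (u v : 'rV[R]_N) : (u - v) 0 b = u 0 b - v 0 b by rewrite !mxE.
  rewrite /psi E; congr (_ - _); rewrite mxE; apply: eq_bigr => j _.
  by rewrite /f lE [sheet _ _ _ _]mxE; ring.
rewrite addr0; apply/rowP => l; rewrite summxE /dpsi mxE mxE mxE; apply: eq_bigr => j _.
by rewrite /d lE mxE mxE [row _ _ _ _]mxE [tmat _ _ _]mxE [sheet _ _ _ _]mxE; ring.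
Qed.

Lemma det_grad_psi g t : det_grad (dpsi g) t = \det (tmat (sheet g t) *m P).
Proof.
by rewrite -det_tr /det_grad; congr (\det _); apply/matrixP => b l; rewrite mxE [LHS]mxE.
Qed.

(** The last clause is properness: approximate solutions on all sheets stay bounded, so none is lost
    at infinity. *)
Definition zero_lists z (T : G -> seq 'rV[R]_N) : Prop :=
  [/\ forall g, uniq (T g), forall g t, t \in T g <-> sheet g t *m P = z,
      forall g t, t \in T g -> \det (tmat (sheet g t) *m P) != 0
    & exists r0, exists2 e0, 0 < e0 & forall g t, esq (sheet g t *m P - z) < e0 -> `|t| <= r0].

Definition zero_count (T : G -> seq 'rV[R]_N) : R :=
  \sum_g (-1) ^+ w g * \sum_(t <- T g) Num.sg (\det (tmat (sheet g t) *m P)).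

Variable I : ('rV[R]_N -> R) -> R.
Hypothesis hI : integral_like I.

(* Heinz's integral for the signed number of zeros of the weighted sheets. *)
Definition degree_integral z (k : nat) c : R :=
  I (fun t => \sum_g (-1) ^+ w g * (cutoff 0 k%:R t * (rho c (\sum_b psi g z b t ^+ 2) * det_grad (dpsi g) t))).

Lemma degree_integral_value z T : zero_lists z T -> exists k0 : nat, exists2 c0, 0 < c0 &
  forall (k : nat) c, (k0 <= k)%N -> c0 <= c ->
    degree_integral z k c = zero_count T * I (fun t => rho c (esq t)).
Proof.
move=> [uT TP dT [r0 [e0 e00 hr]]].
have hg g : exists k0 : nat, exists c0, 0 < c0 /\ forall (k : nat) c, (k0 <= k)%N -> c0 <= c ->
    I (fun t => cutoff 0 k%:R t * (rho c (\sum_b psi g z b t ^+ 2) * det_grad (dpsi g) t)) =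
    \sum_(t <- T g) Num.sg (det_grad (dpsi g) t) * I (fun t => rho c (esq t)).
  have [t|t tT|t|k0 [c0 c00 h]] := finite_zeros hI (smooth_psi g z) (uT g) _ _ e00 (r0 := r0).
  - split=> [/TP h b|h]; first by rewrite /psi h subrr mxE.
    by apply/TP/eqP; rewrite -subr_eq0; apply/eqP/rowP => b; rewrite [RHS]mxE; exact: h.
  - by rewrite det_grad_psi; exact: dT.
  - exact: hr.
  by exists k0, c0.
have [k1 hk1] := choice hg; have [c1 hc1] := choice hk1.
have [c2 c20 hc2] := seq_bound (enum G) c1.
exists (\max_g k1 g).+1, c2 => // k c kk cc.
have k0 : (0 < k)%N by apply: leq_trans kk.
have kp : 0 < k%:R :> R by rewrite ltr0n.
rewrite /degree_integral (int_sum_test hI) => [|g]; last first.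
  have [f' hf'] := tay1_rho c; have [DX [tX _ _]] := cutoff_tay (0 : 'rV[R]_N) kp.
  have [E hE] : exists E, tay (det_grad (dpsi g)) E.
    by apply: tay_det_grad => b j; exact: smooth_tay_hess (smooth_psi g z b) j.
  have tS : tay (fun x => \sum_b psi g z b x ^+ 2)
      (fun x => \sum_b (psi g z b x *: dpsi g b x + psi g z b x *: dpsi g b x)).
    by apply: tay_sum => b; exact: (tayM (smooth_psi g z b).1 (smooth_psi g z b).1).
  have tt := tayZ ((-1) ^+ w g) (tayM tX (tayM (tay_comp hf' tS) hE)).
  have hL : `|0 : 'rV[R]_N| + 2 * k%:R <= k.*2%:R by rewrite normr0 add0r -mul2n natrM.
  have sup : supported (fun t => (-1) ^+ w g * (cutoff 0 k%:R t * (rho c (\sum_b psi g z b t ^+ 2) * det_grad (dpsi g) t))) k.*2.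
    by move=> t Lt; rewrite (cutoff_supported kp hL Lt) mul0r mulr0.
  by have [C [h _]] := tay_test tt sup; exists k.*2, C.
rewrite /zero_count mulr_suml; apply: eq_bigr => g _.
have -> : I (fun t => (-1) ^+ w g * (cutoff 0 k%:R t * (rho c (\sum_b psi g z b t ^+ 2) * det_grad (dpsi g) t))) =
   (-1) ^+ w g * I (fun t => cutoff 0 k%:R t * (rho c (\sum_b psi g z b t ^+ 2) * det_grad (dpsi g) t)).
  have [f' hf'] := tay1_rho c; have [DX [tX _ _]] := cutoff_tay (0 : 'rV[R]_N) kp.
  have [E hE] : exists E, tay (det_grad (dpsi g)) E.
    by apply: tay_det_grad => b j; exact: smooth_tay_hess (smooth_psi g z b) j.
  have tS : tay (fun x => \sum_b psi g z b x ^+ 2)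
      (fun x => \sum_b (psi g z b x *: dpsi g b x + psi g z b x *: dpsi g b x)).
    by apply: tay_sum => b; exact: (tayM (smooth_psi g z b).1 (smooth_psi g z b).1).
  have tt := tayM tX (tayM (tay_comp hf' tS) hE).
  have hL : `|0 : 'rV[R]_N| + 2 * k%:R <= k.*2%:R by rewrite normr0 add0r -mul2n natrM.
  have sup : supported (fun t => cutoff 0 k%:R t * (rho c (\sum_b psi g z b t ^+ 2) * det_grad (dpsi g) t)) k.*2.
    by move=> t Lt; rewrite (cutoff_supported kp hL Lt) mul0r.
  by have [C [h _]] := tay_test tt sup; rewrite (intZ hI _ h).
rewrite (hc1 g).2; last 2 first.
- by apply: leq_trans (ltnW kk); exact: leq_bigmax.
- by apply: le_trans cc; apply: hc2; rewrite mem_enum.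
rewrite -mulrA mulr_suml; congr (_ * _); apply: eq_bigr => t _; by rewrite det_grad_psi.
Qed.

(** The derivative of the cutoff lives where [|t| >= k / N]; there the weighted flux is
    exponentially small, which beats the volume of the box. *)
Lemma degree_integral_const z0 z1 c e : 0 < c -> 0 < e -> exists k0 : nat, forall k : nat, (k0 <= k)%N ->
  `|degree_integral z1 k c - degree_integral z0 k c| < e.
Proof.
move=> c0 e0; have [i hi] := flux_decay hspan hn hDelta ha hw hP z0 z1 c0.
have N0 : 0 < N%:R :> R by rewrite ltr0n.
have i0 : 0 < i.+1%:R :> R by [].
(* [d] is the decay rate in [k], since [|t| >= k / N]; in [A] below, 16 bounds the cutoff derivative
   and [N] counts the directions [l]. *)
pose d : R := (N%:R * i.+1%:R)^-1; have d0 : 0 < d by rewrite invr_gt0 mulr_gt0.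
pose A : R := N%:R * (16 * i%:R); have A0 : 0 <= A by rewrite !mulr_ge0.
have [k0 hk0] := expR_poly_small N d0 A0 e0.
exists (maxn k0 (i * N).+1) => k; rewrite geq_max => /andP[kk0 kN].
have k1 : (0 < k)%N by apply: leq_trans kN.
have kp : 0 < k%:R :> R by rewrite ltr0n.
have k1' : 1 <= k%:R :> R by rewrite ler1n.
have [DX [tX DX0 DXb]] := cutoff_tay (0 : 'rV[R]_N) kp.
have hL : `|0 : 'rV[R]_N| + 2 * k%:R <= k.*2%:R by rewrite normr0 add0r -mul2n natrM.
apply: le_lt_trans (hk0 k kk0).
apply: (homotopy_family hI (D := fun g => dpsi g) (D' := fun g => dpsi g)
  (fun g => smooth_psi g z0) (fun g => smooth_psi g z1) tX (cutoff_supported kp hL)) => s t s01.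
have pE g : path_sq (psi g z0) (psi g z1) s t = esq (sheet g t *m P - segment_pt z0 z1 s).
  apply: eq_bigr => b _; congr (_ ^+ 2); rewrite /psi /segment_pt.
  by move: (sheet g t *m P) => u; rewrite !mxE; ring.
have mE g l : \det (minor_mx (path_mx (psi g z0) (psi g z1) (dpsi g) (dpsi g) s t) (rshift 1 l)) =
    flux_minor a P z0 z1 l (sheet g t).
  congr (\det (minor_mx _ _)); apply/matrixP => b j; rewrite mxE.
  have [p ->|p ->] := split_ordP j.
    rewrite !row_mxEl (ord1 p) /psi; move: (sheet g t *m P) => u; rewrite !mxE; ring.
  by rewrite !row_mxEr subrr scaler0 addr0 /dpsi mxE.
have -> : \sum_g (-1) ^+ w g * (rho c (path_sq (psi g z0) (psi g z1) s t) *
   \sum_l DX t 0 l * \det (minor_mx (path_mx (psi g z0) (psi g z1) (dpsi g) (dpsi g) s t) (rshift 1 l))) =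
   \sum_l DX t 0 l * \sum_g (-1) ^+ w g * sheet_flux a P z0 z1 c l s (sheet g t).
  under [RHS]eq_bigr do rewrite mulr_sumr.
  rewrite [RHS]exchange_big/=; apply: eq_bigr => g _; rewrite pE !mulr_sumr.
  by apply: eq_bigr => l _; rewrite mE /sheet_flux; ring.
have B0 : 0 <= A * expR (- (k%:R * d)) by rewrite mulr_ge0 ?expR_ge0.
have [E|/andP[q1 _]] := DX0 t.
  by rewrite big1 ?normr0// => l _; rewrite E mxE mul0r.
rewrite subr0 in q1.
have tk : k%:R / N%:R <= `|t|.
  rewrite ler_pdivrMr// leNgt; apply/negP => h.
  have t0 := normr_ge0 t.
  have N1 : 1 <= N%:R :> R by rewrite ler1n.
  have : (`|t| * N%:R) ^+ 2 <= k%:R ^+ 2 by rewrite lerXn2r ?nnegrE ?mulr_ge0// ltW.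
  rewrite exprMn => h2; have := esq_le t; have := lt_trans q1; have := sqr_ge0 `|t|; nra.
have it : i%:R <= `|t|.
  by apply: le_trans tk; rewrite ler_pdivlMr// -natrM ler_nat ltnW.
apply: le_trans (ler_norm_sum _ _ _) _.
have -> : A * expR (- (k%:R * d)) = \sum_(l < N) 16 * (i%:R * expR (- (k%:R * d))).
  by rewrite sumr_const card_ord -mulr_natl /A; ring.
apply: ler_sum => l _; rewrite normrM; apply: ler_pM => //.
  apply: le_trans (DXb t l) _; rewrite ler_pdivrMr// ler_peMr//.
apply: le_trans (hi t s l it s01) _; rewrite ler_wpM2l// ler_expR lerN2.
rewrite /d invfM mulrA ler_wpM2r// invr_ge0 ltW//.
Qed.

(** With [c] fixed, each count times the positive number [I0] is the integral for all large [k], and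
    the two integrals become arbitrarily close as [k] grows. *)
Lemma zero_count_const z0 z1 T0 T1 : zero_lists z0 T0 -> zero_lists z1 T1 ->
  zero_count T0 = zero_count T1.
Proof.
move=> /degree_integral_value[k0 [c0 c00 h0]] /degree_integral_value[k1 [c1 c10 h1]].
pose c := c0 + c1; have cp : 0 < c by rewrite addr_gt0.
pose I0 := I (fun t => rho c (esq t)).
have N0 : 0 < N%:R :> R by rewrite ltr0n.
have I00 : 0 < I0.
  have ci : 0 < c^-1 by rewrite invr_gt0.
  have tst : test (fun t : 'rV[R]_N => rho c (esq t)) (Num.truncn (1 + c^-1)).+1 1.
    split=> t.
      move=> tL; rewrite rho_eq0// -ler_pdivrMl// mulr1; apply: le_trans (esq_ge _).
      have : 1 + c^-1 < `|t| by apply: lt_trans tL; exact: truncnS_gt.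
      by nra.
    by rewrite ger0_norm ?rho_ge0// rho_le1// mulr_ge0 ?esq_ge0// ltW.
  have q0 : 0 <= 2 * (c * N%:R) by rewrite !mulr_ge0// ltW.
  (* This [q] ensures [c * esq t <= 1 / 2] on the box of radius [1 / q.+1], where [rho] is therefore
     at least [1 / 4]. *)
  apply: (int_gt0 hI (c := 4^-1) (q := Num.truncn (2 * (c * N%:R))) tst) => [t||t tq]; first exact: rho_ge0.
    by rewrite invr_gt0.
  apply: rho_ge; set q := Num.truncn _ in tq.
  have hq : 2 * (c * N%:R) < q.+1%:R by exact: truncnS_gt.
  have q1 : 0 < q.+1%:R :> R by [].
  have t1 : `|t| <= 1 by apply: le_trans tq _; rewrite invf_le1// ler1n.
  have t2 : `|t| ^+ 2 <= `|t| by rewrite expr2 ler_piMl.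
  have e1 := esq_le t.
  have h2 : c * esq t <= c * (N%:R * `|t|).
    by rewrite ler_pM2l//; apply: le_trans e1 _; rewrite ler_pM2l.
  apply: le_trans h2 _; rewrite mulrA.
  have h3 : c * N%:R * `|t| <= c * N%:R * q.+1%:R^-1 by rewrite ler_pM2l// mulr_gt0.
  apply: le_trans h3 _; rewrite ler_pdivrMr//; lra.
apply/eqP; rewrite -subr_eq0 -normr_eq0 eq_le normr_ge0 andbT; apply/ler_addgt0Pr => e e0; rewrite add0r.
have eI : 0 < e * I0 by rewrite mulr_gt0.
have [k2 hk2] := degree_integral_const z0 z1 cp eI.
pose k := maxn (maxn k0 k1) k2.
have [l0 l1 l2] : [/\ (k0 <= k)%N, (k1 <= k)%N & (k2 <= k)%N] by rewrite /k; split; lia.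
have cc0 : c0 <= c by rewrite lerDl ltW.
have cc1 : c1 <= c by rewrite lerDr ltW.
have := hk2 k l2; rewrite (h1 _ _ l1 cc1) (h0 _ _ l0 cc0) -mulrBl normrM (gtr0_norm I00).
by rewrite ltr_pM2r// distrC => /ltW.
Qed.

End GlobalDegree.

Lemma near_sign (R : realType) (u v : R) : `|u - v| < `|v| -> (0 < u) = (0 < v).
Proof.
case: (ltrgtP 0 v) => [v0|v0|<-]; last by rewrite normr0 normr_lt0.
  by rewrite (gtr0_norm v0) ltr_norml => /andP[h _]; lra.
by rewrite (ltr0_norm v0) ltr_norml => /andP[_ h]; apply/negbTE; rewrite -leNgt; lra.
Qed.

Lemma near_neq0 (R : realType) (u v : R) : `|u - v| < `|v| -> u != 0.
Proof. by apply: contraTneq => ->; rewrite sub0r normrN ltxx. Qed.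

(** * The projection to the sphere *)

Section Sphere.
Context {R : realType}.

Lemma differentiable_sqsum k (x : 'rV[R]_k) : differentiable (fun y : 'rV[R]_k => \sum_i y 0 i ^+ 2 : R) x.
Proof.
have -> : (fun y : 'rV[R]_k => \sum_i y 0 i ^+ 2 : R) = \sum_i (fun y : 'rV[R]_k => y 0 i ^+ 2 : R).
  by apply/funext => y; rewrite fct_sumE.
apply: differentiable_sum => i.
exact: (@differentiableX R _ (fun y : 'rV[R]_k => y 0 i : R) 1 x (differentiable_coord _ _ _)).
Qed.

Lemma differentiable_enorm k (x : 'rV[R]_k) : x != 0 -> differentiable (@enorm R k : 'rV[R]_k -> R) x.
Proof.
move=> x0; apply: (@differentiable_comp _ _ _ _ (fun y : 'rV[R]_k => \sum_i y 0 i ^+ 2 : R) Num.sqrt).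
  exact: differentiable_sqsum.
apply/derivable1_diffP; have h : 0 < \sum_i x 0 i ^+ 2 by rewrite -enorm_sq exprn_gt0// enorm_gt0.
by case: (is_derive1_sqrt h).
Qed.

Lemma differentiable_normalize k (x : 'rV[R]_k) : x != 0 -> differentiable (@normalize R k) x.
Proof.
move=> x0; have -> : @normalize R k = \sum_i (fun y : 'rV[R]_k => ((enorm y)^-1 * y 0 i) *: (delta_mx 0 i : 'rV[R]_k)).
  apply/funext => y; rewrite fct_sumE [LHS]row_sum_delta; apply: eq_bigr => i _.
  by rewrite mxE.
apply: differentiable_sum => i; apply: differentiableZl; apply: (@differentiableM R 'rV[R]_k (fun y => (enorm y)^-1) (fun y => y 0 i)).
  by apply: differentiableV; [exact: differentiable_enorm|rewrite gt_eqF// enorm_gt0].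
exact: differentiable_coord.
Qed.

Lemma is_derive_dot k (c c' : R -> 'rV[R]_k) s u u' : is_derive s (1 : R) c u -> is_derive s (1 : R) c' u' ->
  is_derive s (1 : R) (fun t => (c t *m (c' t)^T) 0 0) ((u *m (c' s)^T) 0 0 + (c s *m u'^T) 0 0).
Proof.
move=> /is_derive_mxP h /is_derive_mxP h'.
have -> : (fun t => (c t *m (c' t)^T) 0 0) = \sum_i (fun t => c t 0 i * c' t 0 i).
  by apply/funext => t; rewrite fct_sumE mxE; apply: eq_bigr => i _; rewrite mxE.
have -> : (u *m (c' s)^T) 0 0 + (c s *m u'^T) 0 0 = \sum_i (c s 0 i *: u' 0 i + c' s 0 i *: u 0 i).
  rewrite mxE [X in _ + X]mxE -big_split; apply: eq_bigr => i _; rewrite !mxE /=.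
  by rewrite addrC; congr (_ + _); rewrite mulrC.
by apply: is_derive_sum => i; apply: is_deriveM.
Qed.

Lemma unit_dot k (x : 'rV[R]_k) : enorm x = 1 -> (x *m x^T) 0 0 = 1.
Proof.
move=> x1; rewrite mxE -[RHS](expr1n _ 2) -x1 enorm_sq; apply: eq_bigr => i _.
by rewrite mxE expr2.
Qed.

Lemma tangent_sphere k (z v : 'rV[R]_k) : tangent (unit_sphere (k := k)) z v -> v *m z^T = 0.
Proof.
move=> [c [c0 nr dc]]; have dd := is_derive_dot dc dc.
have d1 : is_derive (0 : R) (1 : R) (fun t => (c t *m (c t)^T) 0 0) 0.
  have Hc : is_derive (0 : R) (1 : R) (fun=> 1 : R) 0.
    by apply/is_deriveP => e e0; exists 1 => // h _; rewrite scaler0 subrr subr0 normr0 mulr_ge0// ltW.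
  by apply: is_derive_near Hc; apply: filterS nr => t ct; rewrite unit_dot.
have := is_derive_inj dd d1; rewrite c0.
have -> : (z *m v^T) 0 0 = (v *m z^T) 0 0.
  by rewrite !mxE; apply: eq_bigr => i _; rewrite !mxE mulrC.
by move=> h; apply/matrixP => i j; rewrite (ord1 i) (ord1 j) [RHS]mxE; lra.
Qed.

Lemma normalize_scale k (x : 'rV[R]_k) : enorm x *: normalize x = x.
Proof.
have [->|x0] := eqVneq x 0; first by rewrite /normalize !scaler0.
by rewrite /normalize scalerA divff ?scale1r// gt_eqF// enorm_gt0.
Qed.

Lemma normalize_tangent k (x v : 'rV[R]_k) : x != 0 ->
  tangent (unit_sphere (k := k)) (normalize x) (v *m jacobian (@normalize R k) x).
Proof.
move=> x0; have dn := differentiable_normalize x0.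
exists (fun s => normalize (x + s *: v)); split; first by rewrite scale0r addr0.
  have cc : {for 0, continuous (fun s : R => x + s *: v)}.
    apply/continuous_mxP => i j.
    apply: (@continuous_at_eq _ _ _ (fun s : R => x i j + s * v i j)); first by move=> t; rewrite !mxE.
    apply: (@continuousD _ R^o); first exact: cst_continuous.
    by apply: continuousM; [exact: cvg_id|exact: cst_continuous].
  have nx : nbhs ((fun s : R => x + s *: v) 0) [set y | y != 0].
    rewrite scale0r addr0; apply/(@near_normP R 'rV[R]_k); exists `|x|; first by rewrite normr_gt0.
    by move=> y yx; apply: contraTneq yx => ->; rewrite sub0r normrN ltxx.
  by apply: filterS (near_continuous cc nx) => s sx; exact: enorm_normalize.
have := @is_derive_line R k k (@normalize R k) x v 0.
by rewrite scale0r addr0; apply.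
Qed.

(** Differentiate [x = enorm x *: normalize x]; the radial coefficient is found by pairing with [z],
    to which tangent vectors of the sphere are orthogonal. *)
Lemma jacobian_normalize k (x v : 'rV[R]_k) : x != 0 -> let z := normalize x in
  v = enorm x *: (v *m jacobian (@normalize R k) x) + (v *m z^T) 0 0 *: z.
Proof.
move=> x0 z; have dn := differentiable_normalize x0.
have z1 : enorm z = 1 := enorm_normalize x0.
have l0 : x = x + (0 : R) *: v by rewrite scale0r addr0.
have dz : is_derive (0 : R) (1 : R) (fun s => normalize (x + s *: v)) (v *m jacobian (@normalize R k) x).
  have := @is_derive_line R k k (@normalize R k) x v 0.
  by rewrite scale0r addr0; apply.
have dl : is_derive (0 : R) (1 : R) (fun s : R => x + s *: v) v.
  apply/is_deriveP => e e0; exists 1 => // h _.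
  have -> : x + (0 + h) *: v - (x + 0 *: v) - h *: v = 0.
    by apply/rowP => i; rewrite !mxE; ring.
  by rewrite normr0 mulr_ge0// ltW.
have [r dr] : exists r : R, is_derive (0 : R) (1 : R) (fun s => enorm (x + s *: v)) r.
  have : derivable (fun s : R => enorm (x + s *: v)) 0 1.
    apply/derivable1_diffP; apply: (@differentiable_comp _ _ _ _ (fun s : R => x + s *: v) (@enorm R k)).
      by apply/derivable1_diffP; case: dl.
    by rewrite -l0; exact: differentiable_enorm.
  by move=> h; eexists; apply: DeriveDef h erefl.
have dp : is_derive (0 : R) (1 : R) (fun s => enorm (x + s *: v) *: normalize (x + s *: v))
    (enorm x *: (v *m jacobian (@normalize R k) x) + r *: z).
  apply/is_derive_mxP => i j; move/is_derive_mxP/(_ i j): dz => dz.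
  have -> : (fun s => (enorm (x + s *: v) *: normalize (x + s *: v)) i j) =
     (fun s => enorm (x + s *: v)) * (fun s => normalize (x + s *: v) i j).
    by apply/funext => s; rewrite mxE.
  have := is_deriveM dr dz; rewrite -l0 => h; apply: is_derive_eq h _.
  by move: (v *m _) => u; rewrite [RHS]mxE; congr (_ + _); rewrite [RHS]mxE//; exact: mulrC.
have E : v = enorm x *: (v *m jacobian (@normalize R k) x) + r *: z.
  apply: is_derive_inj dl _; have -> : (fun s : R => x + s *: v) =
    (fun s => enorm (x + s *: v) *: normalize (x + s *: v)) by apply/funext => s; rewrite normalize_scale.
  exact: dp.
rewrite {1}E; congr (_ + _ *: _).
rewrite {1}E mulmxDl -scalemxAl (tangent_sphere (normalize_tangent v x0)) scaler0 add0r -scalemxAl mxE.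
by rewrite unit_dot ?mulr1.
Qed.

End Sphere.

Section Projection.
Context {R : realType} {m k : nat}.
Variable P : 'M[R]_(m, k.+1).

Lemma differentiable_mulmx (x : 'rV[R]_m) : differentiable (fun y : 'rV[R]_m => y *m P) x.
Proof.
apply: (linear_differentiable (f := mulmxr P)) => y.
by apply: continuous_mulmx; [exact: cvg_id|exact: cst_continuous].
Qed.

Lemma proj_jacobian (x v : 'rV[R]_m) : x *m P != 0 ->
  v *m jacobian (proj_plus P) x = v *m P *m jacobian (@normalize R k.+1) (x *m P).
Proof.
move=> xP; have dn := differentiable_normalize xP.
have df : differentiable (proj_plus P) x.
  exact: (@differentiable_comp _ _ _ _ (fun y : 'rV[R]_m => y *m P) (@normalize R k.+1) x (differentiable_mulmx x) dn).
have h1 := @is_derive_line R m k.+1 (proj_plus P) x v 0.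
have h2 := @is_derive_line R k.+1 k.+1 (@normalize R k.+1) (x *m P) (v *m P) 0.
rewrite !scale0r !addr0 in h1 h2; have {}h1 := h1 df; have {}h2 := h2 dn.
apply: is_derive_inj h1 _; have -> : (fun s : R => proj_plus P (x + s *: v)) =
    (fun s : R => normalize (x *m P + s *: (v *m P))).
  by apply/funext => s; rewrite /proj_plus mulmxDl -scalemxAl.
exact: h2.
Qed.

Lemma proj_jacobian_mx d (x : 'rV[R]_m) (B : 'M[R]_(d, m)) : x *m P != 0 ->
  B *m jacobian (proj_plus P) x = B *m P *m jacobian (@normalize R k.+1) (x *m P).
Proof.
by move=> xP; apply/row_matrixP => i; rewrite !row_mul proj_jacobian.
Qed.

End Projection.

Section SphereFrames.
Context {R : realType} {n : nat}.
Notation N := (1 + n)%N.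
Notation S := (unit_sphere (k := N) : set 'rV[R]_N).

(** Row operations remove the radial parts of [C]; each of the [N] rows then gives one factor
    [enorm x]. *)
Lemma det_jacobian_normalize (x : 'rV[R]_N) (C : 'M[R]_(n, N)) : x != 0 ->
  \det (col_mx x C) = enorm x ^+ N * \det (col_mx (normalize x) (C *m jacobian (@normalize R N) x)).
Proof.
move=> x0; set z := normalize x; set J := jacobian _ x.
have CE : C = enorm x *: (C *m J) + (C *m z^T) *m z.
  apply/row_matrixP => i; rewrite linearD linearZ /= !row_mul [LHS](jacobian_normalize _ x0).
  congr (_ + _); apply/rowP => j; rewrite [LHS]mxE [RHS]mxE big_ord1; congr (_ * _).
have -> : col_mx x C = block_mx 1%:M 0 ((enorm x)^-1 *: (C *m z^T)) 1%:M *m (enorm x *: col_mx z (C *m J)).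
  rewrite scale_col_mx normalize_scale mul_block_col !mul1mx mul0mx addr0; congr col_mx.
  rewrite {1}CE addrC; congr (_ + _); rewrite -scalemxAl.
  have -> : C *m z^T *m x = enorm x *: (C *m z^T *m z) by rewrite scalemxAr normalize_scale.
  rewrite scalerA mulVf ?scale1r//.
  by rewrite gt_eqF// enorm_gt0.
by rewrite det_mulmx detZ det_lblock !det1 !mul1r.
Qed.

Lemma sphere_frame (z : 'rV[R]_N) (C : 'M[R]_(n, N)) : frame S z C ->
  [/\ enorm z = 1, C *m z^T = 0 & \det (col_mx z C) != 0].
Proof.
move=> [Sz tC fC]; have Cz : C *m z^T = 0.
  by apply/row_matrixP => i; rewrite row_mul row0; apply: tangent_sphere; exact: tC.
split=> //; rewrite -unitfE -unitmxE -row_free_unit; apply: row_free_ker => v.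
rewrite -[v]hsubmxK mul_row_col => E.
have : (lsubmx v *m z + rsubmx v *m C) *m z^T = 0 by rewrite E mul0mx.
rewrite mulmxDl -!mulmxA Cz mulmx0 addr0; have -> : z *m z^T = 1%:M.
  by apply/matrixP => i j; rewrite (ord1 i) (ord1 j) unit_dot// mxE eqxx.
rewrite mulmx1 => v0; move: E; rewrite v0 mul0mx add0r => E.
have -> : rsubmx v = 0 by apply: (row_free_inj fC); rewrite /= E mul0mx.
by rewrite row_mx0.
Qed.

Lemma frame_of_det (x : 'rV[R]_N) (C : 'M[R]_(n, N)) : x != 0 -> \det (col_mx x C) != 0 ->
  frame S (normalize x) (C *m jacobian (@normalize R N) x).
Proof.
move=> x0; rewrite det_jacobian_normalize// mulf_eq0 negb_or => /andP[_ d0]; split.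
- exact: enorm_normalize.
- by move=> i; rewrite row_mul; exact: normalize_tangent.
- apply: row_free_ker => v E; move: d0; rewrite -unitfE -unitmxE => U.
  have : row_mx 0 v *m col_mx (normalize x) (C *m jacobian (@normalize R N) x) = 0.
    by rewrite mul_row_col mul0mx add0r.
  move/(congr1 (mulmx^~ (invmx (col_mx (normalize x) (C *m jacobian (@normalize R N) x))))).
  by rewrite mulmxK// mul0mx => /(congr1 rsubmx); rewrite row_mxKr linear0.
Qed.

Lemma frame_orthogonal (z : 'rV[R]_N) (C : 'M[R]_(n, N)) : enorm z = 1 -> C *m z^T = 0 ->
  \det (col_mx z C) != 0 -> frame S z C.
Proof.
move=> z1 Cz d0; have z0 : z != 0 by rewrite -enorm_eq0 z1 oner_eq0.
have := frame_of_det z0 d0; rewrite normalize_unit//.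
have -> // : C *m jacobian (@normalize R N) z = C.
apply/row_matrixP => i; rewrite row_mul [RHS](jacobian_normalize _ z0) normalize_unit// z1 scale1r.
have -> : row i C *m z^T = 0 by rewrite -row_mul Cz row0.
by rewrite mxE scale0r addr0.
Qed.

Lemma sphere_frame_exists (z : 'rV[R]_N) : enorm z = 1 -> exists C : 'M[R]_(n, N), frame S z C.
Proof.
move=> z1; have z0 : z != 0 by rewrite -enorm_eq0 z1 oner_eq0.
have [C dC] : exists C : 'M[R]_(n, N), \det (col_mx z C) != 0.
  have rk : \rank (kermx z^T) = n.
    by rewrite mxrank_ker mxrank_tr rank_rV z0 addKn.
  have : forall k, \rank (kermx z^T) = k -> exists B : 'M[R]_(k, N), B *m z^T = 0 /\ row_free B.
    move=> k <-; exists (row_base (kermx z^T)); split; last exact: row_base_free.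
    by apply/sub_kermxP; rewrite eq_row_base.
  move=> /(_ n rk)[C [Cz fC]]; exists C.
  rewrite -unitfE -unitmxE -row_free_unit; apply: row_free_ker => v.
  rewrite -[v]hsubmxK mul_row_col => E.
  have : (lsubmx v *m z + rsubmx v *m C) *m z^T = 0 by rewrite E mul0mx.
  rewrite mulmxDl -!mulmxA Cz mulmx0 addr0; have -> : z *m z^T = 1%:M.
    by apply/matrixP => i j; rewrite (ord1 i) (ord1 j) unit_dot// mxE eqxx.
  rewrite mulmx1 => v0; move: E; rewrite v0 mul0mx add0r => E.
  have -> : rsubmx v = 0 by apply: (row_free_inj fC); rewrite /= E mul0mx.
by rewrite row_mx0.
by exists (C *m jacobian (@normalize R N) z); rewrite -{1}(normalize_unit z1); exact: frame_of_det.
Qed.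

Lemma sphere_frame_change (z : 'rV[R]_N) (C C' : 'M[R]_(n, N)) : frame S z C -> frame S z C' ->
  exists2 A, A \in unitmx & C' = A *m C.
Proof.
move=> fC fC'; have [z1 Cz dC] := sphere_frame fC; have [_ Cz' _] := sphere_frame fC'.
have [_ _ free] := fC; have [_ _ free'] := fC'.
have z0 : z != 0 by rewrite -enorm_eq0 z1 oner_eq0.
have rk : \rank (kermx z^T) = n by rewrite mxrank_ker mxrank_tr rank_rV z0 addKn.
have sC : (C <= kermx z^T)%MS by apply/sub_kermxP.
have eC : (C == kermx z^T)%MS.
  by rewrite -(mxrank_leqif_eq sC).2 rk; move: free; rewrite /row_free => /eqP ->.
have : (C' <= C)%MS by rewrite (eqmxP eC); apply/sub_kermxP.
move=> /submxP[A AE]; exists A => //.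
rewrite -row_free_unit; apply: row_free_ker => v vA.
by apply: (row_free_inj free'); rewrite AE mulmxA vA !mul0mx.
Qed.

Variable oS : 'rV[R]_N -> 'M[R]_(n, N) -> bool.
Hypothesis hoS : orientation S oS.
Hypothesis hn : (0 < n)%N.

Let agrees z (C : 'M[R]_(n, N)) : bool := oS z C == (0 < \det (col_mx z C)).

Lemma sphere_agree_frame z (C C' : 'M[R]_(n, N)) : frame S z C -> frame S z C' -> agrees z C = agrees z C'.
Proof.
move=> fC fC'; have [A Au ->] := sphere_frame_change fC fC'; rewrite /agrees (proj1 hoS _ _ _ fC Au).
have [_ _ d0] := sphere_frame fC.
have -> : col_mx z (A *m C) = block_mx 1%:M 0 0 A *m col_mx z C.
  by rewrite mul_block_col !mul1mx !mul0mx addr0 add0r.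
rewrite det_mulmx det_lblock det1 mul1r.
have dA : \det A != 0 by rewrite -unitfE -unitmxE.
case: (ltrgtP 0 (\det A)) => [a0|a0|a0]; last by rewrite -a0 eqxx in dA.
  by rewrite (pmulr_rgt0 _ a0) eqb_id.
by rewrite (nmulr_rgt0 _ a0); case: (ltrgtP 0 (\det (col_mx z C))) d0; case: (oS z C) => //=.
Qed.

Lemma sphere_agree_path (z y : 'rV[R]_N) (C C' : 'M[R]_(n, N)) :
  (forall s, z + s *: (y - z) != 0) -> frame S z C -> frame S y C' -> agrees z C = agrees y C'.
Proof.
move=> nz fC fC'; have [z1 _ _] := sphere_frame fC; have [y1 _ _] := sphere_frame fC'.
pose x (s : R) := z + s *: (y - z); pose p (s : R) := normalize (x s).
have p1 s : enorm (p s) = 1 := enorm_normalize (nz s).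
have [D fD] := choice (fun s => sphere_frame_exists (p1 s)).
have cx : continuous x.
  move=> s; apply/continuous_mxP => i j.
  apply: (@continuous_at_eq _ _ _ (fun s : R => z i j + s * (y - z) i j)); first by move=> t; rewrite /x; move: (y - z) => u; rewrite !mxE.
  apply: (@continuousD _ R^o); first exact: cst_continuous.
  by apply: continuousM; [exact: cvg_id|exact: cst_continuous].
have cp : continuous p.
  by move=> s; apply: (continuous_comp (cx s)); apply: continuous_normalize; exact: nz.
have loc s : \forall s' \near s, agrees (p s') (D s') = agrees (p s) (D s).
  have [_ Dz dD] := sphere_frame (fD s).
  have /near2_normP[e e0 he] := proj2 hoS _ _ (fD s).
  (* Subtracting the component along [p s'] carries the frame at [s] continuously to frames at
     nearby points; at [s] itself nothing changes. *)
  pose K s' : 'M[R]_(n, N) := D s - (D s *m (p s')^T) *m p s'.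
  have cK : {for s, continuous K}.
    apply/continuous_mxP => i j.
    apply: (@continuous_at_eq _ _ _ (fun s' : R => D s i j - (D s *m (p s')^T *m p s') i j)).
      by move=> t; rewrite /K; move: (_ *m p t) => u; rewrite !mxE.
    apply: (@continuousB _ R^o); first exact: cst_continuous.
    move: i j; apply/continuous_mxP; apply: continuous_mulmx; last exact: cp.
    apply: continuous_mulmx; first exact: cst_continuous.
    apply/continuous_mxP => i j; apply: (@continuous_at_eq _ _ _ (fun s' => p s' j i)); first by move=> t; rewrite mxE.
    by have /continuous_mxP := cp s; apply.
  have Ks : K s = D s by rewrite /K Dz mul0mx subr0.
  have cd : {for s, continuous (fun s' => \det (col_mx (p s') (K s')))}.
    have cc : {for s, continuous (fun s' => col_mx (p s') (K s'))}.
      by apply: (@continuous_col_mx); [exact: cp|exact: cK].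
    exact: continuous_det cc.
  have d0 : 0 < `|\det (col_mx (p s) (K s))| by rewrite normr_gt0 Ks.
  have n1 : nbhs (K s) [set B | `|B - D s| < e].
    by apply/(@near_normP R 'M[R]_(n, N)); exists e => // B; rewrite Ks.
  have n2 : nbhs (p s) [set B | `|B - p s| < e].
    by apply/(@near_normP R 'rV[R]_N); exists e.
  have n3 : nbhs (\det (col_mx (p s) (K s))) [set r : R | `|r - \det (col_mx (p s) (K s))| < `|\det (col_mx (p s) (K s))|].
    by apply/(@near_normP R R^o); exists `|\det (col_mx (p s) (K s))|.
  apply: filterS (filterI (filterI (near_continuous cK n1) (near_continuous (cp s) n2)) (near_continuous cd n3)).
  move=> s' [[/= k1 k2] k3].
  have sgu := near_sign k3.
  have fK : frame S (p s') (K s').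
    apply: frame_orthogonal => //; last exact: near_neq0 k3.
    rewrite /K mulmxBl -[_ *m p s' *m _]mulmxA.
    have -> : p s' *m (p s')^T = 1%:M.
      by apply/matrixP => i j; rewrite (ord1 i) (ord1 j) unit_dot// mxE eqxx.
    by rewrite mulmx1 subrr.
  by rewrite (sphere_agree_frame (fD s') fK) /agrees (he _ _ k2 k1 fK) sgu Ks.
have E := locally_constant_bool loc 0 1.
have x0 : p 0 = z by rewrite /p /x scale0r addr0 normalize_unit.
have x1 : p 1 = y by rewrite /p /x scale1r addrC subrK normalize_unit.
rewrite -x0 in fC *; rewrite -x1 in fC' *.
by rewrite (sphere_agree_frame fC (fD 0)) E (sphere_agree_frame (fD 1) fC').
Qed.

Lemma not_span_exists (z : 'rV[R]_N) : exists y : 'rV[R]_N, ~~ (y <= z)%MS.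
Proof.
have : ~~ ((1%:M : 'M[R]_N) <= z)%MS.
  apply/negP => /mxrankS; rewrite mxrank1 => /leq_trans/(_ (rank_leq_row z)).
  by rewrite add1n ltnS leqn0 ; move: hn; rewrite lt0n => /negbTE ->.
by move=> /row_subPn[i hi]; exists (row i 1%:M).
Qed.

Lemma path_neq0 (z y : 'rV[R]_N) : z != 0 -> ~~ (y <= z)%MS -> forall s, z + s *: (y - z) != 0.
Proof.
move=> z0 yz s; apply: contra yz => /eqP E; have [s0|s0] := eqVneq s 0.
  by move: E; rewrite s0 scale0r addr0 => /eqP; rewrite (negbTE z0).
apply/sub_rVP; exists (- (1 - s) / s); apply: (scalerI s0); rewrite scalerA mulrCA divff// mulr1.
by apply/eqP; rewrite -subr_eq0 -E; apply/eqP/rowP => i; rewrite !mxE; ring.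
Qed.

(** For positive [n] two points can be joined by segments through a third one on neither of the
    lines they span; these avoid the origin and project to paths on the sphere, along which
    agreement with the determinant is constant. *)
Lemma sphere_orientation_sign : exists k : bool, forall z (C : 'M[R]_(n, N)), frame S z C ->
  oS z C = (0 < (-1) ^+ k * \det (col_mx z C)).
Proof.
pose b : 'rV[R]_N := normalize (const_mx 1).
have c0 : const_mx 1 != 0 :> 'rV[R]_N.
  by apply/eqP => /rowP/(_ 0); rewrite !mxE => /eqP; rewrite oner_eq0.
have b1 : enorm b = 1 := enorm_normalize c0.
have [Cb fb] := sphere_frame_exists b1.
have neq (z : 'rV[R]_N) : enorm z = 1 -> z != 0 by move=> z1; rewrite -enorm_eq0 z1 oner_eq0.
have con z y (C C' : 'M[R]_(n, N)) (x : 'rV[R]_N) : frame S z C -> frame S y C' ->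
    ~~ (x <= z)%MS -> ~~ (x <= y)%MS -> agrees z C = agrees y C'.
  move=> fC fC' xz xy; have [z1 _ _] := sphere_frame fC; have [y1 _ _] := sphere_frame fC'.
  have x0 : x != 0 by apply: contraNneq xz => ->; exact: sub0mx.
  have nx : enorm x != 0 by rewrite enorm_eq0.
  have eqs : (normalize x :=: x)%MS by apply: eqmx_scale; rewrite invr_eq0.
  have x1 := enorm_normalize x0; have [D fD] := sphere_frame_exists x1.
  rewrite (sphere_agree_path (path_neq0 (neq _ z1) _) fC fD) ?eqs//.
  by rewrite -(sphere_agree_path (path_neq0 (neq _ y1) _) fC' fD) ?eqs.
exists (~~ agrees b Cb) => z C fC; have [z1 _ d0] := sphere_frame fC.
have : agrees z C = agrees b Cb.
  have [bz|bz] := boolP (b <= z)%MS.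
    have [x xz] := not_span_exists z; apply: (con _ _ _ _ x) => //.
    by apply: contra xz => /submx_trans; apply.
  (* The sum of two independent vectors lies on neither of their lines. *)
  apply: (con _ _ _ _ (b + z)) => //.
    apply: contra bz => h; rewrite -[b](addrK z) addmx_sub// -scaleN1r; exact: scalemx_sub.
  apply: contra bz => h; have : (z <= b)%MS.
    by rewrite -[z](addKr b) addmx_sub// -scaleN1r scalemx_sub.
  move=> /sub_rVP[k kE]; have k0 : k != 0.
    by apply: contraNneq (neq _ z1) => k0; rewrite kE k0 scale0r.
  by apply/sub_rVP; exists k^-1; rewrite kE scalerA mulVf// scale1r.
rewrite /agrees; case: (ltrgtP 0 (\det (col_mx z C))) d0 => // h _; case: (oS z C) => <- /=;
  by rewrite ?expr0 ?expr1 ?mul1r ?mulN1r ?oppr_gt0 ?h ?(lt_gtF h).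
Qed.

End SphereFrames.

Section LocalSigns.
Context {R : realType} {n m : nat}.
Variable a : 'I_m -> 'rV[int]_n.
Hypothesis hspan : affinely_spans a.

Notation N := (1 + n)%N.
Notation lam := (@lam R n m a).
Notation hmat := (@hmat R n m a).
Notation umat := (@umat R n m a).
Notation torus_pt := (@torus_pt R n m a).
Notation S := (unit_sphere (k := N) : set 'rV[R]_N).

Variable Delta : set 'rV[R]_n.
Hypotheses (hn : (0 < n)%N) (hDelta : lattice_polytope Delta) (ha : lattice_points Delta a).
Local Notation M := (Yplus_circ Delta a).
Hypothesis hM : C1_submanifold n M.

Lemma near_support (p : 'rV[R]_m) : exists2 e, 0 < e & forall x : 'rV[R]_m, `|x - p| < e ->
  forall j, p 0 j != 0 -> x 0 j != 0.
Proof.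
have /near_normP[e e0 he] := near_logs p ltr01; exists e => // x /he h j pj.
have [_ /(_ pj)[_ sx]] := h j; apply: contra_neq pj => xj.
by move: sx; rewrite xj sgr0 => /esym/eqP; rewrite sgr_eq0 => /eqP.
Qed.

Lemma torus_near g p : torus_pt g p -> exists2 e, 0 < e & forall x, Yplus a x -> `|x - p| < e ->
  exists g', torus_pt g' x.
Proof.
move=> tp; have [e e0 he] := near_support p; exists e => // x Yx xp.
have [g' [t [u sx]]] := Yplus_stratum hspan Yx.
have u0 : u = 0.
  apply: (lam_inj hspan) => j; apply/eqP; rewrite -(stratum_neq0 j sx).
  by apply: he => //; apply: torus_pt_neq0 tp.
by exists g'; apply: (stratum0_torus hspan Yx); rewrite -u0; exact: sx.
Qed.

Lemma rank_umat_mono u u' : (forall j, lam u j == 0 -> lam u' j == 0) ->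
  (\rank (umat u) <= \rank (umat u'))%N.
Proof.
move=> h; apply: mxrankS; apply/row_subP => j.
have [uj|uj] := boolP (lam u j == 0).
  have -> : row j (umat u) = row j (umat u') by apply/rowP => i; rewrite !mxE uj (h _ uj).
  exact: row_sub.
have -> : row j (umat u) = 0 by apply/rowP => i; rewrite !mxE (negbTE uj).
exact: sub0mx.
Qed.

(** Supports can only grow near [p], so the rank of the homogenized exponents cannot drop: [M] is
    open in [Yplus a]. *)
Lemma circ_near p : M p -> exists2 e, 0 < e & forall x, Yplus a x -> `|x - p| < e -> M x.
Proof.
move=> Mp; have [e e0 he] := near_support p; exists e => // x Yx xp.
have [g [t [u sp]]] := Yplus_stratum hspan (proj1 Mp).
have [g' [t' [u' sx]]] := Yplus_stratum hspan Yx.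
have le : (\rank (umat u) <= \rank (umat u'))%N.
  by apply: rank_umat_mono => j; rewrite -(stratum_neq0 j sp) -(stratum_neq0 j sx); exact: he.
have rk : (n <= \rank (umat u))%N.
  have [->|->//] := circ_stratum hspan hDelta ha Mp sp.
  have -> : umat 0 = hmat by apply/matrixP => j i; rewrite !mxE lam0 eqxx.
  by rewrite (rank_hmat hspan) add1n leqnSn.
have := leq_trans rk le; rewrite leq_eqVlt => /orP[/eqP E|lt].
  by apply: (facet_point_circ hspan Delta sx); [exact: Yplus_enorm Yx|rewrite -E].
have full : \rank (umat u') = N by apply/eqP; rewrite eqn_leq rank_leq_col.
have u0 := umat_full full; rewrite u0 in sx.
have tx := stratum0_torus hspan Yx sx; exact: (torus_circ hspan Delta tx).
Qed.

Variable P : 'M[R]_(m, N).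
Hypothesis hP : forall x, Yplus a x -> x *m P != 0.
Notation f := (@proj_plus R n m P).

Lemma det_proj (x : 'rV[R]_m) (B : 'M[R]_(n, m)) : x *m P != 0 ->
  \det (col_mx x B *m P) = enorm (x *m P) ^+ N * \det (col_mx (f x) (B *m jacobian f x)).
Proof.
by move=> xP; rewrite mul_col_mx (det_jacobian_normalize _ xP) (@proj_jacobian_mx R m n P _ _ _ xP).
Qed.

Lemma proj_frame (x : 'rV[R]_m) (B : 'M[R]_(n, m)) : x *m P != 0 -> \det (col_mx x B *m P) != 0 ->
  frame S (f x) (B *m jacobian f x).
Proof.
move=> xP; rewrite mul_col_mx => d0; rewrite (@proj_jacobian_mx R m n P _ _ _ xP).
exact: frame_of_det.
Qed.

Lemma row_free_proj (x : 'rV[R]_m) (B : 'M[R]_(n, m)) : x *m P != 0 ->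
  row_free (B *m jacobian f x) = (\det (col_mx x B *m P) != 0).
Proof.
move=> xP; apply/idP/idP => [fr|d0]; last by have [] := proj_frame xP d0.
have [] : [/\ enorm (f x) = 1, B *m jacobian f x *m (f x)^T = 0 & \det (col_mx (f x) (B *m jacobian f x)) != 0].
  apply: sphere_frame; split=> //; first exact: enorm_normalize.
  by move=> i; rewrite row_mul (@proj_jacobian R m n P) //; exact: normalize_tangent.
move=> _ _ d0; rewrite det_proj// mulf_neq0// expf_neq0// gt_eqF// enorm_gt0//.
Qed.

Lemma det_frame_mul (x : 'rV[R]_m) (B : 'M[R]_(n, m)) (A : 'M[R]_n) :
  \det (col_mx x (A *m B) *m P) = \det A * \det (col_mx x B *m P).
Proof.
have -> : col_mx x (A *m B) = block_mx 1%:M 0 0 A *m col_mx x B.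
  by rewrite mul_block_col !mul1mx !mul0mx addr0 add0r.
by rewrite -mulmxA det_mulmx det_lblock det1 mul1r.
Qed.

Lemma regular_pointP x (B : 'M[R]_(n, m)) : frame M x B ->
  regular_point (d := n) M f x <-> \det (col_mx x B *m P) != 0.
Proof.
move=> fB; have [Mx _ _] := fB; have xP := hP (proj1 Mx).
split=> [[B' [fB' fr]]|d0]; last by exists B; split=> //; rewrite row_free_proj.
have [A _ E] := frame_change hM fB fB'; move: fr.
by rewrite row_free_proj// E det_frame_mul mulf_eq0 negb_or => /andP[].
Qed.

Variable oS : 'rV[R]_N -> 'M[R]_(n, N) -> bool.
Variable kap : bool.
Hypothesis hk : forall z (C : 'M[R]_(n, N)), frame S z C -> oS z C = (0 < (-1) ^+ kap * \det (col_mx z C)).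
Variable oY : 'rV[R]_m -> 'M[R]_(n, m) -> bool.
Hypothesis hoY : orientation M oY.

Definition det_sign (x : 'rV[R]_m) (B : 'M[R]_(n, m)) : bool := 0 < (-1) ^+ kap * \det (col_mx x B *m P).

Lemma det_sign_proj (x : 'rV[R]_m) (B : 'M[R]_(n, m)) : x *m P != 0 -> \det (col_mx x B *m P) != 0 ->
  oS (f x) (B *m jacobian f x) = det_sign x B.
Proof.
move=> xP d0; rewrite (hk (proj_frame xP d0)) /det_sign det_proj// mulrCA.
by have e0 : 0 < enorm (x *m P) ^+ N; [rewrite exprn_gt0// enorm_gt0|rewrite (pmulr_rgt0 _ e0)].
Qed.

Lemma det_sign_mul (x : 'rV[R]_m) (B : 'M[R]_(n, m)) A : \det (col_mx x B *m P) != 0 -> A \in unitmx ->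
  det_sign x (A *m B) = (det_sign x B == (0 < \det A)).
Proof.
rewrite /det_sign unitmxE unitfE det_frame_mul mulrCA => d0 dA.
have: (-1) ^+ kap * \det (col_mx x B *m P) != 0 by rewrite mulf_neq0// signr_eq0.
move: (_ * \det (col_mx x B *m P)) => y y0; case: (ltrgtP 0 (\det A)) dA => // [a0|a0] _.
  by rewrite (pmulr_rgt0 _ a0) eqb_id.
by rewrite (nmulr_rgt0 _ a0); case: (ltrgtP 0 y) y0.
Qed.

Lemma local_signE x (B : 'M[R]_(n, m)) : frame M x B -> \det (col_mx x B *m P) != 0 ->
  local_sign M f oY oS x = if det_sign x B == oY x B then 1 else -1.
Proof.
move=> fB d0; have [Mx _ _] := fB; have xP := hP (proj1 Mx); rewrite /local_sign.
case: asboolP => [[B' [fB' E]]|nE]; case: eqP => //.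
  have [A uA BE] := frame_change hM fB fB'; case; move: E.
  rewrite BE det_sign_proj//; last first.
    by rewrite det_frame_mul mulf_neq0//; move: uA; rewrite unitmxE unitfE.
  by rewrite det_sign_mul// (proj1 hoY _ _ _ fB uA); case: (det_sign x B); case: (oY x B); case: (0 < _).
by move=> E; case: nE; exists B; rewrite det_sign_proj.
Qed.

Lemma local_sign_near x : M x -> regular_point (d := n) M f x -> exists2 e, 0 < e & forall x', M x' -> `|x' - x| < e ->
  regular_point (d := n) M f x' /\ local_sign M f oY oS x' = local_sign M f oY oS x.
Proof.
move=> Mx rx; have [B fB] := frame_exists hM Mx; have d0 := (regular_pointP fB).1 rx.
have [e1 e10 h1] := det_near d0; have [e2 e20 h2] := (near2_normP _ _ _).1 (proj2 hoY _ _ fB).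
have e0 : 0 < Num.min e1 e2 by rewrite lt_min e10.
have [e3 e30 h3] := (near_normP _ _).1 (frame_near hM fB e0).
exists (Num.min e1 (Num.min e2 e3)); first by rewrite !lt_min e10 e20.
move=> x' Mx'; rewrite !lt_min => /and3P[xe1 xe2 xe3].
have [B' fB'] := h3 _ xe3 Mx'; rewrite lt_min => /andP[be1 be2].
have sE := h1 _ _ xe1 be1.
have d0' : \det (col_mx x' B' *m P) != 0 by rewrite -sgr_eq0 sE sgr_eq0.
split; first exact/(regular_pointP fB').
rewrite (local_signE fB d0) (local_signE fB' d0') (h2 _ _ xe2 be2 fB') /det_sign.
by rewrite -sgr_gt0 sgrM sE -sgrM sgr_gt0.
Qed.

End LocalSigns.

(** * Fibers over regular values *)

Lemma count_lt (T : eqType) (p q : pred T) (s : seq T) x : x \in s -> {in s, subpred p q} ->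
  q x -> ~~ p x -> (count p s < count q s)%N.
Proof.
move=> xs pq qx px; have le r : {subset r <= s} -> (count p r <= count q r)%N.
  elim: r => //= y r IH h; apply: leq_add; last by apply: IH => u ur; rewrite h// inE ur orbT.
  by have := pq y (h _ (mem_head _ _)); case: (p y) => // ->.
have [s1 [s2 E]] : exists s1 s2, s = s1 ++ x :: s2 by case/splitPr: xs => s1 s2; exists s1, s2.
rewrite E !count_cat /= qx (negbTE px) add0n add1n addnS ltnS.
by rewrite leq_add// le// => u us; rewrite E mem_cat ?inE us ?orbT.
Qed.

Section Fibers.
Context {R : realType} {n m : nat}.
Variable a : 'I_m -> 'rV[int]_n.
Hypothesis hspan : affinely_spans a.

Notation N := (1 + n)%N.
Notation torus_pt := (@torus_pt R n m a).
Notation S := (unit_sphere (k := N) : set 'rV[R]_N).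

Variable Delta : set 'rV[R]_n.
Hypotheses (hn : (0 < n)%N) (hDelta : lattice_polytope Delta) (ha : lattice_points Delta a).
Local Notation M := (Yplus_circ Delta a).
Hypothesis hM : C1_submanifold n M.
Variable P : 'M[R]_(m, N).
Hypothesis hP : forall x, Yplus a x -> x *m P != 0.
Notation f := (@proj_plus R n m P).
Notation regular := (regular_value (d := n) (Yplus a) M S f).

Definition lists_fiber z (s : seq 'rV[R]_m) : Prop :=
  uniq s /\ forall x, x \in s <-> fiber (Yplus a) f z x.

Lemma proj_unit x : Yplus a x -> enorm (f x) = 1.
Proof. by move=> /hP; exact: enorm_normalize. Qed.

Lemma proj_enorm_gt0 x : Yplus a x -> 0 < enorm (x *m P).
Proof. by move=> /hP; rewrite enorm_gt0. Qed.

Lemma proj_scale x : x *m P = enorm (x *m P) *: f x.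
Proof. by rewrite normalize_scale. Qed.

Lemma continuous_proj x : Yplus a x -> {for x, continuous f}.
Proof.
move=> /hP xP; apply: (@continuous_comp _ _ _ (fun y : 'rV[R]_m => y *m P) (@normalize R N)); last exact: continuous_normalize.
by apply: continuous_mulmx; [exact: cvg_id|exact: cst_continuous].
Qed.

Lemma proj_near x e : Yplus a x -> 0 < e ->
  exists2 d, 0 < d & forall y, `|y - x| < d -> `|f y - f x| < e.
Proof.
move=> Yx e0; have n1 : nbhs (f x) [set u | `|u - f x| < e] by apply/(@near_normP R 'rV[R]_N); exists e.
exact: ((near_normP _ _).1 (near_continuous (continuous_proj Yx) n1)).
Qed.

(** Equal projections mean images under [P] proportional by a positive factor, the situation of
    [cone_chart_inj]. *)
Lemma proj_inj_near x : M x -> regular_point (d := n) M f x -> exists2 e, 0 < e &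
  forall x1 x2, M x1 -> M x2 -> `|x1 - x| < e -> `|x2 - x| < e -> f x1 = f x2 -> x1 = x2.
Proof.
move=> Mx rx; have [B fB] := frame_exists hM Mx; have d0 := (regular_pointP hM hP fB).1 rx.
have [e e0 inj] := cone_chart_inj hM fB d0; exists e => // x1 x2 M1 M2 h1 h2 E.
have p1 := proj_enorm_gt0 (proj1 M1); have p2 := proj_enorm_gt0 (proj1 M2).
apply: (inj _ _ (enorm (x1 *m P) / enorm (x2 *m P)) M1 M2 h1 h2); first by rewrite divr_gt0.
rewrite [LHS]proj_scale E; apply: (scalerI (lt0r_neq0 p2)).
rewrite [RHS]scalerA mulrCA divff ?mulr1 ?lt0r_neq0// scalerA mulrC -scalerA.
by have -> : enorm (x2 *m P) *: f x2 = x2 *m P by exact: normalize_scale.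
Qed.

Lemma fiber_isolated z y : regular z -> Yplus a y -> exists2 e, 0 < e &
  forall x1 x2, fiber (Yplus a) f z x1 -> fiber (Yplus a) f z x2 ->
    `|x1 - y| < e -> `|x2 - y| < e -> x1 = x2.
Proof.
move=> [_ rz] Yy; have [fy|fy] := eqVneq (f y) z.
  have [My ry] := rz y (conj Yy fy).
  have [e e0 he] := proj_inj_near My ry; exists e => // x1 x2 f1 f2 h1 h2.
  have [M1 _] := rz _ f1; have [M2 _] := rz _ f2; apply: he => //.
  by rewrite (proj2 f1) (proj2 f2).
have [|d d0 hd] := @proj_near y `|f y - z| Yy; first by rewrite normr_gt0 subr_eq0.
by exists d => // x1 x2 [_ E] _ /hd; rewrite E distrC ltxx.
Qed.

(** Around every point of the compact set [Yplus a] a ball meets the fiber at most once, so finitely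
    many such balls exhaust it. *)
Lemma fiber_listing z : regular z -> exists s, lists_fiber z s.
Proof.
move=> rz; suff : finite_set (fiber (Yplus a) f z).
  move=> /finite_seqP[s E]; exists (undup s); split; first exact: undup_uniq.
  by move=> x; rewrite mem_undup E.
have /choice[r hr] : forall y : 'rV[R]_m, exists e, 0 < e /\ (Yplus a y -> forall x1 x2,
    fiber (Yplus a) f z x1 -> fiber (Yplus a) f z x2 -> `|x1 - y| < e -> `|x2 - y| < e -> x1 = x2).
  move=> y; have [Yy|nY] := pselect (Yplus a y); last by exists 1.
  by have [e e0 he] := fiber_isolated rz Yy; exists e.
pose U y : set 'rV[R]_m := ([set x | `|x - y| < r y])^°.
have cY : compact (Yplus a : set 'rV[R]_m) := Yplus_compact hspan.
rewrite compact_cover in cY; case: (cY _ (Yplus a) U)=> [y _|y Yy|D' DY cov]; first exact: open_interior.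
  exists y => //; apply/(@near_normP R 'rV[R]_m); exists (r y) => //.
  by have [] := hr y.
move: cov; set A := (X in cover X U) => cov; have finA : finite_set A := finite_fset D'.
have sub : fiber (Yplus a) f z `<=` \bigcup_(y in A) (fiber (Yplus a) f z `&` U y).
  by move=> x fx; have [y Dy Uy] := cov _ (proj1 fx); exists y.
apply: (sub_finite_set sub); apply: bigcup_finite; first exact: finA.
move=> y /= Dy; have [r0 /(_ _) inj] := hr y.
have Yy : Yplus a y by apply/set_mem; exact: (DY y Dy).
have [[x [fx Ux]]|none] := pselect (exists x, (fiber (Yplus a) f z `&` U y) x).
  apply: (@sub_finite_set _ _ [set x]); last exact: finite_set1.
  move=> x' [fx' Ux']; exact: (inj Yy x' x fx' fx (interior_subset Ux') (interior_subset Ux)).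
apply: (@sub_finite_set _ _ set0); last exact: finite_set0.
by move=> x h; apply: none; exists x.
Qed.

Variable oS : 'rV[R]_N -> 'M[R]_(n, N) -> bool.
Variable kap : bool.
Hypothesis hk : forall z (C : 'M[R]_(n, N)), frame S z C -> oS z C = (0 < (-1) ^+ kap * \det (col_mx z C)).
Variable oY : 'rV[R]_m -> 'M[R]_(n, m) -> bool.
Hypothesis hoY : orientation M oY.
Notation lsign := (local_sign (d := n) M f oY oS).

Lemma seq_radius (s : seq 'rV[R]_m) (Q : 'rV[R]_m -> R -> Prop) :
  (forall x r r', Q x r -> r' <= r -> Q x r') ->
  (forall x, x \in s -> exists2 r, 0 < r & Q x r) -> exists2 r, 0 < r & forall x, x \in s -> Q x r.
Proof.
move=> mono h; have /choice[r hr] : forall x, exists r, 0 < r /\ (x \in s -> Q x r).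
  move=> x; have [/h[r r0 Qr]|_] := boolP (x \in s); first by exists r.
  by exists 1.
have [|c c0 hc] := @seq_min R _ s r; first by move=> x; have [] := hr x.
by exists c => // x xs; have [_ /(_ xs) h1] := hr x; apply: mono h1 (hc _ xs).
Qed.

(** The third clause uses [r + r] so that balls of radius [r] around distinct fiber points are
    disjoint. *)
Lemma point_radius z x : regular z -> fiber (Yplus a) f z x -> exists2 r, 0 < r &
  [/\ forall y, Yplus a y -> `|y - x| < r ->
        [/\ M y, regular_point (d := n) M f y, lsign y = lsign x & (exists g, torus_pt g x) -> exists g, torus_pt g y],
      forall x1 x2, M x1 -> M x2 -> `|x1 - x| < r -> `|x2 - x| < r -> f x1 = f x2 -> x1 = x2
    & forall x', fiber (Yplus a) f z x' -> `|x' - x| < r + r -> x' = x].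
Proof.
move=> rz fx; have [Mx rx] := (proj2 rz) _ fx.
have [e1 e10 h1] := circ_near hspan hDelta ha Mx.
have [e2 e20 h2] := local_sign_near hM hP hk hoY Mx rx.
have [e3 e30 h3] := proj_inj_near Mx rx.
have [e4 e40 h4] := fiber_isolated rz (proj1 fx).
have [e5 e50 h5] : exists2 e, 0 < e & (exists g, torus_pt g x) -> forall y, Yplus a y -> `|y - x| < e -> exists g, torus_pt g y.
  have [[g tg]|nt] := pselect (exists g, torus_pt g x); last by exists 1.
  by have [e e0 he] := torus_near hspan tg; exists e.
exists (Num.min e1 (Num.min e2 (Num.min e3 (Num.min (e4 / 2) e5)))).
  by rewrite !lt_min e10 e20 e30 e50 divr_gt0.
split.
- move=> y Yy; rewrite !lt_min => /and5P[k1 k2 k3 k4 k5]; have My := h1 _ Yy k1.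
  by have [k6 k7] := h2 _ My k2; split=> // tx; exact: h5.
- by move=> x1 x2 M1 M2; rewrite !lt_min => /and5P[_ _ k _ _] /and5P[_ _ k' _ _]; exact: h3.
- move=> x' fx' k; apply: h4 => //; last by rewrite subrr normr0.
  apply: lt_le_trans k _; rewrite [leRHS](splitr e4).
  by apply: lerD; rewrite !ge_min lexx !orbT.
Qed.

(** Regularity makes the projection locally bijective near each fiber point, and away from them
    compactness keeps its values at positive distance from [z]; hence nearby fibers correspond point
    by point. *)
Lemma fiber_nearby z s e : regular z -> lists_fiber z s -> 0 < e ->
  exists2 r, 0 < r & r <= e /\ exists2 dl, 0 < dl & forall z', enorm z' = 1 -> `|z' - z| < dl ->
  regular z' /\ exists phi : 'rV[R]_m -> 'rV[R]_m,
  [/\ lists_fiber z' (map phi s),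
      forall x, x \in s -> lsign (phi x) = lsign x,
      forall x, x \in s -> (exists g, torus_pt g x) -> exists g, torus_pt g (phi x)
    & forall x x', x \in s -> `|x' - x| < r -> fiber (Yplus a) f z' x' -> x' = phi x].
Proof.
move=> rz [us sE] e0.
have [| |r1 r10 hr1] := @seq_radius s (fun x r =>
  [/\ forall y, Yplus a y -> `|y - x| < r ->
        [/\ M y, regular_point (d := n) M f y, lsign y = lsign x & (exists g, torus_pt g x) -> exists g, torus_pt g y],
      forall x1 x2, M x1 -> M x2 -> `|x1 - x| < r -> `|x2 - x| < r -> f x1 = f x2 -> x1 = x2
    & forall x', fiber (Yplus a) f z x' -> `|x' - x| < r + r -> x' = x]).
- move=> x q q' [A1 A2 A3] qq; split.
  + by move=> y Yy h; apply: A1 => //; apply: lt_le_trans h _.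
  + by move=> x1 x2 M1 M2 k k'; apply: A2 => //; [apply: lt_le_trans k _|apply: lt_le_trans k' _].
  + by move=> x' fx' k; apply: A3 => //; apply: lt_le_trans k _; exact: lerD.
- by move=> x /sE; exact: point_radius.
pose r := Num.min r1 e; have r0 : 0 < r by rewrite lt_min r10.
have rr1 : r <= r1 by rewrite ge_min lexx.
exists r => //; split; first by rewrite ge_min lexx orbT.
have [d1 d10 hd1] : exists2 d, 0 < d & forall x, x \in s -> forall z', enorm z' = 1 -> `|z' - z| < d ->
    exists x', [/\ M x', `|x' - x| < r & f x' = z'].
  apply: (@seq_radius s (fun x d => forall z', enorm z' = 1 -> `|z' - z| < d ->
    exists x', [/\ M x', `|x' - x| < r & f x' = z'])) => [x q q' h qq z' z1 k|x xs].
    by apply: h => //; apply: lt_le_trans k _.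
  have fx := (sE x).1 xs; have [Mx rx] := (proj2 rz) _ fx.
  have [B fB] := frame_exists hM Mx; have d0 := (regular_pointP hM hP fB).1 rx.
  have [dl dl0 hdl] := cone_chart_surj hM fB d0 r0; have p0 := proj_enorm_gt0 (proj1 Mx).
  exists (dl / enorm (x *m P)); first by rewrite divr_gt0.
  move=> z' z1 k; have [|x' [l [Mx' kx' l0 E]]] := hdl (enorm (x *m P) *: z').
    rewrite [X in _ - X]proj_scale (proj2 fx) -scalerBr normrZ gtr0_norm//.
    by rewrite mulrC -ltr_pdivlMr.
  exists x'; split=> //; rewrite /proj_plus -(normalizeZ _ l0) E normalizeZ//.
  exact: normalize_unit.
have [i hi] : exists i : nat, forall x', Yplus a x' ->
    (exists2 x, x \in s & `|x' - x| < r) \/ i.+1%:R^-1 <= `|f x' - z|.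
  apply: (@compact_nat_bound R m (Yplus a) (fun i x' => (exists2 x, x \in s & `|x' - x| < r) \/ i.+1%:R^-1 <= `|f x' - z|)).
  - exact: Yplus_compact.
  - move=> i j x ij [h|h]; [by left|right]; apply: le_trans h.
    by rewrite lef_pV2 ?posrE ?ltr0Sn// ler_nat ltnS.
  - move=> y Yy; have [fy|fy] := eqVneq (f y) z.
      exists 0%N, r => // y' k; left; exists y => //; apply/sE; by split.
    have n0 : 0 < `|f y - z| / 2 by rewrite divr_gt0// normr_gt0 subr_eq0.
    have [d d0 hd] := proj_near Yy n0.
    have [j] := ltr_add_invr n0; rewrite add0r => hj; exists j, d => // y' /hd k; right; apply: (le_trans (ltW hj)).
    have := ler_distD (f y') (f y) z; rewrite (distrC (f y) (f y')); lra.
exists (Num.min d1 i.+1%:R^-1); first by rewrite lt_min d10 invr_gt0 ltr0Sn.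
move=> z' z1; rewrite lt_min => /andP[k1 k2].
have /choice[phi hphi] : forall x, exists x', x \in s -> [/\ M x', `|x' - x| < r & f x' = z'].
  by move=> x; have [/hd1/(_ z' z1 k1)[x' h]|_] := boolP (x \in s); [exists x'|exists 0].
have lt1 (u v : 'rV[R]_m) : `|u - v| < r -> `|u - v| < r1 by move=> h; apply: lt_le_trans h rr1.
have uniqE x x' : x \in s -> `|x' - x| < r -> fiber (Yplus a) f z' x' -> x' = phi x.
  move=> xs k fx'; have [A1 A2 _] := hr1 _ xs; have [M1 q1 q2] := hphi _ xs.
  have [Mx' _ _ _] := A1 _ (proj1 fx') (lt1 _ _ k).
  by apply: A2 => //; [exact: lt1|exact: lt1|rewrite q2 (proj2 fx')].
have cover x' : fiber (Yplus a) f z' x' -> exists2 x, x \in s & x' = phi x.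
  move=> fx'; have [[x xs k]|] := hi _ (proj1 fx'); first by exists x => //; exact: uniqE.
  by rewrite (proj2 fx') leNgt k2.
have fphi x : x \in s -> fiber (Yplus a) f z' (phi x).
  by move=> /hphi[[Yx _] _ E].
split.
  split; first exact: z1.
  move=> x' /cover[x xs ->]; have [A1 _ _] := hr1 _ xs; have [M1 q1 q2] := hphi _ xs.
  by have [? ? _ _] := A1 _ (proj1 M1) (lt1 _ _ q1).
exists phi; split=> //.
- split.
    rewrite map_inj_in_uniq// => x y xs ys E.
    have [_ _ A3] := hr1 _ ys; apply: A3; first exact/sE.
    have [_ q1 _] := hphi _ xs; have [_ q2 _] := hphi _ ys.
    have := ler_distD (phi x) x y; rewrite (distrC x (phi x)) {2}E; have := lt1 _ _ q1; have := lt1 _ _ q2; lra.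
  move=> x'; split; first by move=> /mapP[x xs ->]; exact: fphi.
  by move=> /cover[x xs ->]; apply: map_f.
- move=> x xs; have [A1 _ _] := hr1 _ xs; have [M1 q1 q2] := hphi _ xs.
  by have [_ _ -> _] := A1 _ (proj1 M1) (lt1 _ _ q1).
- move=> x xs tx; have [A1 _ _] := hr1 _ xs; have [M1 q1 q2] := hphi _ xs.
  by have [_ _ _] := A1 _ (proj1 M1) (lt1 _ _ q1); apply.
Qed.

Definition on_torus (x : 'rV[R]_m) : bool := `[< exists g, torus_pt g x >].

(* Near a regular value fibers move bijectively and keep their local signs, so a
   point over a facet can be replaced by a nearby one in the torus. *)
Lemma move_to_torus z s : regular z -> lists_fiber z s -> exists z' s',
  [/\ regular z', lists_fiber z' s', all on_torus s'
    & \sum_(x <- s') lsign x = \sum_(x <- s) lsign x].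
Proof.
(* The new value is the image of a torus point near an offending one; fiber points already in the
   torus remain there, so the number of the others drops. *)
have [k hk'] := ubnP (count (predC on_torus) s); elim: k => // k IH in z s hk' *; move=> rz ls.
have [al|] := boolP (all on_torus s); first by exists z, s.
rewrite -has_predC => /hasP[x xs nx].
have [r r0 [_ [dl dl0 hdl]]] := fiber_nearby rz ls ltr01.
have fx := ((proj2 ls) x).1 xs.
have [d d0 hd] := proj_near (proj1 fx) dl0.
have rd0 : 0 < Num.min r d by rewrite lt_min r0.
have [g [y [ty]]] := Yplus_approx hspan (proj1 fx) rd0; rewrite lt_min => /andP[y1 y2].
have Yy := torus_pt_Yplus hspan ty.
have [|rz' [phi [l1 l2 l3 l4]]] := hdl (f y) (proj_unit Yy); first by rewrite -(proj2 fx) hd.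
have [|z' [s' [A B C D]]] := IH (f y) (map phi s) _ rz' l1.
  apply: (@leq_trans (count (predC on_torus) s)); last by rewrite -ltnS.
  rewrite count_map; apply: (count_lt xs) => //=.
    by move=> x' xs' /=; apply: contra => /asboolP tx'; apply/asboolP; exact: l3.
  by rewrite negbK -(l4 x y xs y1)//; apply/asboolP; exists g.
exists z', s'; split=> //; rewrite D big_map; apply: eq_big_seq => x' xs'; exact: l2.
Qed.

End Fibers.

Section TorusFibers.
Context {R : realType} {n m : nat}.
Variable a : 'I_m -> 'rV[int]_n.
Hypothesis hspan : affinely_spans a.

Notation N := (1 + n)%N.
Notation G := {ffun 'I_N -> bool}.
Notation lam := (@lam R n m a).
Notation sheet := (@sheet R n m a).
Notation hmat := (@hmat R n m a).
Notation torus_pt := (@torus_pt R n m a).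
Notation on_torus := (@on_torus R n m a).
Notation tmat := (@tmat R n m a).
Notation st := (@st R n m a).
Notation S := (unit_sphere (k := N) : set 'rV[R]_N).

Variable Delta : set 'rV[R]_n.
Hypotheses (hn : (0 < n)%N) (hDelta : lattice_polytope Delta) (ha : lattice_points Delta a).
Local Notation M := (Yplus_circ Delta a).
Hypothesis hM : C1_submanifold n M.
Variable P : 'M[R]_(m, N).
Hypothesis hP : forall x, Yplus a x -> x *m P != 0.
Notation f := (@proj_plus R n m P).
Notation regular := (regular_value (d := n) (Yplus a) M S f).
Notation lists_fiber := (lists_fiber a P).

Lemma tmat_scale l (x : 'rV[R]_m) : tmat (l *: x) = l *: tmat x.
Proof. by apply/matrixP => i j; rewrite !mxE mulrCA. Qed.

Lemma normalize_near (z : 'rV[R]_N) e : enorm z = 1 -> 0 < e -> exists2 d, 0 < d & forall y, `|y - z| < d -> `|normalize y - z| < e.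
Proof.
move=> z1 e0; have z0 : z != 0 by rewrite -enorm_eq0 z1 oner_eq0.
have n1 : nbhs (normalize z) [set u | `|u - z| < e].
  by rewrite (normalize_unit z1); apply/(@near_normP R 'rV[R]_N); exists e.
exact: ((near_normP _ _).1 (near_continuous (continuous_normalize z0) n1)).
Qed.

Lemma torus_fiber_lower z s : regular z -> lists_fiber z s -> all on_torus s ->
  exists2 e, 0 < e & forall x, Yplus a x -> `|f x - z| < e -> forall j, e <= `|x 0 j|.
Proof.
move=> rz [us sE] al.
have [i hi] : exists i : nat, forall x, Yplus a x ->
    (forall j, i.+1%:R^-1 <= `|x 0 j|) \/ i.+1%:R^-1 <= `|f x - z|.
  apply: (@compact_nat_bound R m (Yplus a) (fun i x => (forall j, i.+1%:R^-1 <= `|x 0 j|) \/ i.+1%:R^-1 <= `|f x - z|)).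
  - exact: Yplus_compact.
  - move=> i j x ij h; have le : j.+1%:R^-1 <= i.+1%:R^-1 :> R.
      by rewrite lef_pV2 ?posrE ?ltr0Sn// ler_nat ltnS.
    by case: h => h; [left => l|right]; apply: le_trans le _.
  - move=> y Yy; have [fy|fy] := eqVneq (f y) z.
      have /(allP al)/asboolP[g tg] : y \in s by apply/sE.
      have [e e0 he] : exists2 e, 0 < e & forall j, e <= `|y 0 j|.
        have [|e e0 he] := @seq_min R _ (enum 'I_m) (fun j => `|y 0 j|).
          by move=> j; rewrite normr_gt0; exact: torus_pt_neq0 tg.
        by exists e => // j; apply: he; rewrite mem_enum.
      have e20 : 0 < e / 2 by rewrite divr_gt0.
      have [j] := ltr_add_invr e20; rewrite add0r => hj.
      exists j, (e / 2) => // x xy; left => l; apply: (le_trans (ltW hj)).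
      have := mx_entry_le (x - y) 0 l; have := he l; rewrite !mxE.
      have := ler_distD (x 0 l) (y 0 l) 0; rewrite !subr0 (distrC (y 0 l)).
      move: xy; move: (`|x - y|) => q; lra.
    have n0 : 0 < `|f y - z| / 2 by rewrite divr_gt0// normr_gt0 subr_eq0.
    have [d d0 hd] := proj_near hP Yy n0.
    have [j] := ltr_add_invr n0; rewrite add0r => hj; exists j, d => // y' /hd k; right; apply: (le_trans (ltW hj)).
    have := ler_distD (f y') (f y) z; rewrite (distrC (f y) (f y')); lra.
exists i.+1%:R^-1; first by rewrite invr_gt0 ltr0Sn.
by move=> x Yx h j; case: (hi x Yx) => //; rewrite leNgt h.
Qed.

(** Above values near [z] the normalized coordinates are bounded away from zero, and [sheet_lower]
    bounds the size of the sheet point from above; so all logarithms [lam t j] are bounded, and with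
    them [t]. *)
Lemma torus_fiber_proper z s : regular z -> lists_fiber z s -> all on_torus s ->
  exists r0, exists2 e0, 0 < e0 & forall g t, esq (sheet g t *m P - z) < e0 -> `|t| <= r0.
Proof.
move=> rz ls al; have z1 : enorm z = 1 := proj1 rz.
have [e e0 he] := torus_fiber_lower rz ls al.
have [d d0 hd] := normalize_near z1 e0.
have [k k0 hk] := sheet_lower hspan hP.
have [K K0 hK] := @mulmx_bound R 1 _ _ P.
have fr : row_free hmat^T by rewrite /row_free mxrank_tr (rank_hmat hspan).
have [L L0 hL] := @mulmx_lower R 1 _ _ _ fr.
have z0 : 0 < `|z| by rewrite normr_gt0 -enorm_eq0 z1 oner_eq0.
pose q := Num.min d (`|z| / 2); have q0 : 0 < q by rewrite lt_min d0 divr_gt0.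
pose up := (`|z| + q) / k; pose lo := e * (`|z| / 2 / K).
have lo0 : 0 < lo by rewrite mulr_gt0// !divr_gt0.
have up0 : 0 < up by rewrite divr_gt0// addr_gt0.
exists (L * (`|ln up| + `|ln lo|)), (q ^+ 2); first by rewrite exprn_gt0.
move=> g t lt; have XP : `|sheet g t *m P - z| < q.
  apply: le_lt_trans (norm_le_enorm _) _.
  by rewrite -(@ltr_pXn2r _ 2) ?nnegrE ?enorm_ge0 ?(ltW q0)// enorm_sq.
set X := sheet g t in XP; have Xn : X != 0 := sheet_row_neq0 hspan g t.
have upX : `|X| <= up.
  rewrite ler_pdivlMr// mulrC; apply: le_trans (hk g t) _; rewrite -/X.
  have := ler_normD (X *m P - z) z; rewrite subrK; lra.
have qz : q <= `|z| / 2 by rewrite ge_min lexx orbT.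
have loX : `|z| / 2 / K <= `|X|.
  rewrite ler_pdivrMr// [leRHS]mulrC; apply: le_trans (hK X).
  have := ler_distD (X *m P) z 0; rewrite !subr0 (distrC z); lra.
have tx := torus_pt_normalize hspan g t; have Yx := torus_pt_Yplus hspan tx.
have fx : f (normalize X) = normalize (X *m P).
  by rewrite /proj_plus -scalemxAl normalizeZ// invr_gt0 enorm_gt0.
have dX : `|X *m P - z| < d by apply: lt_le_trans XP _; rewrite ge_min lexx.
have low := he _ Yx; rewrite fx in low; have {}low := low (hd _ dX).
apply: le_trans (hL t) _; rewrite ler_pM2l//.
apply: mx_norm_le => [|i j]; first exact: addr_ge0.
rewrite (ord1 i) -/(lam t j).
have E : expR (lam t j) = `|X 0 j| by rewrite normr_sheet.
have h1 : lo <= `|X 0 j|.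
  have := low j; rewrite mxE normrM normfV (ger0_norm (enorm_ge0 _)) mulrC ler_pdivlMr ?enorm_gt0//.
  apply: le_trans; rewrite /lo ler_pM2l//; apply: le_trans loX _; exact: norm_le_enorm.
have h2 : `|X 0 j| <= up by apply: le_trans (mx_entry_le _ _ _) upX.
have X0 : 0 < `|X 0 j| by rewrite -E expR_gt0.
have l1 : ln lo <= lam t j by rewrite -[leRHS]expRK E ler_ln.
have l2 : lam t j <= ln up by rewrite -[leLHS]expRK E ler_ln.
rewrite ler_norml; apply/andP; split.
  by have := ler_norm (- ln lo); have := normr_ge0 (ln up); rewrite normrN; lra.
by have := ler_norm (ln up); have := normr_ge0 (ln lo); lra.
Qed.

Variable oS : 'rV[R]_N -> 'M[R]_(n, N) -> bool.
Variable kap : bool.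
Hypothesis hk : forall z (C : 'M[R]_(n, N)), frame S z C -> oS z C = (0 < (-1) ^+ kap * \det (col_mx z C)).
Variable oY : 'rV[R]_m -> 'M[R]_(n, m) -> bool.
Hypothesis hoY : orientation M oY.
Notation lsign := (local_sign (d := n) M f oY oS).
Variable c : 'I_N -> 'I_m.
Hypothesis cu : rowsub c hmat \in unitmx.
Variable w : G -> bool.
Hypothesis hw : forall g x (B : 'M[R]_(n, m)), torus_pt g x -> frame M x B ->
  oY x B = (0 < (-1) ^+ w g * st c x B).

Lemma sign_agree (u v : R) : u != 0 -> v != 0 ->
  (if (0 < u) == (0 < v) then 1 else -1 : int)%:~R = Num.sg u * Num.sg v :> R.
Proof.
move=> u0 v0; case: (ltrgtP 0 u) u0 => // hu _; case: (ltrgtP 0 v) v0 => // hv _ /=;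
  rewrite ?(gtr0_sg hu) ?(gtr0_sg hv) ?(ltr0_sg hu) ?(ltr0_sg hv) ?mulr1 ?mul1r ?mulrNN ?mulr1 //.
Qed.

(** The transition determinant from the logarithmic frame enters both the orientation and the
    Jacobian of the projection, and its sign squares to 1. *)
Lemma torus_local_sign g x : torus_pt g x -> regular_point (d := n) M f x ->
  \det (tmat x *m P) != 0 /\
  (lsign x)%:~R = (-1) ^+ kap * ((-1) ^+ w g * Num.sg (\det (tmat x *m P))) :> R.
Proof.
move=> tx rx; have Mx := torus_circ hspan Delta tx; have [B fB] := frame_exists hM Mx.
have d0 := (regular_pointP hM hP fB).1 rx.
have [T TE] := torus_frame_mat hspan tx fB.
have E : \det (col_mx x B *m P) = \det T * \det (tmat x *m P) by rewrite TE -mulmxA det_mulmx.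
have := d0; rewrite E mulf_eq0 negb_or => /andP[T0 D0]; split=> //.
have sg1 (b : bool) : Num.sg ((-1) ^+ b : R) = (-1) ^+ b.
  by case: b; rewrite ?expr0 ?expr1 ?sgrN sgr1.
rewrite (local_signE hM hP hk hoY fB d0) (hw tx fB) /det_sign sign_agree; last 2 first.
- by apply: mulf_neq0; rewrite ?signr_eq0.
- by apply: mulf_neq0 (st_neq0 hspan hM tx fB cu); rewrite signr_eq0.
rewrite [X in _ * X]sgrM (sgr_st tx cu TE) E !sgrM !sg1.
have T1 : Num.sg (\det T) * Num.sg (\det T) = 1 by rewrite -expr2 sqr_sg T0.
move: (Num.sg (\det T)) T1 => s s1.
by rewrite -[RHS]mulr1 -s1; ring.
Qed.

(** Dividing a fiber point by [enorm (x *m P)] turns the equation on the sphere into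
    [sheet g t *m P = z], with exactly one parameter on exactly one sheet. *)
Lemma torus_zero_lists z s : regular z -> lists_fiber z s -> all on_torus s ->
  exists T, zero_lists a P z T /\
    (\sum_(x <- s) lsign x)%:~R = (-1) ^+ kap * zero_count a w P T :> R.
Proof.
move=> rz ls al; have [us sE] := ls.
have /choice[gt hgt] : forall x, exists gt : G * 'rV[R]_N, x \in s ->
    torus_pt gt.1 x /\ sheet gt.1 gt.2 = (enorm (x *m P))^-1 *: x.
  move=> x; have [xs|_] := boolP (x \in s); last by exists ([ffun=> false], 0).
  have /asboolP[g tg] := allP al _ xs; have [_ [t tE]] := tg.
  exists (g, t + ln (enorm (x *m P))^-1 *: e0); split=> //=.
  rewrite sheet_scale -tE lnK// posrE invr_gt0; apply: (proj_enorm_gt0 hP).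
  by have := torus_pt_Yplus hspan tg.
have pE x : x \in s -> 0 < enorm (x *m P).
  by move=> /sE[Yx _]; exact: (proj_enorm_gt0 hP Yx).
pose T g := [seq (gt x).2 | x <- s & (gt x).1 == g].
have fx x : x \in s -> f x = z by move=> /sE[].
have shP x : x \in s -> sheet (gt x).1 (gt x).2 *m P = z.
  by move=> xs; have [_ ->] := hgt _ xs; rewrite -scalemxAl -[LHS]/(f x) fx.
have dT x : x \in s -> \det (tmat (sheet (gt x).1 (gt x).2) *m P) =
    (enorm (x *m P))^-1 ^+ N * \det (tmat x *m P).
  by move=> xs; have [_ ->] := hgt _ xs; rewrite tmat_scale -scalemxAl detZ.
have rx x : x \in s -> regular_point (d := n) M f x.
  by move=> /sE fz; have [] := proj2 rz _ fz.
exists T; split; first split.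
- move=> g; rewrite map_inj_in_uniq ?filter_uniq// => x y; rewrite !mem_filter => /andP[/eqP gx xs] /andP[/eqP gy ys] E.
  have [tx hx] := hgt _ xs; have [ty hy] := hgt _ ys.
  have : (enorm (x *m P))^-1 *: x = (enorm (y *m P))^-1 *: y by rewrite -hx -hy gx gy E.
  move/(congr1 (@normalize R m)); rewrite !normalizeZ ?invr_gt0 ?pE//.
  by rewrite !normalize_unit//; [case: ty|case: tx].
- move=> g t; split.
    by move=> /mapP[x]; rewrite mem_filter => /andP[/eqP <- xs ->]; exact: shP.
  move=> tP; pose x := normalize (sheet g t).
  have tx : torus_pt g x := torus_pt_normalize hspan g t.
  have X0 : 0 < enorm (sheet g t) by rewrite enorm_gt0 sheet_row_neq0.
  have xP : x *m P = (enorm (sheet g t))^-1 *: z by rewrite /x /normalize -scalemxAl tP.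
  have z1 : enorm z = 1 := proj1 rz.
  have xs : x \in s.
    apply/sE; split; first by have := torus_pt_Yplus hspan tx.
    by rewrite /proj_plus xP normalizeZ ?invr_gt0// normalize_unit.
  have [tx' hx] := hgt _ xs; have gE := torus_pt_inj hspan tx' tx.
  apply/mapP; exists x; first by rewrite mem_filter gE eqxx.
  have : sheet g t = sheet g (gt x).2.
    rewrite -[in RHS]gE hx xP enormZ z1 mulr1 gtr0_norm ?invr_gt0// invrK.
    by rewrite normalize_scale.
  by move=> /(sheet_inj hspan)[].
- move=> g t /mapP[x]; rewrite mem_filter => /andP[/eqP <- xs ->].
  rewrite dT// mulf_neq0//; first by rewrite expf_neq0// invr_eq0 gt_eqF// pE.
  by have [tx _] := hgt _ xs; have [] := torus_local_sign tx (rx _ xs).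
- exact: torus_fiber_proper ls al.
rewrite /zero_count mulr_sumr rmorph_sum /=.
rewrite (partition_big (fun x => (gt x).1) xpredT)//=; apply: eq_bigr => g _.
rewrite big_map big_filter mulrA mulr_sumr big_seq_cond [RHS]big_seq_cond.
apply: eq_bigr => x /andP[xs /eqP <-].
have [tx _] := hgt _ xs; have [_ ->] := torus_local_sign tx (rx _ xs).
rewrite -mulrA; congr (_ * (_ * _)); rewrite dT// sgrM.
have e0 : 0 < (enorm (x *m P))^-1 ^+ N by rewrite exprn_gt0// invr_gt0 pE.
by rewrite (gtr0_sg e0) mul1r.
Qed.

End TorusFibers.

(** * Existence and size of the degree *)

Section Degrees.
Context {R : realType} {n m : nat}.
Variable a : 'I_m -> 'rV[int]_n.
Hypothesis hspan : affinely_spans a.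

Notation N := (1 + n)%N.
Notation S := (unit_sphere (k := N) : set 'rV[R]_N).

Variable Delta : set 'rV[R]_n.
Hypotheses (hn : (0 < n)%N) (hDelta : lattice_polytope Delta) (ha : lattice_points Delta a).
Local Notation M := (Yplus_circ Delta a).
Hypothesis hM : C1_submanifold n M.
Variable P : 'M[R]_(m, N).
Hypothesis hP : forall x, Yplus a x -> x *m P != 0.
Notation f := (@proj_plus R n m P).
Notation regular := (regular_value (d := n) (Yplus a) M S f).

Variable oS : 'rV[R]_N -> 'M[R]_(n, N) -> bool.
Hypothesis hoS : orientation S oS.

Lemma orientation_alternating (oY : 'rV[R]_m -> 'M[R]_(n, m) -> bool) : orientation M oY -> exists w, facet_alternating Delta w.
Proof.
move=> hoY; have [c cu] := @torus_chart_exists R n m a hspan.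
have [w hw] := sheet_signs hspan hM cu hoY.
by exists w; exact: (sheet_signs_alternating hspan hn hDelta ha hM cu hoY hw).
Qed.

Lemma alternating_orientation w : facet_alternating Delta w ->
  exists oY : 'rV[R]_m -> 'M[R]_(n, m) -> bool, orientation M oY.
Proof.
move=> hw; have [c cu] := @torus_chart_exists R n m a hspan.
by exists (torus_orientation a Delta c w); exact: torus_orientation_orientation.
Qed.

Lemma fiber_sum_const oY z0 z1 s0 s1 : orientation M oY -> regular z0 -> regular z1 ->
  lists_fiber a P z0 s0 -> lists_fiber a P z1 s1 ->
  \sum_(x <- s0) local_sign (d := n) M f oY oS x = \sum_(x <- s1) local_sign (d := n) M f oY oS x.
Proof.
move=> hoY r0 r1 l0 l1; have [kap hk] := sphere_orientation_sign hoS hn.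
have [c cu] := @torus_chart_exists R n m a hspan.
have [w hw] := sheet_signs hspan hM cu hoY.
have alt := sheet_signs_alternating hspan hn hDelta ha hM cu hoY hw.
have [z0' [s0' [r0' l0' t0 <-]]] := move_to_torus hspan hDelta ha hM hP hk hoY r0 l0.
have [z1' [s1' [r1' l1' t1 <-]]] := move_to_torus hspan hDelta ha hM hP hk hoY r1 l1.
have [T0 [zl0 E0]] := torus_zero_lists hspan hM hP hk hoY cu hw r0' l0' t0.
have [T1 [zl1 E1]] := torus_zero_lists hspan hM hP hk hoY cu hw r1' l1' t1.
have [I hI] := integral_like_exists R N.
apply: (@intr_inj R); rewrite E0 E1; congr (_ * _).
exact: (zero_count_const hspan hn hDelta ha alt hP hI zl0 zl1).
Qed.

Lemma fiber_sumE (F : 'rV[R]_m -> int) z s : lists_fiber a P z s ->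
  finite_set (fiber (Yplus a) f z) /\ \sum_(x \in fiber (Yplus a) f z) F x = \sum_(x <- s) F x.
Proof.
move=> [us sE]; have -> : fiber (Yplus a) f z = [set` s].
  by apply/seteqP; split=> x /sE.
by split; [apply/finite_seqP; exists s|rewrite -fsbig_seq].
Qed.

Lemma degree_exists oY z s : orientation M oY -> regular z -> lists_fiber a P z s ->
  @proj_degree R n m Delta a P oY oS (\sum_(x <- s) local_sign (d := n) M f oY oS x).
Proof.
move=> hoY rz ls; split=> // z' rz'; have [s' ls'] := fiber_listing hspan hM hP rz'.
have [fin ->] := fiber_sumE (local_sign (d := n) M f oY oS) ls'.
split=> //; exact: (fiber_sum_const hoY rz' rz ls' ls).
Qed.

Lemma degree_value oY d z s : @proj_degree R n m Delta a P oY oS d -> regular z -> lists_fiber a P z s ->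
  d = \sum_(x <- s) local_sign (d := n) M f oY oS x.
Proof.
by move=> [_ dE] rz ls; have [_ <-] := dE z rz; have [_ ->] := fiber_sumE (local_sign (d := n) M f oY oS) ls.
Qed.

Lemma degree_le_size oY (s : seq 'rV[R]_m) :
  (absz (\sum_(x <- s) local_sign (d := n) M f oY oS x)%R <= size s)%N.
Proof.
rewrite -lez_nat abszE; elim: s => [|x s IH]; first by rewrite big_nil.
rewrite big_cons /= (PoszD 1 (size s)); apply: le_trans (ler_normD _ _) _; apply: lerD => //.
by rewrite /local_sign; case: ifP.
Qed.

(** The two lifts of a solution to the sphere are antipodal and project to opposite points, so at
    most one lies over [z]. Solutions can therefore be mapped onto the indices of the fiber. *)
Lemma fiber_solutions (C : 'M[R]_(m, n)) z s : solutions_are_fiber a C P z -> enorm z = 1 ->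
  lists_fiber a P z s -> (`I_(size s) #<= solutions a C)%card.
Proof.
move=> hz z1 [us sE].
pose sol (x : 'rV[R]_m) (y : 'rV[R]_n) := x = phi_plus a y \/ x = - phi_plus a y.
have uniqE x x' y : x \in s -> x' \in s -> sol x y -> sol x' y -> x = x'.
  move=> /sE[_ fx] /sE[_ fx'] sx sx'; have : x = x' \/ x = - x'.
    by case: sx sx' => -> [] ->; rewrite ?opprK; auto.
  case=> // E; have : z = - z.
    by rewrite -{1}fx E -[in RHS]fx' /proj_plus mulNmx normalizeN.
  move=> zN; have z0 : z = 0.
    by apply/rowP => i; have /rowP/(_ i) := zN; rewrite !mxE; lra.
  by have := enorm_eq0 z; rewrite z1 oner_eq0 z0 eqxx.
have /choice[g hg] : forall y, exists i : nat, forall j, (j < size s)%N -> sol (nth 0 s j) y -> i = j.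
  move=> y; have [[i [ls si]]|none] := pselect (exists i, (i < size s)%N /\ sol (nth 0 s i) y).
    exists i => j lj sj; apply/eqP; rewrite -(nth_uniq 0 ls lj us); apply/eqP.
    by apply: (uniqE _ _ y) => //; exact: mem_nth.
  by exists 0%N => j lj sj; case: none; exists j.
apply: card_le_trans (card_image_le g _); apply: subset_card_le => i /= li.
have xs : nth 0 s i \in s by exact: mem_nth.
have [Yx fx] := (sE _).1 xs; have [y sy h] := (hz _ Yx).1 (or_introl fx).
by exists y => //; exact: hg.
Qed.

End Degrees.

Theorem theorem3p3 (R : realType) (n : nat) (hn : (0 < n)%N)
  (Delta : set 'rV[R]_n) (hDelta : lattice_polytope Delta)
  (m : nat) (a : 'I_m -> 'rV[int]_n)
  (ha : lattice_points Delta a) (hspan : affinely_spans a)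
  (* (Y^+_Delta)^o consists of smooth points *)
  (hsmooth : C1_submanifold n (Yplus_circ Delta a))
  (C : 'M[R]_(m, n)) (P : 'M[R]_(m, n.+1)) (hP : projection_center a C P)
  (z : 'rV[R]_n.+1) (hz : solutions_are_fiber a C P z)
  (hreg : proj_regular_value Delta a P z)
  (oS : 'rV[R]_n.+1 -> 'M[R]_(n, n.+1) -> bool)
  (hoS : orientation (unit_sphere (k := n.+1)) oS)
  (k : nat) (hk : n_components (Yplus_circ Delta a) k)
  (* changing orientations in each component if necessary, the degree is
     assumed to be divisible by the number of components *)
  (hdiv : forall oY d, proj_degree Delta a P oY oS d ->
     exists oY' d', proj_degree Delta a P oY' oS d' /\ (k %| absz d')%N) :
  (odd_basis_condition Delta ->
     [/\ exists oY : 'rV[R]_m -> 'M[R]_(n, m) -> bool,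
           orientation (Yplus_circ Delta a) oY,
         forall oY, orientation (Yplus_circ Delta a) oY ->
           exists d, proj_degree Delta a P oY oS d /\
             (`I_(absz d) #<= solutions a C)%card
       & exists oY d, [/\ proj_degree Delta a P oY oS d,
           (`I_(absz d) #<= solutions a C)%card & (k %| absz d)%N]]) /\
  (~ odd_basis_condition Delta ->
     ~ exists oY d, proj_degree Delta a P oY oS d).
Proof.
have [_ _ _ hP0] := hP.
have [s ls] := fiber_listing hspan hsmooth hP0 hreg.
have z1 : enorm z = 1 := proj1 hreg.
have bound oY d : proj_degree Delta a P oY oS d -> (`I_(absz d) #<= solutions a C)%card.
  move=> hd; apply: (card_le_trans _ (fiber_solutions hz z1 ls)); rewrite card_le_II.
  by rewrite (degree_value hd hreg ls); exact: degree_le_size.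
have ex oY : orientation (Yplus_circ Delta a) oY -> exists d, proj_degree Delta a P oY oS d.
  by move=> hoY; eexists; exact: (degree_exists hspan hn hDelta ha hsmooth hP0 hoS hoY hreg ls).
(* A degree presupposes an orientation, and an orientation already yields the basis. *)
split=> [odd|nodd [oY [d [hoY _]]]]; last first.
  apply: nodd; have [w hw] := orientation_alternating hspan hn hDelta ha hsmooth hoY.
  exact: alternating_odd_basis hw.
have [w hw] := odd_basis_alternating odd.
have [oY hoY] := alternating_orientation hspan hn hDelta ha hsmooth hw; split.
- by exists oY.
- by move=> oY' /ex[d hd]; exists d; split=> //; exact: bound hd.
- have [d /hdiv[oY' [d' [hd' kd]]]] := ex _ hoY.
  by exists oY', d'; split=> //; exact: bound hd'.
Qed.
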